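(* Let $\alpha\ge0$ be fixed and let $u^1_p$ be the positive least energy radial solution of $-\Delta u=|x|^{\alpha}|u|^{p-1}u$ in $B$, $u=0$ on $\partial B$. Then there exists $p^\star=p^\star(\alpha)>1$ such that for every $p>p^\star$ $$m(u^1_p)=1+2\left\lceil\frac{\alpha}{2}\right\rceil .$$
   Context: $B$ is the open unit disc of $\mathbb R^2$. The least energy radial solution is a minimizer of $\mathcal E(u)=\frac12\int_B|\nabla u|^2-\frac1{p+1}\int_B|x|^\alpha|u|^{p+1}$ on the radial Nehari set $\{v\in H^1_0(B)\text{ radial}, v\ne0,\int_B|\nabla v|^2=\int_B|x|^\alpha|v|^{p+1}\}$. The Morse index $m(u)$ of a solution $u$ is the maximal dimension of a subspace of $H^1_0(B)$ on which the quadratic form $Q_u(\psi)=\int_B\big(|\nabla\psi|^2-p|x|^\alpha|u|^{p-1}\psi^2\big)dx$ is negative definite. $\lceil t\rceil=\min\{k\in\mathbb Z: k\ge t\}$. *)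

(* Defs.v *)
From HB Require Import structures.
From mathcomp Require Import all_boot all_order all_algebra.
From mathcomp Require Import all_classical all_reals all_analysis.
Set Implicit Arguments. Unset Strict Implicit. Unset Printing Implicit Defensive.
Import Order.TTheory GRing.Theory Num.Theory.
Import numFieldNormedType.Exports.
Local Open Scope classical_set_scope.
Local Open Scope ring_scope.

Section Henon.
Variable R : realType.

Definition enorm (x : R * R) : R := Num.sqrt (x.1 ^+ 2 + x.2 ^+ 2).

Definition ball2 : set (R * R) := [set x | enorm x < 1].

Definition leb2 := (@lebesgue_measure R \x @lebesgue_measure R)%E.

Definition intB (f : R * R -> R) : \bar R := (\int[leb2]_(x in ball2) (f x)%:E)%E.

Definition pd (b : bool) (f : R * R -> R) : R * R -> R :=
  fun x => if b then derive1 (fun t => f (t, x.2)) x.1 else derive1 (fun t => f (x.1, t)) x.2.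

Fixpoint dpart (ds : seq bool) (f : R * R -> R) : R * R -> R :=
  if ds is b :: ds' then pd b (dpart ds' f) else f.

Definition smooth2 (f : R * R -> R) : Prop :=
  forall (ds : seq bool) (x : R * R),
    derivable (fun t => dpart ds f (t, x.2)) x.1 1 /\
    derivable (fun t => dpart ds f (x.1, t)) x.2 1 /\
    {for x, continuous (dpart ds f)}.

Definition testfun (f : R * R -> R) : Prop :=
  smooth2 f /\ exists r : R, r < 1 /\ forall x, r < enorm x -> f x = 0.

(* [H10 u g1 g2]: u belongs to H^1_0(B), with weak gradient (g1, g2):
   u is the H^1(B)-limit of test functions. *)
Definition H10 (u g1 g2 : R * R -> R) : Prop :=
  [/\ measurable_fun ball2 u, measurable_fun ball2 g1, measurable_fun ball2 g2 &
  exists phi : nat -> R * R -> R, (forall n, testfun (phi n)) /\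
    [/\ (fun n => intB (fun x => (phi n x - u x) ^+ 2)) @ \oo --> 0%E,
        (fun n => intB (fun x => (pd true (phi n) x - g1 x) ^+ 2)) @ \oo --> 0%E &
        (fun n => intB (fun x => (pd false (phi n) x - g2 x) ^+ 2)) @ \oo --> 0%E]].

Definition ae_zero (u : R * R -> R) : Prop := {ae leb2, forall x, ball2 x -> u x = 0}.

Definition radial (u : R * R -> R) : Prop :=
  exists v : R -> R, {ae leb2, forall x, ball2 x -> u x = v (enorm x)}.

Definition dirichlet (g1 g2 : R * R -> R) : \bar R :=
  intB (fun x => g1 x ^+ 2 + g2 x ^+ 2).

Definition weighted (alpha q : R) (u : R * R -> R) : \bar R :=
  intB (fun x => enorm x `^ alpha * `|u x| `^ q).

Definition energy (alpha p : R) (u g1 g2 : R * R -> R) : \bar R :=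
  ((2^-1)%:E * dirichlet g1 g2 - ((p + 1)^-1)%:E * weighted alpha (p + 1) u)%E.

Definition nehari_rad (alpha p : R) (v g1 g2 : R * R -> R) : Prop :=
  [/\ H10 v g1 g2, radial v, ~ ae_zero v &
      dirichlet g1 g2 = weighted alpha (p + 1) v].

Definition least_energy_radial (alpha p : R) (u : R * R -> R) : Prop :=
  exists g1 g2, nehari_rad alpha p u g1 g2 /\
    forall v h1 h2, nehari_rad alpha p v h1 h2 ->
      (energy alpha p u g1 g2 <= energy alpha p v h1 h2)%E.

Definition Qform (alpha p : R) (u psi h1 h2 : R * R -> R) : \bar R :=
  (dirichlet h1 h2 -
   intB (fun x => p * enorm x `^ alpha * `|u x| `^ (p - 1) * psi x ^+ 2)%R)%E.

(* there is a k-dimensional subspace of H^1_0(B) (spanned by the linearly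
   independent psi_i, with gradients (h1_i, h2_i)) on which Q_u is negative
   definite *)
Definition neg_subspace (alpha p : R) (u : R * R -> R) (k : nat) : Prop :=
  exists psi h1 h2 : 'I_k -> R * R -> R,
    (forall i, H10 (psi i) (h1 i) (h2 i)) /\
    (forall c : 'I_k -> R,
        ae_zero (fun x => \sum_i c i * psi i x) -> forall i, c i = 0) /\
    (forall c : 'I_k -> R, (exists i, c i != 0) ->
       (Qform alpha p u (fun x => (\sum_i c i * psi i x)%R)
                        (fun x => (\sum_i c i * h1 i x)%R)
                        (fun x => (\sum_i c i * h2 i x)%R) < 0)%E).

Definition morse_index (alpha p : R) (u : R * R -> R) (k : nat) : Prop :=
  neg_subspace alpha p u k /\ ~ neg_subspace alpha p u k.+1.

End Henon.

(* Main.v *)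
(* Testing the Euler-Lagrange equation of the minimizer with ln (1 / max(|x|, a)) shows that
   u = w(|x|) with X = - r w' and X' = r^(1+alpha) w^p. Put tau = 1 + alpha/2 and
   J = ceil (alpha/2), so that J < tau <= J + 1.

   Lower bound: on f(|x|) e_j, where f = r^tau w^((p-1)/2) and e_j is an angular mode of
   frequency j <= J, the form is a combination of moments of X/w with respect to
   r^(2 tau) w^(p-1) dr/r. The relations between these moments and Pohozaev's identity bound it
   by a positive multiple of j^2 - tau^2 + O(1/p), which is negative for p large. This gives
   2J + 1 independent negative directions.

   Upper bound: for a test function, Picone's inequality with X r^(-tau) makes the contribution
   of the angular frequencies >= J + 1 >= tau nonnegative. On each of the 2J + 1 other modes,
   z = 2 tau/(p-1) w - X, which solves the linearized radial equation and has one zero, bounds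
   the form below by minus the square of a linear functional. So the form is nonnegative on a
   space of codimension 2J + 1. *)
Require Import Defs.
From HB Require Import structures.
From mathcomp Require Import all_boot all_order all_algebra.
From mathcomp Require Import all_classical all_reals all_analysis.
From mathcomp Require Import measurable_realfun ring lra.
Set Implicit Arguments. Unset Strict Implicit. Unset Printing Implicit Defensive.
Import Order.TTheory GRing.Theory Num.Theory.
Import numFieldNormedType.Exports.
Local Open Scope classical_set_scope.
Local Open Scope ring_scope.

(** * Shears and rotations of the plane *)

(** The number tau is a threshold because of a one-dimensional eigenvalue problem. In the variable
    ln r, the linearized operator on angular frequency j is -d^2 - p V + j^2 with V = r^(2 tau)
    w^(p-1), and X r^(-tau) is a positive solution at energy -tau^2. Hence no Dirichlet energy of
    -d^2 - p V lies below -tau^2, and frequencies j >= tau contribute nothing. As p grows, p V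
    approaches, after translation in ln r, the Liouville potential 2 tau^2 sech^2; its ground state
    has energy exactly -tau^2 and is the limiting shape of r^tau w^((p-1)/2). This trial function
    therefore detects every j < tau once p is large, and explicit moment bounds take the place of a
    limit passage. The minimizer is only given almost everywhere, with a weak gradient. The
    logarithm is a truncated fundamental solution: pairing its gradient with that of a test function
    returns a circle mean, so the regularity of u is read off from explicit integrals. Since the
    energy space consists of limits of test functions, the upper bound is put in the form [Q >= -]
    (finitely many squares of [L2]-continuous functionals), which survives the limit. *)

Lemma image_measure d1 d2 (T1 : measurableType d1) (T2 : measurableType d2)
    (R : realType) (m : {measure set T1 -> \bar R}) (phi : T1 -> T2) :
  measurable_fun setT phi ->
  exists m' : {measure set T2 -> \bar R},
    (forall A, m' A = m (phi @^-1` A)) /\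
    forall f : T2 -> \bar R, measurable_fun setT f -> (forall y, 0 <= f y)%E ->
      (\int[m']_y f y = \int[m]_x f (phi x))%E.
Proof.
move=> mphi.
pose ph : {mfun T1 >-> T2} := HB.pack phi (isMeasurableFun.Build _ _ _ _ _ mphi).
have [m' m'E] : exists m' : {measure set T2 -> \bar R}, m' = pushforward m ph :> (_ -> _).
  by unshelve (eexists; reflexivity); exact: mphi.
exists m'; split=> [A|f mf f0]; first by rewrite m'E.
transitivity (\int[pushforward m phi]_y f y)%E.
  by apply: eq_measure_integral => A _ _; rewrite m'E.
by rewrite ge0_integral_pushforward.
Qed.

Section linear_change.
Context {R : realType}.
Notation mu := (@lebesgue_measure R).

(** Follows from uniqueness of Lebesgue measure: the pushforward under the translation gives each
    interval ]a, b] its length. *)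
Lemma ge0_integral_shift (c : R) (f : measurableTypeR R -> \bar R) :
  measurable_fun setT f -> (forall x, 0 <= f x)%E ->
  (\int[mu]_x f (x + c)%R = \int[mu]_x f x)%E.
Proof.
move=> mf f0.
have mphi : measurable_fun setT ((fun x => x + c) : measurableTypeR R -> measurableTypeR R).
  exact: (@measurable_funD _ (measurableTypeR R)).
have [m [mE mI]] := image_measure mu mphi.
suff E : forall A, measurable A -> mu A = m A.
  rewrite -(mI f)//; apply: eq_measure_integral => A mA _.
  exact/esym/E.
apply: lebesgue_measure_unique => _ [[a b]] _ <-.
rewrite mE (_ : _ @^-1` _ = `](a - c), (b - c)]%classic).
  rewrite /= !lebesgue_measure_itv/= !lte_fin ltrBlDr subrK.
  by case: ifP => // _; rewrite -!EFinB; congr EFin; ring.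
by apply/seteqP; split => x /=; rewrite !in_itv/= ltrBlDr lerBrDr.
Qed.

Lemma ge0_integral_scale (c : R) (f : measurableTypeR R -> \bar R) : 0 < c ->
  measurable_fun setT f -> (forall x, 0 <= f x)%E ->
  (\int[mu]_x f (c * x)%R = (c^-1)%:E * \int[mu]_x f x)%E.
Proof.
move=> c0 mf f0.
have mphi : measurable_fun setT ((fun x => c * x) : measurableTypeR R -> measurableTypeR R).
  exact: (@measurable_funM _ (measurableTypeR R)).
have c0' : 0 <= c by exact: ltW.
have [m [mE mI]] := image_measure mu mphi.
have E' : forall A, measurable A -> mu A = mscale (NngNum c0') m A.
  apply: lebesgue_measure_unique => _ [[a b]] _ <-.
  transitivity (c%:E * mu `](a / c)%R, (b / c)%R]%classic)%E; last first.
    rewrite /mscale; congr (_ * _)%E; rewrite mE; congr (mu _).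
    apply/seteqP; split => x /=; rewrite !in_itv/=.
      by rewrite ltr_pdivrMr// ler_pdivlMr// mulrC.
    by rewrite ltr_pdivrMr// ler_pdivlMr// mulrC.
  rewrite !lebesgue_measure_itv/= !lte_fin ltr_pM2r ?invr_gt0//.
  case: ifP => // _; rewrite ?mule0// -!EFinB -EFinM; congr EFin.
  by field; rewrite gt_eqF.
have E : (\int[mu]_x f x = \int[mscale (NngNum c0') m]_x f x)%E.
  by apply: eq_measure_integral => A mA _; exact: E'.
rewrite -(mI f)// E ge0_integral_mscale//= muleA -EFinM.
by rewrite mulVf ?gt_eqF// mul1e.
Qed.

End linear_change.

Section plane.
Context {R : realType}.
Notation mu := (@lebesgue_measure R).
Notation leb2 := (@leb2 R).
Implicit Type G : R * R -> \bar R.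

Lemma measurable_pairfun d (T : measurableType d) (f g : T -> R) :
  measurable_fun setT f -> measurable_fun setT g ->
  measurable_fun setT (fun x => (f x, g x)).
Proof. by move=> mf mg; exact: measurable_fun_pair. Qed.

Lemma leb2_tonelli1 G : measurable_fun setT G -> (forall x, 0 <= G x)%E ->
  (\int[leb2]_x G x = \int[mu]_x \int[mu]_y G (x, y))%E.
Proof. by move=> mG G0; exact: (@fubini_tonelli1 _ _ _ _ _ mu mu G). Qed.

Lemma leb2_tonelli2 G : measurable_fun setT G -> (forall x, 0 <= G x)%E ->
  (\int[leb2]_x G x = \int[mu]_y \int[mu]_x G (x, y))%E.
Proof. by move=> mG G0; exact: (@fubini_tonelli2 _ _ _ _ _ mu mu G). Qed.

Lemma leb2_shear1 (t : R) G : measurable_fun setT G -> (forall x, 0 <= G x)%E ->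
  (\int[leb2]_x G ((x.1 + t * x.2)%R, x.2) = \int[leb2]_x G x)%E.
Proof.
move=> mG G0.
have mG' : measurable_fun setT (fun x : R * R => G (x.1 + t * x.2, x.2)).
  apply: (measurableT_comp mG); apply: measurable_pairfun.
    apply: measurable_funD; first exact: measurable_fst.
    by apply: measurable_funM => //; exact: measurable_snd.
  exact: measurable_snd.
etransitivity; first exact: (leb2_tonelli2 mG').
rewrite [RHS](leb2_tonelli2 mG G0).
apply: eq_integral => y _ /=.
apply: (@ge0_integral_shift _ (t * y) (fun x => G (x, y))) => //.
by apply: (measurableT_comp mG); apply: measurable_pairfun.
Qed.

Lemma leb2_shear2 (t : R) G : measurable_fun setT G -> (forall x, 0 <= G x)%E ->
  (\int[leb2]_x G (x.1, (x.2 + t * x.1)%R) = \int[leb2]_x G x)%E.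
Proof.
move=> mG G0.
have mG' : measurable_fun setT (fun x : R * R => G (x.1, x.2 + t * x.1)).
  apply: (measurableT_comp mG); apply: measurable_pairfun.
    exact: measurable_fst.
  apply: measurable_funD; first exact: measurable_snd.
  by apply: measurable_funM => //; exact: measurable_fst.
etransitivity; first exact: (leb2_tonelli1 mG').
rewrite [RHS](leb2_tonelli1 mG G0).
apply: eq_integral => y _ /=.
apply: (@ge0_integral_shift _ (t * y) (fun x => G (y, x))) => //.
by apply: (measurableT_comp mG); apply: measurable_pairfun.
Qed.

Lemma leb2_scale (c : R) G : 0 < c -> measurable_fun setT G -> (forall x, 0 <= G x)%E ->
  (\int[leb2]_x G ((c * x.1)%R, (c * x.2)%R) = (c ^- 2)%:E * \int[leb2]_x G x)%E.
Proof.
move=> c0 mG G0.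
have mG' : measurable_fun setT (fun x : R * R => G (c * x.1, c * x.2)).
  apply: (measurableT_comp mG); apply: measurable_pairfun.
    by apply: measurable_funM => //; exact: measurable_fst.
  by apply: measurable_funM => //; exact: measurable_snd.
etransitivity; first exact: (leb2_tonelli1 mG').
rewrite [in RHS]leb2_tonelli1//.
have c0' : (0 <= c^-1 :> R)%R by rewrite invr_ge0 ltW.
under eq_integral.
  move=> x _ /=.
  rewrite (@ge0_integral_scale _ c (fun y => G ((c * x)%R, y)))//; last first.
    by apply: (measurableT_comp mG); apply: measurable_pairfun.
  over.
rewrite /= ge0_integralZl_EFin//=; last 2 first.
  by move=> x _; exact: integral_ge0.
  apply: (measurableT_comp (f := fun z => (\int[mu]_y G (z, y))%E)).
    exact: (measurable_fun_fubini_tonelli_F (m2 := mu) G).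
  exact: measurable_funM.
rewrite (@ge0_integral_scale _ c (fun z => (\int[mu]_y G (z, y))%E))//.
- by rewrite muleA -EFinM -invfM -expr2.
- exact: (measurable_fun_fubini_tonelli_F (m2 := mu) G).
- by move=> x; exact: integral_ge0.
Qed.

(* A rotation of angle [a] (with [cos (a/2) != 0]) is a product of three shears. *)
Definition rot2 (a : R) (x : R * R) : R * R :=
  (x.1 * cos a - x.2 * sin a, x.1 * sin a + x.2 * cos a).

Lemma measurable_rot2 a : measurable_fun setT (rot2 a).
Proof.
apply: measurable_pairfun; [apply: measurable_funB|apply: measurable_funD];
  apply: measurable_funM => //; (exact: measurable_fst || exact: measurable_snd).
Qed.

Lemma leb2_rot_small (a : R) G : cos (a / 2) != 0 ->
  measurable_fun setT G -> (forall x, 0 <= G x)%E ->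
  (\int[leb2]_x G (rot2 a x) = \int[leb2]_x G x)%E.
Proof.
move=> ca mG G0.
pose t := - tan (a / 2); pose s := sin a.
have mS1 u : measurable_fun setT (fun x : R * R => (x.1 + u * x.2, x.2)).
  apply: measurable_pairfun; last exact: measurable_snd.
  apply: measurable_funD; first exact: measurable_fst.
  by apply: measurable_funM => //; exact: measurable_snd.
have mS2 u : measurable_fun setT (fun x : R * R => (x.1, x.2 + u * x.1)).
  apply: measurable_pairfun; first exact: measurable_fst.
  apply: measurable_funD; first exact: measurable_snd.
  by apply: measurable_funM => //; exact: measurable_fst.
rewrite -[RHS](leb2_shear1 t mG G0).
have mG1 := measurableT_comp mG (mS1 t).
rewrite -[RHS](leb2_shear2 s mG1 (fun x => G0 _)).
have mG2 := measurableT_comp mG1 (mS2 s).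
rewrite -[RHS](leb2_shear1 t mG2 (fun x => G0 _)).
apply: eq_integral => -[x y] _ /=; rewrite /rot2/=; congr G.
have sa : sin a = 2 * cos (a / 2) * sin (a / 2).
  by rewrite {1}(_ : a = (a / 2) *+ 2) ?sin_mulr2n; [ring|field].
have ca2 : cos a = cos (a / 2) ^+ 2 - sin (a / 2) ^+ 2.
  rewrite {1}(_ : a = (a / 2) *+ 2) ?cos_mulr2n; last by field.
  by rewrite sin2cos2; ring.
have cs := cos2Dsin2 (a / 2).
(* [ts] and [tc] are the half-angle identities that identify the product of the three shear
   matrices: its diagonal is 1 + t s = cos a and its upper right entry is t (2 + t s) = - sin a. *)
have ts : 1 + t * s = cos a.
  rewrite /t /s /tan sa ca2.
  transitivity (1 - 2 * sin (a / 2) ^+ 2); first by field.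
  by rewrite -{1}cs; ring.
have tc : t * (1 + cos a) = - s.
  rewrite /t /s /tan sa ca2.
  transitivity (- (sin (a / 2) / cos (a / 2)) * (2 * cos (a / 2) ^+ 2)).
    by rewrite (sin2cos2 (a / 2)); ring.
  by field.
congr pair.
  transitivity (x * (1 + t * s) + y * (t * (1 + (1 + t * s)))); last by ring.
  by rewrite ts tc /s; ring.
transitivity (s * x + y * (1 + t * s)); last by ring.
by rewrite ts /s; ring.
Qed.

Lemma rotD a b x : rot2 a (rot2 b x) = rot2 (a + b) x.
Proof. by case: x => x y; rewrite /rot2/= cosD sinD; congr pair; ring. Qed.

Lemma leb2_rot (a : R) G :
  measurable_fun setT G -> (forall x, 0 <= G x)%E ->
  (\int[leb2]_x G (rot2 a x) = \int[leb2]_x G x)%E.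
Proof.
move=> mG G0.
have [c0|c0] := eqVneq (cos (a / 2)) 0; last exact: leb2_rot_small.
(* When the three shears break down at angle a, two rotations by a / 2 are used instead; cos (a / 4)
   = 0 would give cos (a / 2) = -1. *)
have c4 : cos (a / 2 / 2) != 0.
  apply/eqP => c4; move/eqP: c0.
  rewrite {1}(_ : a / 2 = (a / 2 / 2) *+ 2) ?cos_mulr2n; last by field.
  by rewrite c4 expr0n/= mul0rn sub0r oppr_eq0 oner_eq0.
have mG' := measurableT_comp mG (measurable_rot2 (a / 2)).
have E1 := leb2_rot_small c4 mG G0.
have E2 := leb2_rot_small c4 mG' (fun x => G0 _).
rewrite -E1; apply/esym; rewrite -E2; apply: eq_integral => x _ /=.
by rewrite rotD; congr (G (rot2 _ _)); field.
Qed.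

End plane.

(** * Polar coordinates *)

Section polar.
Context {R : realType}.
Notation mu := (@lebesgue_measure R).
Notation leb2 := (@leb2 R).
Implicit Type G : R * R -> \bar R.

Lemma ge0_integral_shift_itv (a b c : R) (f : R -> \bar R) :
  measurable_fun setT f -> (forall x, 0 <= f x)%E ->
  (\int[mu]_(x in `]a, b]) f (x + c)%R = \int[mu]_(x in `](a + c)%R, (b + c)%R]) f x)%E.
Proof.
move=> mf f0; rewrite integral_mkcond [RHS]integral_mkcond.
rewrite -[RHS](@ge0_integral_shift _ c).
- apply: eq_integral => x _; rewrite !patchE.
  have -> // : (x \in `]a, b]%classic) = ((x + c)%R \in `](a + c)%R, (b + c)%R]%classic).
  by apply/idP/idP; rewrite !inE /= !in_itv/= ltrD2r lerD2r.
- by apply/(measurable_restrictT _ _).1 => //; exact: measurable_funTS.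
- by move=> x; rewrite patchE; case: ifP.
Qed.

Lemma ge0_integral_itv_split (a b c : R) (f : R -> \bar R) : a <= b -> b <= c ->
  measurable_fun setT f -> (forall x, 0 <= f x)%E ->
  (\int[mu]_(x in `]a, c]) f x =
   \int[mu]_(x in `]a, b]) f x + \int[mu]_(x in `]b, c]) f x)%E.
Proof.
move=> ab bc mf f0; rewrite -ge0_integral_setU//.
- by rewrite -itv_bndbnd_setU.
- by apply: measurable_funTS.
- apply/disj_setPS => x [] /=; rewrite !in_itv/= => /andP[_ xb] /andP[bx _].
  by move: (lt_le_trans bx xb); rewrite ltxx.
Qed.

Lemma ge0_integral_periodic (T w : R) (f : R -> \bar R) : 0 <= w <= T ->
  measurable_fun setT f -> (forall x, 0 <= f x)%E -> (forall x, f (x + T)%R = f x) ->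
  (\int[mu]_(x in `]0%R, T]) f (x + w)%R = \int[mu]_(x in `]0%R, T]) f x)%E.
Proof.
move=> /andP[w0 wT] mf f0 fT.
rewrite ge0_integral_shift_itv// add0r.
rewrite (@ge0_integral_itv_split w T (T + w))//; last by rewrite lerDl.
rewrite (@ge0_integral_itv_split 0 w T)// addeC; congr adde.
have -> : `]T, (T + w)%R] = `](0 + T)%R, (w + T)%R] :> interval R by rewrite add0r addrC.
rewrite -ge0_integral_shift_itv//.
by apply: eq_integral => x _; rewrite fT.
Qed.

Definition polar (r t : R) : R * R := (r * cos t, r * sin t).

Lemma rot_polar a r t : rot2 a (polar r t) = polar r (t + a).
Proof. by rewrite /rot2 /polar/= cosD sinD; congr pair; ring. Qed.

Lemma enorm_polar r t : 0 <= r -> enorm (polar r t) = r.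
Proof.
move=> r0; rewrite /enorm/= !exprMn -mulrDr cos2Dsin2 mulr1 sqrtr_sqr.
by rewrite ger0_norm.
Qed.

Lemma enorm_ge0 (x : R * R) : 0 <= enorm x.
Proof. exact: sqrtr_ge0. Qed.

Lemma enorm_sqr (x : R * R) : enorm x ^+ 2 = x.1 ^+ 2 + x.2 ^+ 2.
Proof. by rewrite sqr_sqrtr// addr_ge0// sqr_ge0. Qed.

Lemma enorm_rot a (x : R * R) : enorm (rot2 a x) = enorm x.
Proof.
rewrite /enorm/rot2/=; congr Num.sqrt; have := cos2Dsin2 a.
set c := cos a; set s := sin a => E.
transitivity ((x.1 ^+ 2 + x.2 ^+ 2) * (c ^+ 2 + s ^+ 2)); first by ring.
by rewrite E mulr1.
Qed.

Lemma polar_angle (x : R * R) : exists2 w : R, 0 <= w <= pi *+ 2 & x = polar (enorm x) w.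
Proof.
have pi0 : 0 <= pi *+ 2 :> R by rewrite mulrn_wge0// pi_ge0.
have [x0|x0] := eqVneq (enorm x) 0.
  exists 0; first by rewrite lexx.
  have /eqP := enorm_sqr x; rewrite x0 expr0n/= eq_sym paddr_eq0 ?sqr_ge0// !sqrf_eq0.
  by case: x {x0} => a b /= /andP[/eqP -> /eqP ->]; rewrite /polar !mul0r.
have r0 : 0 < enorm x by rewrite lt_neqAle eq_sym x0 enorm_ge0.
pose c := x.1 / enorm x; pose s := x.2 / enorm x.
have cs : c ^+ 2 + s ^+ 2 = 1.
  by rewrite /c /s !exprMn -mulrDl -enorm_sqr exprVn mulfV// expf_neq0.
have c1 : -1 <= c <= 1.
  rewrite -ler_norml -(@expr_le1 _ 2)// real_normK ?num_real//.
  by rewrite -cs lerDl sqr_ge0.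
have ca : cos (acos c) = c by rewrite acosK.
have sa : sin (acos c) = `|s|.
  rewrite sin_acos// -sqrtr_sqr; congr Num.sqrt; apply/eqP.
  by rewrite subr_eq addrC cs.
have E : x = (enorm x * c, enorm x * s).
  by rewrite /c /s; case: x r0 x0 {c s cs c1 ca sa} => a b r0 x0 /=; congr pair; field.
have a0 := acos_ge0 c1; have api := acos_lepi c1.
have [s0|s0] := leP 0 s.
  exists (acos c).
    by rewrite a0 (le_trans api)// mulr2n lerDl pi_ge0.
  by rewrite /polar ca sa ger0_norm.
exists (pi *+ 2 - acos c).
  by rewrite subr_ge0 (le_trans api) ?mulr2n ?lerDl ?pi_ge0//= gerBl.
rewrite /polar addrC cosD2pi sinD2pi cosN sinN ca sa ltr0_norm// opprK; exact: E.
Qed.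

Lemma measurable_enorm : measurable_fun setT (@enorm R).
Proof.
have h : continuous (@Num.sqrt R) by exact: sqrt_continuous.
apply: (measurableT_comp (continuous_measurable_fun h)).
apply: measurable_funD; apply: measurable_funX; [exact: measurable_fst|exact: measurable_snd].
Qed.

Lemma measurable_ball2 : measurable (@ball2 R).
Proof.
rewrite (_ : @ball2 R = setT `&` @enorm R @^-1` `]-oo, 1[%classic).
  exact: measurable_enorm.
by rewrite setTI; apply/seteqP; split => x /=; rewrite in_itv.
Qed.

Lemma measurable_disc (b : R) : measurable [set x : R * R | enorm x < b].
Proof.
rewrite (_ : [set _ | _] = setT `&` @enorm R @^-1` `]-oo, b[%classic).
  exact: measurable_enorm.
by rewrite setTI; apply/seteqP; split => x /=; rewrite in_itv.
Qed.

(** The area of the unit disc is carried as an unevaluated positive constant. *)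
Definition darea : R := fine (leb2 [set x | enorm x < 1]).

Lemma leb2_rect (a b c d : R) : a < b -> c < d ->
  leb2 (`[a, b]%classic `*` `[c, d]%classic) = ((b - a) * (d - c))%:E.
Proof.
move=> ab cd; rewrite /Defs.leb2 product_measure1E//= !lebesgue_measure_itv/= !lte_fin ab cd.
by rewrite -!EFinB -EFinM.
Qed.

Lemma fst_le_enorm (x : R * R) : `|x.1| <= enorm x.
Proof.
rewrite -(@ler_pXn2r _ 2) ?nnegrE ?enorm_ge0// enorm_sqr real_normK ?num_real//.
by rewrite lerDl sqr_ge0.
Qed.

Lemma snd_le_enorm (x : R * R) : `|x.2| <= enorm x.
Proof.
rewrite -(@ler_pXn2r _ 2) ?nnegrE ?enorm_ge0// enorm_sqr real_normK ?num_real//.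
by rewrite lerDr sqr_ge0.
Qed.

Lemma leb2_indic (A : set (R * R)) : measurable A ->
  leb2 A = (\int[leb2]_x (\1_A x)%:E)%E.
Proof.
move=> mA; have := @integral_indic _ _ _ (mu \x mu)%E setT measurableT A mA.
by rewrite setIT => E; exact/esym/E.
Qed.

Lemma leb2_unit_disc_fin : leb2 [set x | enorm x < 1] = darea%:E.
Proof.
rewrite /darea /Defs.leb2; set A := [set x | enorm x < 1].
have mA : measurable A by exact: measurable_disc.
rewrite fineK; first by [].
rewrite ge0_fin_numE; last exact: measure_ge0.
apply: (@le_lt_trans _ _ ((mu \x mu)%E (`[-1, 1]%classic `*` `[-1, 1]%classic))).
  apply: le_measure; rewrite ?inE; [exact: mA| |].
    by apply: measurableX.
  move=> x /= x1; rewrite !in_itv/= -!ler_norml.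
  by split; [exact: le_trans (fst_le_enorm x) (ltW x1)|exact: le_trans (snd_le_enorm x) (ltW x1)].
have n11 : -1 < 1 :> R by lra.
by have := leb2_rect n11 n11; rewrite /Defs.leb2 => ->; exact: ltry.
Qed.

Lemma darea_gt0 : 0 < darea.
Proof.
rewrite -lte_fin -leb2_unit_disc_fin.
apply: (@lt_le_trans _ _ (leb2 (`[- (2^-1), 2^-1]%classic `*` `[- (2^-1), 2^-1]%classic))).
  by rewrite leb2_rect ?lte_fin; lra.
apply: le_measure; rewrite ?inE; [ |exact: measurable_disc|].
  by apply: measurableX.
move=> x /=; rewrite !in_itv/= => -[/andP[a b] /andP[c d]].
rewrite -(@expr_lt1 _ 2) ?enorm_ge0// enorm_sqr; nra.
Qed.

Lemma leb2_disc (b : R) : 0 < b -> leb2 [set x | enorm x < b] = (darea * b ^+ 2)%:E.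
Proof.
move=> b0; have md := measurable_disc.
rewrite (leb2_indic (md b)).
have E : (\int[leb2]_x (\1_[set x | enorm x < b] x)%:E =
  \int[leb2]_x (\1_[set x | enorm x < 1] ((b^-1 * x.1)%R, (b^-1 * x.2)%R))%:E)%E.
  apply: eq_integral => x _; rewrite !indicE; congr ((nat_of_bool _)%:R%:E).
  have -> : (((b^-1 * x.1)%R, (b^-1 * x.2)%R) \in [set x | enorm x < 1]) = (b^-1 * enorm x < 1).
    apply/idP/idP; rewrite inE/= /enorm/= !exprMn -mulrDr sqrtrM ?sqr_ge0// sqrtr_sqr;
    by rewrite ger0_norm// invr_ge0 ltW.
  rewrite mulrC ltr_pdivrMr// mul1r.
  by apply/idP/idP; rewrite inE.
rewrite E (@leb2_scale _ b^-1 (fun x => (\1_[set x | enorm x < 1] x)%:E)) ?invr_gt0//.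
- rewrite -(leb2_indic (md 1)).
  by rewrite leb2_unit_disc_fin -EFinM exprVn invrK mulrC.
- by apply/measurable_EFinP.
Qed.

Lemma ge0_integral_mrestr d (T : measurableType d) (m : {measure set T -> \bar R})
    (D : set T) (mD : measurable D) (f : T -> \bar R) :
  measurable_fun setT f -> (forall x, 0 <= f x)%E ->
  (\int[mrestr m mD]_x f x = \int[m]_(x in D) f x)%E.
Proof.
move=> mf f0; rewrite -(setUv D) ge0_integral_setU//; last 3 first.
- exact: measurableC.
- by rewrite setUv.
- by apply/disj_setPS; rewrite setICr.
rewrite [X in (_ + X)%E](_ : _ = 0%E) ?adde0.
  apply: eq_measure_integral => A mA AD.
  have E : mrestr m mD A = m A by rewrite /mrestr setIidl.
  by first [exact: E|exact: esym E].
rewrite -[RHS](integral_measure_zero (~` D) f); apply: eq_measure_integral => A mA AD.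
have E : mrestr m mD A = 0%E.
  by rewrite /mrestr (_ : A `&` D = set0) ?measure0// -subset0 => x [/AD].
by first [exact: E|exact: esym E].
Qed.

(** Open left rays are stable under intersection and generate the Borel sets; the rays up to the
    integers exhaust the line with finite mass. *)
Lemma eq_measure_rays (m n : {measure set (measurableTypeR R) -> \bar R}) :
  (forall b, m `]-oo, b[%classic = n `]-oo, b[%classic) ->
  (forall b, m `]-oo, b[%classic < +oo)%E ->
  forall A, measurable A -> m A = n A.
Proof.
move=> mn moo A mA.
refine (@measure_unique _ R (measurableTypeR R) (@RGenInftyO.G R) (fun k => `]-oo, k%:R[%classic) _ _ _ _ m n _ _ A mA).
- exact: RGenInftyO.measurableE.
- move=> _ _ [x ->] [y ->]; exists (Num.min x y).
  by apply/seteqP; split => z /=; rewrite !in_itv/= lt_min; [move=> [-> ->]|move=> /andP[]].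
- by move=> k; exists k%:R.
- apply/seteqP; split => // x _; exists (Num.truncn `|x|).+1 => //=.
  rewrite in_itv/= (le_lt_trans (ler_norm x))//.
  exact: truncnS_gt.
- by move=> _ [x ->]; exact: mn.
- by move=> k; exact: moo.
Qed.

(* [r dr] is realized as a measure: the image under the first projection of
   planar Lebesgue measure restricted to [0 < t < r]. *)
Lemma ge0_integral_radial (h : R -> \bar R) :
  measurable_fun setT h -> (forall r, 0 <= h r)%E ->
  (\int[leb2]_x h (enorm x) =
   (2 * darea)%:E * \int[mu]_(r in `]0%R, +oo[) (r%:E * h r))%E.
Proof.
move=> mh h0.
have [m [mE mI]] := image_measure (mu \x mu)%E (measurable_enorm : measurable_fun setT (_ : measurableTypeR R * measurableTypeR R -> measurableTypeR R)).
pose D := [set x : measurableTypeR R * measurableTypeR R | 0 < x.2 < x.1].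
have mD : measurable D.
  have -> : D = [set x | (0 < x.2)%R] `&` [set x | (x.2 < x.1)%R].
    by apply/seteqP; split => x /=; [move=> /andP[]|move=> [? ?]; apply/andP].
  apply: measurableI.
    rewrite (_ : [set _ | _] = setT `&` (@snd R R) @^-1` `]0, +oo[%classic).
      exact: measurable_snd.
    by rewrite setTI; apply/seteqP; split => x /=; rewrite in_itv/= andbT.
  rewrite (_ : [set _ | _] = setT `&` (fun x : R * R => x.1 - x.2) @^-1` `]0, +oo[%classic).
    have : measurable_fun setT (fun x : R * R => x.1 - x.2).
      by apply: measurable_funB; [exact: measurable_fst|exact: measurable_snd].
    by apply.
  by rewrite setTI; apply/seteqP; split => x /=; rewrite in_itv/= andbT subr_gt0.
have c0 : 0 <= 2 * darea by rewrite mulr_ge0// ltW// darea_gt0.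
have [n [nE nI]] := image_measure (mrestr (mu \x mu)%E mD)
  (measurable_fst : measurable_fun setT (_ : measurableTypeR R * measurableTypeR R -> measurableTypeR R)).
have nI' (f : measurableTypeR R -> \bar R) : measurable_fun setT f -> (forall r, 0 <= f r)%E ->
    (\int[n]_r f r = \int[mu]_(r in `]0%R, +oo[) (r%:E * f r))%E.
  move=> mf f0.
  have mf1 : measurable_fun setT (fun x : measurableTypeR R * measurableTypeR R => f x.1).
    exact: (measurableT_comp mf measurable_fst).
  rewrite nI// ge0_integral_mrestr// integral_mkcond.
  rewrite (@fubini_tonelli1 _ _ _ _ _ mu mu)//; last 2 first.
  - by apply/(measurable_restrictT _ _).1 => //; exact: measurable_funTS.
  - by move=> x; rewrite patchE; case: ifP.
  rewrite [RHS]integral_mkcond; apply: eq_integral => r _; rewrite /fubini_F patchE.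
  transitivity (\int[mu]_(t in `]0%R, r[) cst (f r) t)%E.
    rewrite [RHS]integral_mkcond; apply: eq_integral => t _; rewrite !patchE.
    have -> // : ((r, t) \in D) = (t \in `]0%R, r[%classic).
    by apply/idP/idP; rewrite !inE /D/= ?in_itv.
  rewrite integral_cst//= lebesgue_measure_itv/= lte_fin.
  case: ifPn => r0.
    by rewrite mem_set /= ?in_itv/= ?r0// -EFinB subr0 muleC.
  by rewrite memNset ?mule0//= in_itv/= andbT; apply/negP.
(* A ray up to b > 0 has mass b^2 / 2 for [n] and [darea] b^2 for the image of planar measure under
   the norm; this is the factor 2 [darea]. *)
have half b : n `]-oo, b[%classic = (Num.max b 0 ^+ 2 / 2)%:E.
  have -> : n `]-oo, b[%classic = (\int[n]_r (\1_(`]-oo, b[%classic) r)%:E)%E.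
    by rewrite integral_indic// setIT.
  rewrite nI'; [|by apply/measurable_EFinP|by move=> r; rewrite lee_fin].
  have -> : (\int[mu]_(r in `]0%R, +oo[) (r%:E * (\1_(`]-oo, b[%classic) r)%:E) =
      \int[mu]_(r in `]0%R, b[) (r%:E))%E.
    rewrite integral_mkcond [RHS]integral_mkcond; apply: eq_integral => r _.
    rewrite !patchE indicE; have [r0|r0] := ltP 0 r; last first.
      by rewrite !memNset//= in_itv/= ?andbT; apply/negP; rewrite -?leNgt ?negb_and -?leNgt ?r0.
    rewrite [in LHS]mem_set/= ?in_itv/= ?r0// .
    have [rb|rb] := ltP r b.
      by rewrite !mem_set/= ?mule1// in_itv/= ?r0.
    by rewrite !memNset/= ?mule0// in_itv/= ?r0 -?leNgt//; apply/negP; rewrite -leNgt.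
  have [b0|b0] := leP b 0.
    by rewrite set_itv_ge ?integral_set0 ?expr0n ?mul0r// bnd_simp -leNgt.
  have mid : measurable_fun `]0, b[ (fun r : R => r%:E).
    by apply/measurable_EFinP; exact: measurable_funTS.
  transitivity (\int[mu]_(r in `[0%R, b]) r%:E)%E.
    by apply/esym; exact: integral_itv_bndoo mid.
  rewrite (@continuous_FTC2 _ id (fun x => x ^+ 2 / 2))//.
  - by rewrite expr0n/= mul0r sube0.
  - by apply: continuous_subspaceT => x.
  - split.
    + by move=> x _; apply: derivableM => //; exact: exprn_derivable.
    + by apply: cvg_at_right_filter; apply: cvgM; [exact: exprn_continuous|exact: cvg_cst].
    + by apply: cvg_at_left_filter; apply: cvgM; [exact: exprn_continuous|exact: cvg_cst].
  - move=> x _; rewrite derive1E; apply: (@derive_val _ _ _ _ _ _ _).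
    by apply: is_derive_eq; rewrite /GRing.scale/=; field.
have mb b : m `]-oo, b[%classic = ((2 * darea) * (Num.max b 0 ^+ 2 / 2))%:E.
  rewrite mE; have [b0|b0] := leP b 0.
    rewrite expr0n/= mul0r mulr0 (_ : _ @^-1` _ = set0) ?measure0//.
    rewrite -subset0 => x /=; rewrite in_itv/= => xb.
    by have := enorm_ge0 x; move: (lt_le_trans xb b0); rewrite ltNge => /negP.
  transitivity (leb2 [set x | enorm x < b]); last by rewrite leb2_disc//; congr EFin; field.
  by congr (leb2 _); apply/seteqP; split => x /=; rewrite in_itv.
have E : forall A, measurable A -> m A = mscale (NngNum c0) n A.
  apply: eq_measure_rays => b; last by rewrite mb ltry.
  rewrite mb; transitivity ((2 * darea)%:E * n `]-oo, b[%classic)%E; last by [].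
  by rewrite half.
transitivity (\int[m]_r h r)%E; first exact/esym/mI.
transitivity (\int[mscale (NngNum c0) n]_r h r)%E.
  by apply: eq_measure_integral => A mA _; by first [exact: E|exact/esym/E].
by rewrite ge0_integral_mscale// nI'.
Qed.

Lemma measurable_polar : measurable_fun setT (fun z : R * R => polar z.1 z.2).
Proof.
apply: measurable_pairfun; apply: measurable_funM; try exact: measurable_fst.
  apply: (measurableT_comp (f := @cos R)); last exact: measurable_snd.
  exact: continuous_measurable_fun (@continuous_cos R).
apply: (measurableT_comp (f := @sin R)); last exact: measurable_snd.
exact: continuous_measurable_fun (@continuous_sin R).
Qed.

Lemma measurable_polar2 r : measurable_fun setT (polar r).
Proof.
have mg : measurable_fun setT (fun t : R => (r, t)) by apply: measurable_pairfun.
exact: (measurableT_comp measurable_polar mg).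
Qed.

(** The constant in polar coordinates; it equals 1, but is kept symbolic together with the disc
    area. *)
Definition kappa : R := darea / pi.

Lemma kappa_gt0 : 0 < kappa.
Proof. by rewrite divr_gt0 ?darea_gt0 ?pi_gt0. Qed.

Lemma sigma_finite_plane : sigma_finite setT (mu \x mu)%E.
Proof.
exists (fun n => `[- n%:R, n%:R]%classic `*` `[- n%:R, n%:R]%classic).
  apply/seteqP; split => // x _.
  exists (maxn (Num.truncn `|x.1|).+1 (Num.truncn `|x.2|).+1) => //=.
  rewrite !in_itv/= -!ler_norml; split.
    by rewrite (le_trans (ltW (truncnS_gt _)))// ler_nat leq_maxl.
  by rewrite (le_trans (ltW (truncnS_gt _)))// ler_nat leq_maxr.
move=> n; split; first exact: measurableX.
rewrite product_measure1E//= !lebesgue_measure_itv/=.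
by case: ifP; rewrite -?EFinB -?EFinM ?mule0 ltry.
Qed.

(** Rotation invariance and Tonelli replace G by its average over all rotations. That average is a
    function of the norm alone, to which [ge0_integral_radial] applies. *)
Lemma ge0_integral_polar G : measurable_fun setT G -> (forall x, 0 <= G x)%E ->
  (\int[leb2]_(x in @ball2 R) G x = kappa%:E *
    \int[mu]_(r in `]0%R, 1%R[)
      (r%:E * \int[mu]_(t in `]0%R, (pi *+ 2)%R]) G (polar r t)))%E.
Proof.
move=> mG G0; set T : R := pi *+ 2.
have T0 : 0 < T by rewrite pmulrn_lgt0// pi_gt0.
pose H := G \_ (@ball2 R).
have HE x : H x = if enorm x < 1 then G x else 0%E.
  by rewrite /H patchE; congr (if _ then _ else _); apply/idP/idP; rewrite inE.
have mH : measurable_fun setT H.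
  apply: (measurable_restrictT G measurable_ball2).1.
  by apply: measurable_funS mG.
have H0 x : (0 <= H x)%E by rewrite HE; case: ifP.
pose h r := (\int[mu]_(t in `]0%R, T]) H (polar r t))%E.
have mHp : measurable_fun setT (fun z : R * R => H (polar z.1 z.2)).
  exact: measurableT_comp mH measurable_polar.
have mres (f : R -> \bar R) : measurable_fun setT f -> measurable_fun setT (f \_ `]0%R, T]).
  by move=> mf; apply/(measurable_restrictT _ _).1 => //; exact: measurable_funTS.
have h0 r : (0 <= h r)%E by apply: integral_ge0.
have mh : measurable_fun setT h.
  pose K (z : R * R) := if 0 < z.2 <= T then H (polar z.1 z.2) else 0%E.
  have mK : measurable_fun setT K.
    apply: measurable_fun_if => //; last exact: measurable_funTS.
    by apply: measurable_and; apply: measurable_fun_ltr || apply: measurable_fun_ler;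
      (exact: measurable_cst || exact: measurable_snd).
  have -> : h = fun r => (\int[mu]_t K (r, t))%E.
    apply/funext => r; rewrite /h integral_mkcond; apply: eq_integral => t _.
    by rewrite patchE /K/=; congr (if _ then _ else _); apply/idP/idP; rewrite inE/= in_itv.
  apply: (@measurable_fun_fubini_tonelli_F _ _ _ _ _ mu K) => //.
  by move=> x; rewrite /K; case: ifP.
(* Writing x in polar form with angle w, a rotation by a only shifts the angle, and the shift by w
   is absorbed by periodicity. *)
have inner x : (\int[mu]_(a in `]0%R, T]) H (rot2 a x) = h (enorm x))%E.
  have [w wT xE] := polar_angle x.
  rewrite {1}xE /h.
  rewrite -[RHS](@ge0_integral_periodic T w (fun t => H (polar (enorm x) t)))//.
  - by apply: eq_integral => a _; rewrite rot_polar addrC.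
  - exact: measurableT_comp mH (measurable_polar2 _).
  - by move=> t; rewrite /polar cosD2pi sinD2pi.
have avg : (T%:E * \int[leb2]_x H x = \int[leb2]_x h (enorm x))%E.
  pose K (z : (R * R) * R) := if 0 < z.2 <= T then H (rot2 z.2 z.1) else 0%E.
  have mrot : measurable_fun setT (fun z : (R * R) * R => rot2 z.2 z.1).
    have m1 : measurable_fun setT (fun z : (R * R) * R => z.1.1).
      exact: measurableT_comp measurable_fst measurable_fst.
    have m2 : measurable_fun setT (fun z : (R * R) * R => z.1.2).
      exact: measurableT_comp measurable_snd measurable_fst.
    have mc : measurable_fun setT (fun z : (R * R) * R => cos z.2).
      apply: measurableT_comp measurable_snd.
      exact: continuous_measurable_fun (@continuous_cos R).
    have ms : measurable_fun setT (fun z : (R * R) * R => sin z.2).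
      apply: measurableT_comp measurable_snd.
      exact: continuous_measurable_fun (@continuous_sin R).
    by apply: measurable_pairfun; [apply: measurable_funB|apply: measurable_funD];
      apply: measurable_funM.
  have mK : measurable_fun setT K.
    apply: measurable_fun_if => //.
    - by apply: measurable_and; apply: measurable_fun_ltr || apply: measurable_fun_ler;
        (exact: measurable_cst || exact: measurable_snd).
    - by apply: measurable_funTS; exact: measurableT_comp mH mrot.
  have K0 z : (0 <= K z)%E by rewrite /K; case: ifP.
  pose m2d : {sigma_finite_measure set (measurableTypeR R * measurableTypeR R)%type -> \bar R} :=
    HB.pack (mu \x mu)%E (Measure_isSigmaFinite.Build _ _ _ (mu \x mu)%E sigma_finite_plane).
  have := @fubini_tonelli _ _ (measurableTypeR R * measurableTypeR R)%type (measurableTypeR R) R m2d mu K mK K0.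
  have -> : (\int[m2d]_x \int[mu]_y K (x, y) = \int[leb2]_x h (enorm x))%E.
    apply: eq_integral => x _; rewrite -inner [RHS]integral_mkcond.
    apply: eq_integral => a _; rewrite patchE /K/=; congr (if _ then _ else _).
    by apply/idP/idP; rewrite inE/= in_itv.
  move=> ->.
  transitivity (\int[mu]_(a in `]0%R, T]) (cst (\int[leb2]_x H x) a))%E.
    by rewrite integral_cst//= lebesgue_measure_itv/= lte_fin T0 -EFinB subr0 muleC.
  rewrite integral_mkcond; apply: eq_integral => a _; rewrite patchE.
  case: ifPn => aT.
    transitivity (\int[leb2]_x H (rot2 a x))%E; first by rewrite leb2_rot.
    by apply: eq_integral => x _; rewrite /K/=; move: aT; rewrite inE/= in_itv/= => ->.
  rewrite (@integral0_eq _ _ _ _ _)// => x _; rewrite /K/= ifF//.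
  by apply/negbTE; apply: contra aT; rewrite inE/= in_itv.
rewrite integral_mkcond -/H.
have -> : (\int[leb2]_x H x = T^-1%:E * \int[leb2]_x h (enorm x))%E.
  by rewrite -avg muleA -EFinM mulVf ?mul1e// gt_eqF.
rewrite ge0_integral_radial// muleA -EFinM; congr (_%:E * _)%E.
  have aux (P D : R) : P != 0 -> (P *+ 2)^-1 * (2 * D) = D / P.
    by move=> P0; rewrite -mulr_natl; field.
  by rewrite /kappa /T aux// gt_eqF ?pi_gt0.
rewrite integral_mkcond [RHS]integral_mkcond; apply: eq_integral => r _.
rewrite !patchE; case: ifPn => r0; last first.
  by rewrite memNset// => /=; apply/negP; apply: contra r0; rewrite inE/= !in_itv/= => /andP[->].
move: r0; rewrite inE/= in_itv/= andbT => r0.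
have [r1|r1] := ltP r 1; last first.
  rewrite memNset/=; last by rewrite in_itv/= r0/=; apply/negP; rewrite -leNgt.
  rewrite [h r]integral0_eq ?mule0// => t _.
  by rewrite HE enorm_polar ?ltW// ltNge r1.
rewrite mem_set/= ?in_itv/= ?r0//.
congr (_ * _)%E; apply: eq_integral => t _.
by rewrite HE enorm_polar ?ltW// r1.
Qed.

End polar.

(** * Calculus on the line *)

Section calculus.
Context {R : realType}.
Notation mu := (@lebesgue_measure R).
Implicit Types f g : R -> R.

Lemma ctsC (c : R) : continuous (fun _ : R => c).
Proof. by move=> x; exact: cvg_cst. Qed.

Lemma ctsI : continuous (fun x : R => x).
Proof. by move=> x; exact: cvg_id. Qed.

Lemma ctsD f g : continuous f -> continuous g -> continuous (fun x => f x + g x).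
Proof. by move=> cf cg x; apply: cvgD; [exact: cf|exact: cg]. Qed.

Lemma ctsN f : continuous f -> continuous (fun x => - f x).
Proof. by move=> cf x; apply: cvgN; exact: cf. Qed.

Lemma ctsB f g : continuous f -> continuous g -> continuous (fun x => f x - g x).
Proof. by move=> cf cg; apply: ctsD => //; exact: ctsN. Qed.

Lemma ctsM f g : continuous f -> continuous g -> continuous (fun x => f x * g x).
Proof. by move=> cf cg x; apply: cvgM; [exact: cf|exact: cg]. Qed.

Lemma ctsX f n : continuous f -> continuous (fun x => f x ^+ n).
Proof.
move=> cf; elim: n => [|n IH]; first by under eq_fun do rewrite expr0; exact: ctsC.
by under eq_fun do rewrite exprS; exact: ctsM.
Qed.

Lemma cts_comp f g : continuous f -> continuous g -> continuous (fun x => f (g x)).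
Proof. by move=> cf cg x; apply: (@continuous_comp _ _ _ g f); [exact: cg|exact: cf]. Qed.

(* Not a class: keeps type class resolution out of rewriting and application. *)
Definition isd (x : R) f (d : R) : Prop := is_derive x 1 f d.

Lemma derC (c x : R) : isd x (fun _ : R => c) 0.
Proof. exact: is_derive_cst. Qed.

Lemma derI (x : R) : isd x (fun y : R => y) 1.
Proof. exact: is_derive_id. Qed.

Lemma der_eq f (x d e : R) : isd x f d -> d = e -> isd x f e.
Proof. by move=> h <-. Qed.

Lemma derD f g (x a b : R) : isd x f a -> isd x g b ->
  isd x (fun y => f y + g y) (a + b).
Proof. by move=> df dg; exact: (@is_deriveD _ _ _ f g). Qed.

Lemma derN f (x a : R) : isd x f a -> isd x (fun y => - f y) (- a).
Proof. by move=> df; exact: (@is_deriveN _ _ _ f). Qed.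

Lemma derB f g (x a b : R) : isd x f a -> isd x g b ->
  isd x (fun y => f y - g y) (a - b).
Proof. by move=> df dg; exact: (@is_deriveB _ _ _ f g). Qed.

Lemma derM f g (x a b : R) : isd x f a -> isd x g b ->
  isd x (fun y => f y * g y) (a * g x + f x * b).
Proof.
move=> df dg; have := @is_deriveM _ _ f g x 1 a b df dg.
by move=> h; apply: der_eq h _; rewrite /GRing.scale/= addrC mulrC.
Qed.

Lemma derZ f (c x a : R) : isd x f a -> isd x (fun y => c * f y) (c * a).
Proof. by move=> df; apply: der_eq (derM (derC c x) df) _; rewrite mul0r add0r. Qed.

Lemma derX2 f (x a : R) : isd x f a -> isd x (fun y => f y ^+ 2) (2 * f x * a).
Proof. by move=> df; apply: der_eq (derM df df) _; ring. Qed.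

Lemma derV f (x a : R) : f x != 0 -> isd x f a ->
  isd x (fun y => (f y)^-1) (- a / f x ^+ 2).
Proof.
move=> f0 df; have := @is_deriveV _ f x a 1 f0 df.
by move=> h; apply: der_eq h _; rewrite /GRing.scale/=; field.
Qed.

Lemma der_div f g (x a b : R) : g x != 0 -> isd x f a -> isd x g b ->
  isd x (fun y => f y / g y) ((a * g x - f x * b) / g x ^+ 2).
Proof.
by move=> g0 df dg; apply: der_eq (derM df (derV g0 dg)) _; field.
Qed.

Lemma der_comp f g (x a b : R) : isd x g b -> isd (g x) f a ->
  isd x (fun y => f (g y)) (a * b).
Proof. by move=> dg df; exact: (@is_derive1_comp _ f g x a b df dg). Qed.

Lemma der_near f g (x a : R) : (\forall y \near x, f y = g y) ->
  isd x f a -> isd x g a.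
Proof. by move=> fg df; apply: near_eq_is_derive df => //; rewrite oner_neq0. Qed.

Lemma der_cts f (x a : R) : isd x f a -> {for x, continuous f}.
Proof.
move=> [df _]; apply: differentiable_continuous; exact/derivable1_diffP.
Qed.

Lemma der_slope f (x a e : R) : isd x f a -> 0 < e ->
  \forall y \near x, `|f y - f x - a * (y - x)| <= e * `|y - x|.
Proof.
move=> [h1 h2] e0.
have := h1; rewrite /derivable => /cvg_ex[l hl].
have la : l = a by rewrite -h2; apply/esym/cvg_lim.
move: hl; rewrite la => /cvgrPdist_le /(_ e e0) /nbhs_ballP[d /= d0 H].
apply/nbhs_ballP; exists d => //= y xy.
have [->|yx] := eqVneq y x; first by rewrite !subrr mulr0 subr0 normr0 mulr0.
have yx0 : y - x != 0 by rewrite subr_eq0.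
have := H (y - x); rewrite /ball/= sub0r normrN distrC => /(_ xy yx0).
rewrite /GRing.scale/= mulr1 subrK => h.
rewrite (_ : f y - f x - a * (y - x) = - ((a - (y - x)^-1 * (f y - f x)) * (y - x))); last by field.
by rewrite normrN normrM [`|x - y|]distrC ler_wpM2r.
Qed.

(** Used where a derivative must be found from estimates: at the origin for [pp] and [flat], along
    curves in [chain2], and for [W]. *)
Lemma slope_der f (x a : R) :
  (forall e, 0 < e -> \forall y \near x, `|f y - f x - a * (y - x)| <= e * `|y - x|) ->
  isd x f a.
Proof.
move=> H.
have C : h^-1 *: (f (h *: (1 : R) + x) - f x) @[h --> 0^'] --> a.
  apply/cvgrPdist_le => e e0; have /nbhs_ballP[d /= d0 Hd] := H e e0.
  apply/nbhs_ballP; exists d => //= h; rewrite /ball/= sub0r normrN => hd h0.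
  have := Hd (h + x); rewrite /ball/= opprD addrCA subrr addr0 normrN => /(_ hd).
  rewrite addrK /GRing.scale/= mulr1 => E.
  rewrite -(@ler_pM2r _ `|h|) ?normr_gt0// -normrM.
  rewrite (_ : _ * h = - (f (h + x) - f x - a * h)) ?normrN//; by field.
by apply: DeriveDef; [apply/cvg_ex; exists a|exact/cvg_lim].
Qed.

(** Power of the positive part. It is continuous on the whole line for a > 0 and differentiable for
    a > 1, so expressions in r and w can be treated across r = 0 and across the zero of w. *)
Definition pp (a x : R) : R := (Num.max x 0) `^ a.

Lemma pp_ge0 a x : 0 <= pp a x.
Proof. exact: powR_ge0. Qed.

Lemma ppE a x : 0 <= x -> pp a x = x `^ a.
Proof. by move=> x0; rewrite /pp max_l. Qed.

Lemma pp_neg (a x : R) : a != 0 -> x <= 0 -> pp a x = 0.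
Proof. by move=> a0 x0; rewrite /pp max_r// powR0. Qed.

Lemma pp_gt0 a x : 0 < x -> 0 < pp a x.
Proof. by move=> x0; rewrite ppE ?ltW// powR_gt0. Qed.

Lemma pp1 a : pp a 1 = 1.
Proof. by rewrite ppE// powR1. Qed.

Lemma ppM (a b x : R) : 0 < a -> 0 < b -> pp a x * pp b x = pp (a + b) x.
Proof.
move=> a0 b0; have [x0|x0] := leP x 0.
  by rewrite !pp_neg ?mul0r// gt_eqF// addr_gt0.
by rewrite !ppE ?ltW// -powRD// (gt_eqF x0) implybT.
Qed.

Lemma ppS (a x : R) : 0 < a -> x * pp a x = pp (a + 1) x.
Proof.
move=> a0; have [x0|x0] := leP x 0.
  by rewrite !pp_neg ?mulr0// gt_eqF// addr_gt0.
by rewrite !ppE ?ltW// addrC powRD ?powRr1 ?ltW// (gt_eqF x0) implybT.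
Qed.

Lemma pp_le (a x y : R) : 0 <= a -> x <= y -> pp a x <= pp a y.
Proof.
move=> a0 xy; have h : Num.max x 0 <= Num.max y 0 by rewrite ge_max !le_max xy lexx orbT.
by apply: ge0_ler_powR => //; rewrite nnegrE le_max lexx orbT.
Qed.

Lemma pp_cont (a : R) : 0 < a -> continuous (pp a).
Proof.
move=> a0 x; have [x0|x0|x0] := ltgtP x 0.
- apply: (@der_cts _ _ 0); apply: (@der_near (fun _ : R => 0 : R)); last exact: (derC 0 x).
  near=> y.
  by rewrite pp_neg ?gt_eqF// ltW//; near: y; exact: lt_nbhsl.
- apply: (@der_cts _ _ (a * x `^ (a - 1))).
  refine (der_near _ (is_derive1_powR a x0)).
  by near=> y; rewrite ppE// ltW//; near: y; exact: lt_nbhsr.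
- rewrite {}x0 /continuous_at pp_neg ?gt_eqF//.
  apply/cvgrPdist_lt => e e0.
  have d0 : 0 < e `^ a^-1 by exact: powR_gt0.
  near=> y; rewrite sub0r normrN ger0_norm ?pp_ge0//.
  have yd : `|y| < e `^ a^-1.
    near: y; apply: (@nbhs0_lt _ R) => //.
  have [y0|y0] := leP y 0; first by rewrite pp_neg ?gt_eqF.
  rewrite ppE ?ltW// -[e](@powRr1 _ e) ?ltW// -[1](@mulVf _ a) ?gt_eqF// powRrM.
  by rewrite gt0_ltr_powR ?nnegrE ?powR_ge0 ?(ltW y0)// (le_lt_trans (ler_norm y)).
Unshelve. all: by end_near. Qed.

Lemma pp_der (a x : R) : 1 < a -> isd x (pp a) (a * pp (a - 1) x).
Proof.
move=> a1; have a0 : 0 < a by exact: lt_trans a1.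
have b0 : 0 < a - 1 by rewrite subr_gt0.
have [x0|x0|x0] := ltgtP x 0.
- rewrite pp_neg ?gt_eqF ?ltW// mulr0.
  apply: (@der_near (fun _ : R => 0 : R)); last exact: (derC 0 x).
  by near=> y; rewrite pp_neg ?gt_eqF// ltW//; near: y; exact: lt_nbhsl.
- rewrite ppE ?ltW//; refine (der_near _ (is_derive1_powR a x0)).
  by near=> y; rewrite ppE// ltW//; near: y; exact: lt_nbhsr.
- rewrite {}x0 pp_neg ?gt_eqF// mulr0.
  apply: slope_der => e e0; have := @pp_cont (a - 1) b0 0.
  rewrite /continuous_at pp_neg ?gt_eqF// => /cvgrPdist_lt /(_ e e0) H.
  near=> y; rewrite (@pp_neg a 0) ?gt_eqF// !subr0 mul0r subr0.
  have : `|0 - pp (a - 1) y| < e by near: y.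
  rewrite sub0r normrN (ger0_norm (pp_ge0 _ _)) (ger0_norm (pp_ge0 _ _)) => h.
  have := @ppS (a - 1) y b0; rewrite subrK => <-.
  have [y0|y0] := leP y 0; first by rewrite pp_neg ?mulr0 ?mulr_ge0// ?ltW// gt_eqF.
  by rewrite (ger0_norm (ltW y0)) mulrC ler_wpM2r// ltW.
Unshelve. all: by end_near. Qed.

Lemma der_mono f df (a b : R) : a <= b -> continuous f ->
  (forall x, a < x < b -> isd x f (df x)) ->
  (forall x, a < x < b -> 0 <= df x) -> f a <= f b.
Proof.
move=> ab cf d d0.
have cf' : {within `[a, b], continuous f} by exact: continuous_subspaceT.
have h x : x \in `]a, b[%R -> isd x f (df x).
  by rewrite in_itv/=; exact: d.
move: ab; rewrite le_eqVlt => /predU1P[->//|ab].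
have [c cab E] := MVT ab h cf'.
by rewrite -subr_ge0 E mulr_ge0 ?subr_ge0 ?(ltW ab)// d0//; rewrite in_itv in cab.
Qed.

Lemma der_mono_cc f df (a b : R) : a <= b ->
  (forall x, a <= x <= b -> isd x f (df x)) ->
  (forall x, a <= x <= b -> 0 <= df x) -> f a <= f b.
Proof.
rewrite le_eqVlt => /predU1P[->//|ab] d d0.
have h x : x \in `]a, b[%R -> isd x f (df x).
  by rewrite in_itv/= => /andP[ax xb]; apply: d; rewrite !ltW.
have cf' : {within `[a, b], continuous f}.
  by apply: derivable_within_continuous => x; rewrite in_itv/= => /d[].
have [c cab E] := MVT ab h cf'.
rewrite -subr_ge0 E mulr_ge0 ?subr_ge0 ?(ltW ab)// d0//.
by move: cab; rewrite in_itv/= => /andP[ac cb]; rewrite !ltW.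
Qed.

Lemma der0_const f (a b : R) : a <= b -> (forall x, a <= x <= b -> isd x f 0) -> f a = f b.
Proof.
move=> ab h; apply/eqP; rewrite eq_le; apply/andP; split.
  by apply: (@der_mono_cc f (fun=> 0)).
rewrite -lerN2; apply: (@der_mono_cc (fun x => - f x) (fun=> 0)) => // x /h d.
by apply: der_eq (derN d) _; rewrite oppr0.
Qed.

Definition itg (a b : R) (f : R -> R) : R := \int[mu]_(x in `[a, b]) f x.

Lemma cts_integrable f a b : continuous f -> mu.-integrable `[a, b] (EFin \o f).
Proof.
move=> cf; apply: continuous_compact_integrable; first exact: segment_compact.
exact: continuous_subspaceT.
Qed.

Lemma itgD a b f g : continuous f -> continuous g ->
  itg a b (fun x => f x + g x) = itg a b f + itg a b g.
Proof. by move=> cf cg; rewrite /itg RintegralD//; exact: cts_integrable. Qed.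

Lemma itgZ a b c f : continuous f -> itg a b (fun x => c * f x) = c * itg a b f.
Proof. by move=> cf; rewrite /itg RintegralZl//; exact: cts_integrable. Qed.

Lemma itgB a b f g : continuous f -> continuous g ->
  itg a b (fun x => f x - g x) = itg a b f - itg a b g.
Proof. by move=> cf cg; rewrite /itg RintegralB//; exact: cts_integrable. Qed.

Lemma eq_itg a b f g : (forall x, a <= x <= b -> f x = g x) -> itg a b f = itg a b g.
Proof.
move=> fg; apply: eq_Rintegral => x; rewrite inE/= in_itv/=; exact: fg.
Qed.

Lemma itg_ge0 a b f : (forall x, a <= x <= b -> 0 <= f x) -> 0 <= itg a b f.
Proof. by move=> f0; apply: Rintegral_ge0 => x /=; rewrite in_itv/=; exact: f0. Qed.

Lemma itg_le a b f g : continuous f -> continuous g ->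
  (forall x, a <= x <= b -> f x <= g x) -> itg a b f <= itg a b g.
Proof.
move=> cf cg fg; apply: le_Rintegral; [by []|exact: cts_integrable|exact: cts_integrable|].
by move=> x; rewrite /= in_itv/=; exact: fg.
Qed.

(** The shape shared by the moment identities; shorter combinations are padded with zero
    coefficients. *)
Lemma itg_lin a b (f1 f2 f3 f4 : R -> R) c1 c2 c3 c4 :
  continuous f1 -> continuous f2 -> continuous f3 -> continuous f4 ->
  itg a b (fun x => c1 * f1 x + c2 * f2 x + c3 * f3 x + c4 * f4 x) =
  c1 * itg a b f1 + c2 * itg a b f2 + c3 * itg a b f3 + c4 * itg a b f4.
Proof.
move=> h1 h2 h3 h4.
have z c f : continuous f -> continuous (fun x => c * f x).
  by move=> cf; apply: ctsM => //; exact: ctsC.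
by rewrite !itgD ?itgZ//; do ?[apply: ctsD]; exact: z.
Qed.

Lemma itg_FTC (a b : R) (F f : R -> R) : a <= b -> continuous f -> continuous F ->
  (forall x, a < x < b -> isd x F (f x)) ->
  itg a b f = F b - F a.
Proof.
move=> + cf cF d; rewrite le_eqVlt => /predU1P[<-|ab].
  by rewrite /itg subrr set_itv1 Rintegral_set1.
rewrite /itg /Rintegral (@continuous_FTC2 _ f F a b ab) ?EFinB//.
- exact: continuous_subspaceT.
- split.
  + by move=> x; rewrite in_itv/= => /d[].
  + by apply: cvg_at_right_filter; exact: cF.
  + by apply: cvg_at_left_filter; exact: cF.
- by move=> x; rewrite in_itv/= => /d[_]; rewrite derive1E.
Qed.

Lemma antiderivative f : continuous f ->
  exists2 N : R -> R, N 0 = 0 & forall r : R, isd r N (f r).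
Proof.
move=> cf.
have add (a x b : R) : a <= x -> x <= b ->
    itg a b f - itg a x f = \int[mu]_(t in `]x, b]) f t.
  by move=> ax xb; rewrite /itg Rintegral_itvB ?bnd_simp//; exact: cts_integrable.
have indep (a c y : R) : a <= y -> a <= 0 -> c <= y -> c <= 0 ->
    itg a y f - itg a 0 f = itg c y f - itg c 0 f.
  move=> ay a0 cy c0; have [y0|y0] := leP 0 y; first by rewrite !add.
  by rewrite -opprB -[RHS]opprB !add// ltW.
(* The base point depends on y so that it lies to the left of both y and 0; by [indep] it can be
   frozen at c near a given x. *)
exists (fun y => itg (- (`|y| + 1)) y f - itg (- (`|y| + 1)) 0 f); first by rewrite subrr.
move=> x; set c := - (`|x| + 2).
have cx : c < x by rewrite /c; have := ler_norm (- x); rewrite normrN; lra.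
apply: (@der_near (fun y => itg c y f - itg c 0 f)).
  near=> y.
  have : `|y - x| < 1 by rewrite distrC; near: y; apply: (@nbhsx_ballx _ _ _ 1).
  move=> yx; have h1 : `|y| <= `|x| + 1.
    by rewrite -[y](subrK x) (le_trans (ler_normD _ _))// addrC lerD2l ltW.
  have h2 := ler_norm (- y); have h3 := normr_ge0 y; have h4 := normr_ge0 x; rewrite normrN in h2.
  by apply: indep; rewrite /c; lra.
have int : mu.-integrable `[c, x + 1] (EFin \o f) by exact: cts_integrable.
have x1 : x < x + 1 by rewrite ltrDl.
have [d1 d2] := @continuous_FTC1_closed _ f c x (x + 1) x1 int cx (cf x).
apply: der_eq (derB (DeriveDef d1 (esym (derive1E _ _))) (derC _ _)) _.
by rewrite subr0 d2.
Unshelve. all: by end_near. Qed.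

End calculus.

Ltac cts := lazymatch goal with
  | |- continuous ?h => lazymatch h with
    | (fun x => GRing.add (@?f x) (@?g x)) => apply: (@ctsD _ f g); cts
    | (fun x => GRing.opp (@?f x)) => apply: (@ctsN _ f); cts
    | (fun x => GRing.mul (@?f x) (@?g x)) => apply: (@ctsM _ f g); cts
    | (fun x => GRing.exp (@?f x) ?n) => apply: (@ctsX _ f n); cts
    | (fun x => x) => apply: ctsI
    | (fun _ => ?c) => apply: ctsC
    | _ => try assumption
    end
  end.

(** * The radial profile: moments and the radial quadratic form *)

(* [w] is the radial profile and [X = - r w'] its flux. *)
Record profile (R : realType) (tau p : R) (w X : R -> R) : Prop := Profile {
  prof_tau : 1 <= tau;
  prof_p : 3 < p;
  prof_cw : continuous w;
  prof_cX : continuous X;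
  prof_dw : forall r : R, 0 < r -> isd r w (- (X r / r));
  prof_dX : forall r : R, 0 < r -> isd r X (pp (2 * tau - 1) r * pp p (w r));
  prof_w1 : w 1 = 0;
  prof_wpos : forall r, 0 <= r -> r < 1 -> 0 < w r;
  prof_X0 : forall r, r <= 0 -> X r = 0 }.

Section profile_theory.
Context {R : realType} (tau p : R) (w X : R -> R) (H : profile tau p w X).

Let t1 : 1 <= tau. Proof. exact: prof_tau H. Qed.
Let p3 : 3 < p. Proof. exact: prof_p H. Qed.
Let cw : continuous w. Proof. exact: prof_cw H. Qed.
Let cX : continuous X. Proof. exact: prof_cX H. Qed.
Let X0 : X 0 = 0. Proof. exact: (prof_X0 H). Qed.

(** Every power of w that occurs is written as a natural power of w times [pb], so identities
    between derivatives become polynomial and are closed by [ring]. The assumption p > 3 keeps the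
    exponent p - 3 of [pb] positive. *)
Definition pa (r : R) := pp (2 * tau - 1) r.
Definition pb (r : R) := pp (p - 3) (w r).
Definition pY (r : R) := X r / r.

Ltac plra := have h1__ := prof_tau H; have h3__ := prof_p H; lra.

Local Notation a := pa.
Local Notation b := pb.
Local Notation Y := pY.

Lemma pa_ge0 (r : R) : 0 <= a r. Proof. exact: pp_ge0. Qed.
Lemma pb_ge0 (r : R) : 0 <= b r. Proof. exact: pp_ge0. Qed.

Lemma pa_cont : continuous a.
Proof. by apply: pp_cont; plra. Qed.

Lemma pb_cont : continuous b.
Proof. by apply: cts_comp cw; apply: pp_cont; plra. Qed.

Lemma ppb1 (r : R) : pp (p - 2) (w r) = w r * b r.
Proof. by rewrite /pb ppS; [congr pp; ring|plra]. Qed.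

Lemma ppb2 (r : R) : pp (p - 1) (w r) = w r ^+ 2 * b r.
Proof.
rewrite expr2 -mulrA -ppb1 ppS; last by plra.
by congr pp; ring.
Qed.

Lemma ppb3 (r : R) : pp p (w r) = w r ^+ 3 * b r.
Proof.
rewrite exprS -mulrA -ppb2 ppS; last by plra.
by congr pp; ring.
Qed.

Lemma ppb4 (r : R) : pp (p + 1) (w r) = w r ^+ 4 * b r.
Proof.
rewrite exprS -mulrA -ppb3 ppS; last by plra.
by congr pp; ring.
Qed.

Lemma ppa1 (r : R) : pp (2 * tau) r = r * a r.
Proof. by rewrite /pa ppS; [congr pp; ring|plra]. Qed.

Lemma XY (r : R) : 0 < r -> X r = r * Y r.
Proof. by move=> r0; rewrite /pY; field; rewrite gt_eqF. Qed.

Lemma der_w (r : R) : 0 < r -> isd r w (- Y r).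
Proof. exact: (prof_dw H). Qed.

Lemma der_X (r : R) : 0 < r -> isd r X (a r * (w r ^+ 3 * b r)).
Proof. by move=> /(prof_dX H); rewrite ppb3. Qed.

Lemma der_pw2 (r : R) : 0 < r ->
  isd r (fun r => pp (p - 2) (w r)) ((p - 2) * b r * - Y r).
Proof.
move=> r0; apply: der_comp (der_w r0) _; apply: der_eq (pp_der _ _) _; first by plra.
by rewrite /pb (_ : p - 2 - 1 = p - 3)//; ring.
Qed.

Lemma der_pw1 (r : R) : 0 < r ->
  isd r (fun r => pp (p - 1) (w r)) ((p - 1) * (w r * b r) * - Y r).
Proof.
move=> r0; apply: der_comp (der_w r0) _; apply: der_eq (pp_der _ _) _; first by plra.
by rewrite -ppb1 (_ : p - 1 - 1 = p - 2)//; ring.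
Qed.

Lemma der_pw (r : R) : 0 < r ->
  isd r (fun r => pp p (w r)) (p * (w r ^+ 2 * b r) * - Y r).
Proof.
move=> r0; apply: der_comp (der_w r0) _; apply: der_eq (pp_der _ _) _; first by plra.
by rewrite -ppb2.
Qed.

Lemma der_pwS (r : R) : 0 < r ->
  isd r (fun r => pp (p + 1) (w r)) ((p + 1) * (w r ^+ 3 * b r) * - Y r).
Proof.
move=> r0; apply: der_comp (der_w r0) _; apply: der_eq (pp_der _ _) _; first by plra.
by rewrite -ppb3 addrK.
Qed.

Lemma der_pa2 (r : R) : isd r (pp (2 * tau)) (2 * tau * a r).
Proof. by apply: pp_der; plra. Qed.

Lemma w_ge0 (r : R) : 0 <= r -> r <= 1 -> 0 <= w r.
Proof.
move=> r0; rewrite le_eqVlt => /predU1P[->|r1]; first by rewrite (prof_w1 H).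
by rewrite ltW// (prof_wpos H).
Qed.

Lemma X_ge0 (r : R) : 0 <= r -> r <= 1 -> 0 <= X r.
Proof.
move=> r0 r1; rewrite -X0; apply: der_mono r0 cX _ _ => x /andP[x0 xr].
  exact: der_X x0.
rewrite mulr_ge0 ?pa_ge0// mulr_ge0 ?pb_ge0// exprn_ge0// w_ge0 ?ltW//.
exact: lt_le_trans xr r1.
Qed.

Lemma X_gt0 (r : R) : 0 < r -> r <= 1 -> 0 < X r.
Proof.
move=> r0 r1; have cX' : {within `[0, r], continuous X} by exact: continuous_subspaceT.
have d x : x \in `]0, r[%R -> isd x X (a x * (w x ^+ 3 * b x)).
  by rewrite in_itv/= => /andP[x0 _]; exact: der_X.
have [c] := MVT r0 d cX'; rewrite in_itv/= X0 !subr0 => /andP[c0 cr] ->.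
have wc : 0 < w c by rewrite (prof_wpos H) ?ltW// (lt_le_trans cr).
by rewrite !mulr_gt0 ?exprn_gt0 ?pp_gt0.
Qed.

(** Since w is nonincreasing and 2 tau - 1 >= 1, X' <= r w(0)^p. The quadratic bound makes X / r,
    that is -w', continuous at the origin. *)
Lemma X_le_sqr : exists2 M, 0 <= M & forall r, 0 <= r -> r <= 1 -> X r <= M * r ^+ 2.
Proof.
pose M := w 0 ^+ 3 * b 0.
have wle r : 0 <= r -> r <= 1 -> w r <= w 0.
  move=> r0 r1; rewrite -lerN2; apply: (@der_mono _ (fun r => - w r) (fun r => Y r)) => //.
  - exact: ctsN.
  - by move=> x /andP[x0 _]; apply: der_eq (derN (der_w x0)) _; rewrite opprK.
  - move=> x /andP[x0 xr]; rewrite /pY divr_ge0 ?X_ge0// ltW//; exact: lt_le_trans xr r1.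
have M0 : 0 <= M by rewrite mulr_ge0 ?pb_ge0// exprn_ge0// w_ge0.
exists M => // r r0 r1; rewrite -subr_ge0.
have -> : 0 = M * 0 ^+ 2 - X 0 by rewrite X0 expr0n/= mulr0 subr0.
apply: (@der_mono _ (fun r => M * r ^+ 2 - X r) (fun r => M * (2 * r * 1) - a r * (w r ^+ 3 * b r))); first exact: r0.
- by apply: ctsB => //; apply: ctsM; [exact: ctsC|apply: ctsX; exact: ctsI].
- by move=> x /andP[x0 _]; apply: derB; [apply: derZ; exact: derX2 (derI x)|exact: der_X].
move=> x /andP[x0 xr]; have x1 : x <= 1 by rewrite ltW// (lt_le_trans xr).
have ax : a x <= x.
  have : x `^ (2 * tau - 1) <= x `^ 1 by apply: ger_powR; [rewrite x0 x1|plra].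
  by rewrite powRr1 ?(ltW x0)// /pa ppE ?(ltW x0).
have h : w x ^+ 3 * b x <= M.
  rewrite -ppb3 /M -ppb3; apply: pp_le; first by plra.
  by apply: wle => //; exact: ltW.
have h0 : 0 <= w x ^+ 3 * b x by rewrite -ppb3 pp_ge0.
have := pa_ge0 x; nra.
Qed.

Lemma pY_cont : continuous Y.
Proof.
move=> x; have [x0|x0] := eqVneq x 0; last first.
  by apply: cvgM; [exact: cX|apply: cvgV => //; exact: cvg_id].
have [M M0 HM] := X_le_sqr.
rewrite x0 /continuous_at {2}/pY invr0 mulr0; apply/cvgrPdist_lt => e e0.
near=> y; rewrite sub0r normrN.
have y1 : `|y| < 1 by near: y; exact: (@nbhs0_lt _ R).
have ye : `|y| < e / (M + 1) by near: y; apply: (@nbhs0_lt _ R); rewrite divr_gt0// ltr_wpDl.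
have [yn|yp] := leP y 0; first by rewrite /pY (prof_X0 H)// mul0r normr0.
rewrite /pY ger0_norm; last first.
  by rewrite divr_ge0 ?X_ge0 ?ltW//; rewrite (le_lt_trans (ler_norm y)).
have yl : y < e / (M + 1) by rewrite (le_lt_trans (ler_norm y)).
rewrite ltr_pdivrMr// (le_lt_trans (HM _ (ltW yp) _))//.
  by rewrite ltW// (le_lt_trans (ler_norm y)).
move: yl; rewrite ltr_pdivlMr ?ltr_wpDl// => yl.
rewrite expr2 mulrA ltr_pM2r//; nra.
Unshelve. all: by end_near. Qed.

(** [k0], [k1], [k2] are the densities of the moments of order 0, 1, 2 of X / w. [kp] is X', [kD] is
    the density of the nonlinear energy, and [kk] = r^(4 tau - 1) w^(2p-2) comes from the potential
    acting on the trial function. *)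
Definition k0 (r : R) := a r * (w r ^+ 2 * b r).
Definition k1 (r : R) := a r * (w r * b r) * X r.
Definition k2 (r : R) := a r * b r * X r ^+ 2.
Definition kp (r : R) := a r * (w r ^+ 3 * b r).
Definition kD (r : R) := a r * (w r ^+ 4 * b r).
Definition kk (r : R) := r * k0 r ^+ 2.

Let ca : continuous a. Proof. exact: pa_cont. Qed.
Let cb : continuous b. Proof. exact: pb_cont. Qed.

Lemma k0_cont : continuous k0. Proof. rewrite /k0; cts. Qed.
Lemma k1_cont : continuous k1. Proof. rewrite /k1; cts. Qed.
Lemma k2_cont : continuous k2. Proof. rewrite /k2; cts. Qed.
Lemma kp_cont : continuous kp. Proof. rewrite /kp; cts. Qed.
Lemma kD_cont : continuous kD. Proof. rewrite /kD; cts. Qed.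
Lemma kk_cont : continuous kk.
Proof. by have := k0_cont; move=> ?; rewrite /kk; cts. Qed.

Lemma k0_ge0 (r : R) : 0 <= k0 r.
Proof. by rewrite mulr_ge0 ?pa_ge0// mulr_ge0 ?pb_ge0// sqr_ge0. Qed.

Lemma ppw_cont (q : R) : 0 < q -> continuous (fun r => pp q (w r)).
Proof. by move=> q0; apply: cts_comp cw; exact: pp_cont. Qed.

Lemma ppr_cont : continuous (pp (2 * tau)).
Proof. by apply: pp_cont; plra. Qed.

Lemma w10 (q : R) : 0 < q -> pp q (w 1) = 0.
Proof. by move=> q0; rewrite (prof_w1 H) pp_neg ?gt_eqF. Qed.

Lemma ppr0 : pp (2 * tau) 0 = 0.
Proof. by rewrite pp_neg// gt_eqF//; plra. Qed.

(** Integrates the derivative of r^(2 tau) w^(p-1), which vanishes at both ends. *)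
Lemma moment1 : 2 * tau * itg 0 1 k0 = (p - 1) * itg 0 1 k1.
Proof.
have ck0 := k0_cont; have ck1 := k1_cont.
suff : 2 * tau * itg 0 1 k0 + (- (p - 1)) * itg 0 1 k1 + 0 * itg 0 1 k0 + 0 * itg 0 1 k0 = 0 by plra.
rewrite -itg_lin//.
rewrite (@itg_FTC _ 0 1 (fun r => pp (2 * tau) r * pp (p - 1) (w r))) ?ler01//.
- by rewrite w10 ?ppr0 ?mulr0 ?mul0r ?subrr//; plra.
- by cts.
- by apply: ctsM ppr_cont (ppw_cont _); plra.
move=> x /andP[x0 _]; apply: der_eq (derM (der_pa2 x) (der_pw1 x0)) _.
by rewrite ppb2 ppa1 /k0 /k1 (XY x0); ring.
Qed.

(** Integrates the derivative of r^(2 tau) w^(p-2) X; it eliminates the potential term in favour of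
    moments. *)
Lemma moment2 : itg 0 1 kk = (p - 2) * itg 0 1 k2 - 2 * tau * itg 0 1 k1.
Proof.
have ck1 := k1_cont; have ck2 := k2_cont; have ckk := kk_cont.
suff : 2 * tau * itg 0 1 k1 + (- (p - 2)) * itg 0 1 k2 + 1 * itg 0 1 kk + 0 * itg 0 1 kk = 0 by plra.
rewrite -itg_lin//.
rewrite (@itg_FTC _ 0 1 (fun r => pp (2 * tau) r * (pp (p - 2) (w r) * X r))) ?ler01//.
- by rewrite w10 ?ppr0 ?mul0r ?mulr0 ?subrr//; plra.
- by cts.
- by apply: ctsM ppr_cont _; apply: ctsM => //; apply: ppw_cont; plra.
move=> x /andP[x0 _].
apply: der_eq (derM (der_pa2 x) (derM (der_pw2 x0) (der_X x0))) _.
by rewrite ppb1 ppa1 /kk /k0 /k1 /k2 (XY x0); ring.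
Qed.

(** Pohozaev's identity: the derivative of X^2 + 2/(p+1) r^(2 tau) w^(p+1) keeps only the term where
    r^(2 tau) is differentiated. *)
Lemma moment_pohozaev : X 1 ^+ 2 = 4 * tau / (p + 1) * itg 0 1 kD.
Proof.
have p1 : p + 1 != 0 by rewrite gt_eqF//; plra.
rewrite -itgZ; last exact: kD_cont.
rewrite (@itg_FTC _ 0 1 (fun r => X r ^+ 2 + 2 / (p + 1) * (pp (2 * tau) r * pp (p + 1) (w r)))) ?ler01//.
- by rewrite w10 ?ppr0 ?X0 ?mul0r ?mulr0 ?expr0n/= ?addr0 ?subr0//; plra.
- by apply: ctsM; [exact: ctsC|exact: kD_cont].
- apply: ctsD; first exact: ctsX.
  by apply: ctsM; [exact: ctsC|apply: ctsM; [exact: ppr_cont|apply: ppw_cont; plra]].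
move=> x /andP[x0 _].
apply: der_eq (derD (derX2 (der_X x0)) (derZ _ (derM (der_pa2 x) (der_pwS x0)))) _.
by rewrite ppb4 ppa1 /kD (XY x0); field.
Qed.

Lemma itg_kp : itg 0 1 kp = X 1.
Proof.
rewrite (@itg_FTC _ 0 1 X) ?ler01 ?X0 ?subr0//; first exact: kp_cont.
by move=> x /andP[x0 _]; exact: der_X.
Qed.

Lemma kD_gt0 : 0 < itg 0 1 kD.
Proof.
have := moment_pohozaev; have := X_gt0 ltr01 (lexx 1).
move=> h; have : 0 < X 1 ^+ 2 by rewrite exprn_gt0.
by move=> + E; rewrite E pmulr_rgt0// divr_gt0; plra.
Qed.

(** Cauchy-Schwarz for w^3 = w * w^2 gives X(1)^2 <= (integral of [k0])(integral of [kD]); Pohozaev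
    turns the left side into a multiple of the integral of [kD], which cancels. *)
Lemma moment0_lb : 4 * tau / (p + 1) <= itg 0 1 k0.
Proof.
have D0 := kD_gt0; have X1 := X_gt0 ltr01 (lexx 1).
have E := moment_pohozaev.
(* With this t the cross term in the integral of [k0] (w - t)^2 >= 0 is exactly -2 times the
   integral of [kD]. *)
pose t := itg 0 1 kD / X 1.
have : 0 <= t ^+ 2 * itg 0 1 k0 + (- (2 * t)) * itg 0 1 kp + 1 * itg 0 1 kD + 0 * itg 0 1 kD.
  rewrite -itg_lin; try exact: k0_cont; try exact: kp_cont; try exact: kD_cont.
  apply: itg_ge0 => x _; rewrite /k0 /kp /kD.
  rewrite (_ : _ + _ = a x * (b x * w x ^+ 2) * (w x - t) ^+ 2); last by ring.
  by rewrite mulr_ge0 ?sqr_ge0// mulr_ge0 ?pa_ge0// mulr_ge0 ?pb_ge0 ?sqr_ge0.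
rewrite itg_kp mul1r mul0r addr0 => h.
have tX : t * X 1 = itg 0 1 kD by rewrite /t divfK ?gt_eqF.
have h' : - (2 * t) * X 1 = - (2 * itg 0 1 kD) by rewrite -tX; ring.
have : itg 0 1 kD <= t ^+ 2 * itg 0 1 k0 by rewrite h' in h; plra.
have t0 : 0 < t by rewrite divr_gt0.
move=> hh; have := ler_wpM2l (sqr_ge0 (X 1)) hh.
rewrite (_ : X 1 ^+ 2 * (t ^+ 2 * itg 0 1 k0) = (t * X 1) ^+ 2 * itg 0 1 k0); last by ring.
rewrite tX E => h2; rewrite -(ler_pM2r (mulr_gt0 D0 D0)).
rewrite mulrA; apply: le_trans h2 _; by rewrite expr2 mulrC.
Qed.

(** With N the primitive of [k0], (X - w N)' = N X / r >= 0, so X >= w N and [k2] >= [k0] N^2, whose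
    primitive is N^3 / 3. *)
Lemma moment2_lb : itg 0 1 k0 ^+ 3 / 3 <= itg 0 1 k2.
Proof.
have [N N0 dN] := antiderivative k0_cont.
have cN : continuous N by move=> x; apply: der_cts (dN x).
have N1 : itg 0 1 k0 = N 1.
  by rewrite (@itg_FTC _ 0 1 N) ?ler01 ?N0 ?subr0//; exact: k0_cont.
have Nge r : 0 <= r -> 0 <= N r.
  move=> r0; rewrite -N0; apply: der_mono r0 cN _ _ => x _; [exact: dN|exact: k0_ge0].
have XN r : 0 <= r -> r <= 1 -> w r * N r <= X r.
  move=> r0 r1; rewrite -subr_ge0.
  have -> : 0 = X 0 - w 0 * N 0 by rewrite X0 N0 mulr0 subr0.
  apply: (@der_mono _ (fun r => X r - w r * N r) (fun r => Y r * N r)) => //.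
  - by cts.
  - move=> x /andP[x0 _]; apply: der_eq (derB (der_X x0) (derM (der_w x0) (dN x))) _.
    by rewrite /k0; ring.
  move=> x /andP[x0 xr]; apply: mulr_ge0; last by apply: Nge; exact: ltW.
  by apply: divr_ge0; [apply: X_ge0; [exact: ltW|exact: ltW (lt_le_trans xr r1)]|exact: ltW].
have -> : itg 0 1 k0 ^+ 3 / 3 = itg 0 1 (fun r => k0 r * N r ^+ 2).
  rewrite [RHS](@itg_FTC _ 0 1 (fun r => N r ^+ 2 * N r / 3)) ?ler01//.
  - by rewrite N0 N1 mulr0 mul0r subr0; ring.
  - by apply: ctsM; [exact: k0_cont|exact: ctsX].
  - by cts.
  - move=> x _; apply: der_eq (derM (derM (derX2 (dN x)) (dN x)) (derC _ _)) _.
    by field.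
apply: itg_le.
- by apply: ctsM; [exact: k0_cont|exact: ctsX].
- exact: k2_cont.
move=> x /andP[x0 x1]; rewrite /k0 /k2.
rewrite (_ : _ * _ ^+ 2 = a x * b x * (w x * N x) ^+ 2); last by ring.
rewrite ler_wpM2l ?mulr_ge0 ?pa_ge0 ?pb_ge0//.
by rewrite ler_pXn2r ?nnegrE ?X_ge0 ?mulr_ge0 ?w_ge0 ?Nge ?XN.
Qed.

(* The quadratic form evaluated at [r^tau w^((p-1)/2) e_j], where [j2 = j^2]. *)
Lemma moment_neg (j2 : R) :
  j2 - tau ^+ 2 + 4 * tau ^+ 2 * p / (p - 1)
    - 16 * tau ^+ 2 / 3 * (p * (p - 2) - (p - 1) ^+ 2 / 4) / (p + 1) ^+ 2 < 0 ->
  itg 0 1 (fun r => (tau ^+ 2 + j2) * k0 r + (- (tau * (p - 1))) * k1 r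
     + (p - 1) ^+ 2 / 4 * k2 r + (- p) * kk r) < 0.
Proof.
move=> hp; rewrite itg_lin; try by [exact: k0_cont|exact: k1_cont|exact: k2_cont|exact: kk_cont].
have M1 := moment1; have M2 := moment2; have L2 := moment2_lb; have L0 := moment0_lb.
rewrite M2; set m0 := itg 0 1 k0 in M1 L2 L0 *; set m1 := itg 0 1 k1 in M1 *.
set m2 := itg 0 1 k2 in L2 *.
have p1 : 0 < p - 1 by plra.
have pp1 : 0 < p + 1 by plra.
have m00 : 0 < m0 by apply: lt_le_trans L0; rewrite divr_gt0; plra.
have E1 : m1 = 2 * tau * m0 / (p - 1) by rewrite M1; field; rewrite gt_eqF.
set c := p * (p - 2) - (p - 1) ^+ 2 / 4 in hp.
have c0 : 0 <= c by have h3 := prof_p H; rewrite /c; nra.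
have sq : 16 * tau ^+ 2 / (p + 1) ^+ 2 <= m0 ^+ 2.
  rewrite (_ : 16 * tau ^+ 2 / (p + 1) ^+ 2 = (4 * tau / (p + 1)) ^+ 2); last by field; rewrite gt_eqF.
  by rewrite ler_pXn2r ?nnegrE ?(ltW m00)// divr_ge0; plra.
have cu : m0 * (16 * tau ^+ 2 / (p + 1) ^+ 2) / 3 <= m2.
  apply: le_trans L2; rewrite exprS ler_pM2r ?invr_gt0 ?ltr0n// ler_pM2l//.
have : m0 * (j2 - tau ^+ 2 + 4 * tau ^+ 2 * p / (p - 1)
    - 16 * tau ^+ 2 / 3 * c / (p + 1) ^+ 2) < 0 by rewrite pmulr_rlt0.
apply: le_lt_trans.
(* After eliminating [kk] and [k1] only m0 and -c m2 remain. The bounds m2 >= m0^3 / 3 and m0 >= 4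
   tau / (p + 1) then allow division by m0 and produce the constant 16 tau^2 / 3. *)
have -> : (tau ^+ 2 + j2) * m0 + - (tau * (p - 1)) * m1 + (p - 1) ^+ 2 / 4 * m2 +
   - p * ((p - 2) * m2 - 2 * tau * m1) = m0 * (j2 - tau ^+ 2 + 4 * tau ^+ 2 * p / (p - 1)) - c * m2.
  by rewrite E1 /c; field; rewrite gt_eqF.
have -> : m0 * (j2 - tau ^+ 2 + 4 * tau ^+ 2 * p / (p - 1) - 16 * tau ^+ 2 / 3 * c / (p + 1) ^+ 2) =
  m0 * (j2 - tau ^+ 2 + 4 * tau ^+ 2 * p / (p - 1)) - c * (m0 * (16 * tau ^+ 2 / (p + 1) ^+ 2) / 3).
  by field; rewrite !gt_eqF.
by rewrite lerD2l lerN2 ler_wpM2l.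
Qed.

(** * A solution of the linearized radial equation, and Picone's inequality *)

Definition q0 : R := 2 * tau / (p - 1).
(** Generator of the scaling symmetry: the derivative at s = 1 of s^q0 w(s r), which solves the same
    equation for every s. Its flux r z' is [pzeta]. *)
Definition pz (r : R) := q0 * w r - X r.
Definition pzeta (r : R) := - (q0 * X r) - pp (2 * tau) r * pp p (w r).

Lemma q0_gt0 : 0 < q0.
Proof. by rewrite divr_gt0; plra. Qed.

Lemma der_pz r : 0 < r -> isd r pz (pzeta r / r).
Proof.
move=> r0; apply: der_eq (derB (derZ _ (der_w r0)) (der_X r0)) _.
by rewrite /pzeta ppa1 ppb3 (XY r0); field; rewrite gt_eqF.
Qed.

Lemma der_pzeta r : 0 < r -> isd r pzeta (- p * k0 r * pz r).
Proof.
move=> r0.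
apply: der_eq (derB (derN (derZ _ (der_X r0))) (derM (der_pa2 r) (der_pw r0))) _.
have p1 : p - 1 != 0 by rewrite gt_eqF//; plra.
rewrite /pz /k0 ppa1 ppb3 (XY r0) /q0; field => //.
Qed.

Lemma pz_cont : continuous pz.
Proof. by rewrite /pz; cts. Qed.

Lemma pzeta_cont : continuous pzeta.
Proof.
have c1 := ppr_cont; have c2 : continuous (fun r => pp p (w r)) by apply: ppw_cont; plra.
by rewrite /pzeta; cts.
Qed.

Lemma pzeta_lt0 r : 0 < r -> r <= 1 -> pzeta r < 0.
Proof.
move=> r0 r1; have := mulr_gt0 q0_gt0 (X_gt0 r0 r1).
by have := mulr_ge0 (pp_ge0 (2 * tau) r) (pp_ge0 p (w r)); rewrite /pzeta; lra.
Qed.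

Lemma pz_decr r s : 0 <= r -> r < s -> s <= 1 -> pz s < pz r.
Proof.
move=> r0 rs s1.
have d x : x \in `]r, s[%R -> is_derive x 1 pz (pzeta x / x).
  by rewrite in_itv/= => /andP[rx _]; apply: der_pz; exact: le_lt_trans rx.
have c : {within `[r, s], continuous pz} by apply: continuous_subspaceT; exact: pz_cont.
have [x] := MVT rs d c; rewrite in_itv/= => /andP[rx xs] E.
rewrite -subr_lt0 E pmulr_llt0 ?subr_gt0//.
have x0 : 0 < x by exact: le_lt_trans rx.
by rewrite pmulr_llt0 ?invr_gt0// pzeta_lt0// ltW// (lt_le_trans xs).
Qed.

Lemma pz_root : exists2 r0, 0 < r0 < 1 & pz r0 = 0.
Proof.
have z0 : 0 < pz 0 by rewrite /pz X0 subr0 mulr_gt0 ?q0_gt0// (prof_wpos H).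
have z1 : pz 1 < 0.
  by rewrite /pz (prof_w1 H) mulr0 sub0r oppr_lt0; exact: X_gt0.
have c : {within `[0, 1], continuous pz} by apply: continuous_subspaceT; exact: pz_cont.
have [|r] := @IVT _ pz 0 1 0 ler01 c.
  by rewrite ge_min le_max (ltW z0) (ltW z1) orbT.
rewrite in_itv/= !le_eqVlt => /andP[h1 h2] zr; exists r => //; apply/andP; split.
  by case/predU1P: h1 => // E; move: zr z0; rewrite -E => ->; rewrite ltxx.
by case/predU1P: h2 => // E; move: zr z1; rewrite E => ->; rewrite ltxx.
Qed.

(** Picone's identity: G minus g^2 r z' / z has derivative r (g' - g z' / z)^2, because z solves the
    linearized equation. *)
Lemma picone (G g dg : R -> R) (u v : R) : 0 < u -> u <= v -> v <= 1 ->
  (forall r, u <= r <= v -> pz r != 0) ->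
  (forall r, 0 < r -> isd r g (dg r)) ->
  (forall r, isd r G (r * dg r ^+ 2 - p * k0 r * g r ^+ 2)) ->
  g v ^+ 2 * pzeta v / pz v - g u ^+ 2 * pzeta u / pz u <= G v - G u.
Proof.
move=> u0 uv v1 z0 Hg HG.
rewrite -subr_ge0 (_ : _ - _ = (G v - g v ^+ 2 * pzeta v / pz v) - (G u - g u ^+ 2 * pzeta u / pz u)); last by ring.
rewrite subr_ge0.
apply: (@der_mono_cc _ (fun r => G r - g r ^+ 2 * pzeta r / pz r)
  (fun r => r * (dg r - g r * pzeta r / (r * pz r)) ^+ 2)) => //.
- move=> r rv; have r0 : 0 < r by move: rv => /andP[+ _]; exact: lt_le_trans.
  apply: der_eq (derB (HG r) (der_div (z0 r rv) (derM (derX2 (Hg r r0)) (der_pzeta r0)) (der_pz r0))) _.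
  by field; rewrite z0// gt_eqF.
- move=> r /andP[ur _]; rewrite mulr_ge0 ?sqr_ge0// ltW//; exact: lt_le_trans ur.
Qed.

(* The boundary term of [picone] at the simple zero of [pz] vanishes in the limit. *)
Lemma picone_zero (g dg : R -> R) (r0 e : R) : 0 < r0 < 1 -> pz r0 = 0 -> 0 < e ->
  continuous g -> isd r0 g (dg r0) -> g r0 = 0 ->
  \forall r \near r0, r != r0 -> `|g r ^+ 2 * pzeta r / pz r| <= e.
Proof.
move=> /andP[r00 r01] z0 e0 cg dg0 g0.
have l0 : pzeta r0 / r0 < 0 by rewrite pmulr_llt0 ?invr_gt0// pzeta_lt0// ltW.
set l := pzeta r0 / r0 in l0.
set C := `|dg r0| + 1; have C0 : 0 < C by rewrite ltr_wpDl.
have l2 : 0 < - l / 2 by lra.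
have cgz : continuous (fun r : R => g r * pzeta r).
  by apply: ctsM => //; exact: pzeta_cont.
(* Near r0, |g| <= C |r - r0| while |z| >= (-l/2) |r - r0|, so the quotient is at most C / (-l/2)
   times |g [pzeta]|, and the last factor tends to 0. *)
have d0 : 0 < e * (- l / 2) / C by rewrite divr_gt0// mulr_gt0.
have near1 := der_slope dg0 (@ltr01 R); have near2 := der_slope (der_pz r00) l2.
have near3 : \forall r \near r0, `|g r * pzeta r| < e * (- l / 2) / C.
  have /cvgrPdist_lt /(_ _ d0) := cgz r0; rewrite g0 mul0r.
  by apply: filterS => r; rewrite sub0r normrN.
near=> r; move=> rr0.
have h1 : `|g r - g r0 - dg r0 * (r - r0)| <= 1 * `|r - r0| by near: r; exact: near1.
have h2 : `|pz r - pz r0 - l * (r - r0)| <= - l / 2 * `|r - r0| by near: r; exact: near2.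
have h3 : `|g r * pzeta r| < e * (- l / 2) / C by near: r; exact: near3.
have rp : 0 < `|r - r0| by rewrite normr_gt0 subr_eq0.
have gb : `|g r| <= C * `|r - r0|.
  rewrite g0 subr0 mul1r in h1; rewrite -[g r](subrK (dg r0 * (r - r0))).
  by rewrite (le_trans (ler_normD _ _))// normrM /C mulrDl mul1r addrC lerD2l.
have zb : - l / 2 * `|r - r0| <= `|pz r|.
  rewrite z0 subr0 in h2.
  have := ler_normB (pz r) (pz r - l * (r - r0)).
  rewrite opprB addrCA subrr addr0 normrM (ltr0_norm l0) => h.
  have := le_trans h (lerD (lexx _) h2); lra.
have zp : 0 < `|pz r| by apply: lt_le_trans zb; rewrite mulr_gt0.
rewrite normrM normfV ler_pdivrMr// expr2 -mulrA normrM.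
apply: (@le_trans _ _ (C * `|r - r0| * (e * (- l / 2) / C))).
  by apply: ler_pM => //; exact: ltW.
rewrite (_ : C * `|r - r0| * (e * (- l / 2) / C) = e * (- l / 2 * `|r - r0|)); last by field; rewrite gt_eqF.
by rewrite ler_pM2l.
Unshelve. all: by end_near. Qed.

(** Picone applies on both sides of the single zero of z separately; vanishing of g at r0 and at 1
    removes the boundary terms there. *)
Lemma radial_vanish (g dg : R -> R) (r0 : R) : 0 < r0 < 1 -> pz r0 = 0 ->
  continuous g -> continuous dg -> (forall r, 0 < r -> isd r g (dg r)) ->
  g r0 = 0 -> g 1 = 0 ->
  0 <= itg 0 1 (fun r => r * dg r ^+ 2 - p * k0 r * g r ^+ 2).
Proof.
move=> r01 z0 cg cdg Hg g0 g1; have /andP[rp r1] := r01.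
have ck := k0_cont.
have cF : continuous (fun r : R => r * dg r ^+ 2 - p * k0 r * g r ^+ 2) by cts.
have [G G0 dG] := antiderivative cF.
have cG : continuous G by move=> x; apply: der_cts (dG x).
rewrite (@itg_FTC _ 0 1 G) ?ler01// G0 subr0.
have pzpos r : 0 <= r -> r < r0 -> 0 < pz r.
  by move=> ? ?; rewrite -z0; apply: pz_decr => //; exact: ltW.
have pzneg r : r0 < r -> r <= 1 -> pz r < 0.
  by move=> ? ?; rewrite -z0; apply: pz_decr => //; exact: ltW.
have near_g e : 0 < e -> \forall r \near r0, r != r0 -> `|g r ^+ 2 * pzeta r / pz r| <= e.
  by move=> e0; apply: picone_zero (Hg r0 rp) g0.
have right : G r0 <= G 1.
  apply/ler_addgt0Pr => e e0; have e2 : 0 < e / 2 by lra.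
  have hG : \forall r \near r0, `|G r0 - G r| < e / 2.
    by have := cG r0 => /cvgrPdist_lt /(_ _ e2).
  have [d /= d0 Hd] := (nbhs_ballP _ _).1 (filterI hG (near_g _ e2)).
  pose r := r0 + Num.min (d / 2) ((1 - r0) / 2).
  have m0 : 0 < Num.min (d / 2) ((1 - r0) / 2) by rewrite lt_min; apply/andP; split; lra.
  have m1 : Num.min (d / 2) ((1 - r0) / 2) <= d / 2 by rewrite ge_min lexx.
  have m2 : Num.min (d / 2) ((1 - r0) / 2) <= (1 - r0) / 2 by rewrite ge_min lexx orbT.
  have [] := Hd r.
    by rewrite /ball/= /r opprD addrA subrr add0r normrN gtr0_norm//; lra.
  move=> h1 h2; have rr : r != r0 by rewrite gt_eqF// /r; lra.
  have := h2 rr; rewrite ler_norml => /andP[h3 h4].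
  have u0 : 0 < r by rewrite /r; lra.
  have uv : r <= 1 by rewrite /r; lra.
  have := @picone G g dg r 1 u0 uv (lexx _) _ Hg dG.
  rewrite g1 expr0n/= !mul0r sub0r => h5.
  have {h5} : - (g r ^+ 2 * pzeta r / pz r) <= G 1 - G r.
    by apply: h5 => x /andP[rx x1]; rewrite lt_eqF// pzneg//; apply: lt_le_trans rx; rewrite /r; lra.
  by move: h1; rewrite ltr_norml => /andP[]; lra.
have left : 0 <= G r0.
  apply/ler_addgt0Pr => e e0; have e4 : 0 < e / 4 by lra.
  have hG : \forall r \near r0, `|G r0 - G r| < e / 4.
    by have := cG r0 => /cvgrPdist_lt /(_ _ e4).
  have [d /= d0 Hd] := (nbhs_ballP _ _).1 (filterI hG (near_g _ e4)).
  pose m := Num.min (d / 2) (r0 / 2); pose r := r0 - m.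
  have m0 : 0 < m by rewrite lt_min; apply/andP; split; lra.
  have m1 : m <= d / 2 by rewrite ge_min lexx.
  have m2 : m <= r0 / 2 by rewrite ge_min lexx orbT.
  have [] := Hd r.
    by rewrite /ball/= /r opprB addrC subrK gtr0_norm//; lra.
  move=> h1 h2; have rr : r != r0 by rewrite lt_eqF// /r; lra.
  have := h2 rr; rewrite ler_norml => /andP[h3 h4].
  have hG0 : \forall s \near (0 : R), `|G 0 - G s| < e / 4.
    by have := cG 0 => /cvgrPdist_lt /(_ _ e4).
  have hB0 : \forall s \near (0 : R), `|g s ^+ 2 * pzeta s / pz s| < e / 4.
    have z00 : pz 0 != 0 by rewrite gt_eqF// pzpos.
    have c0 : (fun s => g s ^+ 2 * pzeta s / pz s) @ (0 : R) --> g 0 ^+ 2 * pzeta 0 / pz 0.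
      apply: cvgM; last by apply: cvgV => //; exact: pz_cont.
      by apply: (@ctsM _ (fun s => g s ^+ 2) pzeta); [exact: ctsX|exact: pzeta_cont].
    (* At the origin the boundary term is killed by the flux of z, since g may be nonzero there. *)
    have pz00 : pzeta 0 = 0 by rewrite /pzeta X0 ppr0; ring.
    move: c0; rewrite pz00 mulr0 mul0r => /cvgrPdist_lt /(_ _ e4).
    by apply: filterS => s; rewrite sub0r normrN.
  have [d' /= d'0 Hd'] := (nbhs_ballP _ _).1 (filterI hG0 hB0).
  pose s := Num.min (d' / 2) r.
  have rpos : 0 < r by rewrite /r; lra.
  have s0 : 0 < s by rewrite lt_min rpos andbT; lra.
  have sr : s <= r by rewrite ge_min lexx orbT.
  have sd : s <= d' / 2 by rewrite ge_min lexx.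
  have [] := Hd' s.
    by rewrite /ball/= sub0r normrN gtr0_norm//; lra.
  rewrite G0 sub0r normrN !ltr_norml => /andP[g1' g2'] /andP[g3' g4'].
  have rle : r <= 1 by rewrite /r; lra.
  have := @picone G g dg s r s0 sr rle _ Hg dG => h5.
  have {h5} : g r ^+ 2 * pzeta r / pz r - g s ^+ 2 * pzeta s / pz s <= G r - G s.
    apply: h5 => x /andP[sx xr]; rewrite gt_eqF// pzpos//.
      by apply: le_trans sx; exact: ltW.
    by apply: le_lt_trans xr _; rewrite /r; lra.
  by move: h1; rewrite ltr_norml => /andP[]; lra.
exact: le_trans left right.
Qed.

(** A multiple of w is subtracted from c so that the difference vanishes at the zero of z, where
    [radial_vanish] applies. The functional on the left is the pairing of c with w in the linearized
    potential, up to a factor. *)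
Lemma radial_form_ge (c dc : R -> R) :
  continuous dc -> (forall r, isd r c (dc r)) -> c 1 = 0 ->
  - ((p - 1) / itg 0 1 kD) * itg 0 1 (fun r => kp r * c r) ^+ 2 <=
  itg 0 1 (fun r => r * dc r ^+ 2 - p * k0 r * c r ^+ 2).
Proof.
move=> cdc Hc c1; have [r0 r01 z0] := pz_root.
have cc : continuous c by move=> x; apply: der_cts (Hc x).
have /andP[rp r1] := r01.
have wr0 : 0 < w r0 by apply: (prof_wpos H) => //; exact: ltW.
have cY := pY_cont; have ck0 := k0_cont; have ckp := kp_cont; have ckD := kD_cont.
pose t := c r0 / w r0.
have := @radial_vanish (fun r => c r - t * w r) (fun r => dc r + t * Y r) r0 r01 z0.
have -> : itg 0 1 (fun r => r * (dc r + t * Y r) ^+ 2 - p * k0 r * (c r - t * w r) ^+ 2) =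
  1 * itg 0 1 (fun r => r * dc r ^+ 2 - p * k0 r * c r ^+ 2) +
  (2 * t) * itg 0 1 (fun r => dc r * X r + c r * kp r) +
  (2 * t * (p - 1)) * itg 0 1 (fun r => kp r * c r) +
  t ^+ 2 * itg 0 1 (fun r => X r * Y r - p * kD r).
  rewrite -itg_lin; [|by cts..]; apply: eq_itg => r /andP[rge _].
  have E : X r = r * Y r.
    by move: rge; rewrite le_eqVlt => /predU1P[<-|/XY//]; rewrite X0 mul0r.
  by rewrite E /k0 /kp /kD; ring.
have -> : itg 0 1 (fun r => dc r * X r + c r * kp r) = 0.
  rewrite (@itg_FTC _ 0 1 (fun r => c r * X r)) ?ler01//; [|by cts|by cts|].
    by rewrite c1 X0 mul0r mulr0 subrr.
  by move=> x /andP[x0 _]; apply: derM (Hc x) (der_X x0).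
(* The value of the form at w: integrating (w X)' equates the Dirichlet and the nonlinear energy of
   w. *)
have -> : itg 0 1 (fun r => X r * Y r - p * kD r) = (1 - p) * itg 0 1 kD.
  have : itg 0 1 (fun r => X r * Y r - kD r) = 0.
    rewrite (@itg_FTC _ 0 1 (fun r => - (w r * X r))) ?ler01//; [|by cts|by cts|].
      by rewrite (prof_w1 H) X0 mul0r mulr0 subrr.
    move=> x /andP[x0 _]; apply: der_eq (derN (derM (der_w x0) (der_X x0))) _.
    by rewrite /kD; ring.
  rewrite !itgB; [|by cts..]; rewrite itgZ// => h.
  by rewrite mulrBl mul1r; lra.
rewrite mul1r mulr0 addr0; set A := itg 0 1 (fun r => r * dc r ^+ 2 - _).
set I := itg 0 1 (fun r => kp r * c r); set D := itg 0 1 kD => hh.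
have {hh} : 0 <= A + 2 * t * (p - 1) * I + t ^+ 2 * ((1 - p) * D).
  apply: hh; [by cts|by cts| | |].
  - by move=> r rpos; apply: der_eq (derB (Hc r) (derZ _ (der_w rpos))) _; rewrite mulrN opprK.
  - by rewrite /t divfK ?gt_eqF// subrr.
  - by rewrite c1 (prof_w1 H) mulr0 subrr.
have D0 : 0 < D := kD_gt0.
have p1 : 0 < p - 1 by plra.
move=> h; rewrite -subr_ge0.
(* Completing the square removes the dependence on t, that is, on the position of the zero. *)
rewrite (_ : A - _ = (A + 2 * t * (p - 1) * I + t ^+ 2 * ((1 - p) * D)) + (p - 1) / D * (I - t * D) ^+ 2); last by field; rewrite gt_eqF.
by apply: addr_ge0 => //; apply: mulr_ge0; [exact: divr_ge0 (ltW p1) (ltW D0)|exact: sqr_ge0].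
Qed.

(* [beta = r y' / y] for [y = X r^(-tau)], hence the Riccati equation below. *)
Definition beta (r : R) := pp (2 * tau) r * pp p (w r) / X r - tau.

Lemma der_beta r : 0 < r -> r <= 1 ->
  isd r beta ((tau ^+ 2 - p * r * k0 r - beta r ^+ 2) / r).
Proof.
move=> r0 r1; have Xr := X_gt0 r0 r1; have Xn : X r != 0 by rewrite gt_eqF.
apply: der_eq (derB (der_div Xn (derM (der_pa2 r) (der_pw r0)) (der_X r0)) (derC _ _)) _.
rewrite /beta ppa1 ppb3 /k0 /pY; field.
by rewrite !gt_eqF.
Qed.

(** The difference 2 tau X - r^(2 tau) w^p vanishes at 0 and has derivative p [k0] X >= 0. The
    uniform bound controls the boundary term near the origin. *)
Lemma beta_bound r : 0 < r -> r <= 1 -> `|beta r| <= tau.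
Proof.
move=> r0 r1; have Xr := X_gt0 r0 r1.
have S0 : 0 <= pp (2 * tau) r * pp p (w r) by rewrite mulr_ge0 ?pp_ge0.
have le : pp (2 * tau) r * pp p (w r) <= 2 * tau * X r.
  rewrite -subr_ge0.
  have -> : 0 = 2 * tau * X 0 - pp (2 * tau) 0 * pp p (w 0) by rewrite X0 ppr0 mulr0 mul0r subrr.
  apply: (@der_mono _ (fun r => 2 * tau * X r - pp (2 * tau) r * pp p (w r)) (fun r => p * k0 r * X r)).
  - exact: ltW.
  - have c1 := ppr_cont; have c2 : continuous (fun r => pp p (w r)) by apply: ppw_cont; plra.
    by cts.
  - move=> x /andP[x0 _]; apply: der_eq (derB (derZ _ (der_X x0)) (derM (der_pa2 x) (der_pw x0))) _.
    by rewrite ppa1 ppb3 /k0 (XY x0); ring.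
  - move=> x /andP[x0 xr]; apply: mulr_ge0; [apply: mulr_ge0; [plra|exact: k0_ge0]|].
    by apply: X_ge0; [exact: ltW|exact: ltW (lt_le_trans xr r1)].
have h1 : pp (2 * tau) r * pp p (w r) / X r <= 2 * tau by rewrite ler_pdivrMr.
have h2 : 0 <= pp (2 * tau) r * pp p (w r) / X r by rewrite divr_ge0// ltW.
by rewrite ler_norml /beta; apply/andP; split; plra.
Qed.

End profile_theory.

(** * Trigonometric modes: Bessel and Wirtinger inequalities *)

Section circle.
Context {R : realType}.
Local Notation T := (pi *+ 2 : R).

(** One list for the real Fourier basis: index 0 is the constant, indices 2j - 1 and 2j are sin (j
    x) and cos (j x). The first 2J + 1 indices are exactly the frequencies at most J. *)
Definition freq (i : nat) : R := (uphalf i)%:R.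

Definition trig (i : nat) (x : R) : R :=
  if odd i then sin (freq i * x) else cos (freq i * x).

Definition dtrig (i : nat) (x : R) : R :=
  if odd i then freq i * cos (freq i * x) else - (freq i * sin (freq i * x)).

Definition tnorm (i : nat) : R := if i == 0%N then pi *+ 2 else pi.

Lemma T_gt0 : 0 < T. Proof. by rewrite pmulrn_lgt0// pi_gt0. Qed.

Lemma tnorm_gt0 i : 0 < tnorm i.
Proof. by rewrite /tnorm; case: ifP => _; rewrite ?T_gt0 ?pi_gt0. Qed.

Lemma der_sin (x : R) : isd x sin (cos x). Proof. exact: is_derive_sin. Qed.

Lemma der_cos (x : R) : isd x cos (- sin x). Proof. exact: is_derive_cos. Qed.

Lemma der_trig i (x : R) : isd x (trig i) (dtrig i x).
Proof.
rewrite /trig /dtrig; have d : isd x (fun x => freq i * x) (freq i).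
  by apply: der_eq (derZ _ (derI x)) _; rewrite mulr1.
case: odd.
  by apply: der_eq (der_comp d (der_sin _)) _; rewrite mulrC.
by apply: der_eq (der_comp d (der_cos _)) _; rewrite mulNr mulrC.
Qed.

Lemma der_dtrig i (x : R) : isd x (dtrig i) (- (freq i ^+ 2 * trig i x)).
Proof.
rewrite /trig /dtrig; have d : isd x (fun x => freq i * x) (freq i).
  by apply: der_eq (derZ _ (derI x)) _; rewrite mulr1.
case: odd.
  by apply: der_eq (derZ _ (der_comp d (der_cos _))) _; ring.
by apply: der_eq (derN (derZ _ (der_comp d (der_sin _)))) _; ring.
Qed.

Lemma trig_cont i : continuous (trig i).
Proof. by move=> x; apply: der_cts (der_trig i x). Qed.

Lemma dtrig_cont i : continuous (dtrig i).
Proof. by move=> x; apply: der_cts (der_dtrig i x). Qed.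

Lemma sin_period n (x : R) : sin (x + n%:R * T) = sin x.
Proof. by rewrite mulr_natl (periodicn (@sinD2pi R)). Qed.

Lemma cos_period n (x : R) : cos (x + n%:R * T) = cos x.
Proof. by rewrite mulr_natl (periodicn (@cosD2pi R)). Qed.

Lemma trig_period i (x : R) : trig i (x + T) = trig i x.
Proof. by rewrite /trig mulrDr /freq cos_period sin_period. Qed.

Lemma dtrig_period i (x : R) : dtrig i (x + T) = dtrig i x.
Proof. by rewrite /dtrig mulrDr /freq cos_period sin_period. Qed.

Lemma itg_sum (a b : R) n (F : nat -> R -> R) : (forall i, continuous (F i)) ->
  itg a b (fun x => \sum_(i < n) F i x) = \sum_(i < n) itg a b (F i).
Proof.
move=> cF; elim: n => [|n IH].
  rewrite big_ord0 (@eq_itg _ _ _ _ (fun x => 0 * 0)); last by move=> x _; rewrite big_ord0 mulr0.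
  by rewrite itgZ ?mul0r//; exact: ctsC.
rewrite big_ord_recr/= -IH -itgD//.
  by apply: eq_itg => x _; rewrite big_ord_recr.
elim: n {IH} => [|n IH]; first by under eq_fun do rewrite big_ord0; exact: ctsC.
by under eq_fun do rewrite big_ord_recr/=; apply: ctsD.
Qed.

Lemma cts_sum n (F : nat -> R -> R) : (forall i, continuous (F i)) ->
  continuous (fun x => \sum_(i < n) F i x).
Proof.
move=> cF; elim: n => [|n IH]; first by under eq_fun do rewrite big_ord0; exact: ctsC.
by under eq_fun do rewrite big_ord_recr/=; apply: ctsD.
Qed.

Lemma der_sum n (F : nat -> R -> R) (dF : nat -> R) (x : R) :
  (forall i, isd x (F i) (dF i)) ->
  isd x (fun x => \sum_(i < n) F i x) (\sum_(i < n) dF i).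
Proof.
move=> dFx; elim: n => [|n IH].
  by under eq_fun do rewrite big_ord0; rewrite big_ord0; exact: derC.
by under eq_fun do rewrite big_ord_recr/=; rewrite big_ord_recr/=; apply: derD.
Qed.

Lemma trig_parts i (h dh : R -> R) : continuous dh -> (forall x, isd x h (dh x)) ->
  (forall x, h (x + T) = h x) ->
  itg 0 T (fun x => dh x * dtrig i x) = freq i ^+ 2 * itg 0 T (fun x => h x * trig i x).
Proof.
move=> cdh dhh hT; have ch : continuous h by move=> x; apply: der_cts (dhh x).
have ce := @trig_cont i; have cde := @dtrig_cont i.
apply/eqP; rewrite -subr_eq0 -itgZ; last by cts.
rewrite -itgB; [|by cts|by cts].
rewrite (@itg_FTC _ 0 T (fun x => h x * dtrig i x)) ?ltW ?T_gt0//; [|by cts|by cts|].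
  by rewrite -[X in h X * dtrig _ X]add0r hT dtrig_period subrr.
by move=> x _; apply: der_eq (derM (dhh x) (der_dtrig i x)) _; ring.
Qed.

(** Integration by parts in both orders gives the same integral with factor [freq i ^+ 2] and with
    factor [freq k ^+ 2]. *)
Lemma trig_orth_freq i k : freq i != freq k ->
  itg 0 T (fun x => trig i x * trig k x) = 0.
Proof.
move=> ik.
have h1 := trig_parts i (@dtrig_cont k) (@der_trig k) (@trig_period k).
have h2 := trig_parts k (@dtrig_cont i) (@der_trig i) (@trig_period i).
have e1 : itg 0 T (fun x => dtrig i x * dtrig k x) = itg 0 T (fun x => dtrig k x * dtrig i x).
  by apply: eq_itg => x _; rewrite mulrC.
have e2 : itg 0 T (fun x => trig i x * trig k x) = itg 0 T (fun x => trig k x * trig i x).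
  by apply: eq_itg => x _; rewrite mulrC.
move: h2; rewrite e1 h1 e2 => /eqP; rewrite -subr_eq0 -mulrBl mulf_eq0 => /orP[|/eqP//].
rewrite subr_eq0 eqrXn2 ?ler0n// => /eqP E; by rewrite E eqxx in ik.
Qed.

Lemma trig_sincos n : (0 < n)%N ->
  itg 0 T (fun x : R => sin (n%:R * x) * cos (n%:R * x)) = 0.
Proof.
move=> n0; have nn : n%:R != 0 :> R by rewrite pnatr_eq0 -lt0n.
have d (x : R) : isd x (fun x => n%:R * x) n%:R.
  by apply: der_eq (derZ _ (derI x)) _; rewrite mulr1.
have cs : continuous (fun x : R => sin (n%:R * x)).
  by move=> x; apply: der_cts (der_comp (d x) (der_sin _)).
have cc : continuous (fun x : R => cos (n%:R * x)).
  by move=> x; apply: der_cts (der_comp (d x) (der_cos _)).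
rewrite (@itg_FTC _ 0 T (fun x => sin (n%:R * x) ^+ 2 / (2 * n%:R))) ?ltW ?T_gt0//.
- by rewrite mulr0 -[n%:R * T]add0r sin_period subrr.
- by cts.
- by cts.
- move=> x _; apply: der_eq (derM (derX2 (der_comp (d x) (der_sin _))) (derC _ _)) _.
  by field.
Qed.

Lemma trig_cos2sin2 n : (0 < n)%N ->
  itg 0 T (fun x : R => cos (n%:R * x) ^+ 2) = pi /\
  itg 0 T (fun x : R => sin (n%:R * x) ^+ 2) = pi.
Proof.
move=> n0; have nn : n%:R != 0 :> R by rewrite pnatr_eq0 -lt0n.
have d (x : R) : isd x (fun x => n%:R * x) n%:R.
  by apply: der_eq (derZ _ (derI x)) _; rewrite mulr1.
have cs : continuous (fun x : R => sin (n%:R * x)).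
  by move=> x; apply: der_cts (der_comp (d x) (der_sin _)).
have cc : continuous (fun x : R => cos (n%:R * x)).
  by move=> x; apply: der_cts (der_comp (d x) (der_cos _)).
have E1 : itg 0 T (fun x : R => cos (n%:R * x) ^+ 2) + itg 0 T (fun x : R => sin (n%:R * x) ^+ 2) = pi *+ 2.
  rewrite -itgD; [|by cts|by cts].
  rewrite (@itg_FTC _ 0 T (fun x => x)) ?ltW ?T_gt0 ?subr0//; [by cts|by cts|].
  by move=> x _; rewrite cos2Dsin2; exact: derI.
have E2 : itg 0 T (fun x : R => cos (n%:R * x) ^+ 2) - itg 0 T (fun x : R => sin (n%:R * x) ^+ 2) = 0.
  rewrite -itgB; [|by cts|by cts].
  rewrite (@itg_FTC _ 0 T (fun x => sin (n%:R * x) * cos (n%:R * x) / n%:R)) ?ltW ?T_gt0//.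
  - by rewrite mulr0 -[n%:R * T]add0r sin_period cos_period subrr.
  - by cts.
  - by cts.
  - move=> x _; apply: der_eq (derM (derM (der_comp (d x) (der_sin _)) (der_comp (d x) (der_cos _))) (derC _ _)) _.
    by field.
by move: E1 E2; rewrite mulr2n; split; lra.
Qed.

Lemma trig_orth i k : itg 0 T (fun x => trig i x * trig k x) = if i == k then tnorm i else 0.
Proof.
case: eqVneq => [<-|ik].
  case: i => [|i].
    rewrite /tnorm/= (@itg_FTC _ 0 T (fun x => x)) ?ltW ?T_gt0 ?subr0//.
    - by have := @trig_cont 0; move=> ?; cts.
    - by cts.
    - by move=> x _; apply: der_eq (derI x) _; rewrite /trig/= /freq/= mul0r cos0 mulr1.
  have [h1 h2] := @trig_cos2sin2 (uphalf i.+1) isT.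
  rewrite /trig /tnorm /=; case: (odd i) => /=.
    by under eq_fun do rewrite -expr2; exact: h1.
  by under eq_fun do rewrite -expr2; exact: h2.
have [E|/trig_orth_freq//] := eqVneq (freq i) (freq k).
have E' : uphalf i = uphalf k by move/eqP: E; rewrite /freq eqr_nat => /eqP.
have up0 : (0 < uphalf i)%N.
  by case: i k ik E' {E} => [|i] [|k].
(* An index is determined by its half and its parity, so two distinct indices of equal frequency are
   a sine and a cosine. *)
have ok : odd i = ~~ odd k.
  apply/eqP; apply: contraNT ik => h; have {}h : odd i = odd k by move: h; do 2 case: odd.
  have := odd_double_half i.+1; have := odd_double_half k.+1; rewrite /= h.
  by rewrite -/(uphalf i) -/(uphalf k) E' => -> [->].
rewrite /trig ok E; have := trig_sincos up0.
rewrite /freq E'; case: (odd k) => /= h.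
  by rewrite -[RHS]h; apply: eq_itg => x _; rewrite mulrC.
by rewrite -[RHS]h.
Qed.

Lemma dtrig_orth i k : itg 0 T (fun x => dtrig i x * dtrig k x) = if i == k then freq i ^+ 2 * tnorm i else 0.
Proof.
rewrite (trig_parts k (@dtrig_cont i) (@der_trig i) (@trig_period i)) trig_orth.
by case: eqVneq => [->|]; rewrite ?mulr0.
Qed.

(** Stated for an arbitrary orthogonal family so that it serves both the modes and their
    derivatives, where the norm at index 0 is zero. *)
Lemma itg_lincomb m (t : nat -> R) (F : nat -> R -> R) (h : R -> R) (n : nat -> R) :
  continuous h -> (forall i, continuous (F i)) ->
  (forall i k, itg 0 T (fun x => F i x * F k x) = if i == k then n i else 0) ->
  itg 0 T (fun x => (h x - \sum_(i < m) t i * F i x) ^+ 2) =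
  itg 0 T (fun x => h x ^+ 2) - 2 * \sum_(i < m) t i * itg 0 T (fun x => h x * F i x)
   + \sum_(i < m) t i ^+ 2 * n i.
Proof.
move=> ch cF orth.
have cS : continuous (fun x => \sum_(i < m) t i * F i x).
  by apply: (@cts_sum m (fun i x => t i * F i x)) => i; have := cF i => ?; cts.
have -> : \sum_(i < m) t i * itg 0 T (fun x => h x * F i x) =
    itg 0 T (fun x => h x * \sum_(i < m) t i * F i x).
  rewrite (@eq_itg _ _ _ _ (fun x => \sum_(i < m) t i * (h x * F i x))); last first.
    by move=> x _; rewrite mulr_sumr; apply: eq_bigr => i _; ring.
  rewrite (@itg_sum _ _ m (fun i x => t i * (h x * F i x))); last by move=> i; have := cF i => ?; cts.
  by apply: eq_bigr => i _; have := cF i => ?; rewrite itgZ//; cts.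
have -> : \sum_(i < m) t i ^+ 2 * n i = itg 0 T (fun x => (\sum_(i < m) t i * F i x) ^+ 2).
  rewrite (@eq_itg _ _ _ _ (fun x => \sum_(i < m) t i * (F i x * \sum_(k < m) t k * F k x))); last first.
    by move=> x _; rewrite expr2 mulr_suml; apply: eq_bigr => i _; rewrite mulrA.
  rewrite (@itg_sum _ _ m (fun i x => t i * (F i x * \sum_(k < m) t k * F k x))); last first.
    by move=> i; have := cF i => ?; cts.
  apply: eq_bigr => i _; have ci := cF i; rewrite itgZ; last by cts.
  rewrite (@eq_itg _ _ _ _ (fun x => \sum_(k < m) t k * (F i x * F k x))); last first.
    by move=> x _; rewrite mulr_sumr; apply: eq_bigr => k _; ring.
  rewrite (@itg_sum _ _ m (fun k x => t k * (F i x * F k x))); last by move=> k; have := cF k => ?; cts.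
  rewrite (bigD1 i)//= big1 ?addr0; last first.
    move=> k ki; have := cF k => ?; rewrite itgZ; last by cts.
    by rewrite orth ifF ?mulr0//; apply/negbTE; rewrite eq_sym.
  by rewrite itgZ ?orth ?eqxx; [ring|cts].
have -> : itg 0 T (fun x => (h x - \sum_(i < m) t i * F i x) ^+ 2) =
   1 * itg 0 T (fun x => h x ^+ 2) + (- 2) * itg 0 T (fun x => h x * \sum_(i < m) t i * F i x)
   + 1 * itg 0 T (fun x => (\sum_(i < m) t i * F i x) ^+ 2) + 0 * itg 0 T h.
  rewrite -itg_lin; [|by cts..]; apply: eq_itg => x _; ring.
by ring.
Qed.

Lemma bessel m (h : R -> R) : continuous h ->
  \sum_(i < m) itg 0 T (fun x => h x * trig i x) ^+ 2 / tnorm i <= itg 0 T (fun x => h x ^+ 2).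
Proof.
move=> ch; set A := fun i => itg 0 T (fun x => h x * trig i x).
have := @itg_lincomb m (fun i => A i / tnorm i) trig h tnorm ch (@trig_cont) trig_orth.
have : 0 <= itg 0 T (fun x => (h x - \sum_(i < m) A i / tnorm i * trig i x) ^+ 2).
  by apply: itg_ge0 => x _; exact: sqr_ge0.
move=> + E; rewrite E -/A.
have -> : \sum_(i < m) A i / tnorm i * A i = \sum_(i < m) A i ^+ 2 / tnorm i.
  by apply: eq_bigr => i _; ring.
have -> : \sum_(i < m) (A i / tnorm i) ^+ 2 * tnorm i = \sum_(i < m) A i ^+ 2 / tnorm i.
  by apply: eq_bigr => i _; field; rewrite gt_eqF ?tnorm_gt0.
by rewrite /A; lra.
Qed.

(** The Dirichlet inequality on an interval of length pi / N, proved by Picone with the comparison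
    function cos (M (x - m)), m the midpoint, and M tending to N. *)
Lemma dirichlet_arc (N a b : R) (G g dg : R -> R) : 0 < N -> b - a = pi / N ->
  (forall x, isd x g (dg x)) -> (forall x, isd x G (g x ^+ 2)) ->
  forall K : R -> R, (forall x, isd x K (dg x ^+ 2)) ->
  g a = 0 -> g b = 0 -> N ^+ 2 * (G b - G a) <= K b - K a.
Proof.
move=> N0 ab Hg HG K HK ga gb.
have ab0 : a < b by rewrite -subr_gt0 ab divr_gt0// pi_gt0.
have Gab : 0 <= G b - G a.
  rewrite subr_ge0; apply: (@der_mono_cc _ G (fun x => g x ^+ 2)); first exact: ltW.
    by move=> x _; exact: HG.
  by move=> x _; exact: sqr_ge0.
(* For M < N the cosine stays positive on the closed arc, so the quotient in Picone's identity is
   defined up to the ends. *)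
have weak (M : R) : 0 < M -> M < N -> M ^+ 2 * (G b - G a) <= K b - K a.
  move=> M0 MN; pose m := (a + b) / 2.
  have cpos x : a <= x <= b -> 0 < cos (M * (x - m)).
    move=> /andP[ax xb]; apply: cos_gt0_pihalf.
    have h : M * ((b - a) / 2) < pi / 2.
      by rewrite ab mulrA ltr_pM2r ?invr_gt0// mulrCA gtr_pMr ?pi_gt0// ltr_pdivrMr// mul1r.
    have x1 : x - m <= (b - a) / 2 by rewrite /m; lra.
    have x2 : - ((b - a) / 2) <= x - m by rewrite /m; lra.
    apply/andP; split.
      apply: lt_le_trans (ler_wpM2l (ltW M0) x2); rewrite mulrN ltrN2; exact: h.
    by apply: le_lt_trans (ler_wpM2l (ltW M0) x1) _; exact: h.
  have d (x : R) : isd x (fun x => M * (x - m)) M.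
    by apply: der_eq (derZ _ (derB (derI x) (derC _ _))) _; ring.
  pose Q x := K x - M ^+ 2 * G x + g x ^+ 2 * (M * sin (M * (x - m))) / cos (M * (x - m)).
  suff : Q a <= Q b by rewrite /Q ga gb expr0n/= !mul0r !addr0; lra.
  apply: (@der_mono_cc _ Q (fun x => (dg x + g x * (M * sin (M * (x - m))) / cos (M * (x - m))) ^+ 2)).
  - exact: ltW.
  - move=> x xab; have c0 := cpos x xab; have cn : cos (M * (x - m)) != 0 by rewrite gt_eqF.
    apply: der_eq (derD (derB (HK x) (derZ _ (HG x))) (der_div cn (derM (derX2 (Hg x))
      (derZ _ (der_comp (d x) (der_sin _)))) (der_comp (d x) (der_cos _)))) _.
    have := cos2Dsin2 (M * (x - m)); move: cn.
    set c := cos _; set s := sin _ => cn cs.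
    rewrite (_ : ((2 * g x * dg x * (M * s) + g x ^+ 2 * (M * (c * M))) * c - g x ^+ 2 * (M * s) * (- s * M)) / c ^+ 2 =
      2 * g x * dg x * (M * s) / c + g x ^+ 2 * M ^+ 2 * (c ^+ 2 + s ^+ 2) / c ^+ 2); last by field.
    rewrite cs mulr1.
    rewrite (_ : g x ^+ 2 * M ^+ 2 / c ^+ 2 = g x ^+ 2 * M ^+ 2 * (c ^+ 2 + s ^+ 2) / c ^+ 2); last by rewrite cs mulr1.
    by field.
  - by move=> x _; exact: sqr_ge0.
apply/ler_addgt0Pr => e e0; set D := G b - G a.
(* Chosen so that (N - d)^2 D >= N^2 D - 2 N d D >= N^2 D - e, while N - d stays positive. *)
pose d := Num.min (N / 2) (e / (2 * N * (D + 1))).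
have D1 : 0 < D + 1 by rewrite ltr_wpDl.
have d0 : 0 < d by rewrite lt_min !divr_gt0// !mulr_gt0.
have d1 : d <= N / 2 by rewrite ge_min lexx.
have d2 : d * (2 * N * (D + 1)) <= e.
  by rewrite -ler_pdivlMr ?mulr_gt0// ge_min lexx orbT.
have := @weak (N - d) _ _; rewrite -/D => h.
have {}h : (N - d) ^+ 2 * D <= K b - K a by apply: h; lra.
nra.
Qed.

(** The Dirichlet kernel of degree J; [gfac] holds its weights on the real Fourier basis. *)
Definition dker (J : nat) (x : R) : R := 1 + \sum_(j < J) 2 * cos (j.+1%:R * x).

Definition gfac (i : nat) : R := if i == 0%N then 1 else 2.

Lemma dker_trig J (x y : R) :
  \sum_(i < J.*2.+1) gfac i * (trig i x * trig i y) = dker J (x - y).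
Proof.
elim: J => [|J IH].
  by rewrite big_ord_recr big_ord0/= /dker big_ord0 /gfac/= /trig/= /freq/= !mul0r cos0; ring.
rewrite doubleS big_ord_recr big_ord_recr/= IH /dker big_ord_recr/= -!addrA; congr (_ + (_ + _)).
rewrite /gfac/= /trig/= /freq/= odd_double/= !uphalf_double ?doubleK.
rewrite mulrBr cosB.
by ring.
Qed.

Lemma dker_sin J (x : R) : sin (x / 2) * dker J x = sin (J%:R * x + x / 2).
Proof.
elim: J => [|J IH]; first by rewrite /dker big_ord0 addr0 mulr1 mul0r add0r.
rewrite /dker big_ord_recr/= addrA mulrDr -/(dker J x) IH.
have -> : J%:R * x + x / 2 = J.+1%:R * x - x / 2 by rewrite -natr1; field.
by rewrite (sinB (J.+1%:R * x)) (sinD (J.+1%:R * x)); ring.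
Qed.

Lemma sin_npi n : sin (n%:R * pi) = 0 :> R.
Proof.
elim: n => [|n IH]; first by rewrite mul0r sin0.
by rewrite -natr1 mulrDl mul1r sinDpi IH oppr0.
Qed.

Lemma cos_npi n : cos (n%:R * pi) = (-1) ^+ n :> R.
Proof.
elim: n => [|n IH]; first by rewrite mul0r cos0.
by rewrite -natr1 mulrDl mul1r cosDpi IH exprS mulN1r.
Qed.

(** On 2(J+1) equispaced points, trigonometric polynomials of degree J have dimension one less than
    the number of points. The missing direction is the alternating vector, hence the rank-one
    correction to the discrete delta. *)
Lemma dker_points J (l k : nat) (t0 : R) : (l < J.+1.*2)%N -> (k < J.+1.*2)%N ->
  dker J ((t0 + l%:R * (pi / J.+1%:R)) - (t0 + k%:R * (pi / J.+1%:R))) =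
  (if l == k then (J.+1.*2)%:R else 0) - (-1) ^+ l * (-1) ^+ k.
Proof.
move=> lN kN; set x := _ - _.
have N0 : J.+1%:R != 0 :> R by rewrite pnatr_eq0.
have xE : x = (l%:R - k%:R) * (pi / J.+1%:R) by rewrite /x; ring.
case: eqVneq => [lk|lk].
  rewrite lk -expr2 sqrr_sign xE lk subrr mul0r /dker.
  under eq_bigr do rewrite mulr0 cos0 mulr1.
  rewrite sumr_const card_ord -mul2n natrM -natr1 -[_ *+ J]mulr_natr; ring.
have Nx : J.+1%:R * x = l%:R * pi - k%:R * pi by rewrite xE; field.
have sx : sin (x / 2) != 0.
  have gen (m : nat) : (0 < m)%N -> (m < J.+1.*2)%N -> sin (m%:R * (pi / J.+1%:R) / 2) != 0 :> R.
    move=> m0 mN; rewrite gt_eqF// sin_gt0_pi//; apply/andP; split.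
      by rewrite !mulr_gt0 ?invr_gt0 ?ltr0n ?pi_gt0.
    rewrite ltr_pdivrMr// mulrA ltr_pdivrMr ?ltr0n// mulrC -mulrA ltr_pM2l ?pi_gt0//.
    by rewrite -natrM ltr_nat mul2n.
  rewrite xE; case: (ltngtP l k) lk => // lk _.
    have e : (k - l)%:R = k%:R - l%:R :> R by apply: natrB; exact: ltnW.
    rewrite -[l%:R - _]opprB -e !mulNr sinN oppr_eq0.
    by apply: gen; [rewrite subn_gt0|exact: leq_ltn_trans (leq_subr _ _) kN].
  have e : (l - k)%:R = l%:R - k%:R :> R by apply: natrB; exact: ltnW.
  by rewrite -e; apply: gen; [rewrite subn_gt0|exact: leq_ltn_trans (leq_subr _ _) lN].
apply: (mulfI sx); rewrite dker_sin.
have -> : J%:R * x + x / 2 = J.+1%:R * x - x / 2 by rewrite -natr1; field.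
rewrite sinB Nx sinB cosB !sin_npi !cos_npi; ring.
Qed.

(** The alternating sum changes sign when the grid is shifted by one step, so it vanishes for some
    shift. On that grid the obstruction of [dker_points] to interpolation disappears. *)
Lemma alternating_zero n (h : R -> R) : (0 < n)%N -> continuous h ->
  (forall x, h (x + T) = h x) ->
  exists t0, \sum_(k < n.*2) (-1) ^+ k * h (t0 + k%:R * (pi / n%:R)) = 0.
Proof.
move=> n0 ch hT; set d := pi / n%:R.
have nn : n%:R != 0 :> R by rewrite pnatr_eq0 -lt0n.
have d0 : 0 < d by rewrite divr_gt0 ?pi_gt0 ?ltr0n.
pose g x := \sum_(k < n.*2) (-1) ^+ k * h (x + k%:R * d).
have cg : continuous g.
  apply: (@cts_sum _ (fun k x => (-1) ^+ k * h (x + k%:R * d))) => k.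
  apply: ctsM; first exact: ctsC.
  by apply: cts_comp => //; cts.
have gd x : g (x + d) = - g x.
  have [m mE] : exists m, n.*2 = m.+1 by exists n.*2.-1; rewrite prednK// double_gt0.
  rewrite /g mE big_ord_recr [in RHS]big_ord_recl/= opprD -sumrN addrC; congr (_ + _).
    have -> : (-1) ^+ m = -1 :> R.
      by rewrite -signr_odd (_ : odd m) ?expr1//; have := odd_double n; rewrite mE/= => /negbFE.
    rewrite expr0 mul1r mul0r addr0 mulN1r; congr (- _).
    rewrite -(hT x); congr h; rewrite -addrA; congr (_ + _).
    rewrite -{1}[d]mul1r -mulrDl addrC natr1 -mE /d -mul2n natrM; field => //.
  apply: eq_bigr => k _; rewrite /bump/= add1n exprS mulN1r mulNr opprK -natr1.
  by congr (_ * h _); ring.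
have [|t _ gt] := @IVT _ g 0 d 0 (ltW d0) (continuous_subspaceT cg).
  have := gd 0; rewrite add0r => ->.
  by have [h0|h0] := leP 0 (g 0); rewrite ge_min le_max ?h0 ?oppr_le0 ?h0 ?orbT//= ?oppr_ge0 ?(ltW h0) ?orbT.
by exists t.
Qed.

Lemma periodic_increment (F f : R -> R) : (forall x, isd x F (f x)) -> (forall x, f (x + T) = f x) ->
  forall x, F (x + T) - F x = F T - F 0.
Proof.
move=> HF fT x.
have dT (y : R) : isd y (fun x => x + T) 1.
  by apply: der_eq (derD (derI y) (derC _ _)) _; rewrite addr0.
have hy y : isd y (fun z => F (z + T) - F z) 0.
  by apply: der_eq (derB (der_comp (dT y) (HF (y + T))) (HF y)) _; rewrite fT mulr1 subrr.
have hc : continuous (fun z => F (z + T) - F z) by move=> y; apply: der_cts (hy y).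
have := @itg_FTC _ (Num.min 0 x) (Num.max 0 x) (fun z => F (z + T) - F z) (fun=> 0).
have zero (a b : R) : itg a b (fun=> 0) = 0.
  by rewrite (@eq_itg _ _ _ _ (fun=> 0 * 0)) ?itgZ ?mul0r//; exact: ctsC.
rewrite zero; have [x0|x0] := leP 0 x => /(_ _ _ hc) E.
  by have := E x0 (@ctsC _ 0) (fun y _ => hy y); rewrite add0r; lra.
by have := E (ltW x0) (@ctsC _ 0) (fun y _ => hy y); rewrite add0r; lra.
Qed.

Lemma itg_periodic (f : R -> R) (w : R) : continuous f -> (forall x, f (x + T) = f x) ->
  itg 0 T (fun t => f (w + t)) = itg 0 T f.
Proof.
move=> cf fT; have [F F0 HF] := antiderivative cf.
have cF : continuous F by move=> x; apply: der_cts (HF x).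
have d (t : R) : isd t (fun t => w + t) 1 by apply: der_eq (derD (derC w t) (derI t)) _; rewrite add0r.
have T0 := ltW T_gt0.
have cw : continuous (fun t => w + t) by cts.
have cfw : continuous (fun t => f (w + t)) by apply: (cts_comp cf cw).
have cFw : continuous (fun t => F (w + t)) by apply: (cts_comp cF cw).
rewrite (@itg_FTC _ 0 T (fun t => F (w + t)))//; last first.
  by move=> t _; apply: der_eq (der_comp (d t) (HF _)) _; rewrite mulr1.
by rewrite (@itg_FTC _ 0 T F)// addr0; exact: periodic_increment.
Qed.

(** A trigonometric polynomial P of degree J interpolates h on 2(J+1) equispaced points. Then h - P
    vanishes at the ends of arcs of length pi / (J+1), where [dirichlet_arc] gives the constant
    (J+1)^2. Expanding the squares, the coefficients of P enter only through squares that can be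
    discarded. *)
Lemma wirtinger J (h dh : R -> R) : continuous dh -> (forall x, isd x h (dh x)) ->
  (forall x, h (x + T) = h x) ->
  J.+1%:R ^+ 2 * itg 0 T (fun x => h x ^+ 2)
   - \sum_(i < J.*2.+1) (J.+1%:R ^+ 2 - freq i ^+ 2) * (itg 0 T (fun x => h x * trig i x) ^+ 2 / tnorm i)
  <= itg 0 T (fun x => dh x ^+ 2).
Proof.
move=> cdh dhh hT; have ch : continuous h by move=> x; apply: der_cts (dhh x).
set N : R := J.+1%:R; set m := J.*2.+1.
have N0 : 0 < N by rewrite ltr0n.
have [t0 ht0] := alternating_zero (ltn0Sn J) ch hT.
set d := pi / N in ht0.
pose pt k := t0 + k%:R * d.
(* Discrete Fourier coefficients of h on the grid. Summed up, they convolve h with [dker], and the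
   choice of t0 removes the alternating term, so P agrees with h on the grid. *)
pose t i := gfac i / (J.+1.*2)%:R * \sum_(k < J.+1.*2) h (pt k) * trig i (pt k).
pose P x := \sum_(i < m) t i * trig i x.
pose dP x := \sum_(i < m) t i * dtrig i x.
have dPP x : isd x P (dP x).
  by apply: (@der_sum m (fun i x => t i * trig i x) (fun i => t i * dtrig i x)) => i; apply: derZ; exact: der_trig.
have cP : continuous P by move=> x; apply: der_cts (dPP x).
have cdP : continuous dP.
  by apply: (@cts_sum m (fun i x => t i * dtrig i x)) => i; have := @dtrig_cont i => ?; cts.
have N2 : (J.+1.*2)%:R != 0 :> R by rewrite pnatr_eq0.
have interp l : (l < J.+1.*2)%N -> P (pt l) = h (pt l).
  move=> lN; rewrite /P /t.
  have -> : \sum_(i < m) gfac i / (J.+1.*2)%:R * (\sum_(k < J.+1.*2) h (pt k) * trig i (pt k)) * trig i (pt l) =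
     (J.+1.*2)%:R^-1 * \sum_(k < J.+1.*2) h (pt k) * dker J (pt l - pt k).
    rewrite mulr_sumr; under [RHS]eq_bigr do rewrite -dker_trig mulr_sumr mulr_sumr.
    rewrite exchange_big/=; apply: eq_bigr => i _.
    rewrite mulr_sumr mulr_suml; apply: eq_bigr => k _; ring.
  under eq_bigr => k _ do rewrite /pt dker_points// mulrBr.
  rewrite sumrB (bigD1 (Ordinal lN))//= eqxx big1 ?addr0; last first.
    by move=> k kl; rewrite ifF ?mulr0//; apply/negbTE; apply: contra kl => /eqP kl; apply/eqP/val_inj.
  have -> : \sum_(k < J.+1.*2) h (t0 + k%:R * d) * ((-1) ^+ l * (-1) ^+ k) = 0.
    rewrite (_ : \sum_(k < J.+1.*2) _ = (-1) ^+ l * \sum_(k < J.+1.*2) (-1) ^+ k * h (t0 + k%:R * d)).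
      by rewrite ht0 mulr0.
    by rewrite mulr_sumr; apply: eq_bigr => k _; ring.
  by rewrite subr0; field.
have PT x : P (x + T) = P x.
  by rewrite /P; apply: eq_bigr => i _; rewrite trig_period.
pose g x := h x - P x; pose dg x := dh x - dP x.
have gT x : g (x + T) = g x by rewrite /g hT PT.
have dgg x : isd x g (dg x) by apply: derB.
have cg : continuous g by rewrite /g; cts.
have cdg : continuous dg by rewrite /dg; cts.
have gpt l : (l <= J.+1.*2)%N -> g (pt l) = 0.
  rewrite leq_eqVlt => /predU1P[->|lN]; last by rewrite /g interp// subrr.
  have -> : pt J.+1.*2 = pt 0%N + T.
    rewrite /pt mul0r addr0; congr (_ + _); rewrite /d /N -mul2n natrM mulr2n.
    by move: (lt0r_neq0 N0); rewrite /N; move: (J.+1%:R : R) => n nn; field.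
  by rewrite gT /g interp ?subrr.
have cg2 : continuous (fun x => g x ^+ 2) by cts.
have cdg2 : continuous (fun x => dg x ^+ 2) by cts.
have [G G0 HG] := antiderivative cg2; have [K K0 HK] := antiderivative cdg2.
have dgT x : dg (x + T) = dg x.
  have dT (y : R) : isd y (fun x => x + T) 1.
    by apply: der_eq (derD (derI y) (derC _ _)) _; rewrite addr0.
  have h1 := der_comp (dT x) (dgg (x + T)).
  have h2 : isd x (fun y => g (y + T)) (dg x) by rewrite (_ : (fun y => _) = g); [exact: dgg|apply/funext => y; exact: gT].
  by case: h1 => _; case: h2 => _ <-; rewrite mulr1.
have arcs n : (n <= J.+1.*2)%N -> N ^+ 2 * (G (pt n) - G (pt 0%N)) <= K (pt n) - K (pt 0%N).
  elim: n => [|n IH] nN; first by rewrite !subrr mulr0.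
  have := @dirichlet_arc N (pt n) (pt n.+1) G g dg N0 _ dgg HG K HK (gpt n (ltnW nN)) (gpt n.+1 nN).
  have -> : pt n.+1 - pt n = pi / N by rewrite /pt -natr1 /d; ring.
  move=> /(_ erefl); have := IH (ltnW nN); lra.
have := arcs _ (leqnn _).
have -> : pt J.+1.*2 = pt 0%N + T.
  rewrite /pt mul0r addr0; congr (_ + _); rewrite /d /N -mul2n natrM mulr2n.
  by move: (lt0r_neq0 N0); rewrite /N; move: (J.+1%:R : R) => n nn; field.
rewrite (periodic_increment HG) ?(periodic_increment HK); [|by move=> x; rewrite dgT|by move=> x; rewrite gT].
have T0 := ltW T_gt0.
have <- : itg 0 T (fun x => g x ^+ 2) = G T - G 0.
  by apply: itg_FTC; [exact: T0|exact: cg2|move=> x; apply: der_cts (HG x)|move=> x _; exact: HG].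
have <- : itg 0 T (fun x => dg x ^+ 2) = K T - K 0.
  by apply: itg_FTC; [exact: T0|exact: cdg2|move=> x; apply: der_cts (HK x)|move=> x _; exact: HK].
rewrite (@itg_lincomb m t trig h tnorm ch (@trig_cont) trig_orth).
rewrite (@itg_lincomb m t dtrig dh (fun i => freq i ^+ 2 * tnorm i) cdh (@dtrig_cont) dtrig_orth).
set A := fun i => itg 0 T (fun x => h x * trig i x).
have -> : \sum_(i < m) t i * itg 0 T (fun x => dh x * dtrig i x) = \sum_(i < m) t i * (freq i ^+ 2 * A i).
  by apply: eq_bigr => i _; rewrite (trig_parts i cdh dhh hT).
rewrite -/A => main.
(* Termwise the difference is (N^2 - freq^2) times a multiple of the square of t i - A i / [tnorm]
   i, nonnegative because each frequency is at most J < N. Equality would be at the true Fourier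
   coefficients. *)
have key : - \sum_(i < m) (N ^+ 2 - freq i ^+ 2) * (A i ^+ 2 / tnorm i) <=
   - (2 * (N ^+ 2 * \sum_(i < m) t i * A i)) + N ^+ 2 * \sum_(i < m) t i ^+ 2 * tnorm i
   + 2 * \sum_(i < m) t i * (freq i ^+ 2 * A i) - \sum_(i < m) t i ^+ 2 * (freq i ^+ 2 * tnorm i).
  rewrite !mulr_sumr -!sumrN -!big_split/=; apply: ler_sum => i _.
  have n0 := tnorm_gt0 i.
  have f0 : 0 <= N ^+ 2 - freq i ^+ 2.
    rewrite subr_ge0 ler_pXn2r ?nnegrE ?ler0n// /freq /N ler_nat.
    by rewrite uphalf_half (leq_trans (leq_add (leq_b1 _) (half_leq (ltnW (ltn_ord i)))))// /m /= uphalf_double.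
  rewrite -subr_ge0 (_ : _ - _ = (N ^+ 2 - freq i ^+ 2) * (tnorm i * (t i - A i / tnorm i) ^+ 2)); last by field; rewrite gt_eqF.
  by apply: mulr_ge0 => //; apply: mulr_ge0; [exact: ltW|exact: sqr_ge0].
by move: main key; rewrite /A; lra.
Qed.

End circle.

(** * Square integrable functions *)

Section L2.
Context d (T : measurableType d) (R : realType) (mu : {measure set T -> \bar R}).
Variables (D : set T).
Hypothesis mD : measurable D.
Implicit Types f g h V : T -> R.

Definition L1 f := mu.-integrable D (EFin \o f).

Definition ii f : R := \int[mu]_(x in D) f x.

Definition L2 f := measurable_fun D f /\ L1 (fun x => f x ^+ 2).

Lemma L1_meas f : L1 f -> measurable_fun D f.
Proof. by move=> /integrableP[/measurable_EFinP]. Qed.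

Lemma L1_le f g : measurable_fun D f -> (forall x, D x -> `|f x| <= g x) -> L1 g -> L1 f.
Proof.
move=> mf fg ig; apply: (le_integrable mD _ _ ig); first exact/measurable_EFinP.
by move=> x Dx /=; rewrite lee_fin (le_trans (fg x Dx)) ?ler_norm.
Qed.

Lemma L1D f g : L1 f -> L1 g -> L1 (fun x => f x + g x).
Proof. by move=> hf hg; have := integrableD mD hf hg; apply: eq_integrable. Qed.

Lemma L1B f g : L1 f -> L1 g -> L1 (fun x => f x - g x).
Proof. by move=> hf hg; have := integrableB mD hf hg; apply: eq_integrable. Qed.

Lemma L1Z c f : L1 f -> L1 (fun x => c * f x).
Proof. by move=> hf; have := integrableZl mD c hf; apply: eq_integrable. Qed.

Lemma iiD f g : L1 f -> L1 g -> ii (fun x => f x + g x) = ii f + ii g.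
Proof. by move=> hf hg; rewrite /ii RintegralD. Qed.

Lemma iiB f g : L1 f -> L1 g -> ii (fun x => f x - g x) = ii f - ii g.
Proof. by move=> hf hg; rewrite /ii RintegralB. Qed.

Lemma iiZ c f : L1 f -> ii (fun x => c * f x) = c * ii f.
Proof. by move=> hf; rewrite /ii RintegralZl. Qed.

Lemma eq_ii f g : (forall x, D x -> f x = g x) -> ii f = ii g.
Proof. by move=> E; apply: eq_Rintegral => x /set_mem; exact: E. Qed.

Lemma eq_L1 f g : (forall x, D x -> f x = g x) -> L1 f -> L1 g.
Proof. by move=> E; apply: eq_integrable => // x /set_mem Dx /=; rewrite E. Qed.

Lemma eq_L2 f g : (forall x, D x -> f x = g x) -> L2 f -> L2 g.
Proof.
move=> E [mf h]; split.
  by apply: eq_measurable_fun mf => x /set_mem; exact: E.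
by apply: eq_L1 h => x Dx; rewrite E.
Qed.

Lemma ii_ge0 f : (forall x, D x -> 0 <= f x) -> 0 <= ii f.
Proof. by move=> h; apply: Rintegral_ge0. Qed.

Lemma ii_le f g : L1 f -> L1 g -> (forall x, D x -> f x <= g x) -> ii f <= ii g.
Proof. by move=> hf hg h; apply: le_Rintegral. Qed.

Lemma ii_lin a b c f g h : L1 f -> L1 g -> L1 h ->
  ii (fun x => a * f x + b * g x + c * h x) = a * ii f + b * ii g + c * ii h.
Proof.
move=> hf hg hh; have ha := L1Z a hf; have hb := L1Z b hg; have hc := L1Z c hh.
by rewrite iiD ?iiD ?iiZ//; exact: L1D.
Qed.

Lemma ii_lin2 a b f g : L1 f -> L1 g ->
  ii (fun x => a * f x + b * g x) = a * ii f + b * ii g.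
Proof.
by move=> hf hg; have ha := L1Z a hf; have hb := L1Z b hg; rewrite iiD ?iiZ.
Qed.

Lemma L1P f : measurable_fun D f -> (forall x, D x -> 0 <= f x) ->
  L1 f <-> (\int[mu]_(x in D) (f x)%:E < +oo)%E.
Proof.
move=> mf f0; rewrite (eq_integral (fun x => `|(EFin \o f) x|%E)); last first.
  by move=> x /set_mem Dx /=; rewrite ger0_norm// f0.
by split=> [/integrableP[]//|h]; apply/integrableP; split => //; exact/measurable_EFinP.
Qed.

Lemma L1E f : L1 f -> (\int[mu]_(x in D) (f x)%:E = (ii f)%:E)%E.
Proof. by move=> h; rewrite /ii /Rintegral fineK//; exact: integrable_fin_num. Qed.

Lemma L2M f g : L2 f -> L2 g -> L1 (fun x => f x * g x).
Proof.
move=> [mf hf] [mg hg]; apply: (L1_le _ _ (L1D hf hg)); first exact: measurable_funM.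
by move=> x _; rewrite ler_norml; apply/andP; split;
  have := sqr_ge0 (f x - g x); have := sqr_ge0 (f x + g x); have := sqr_ge0 (f x); have := sqr_ge0 (g x); nra.
Qed.

Lemma L2Z c f : L2 f -> L2 (fun x => c * f x).
Proof.
move=> [mf hf]; split; first exact: measurable_funM.
by apply: eq_L1 (L1Z (c ^+ 2) hf) => x _; rewrite exprMn.
Qed.

Lemma L2D f g : L2 f -> L2 g -> L2 (fun x => f x + g x).
Proof.
move=> hf hg; have [mf if_] := hf; have [mg ig] := hg; split; first exact: measurable_funD.
by apply: eq_L1 (L1D (L1D if_ ig) (L1Z 2 (L2M hf hg))) => x _; ring.
Qed.

Lemma L2B f g : L2 f -> L2 g -> L2 (fun x => f x - g x).
Proof. by move=> hf hg; apply: eq_L2 (L2D hf (L2Z (-1) hg)) => x _; rewrite mulN1r. Qed.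

Lemma L2_bounded M f g : measurable_fun D f -> (forall x, D x -> `|f x| <= M * `|g x|) -> L2 g -> L2 f.
Proof.
move=> mf fg [mg hg]; split => //; apply: (L1_le _ _ (L1Z (M ^+ 2) hg)); first exact: measurable_funX.
move=> x Dx; rewrite normrX -(normr_id (f x)) -[g x ^+ 2]real_normK ?num_real// -exprMn normr_id.
by rewrite ler_pXn2r ?nnegrE ?fg// (le_trans _ (fg x Dx)).
Qed.

Lemma ii_sum m (F : 'I_m -> T -> R) : (forall i, L1 (F i)) ->
  ii (fun x => \sum_i F i x) = \sum_i ii (F i) /\ L1 (fun x => \sum_i F i x).
Proof.
elim: m F => [|m IH] F hF.
  rewrite (_ : (fun _ => _) = cst 0); last by apply/funext => x; rewrite big_ord0.
  rewrite big_ord0 /ii /Rintegral integral0_eq//; split=> //; exact: integrable0.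
rewrite (_ : (fun _ => _) = fun x => F ord0 x + \sum_i F (lift ord0 i) x); last first.
  by apply/funext => x; rewrite big_ord_recl.
have [E h] := IH (fun i => F (lift ord0 i)) (fun i => hF _).
by rewrite iiD// E big_ord_recl; split=> //; exact: L1D.
Qed.

Lemma ii_cauchy f g : L2 f -> L2 g -> ii (fun x => f x * g x) ^+ 2 <= ii (fun x => f x ^+ 2) * ii (fun x => g x ^+ 2).
Proof.
move=> hf hg; set a := ii _; set F := ii _; set G := ii (fun x => g x ^+ 2).
have F0 : 0 <= F by apply: ii_ge0 => x _; exact: sqr_ge0.
have G0 : 0 <= G by apply: ii_ge0 => x _; exact: sqr_ge0.
have Q s t : 0 <= s ^+ 2 * F + 2 * s * t * a + t ^+ 2 * G.
  have <- : ii (fun x => (s * f x + t * g x) ^+ 2) = s ^+ 2 * F + 2 * s * t * a + t ^+ 2 * G.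
    rewrite -ii_lin; [by apply: eq_ii => x _; ring|exact: hf.2|exact: L2M|exact: hg.2].
  by apply: ii_ge0 => x _; exact: sqr_ge0.
have [G1|G1] := eqVneq G 0.
  (* In the degenerate case G = 0 this choice yields -a^2 (F + 2) >= 0, hence a = 0. *)
  have h := Q a (- (F + 1)).
  rewrite G1 in h *; rewrite mulr0 in h *.
  have : 0 <= - (a ^+ 2 * (F + 2)) by move: h; congr (_ <= _); ring.
  have F2 : 0 < F + 2 by rewrite ltr_wpDl.
  by rewrite mulr0 oppr_ge0 pmulr_lle0.
have {}G1 : 0 < G by rewrite lt_neqAle eq_sym G1.
have := Q G (- a); rewrite (_ : _ + _ = G * (F * G - a ^+ 2)); last by ring.
by rewrite pmulr_rge0// subr_ge0.
Qed.

Lemma cvg_ip (phi : nat -> T -> R) f g : (forall n, L2 (phi n)) -> L2 f -> L2 g ->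
  (fun n => ii (fun x => (phi n x - f x) ^+ 2)) @ \oo --> (0 : R) ->
  (fun n => ii (fun x => phi n x * g x)) @ \oo --> ii (fun x => f x * g x).
Proof.
move=> hphi hf hg h; apply/cvgrPdist_lt => e e0.
set G := ii (fun x => g x ^+ 2).
have G0 : 0 <= G by apply: ii_ge0 => x _; exact: sqr_ge0.
have G1 : 0 < G + 1 by rewrite ltr_wpDl.
have d0 : 0 < e ^+ 2 / (G + 1) by rewrite divr_gt0// exprn_gt0.
have /cvgrPdist_lt/(_ _ d0) := h; apply: filterS => n.
have hn := L2B (hphi n) hf.
have n0 : 0 <= ii (fun x => (phi n x - f x) ^+ 2) by apply: ii_ge0 => x _; exact: sqr_ge0.
rewrite sub0r normrN ger0_norm// => hlt.
have := ii_cauchy hn hg; rewrite -/G => hc.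
have E : ii (fun x => f x * g x) - ii (fun x => phi n x * g x) = - ii (fun x => (phi n x - f x) * g x).
  rewrite (@eq_ii (fun x => (phi n x - f x) * g x) (fun x => phi n x * g x - f x * g x)).
    by rewrite iiB ?opprB//; exact: L2M.
  by move=> x _; rewrite mulrBl.
rewrite E normrN -(@ltr_pXn2r _ 2) ?nnegrE ?(ltW e0)// real_normK ?num_real//.
apply: le_lt_trans hc _.
apply: (@le_lt_trans _ _ (ii (fun x => (phi n x - f x) ^+ 2) * (G + 1))).
  by rewrite ler_wpM2l// lerDl.
by rewrite -ltr_pdivlMr.
Qed.

Lemma cvg_sq (phi : nat -> T -> R) f V M : (forall n, L2 (phi n)) -> L2 f ->
  measurable_fun D V -> (forall x, D x -> `|V x| <= M) ->
  (fun n => ii (fun x => (phi n x - f x) ^+ 2)) @ \oo --> (0 : R) ->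
  (fun n => ii (fun x => V x * phi n x ^+ 2)) @ \oo --> ii (fun x => V x * f x ^+ 2).
Proof.
move=> hphi hf mV VM h.
have L2V g : L2 g -> L2 (fun x => V x * g x).
  move=> hg; apply: (@L2_bounded M _ g) => //; first by apply: measurable_funM => //; case: hg.
  by move=> x Dx; rewrite normrM ler_wpM2r// VM.
have L1V g : L2 g -> L1 (fun x => V x * g x ^+ 2).
  by move=> hg; apply: eq_L1 (L2M (L2V _ hg) hg) => x _; rewrite expr2 mulrA.
(* The expansion about f leaves a weighted square of the difference, which tends to 0, and a pairing
   with the fixed function V f, covered by [cvg_ip]. *)
have E n : ii (fun x => V x * phi n x ^+ 2) =
    ii (fun x => V x * (phi n x - f x) ^+ 2) + 2 * (ii (fun x => phi n x * (V x * f x))) - ii (fun x => V x * f x ^+ 2).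
  have l1 := L1V _ (L2B (hphi n) hf); have l2 := L2M (hphi n) (L2V _ hf); have l3 := L1V _ hf.
  transitivity (1 * ii (fun x => V x * (phi n x - f x) ^+ 2) + 2 * (ii (fun x => phi n x * (V x * f x))) + (-1) * ii (fun x => V x * f x ^+ 2)); last by ring.
  by rewrite -ii_lin//; apply: eq_ii => x _; ring.
set L := ii (fun x => V x * f x ^+ 2).
have EL : 0 + 2 * ii (fun x => f x * (V x * f x)) - L = L.
  rewrite (@eq_ii (fun x => f x * (V x * f x)) (fun x => V x * f x ^+ 2)); first by rewrite /L; ring.
  by move=> x _; ring.
suff H : (fun n => ii (fun x => V x * (phi n x - f x) ^+ 2) + 2 * (ii (fun x => phi n x * (V x * f x))) - L) @ \oo
    --> 0 + 2 * ii (fun x => f x * (V x * f x)) - L.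
  by rewrite EL in H; rewrite (funext E).
apply: cvgB; last exact: cvg_cst.
apply: cvgD; last first.
  by apply: cvgM; [exact: cvg_cst|apply: cvg_ip => //; exact: L2V].
apply/cvgrPdist_lt => e e0.
have M1 : 0 < `|M| + 1 by rewrite ltr_wpDl.
have d0 : 0 < e / (`|M| + 1) by rewrite divr_gt0.
have /cvgrPdist_lt/(_ _ d0) := h; apply: filterS => n.
have hn := L2B (hphi n) hf.
have n0 : 0 <= ii (fun x => (phi n x - f x) ^+ 2) by apply: ii_ge0 => x _; exact: sqr_ge0.
rewrite !sub0r !normrN ger0_norm// ltr_pdivlMr// => hlt.
apply: le_lt_trans hlt; rewrite mulrC.
have hM x : D x -> `|V x| <= `|M| + 1.
  by move=> Dx; rewrite (le_trans (VM x Dx))// (le_trans (ler_norm M))// lerDl.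
rewrite -iiZ; last exact: hn.2.
apply: le_trans (le_normr_Rintegral mD (L1V _ hn)) _.
apply: le_Rintegral => //; [|by apply: L1Z; exact: hn.2|].
  have := integrable_norm (L1V _ hn); apply: eq_integrable => //.
by move=> x /hM ?; rewrite normrM (ger0_norm (sqr_ge0 _)) ler_wpM2r// sqr_ge0.
Qed.

End L2.

(** * The space H10 *)

Section H10basics.
Context {R : realType}.
Notation mu := (@lebesgue_measure R).
Notation leb2 := (@leb2 R).
Notation plane := (measurableTypeR R * measurableTypeR R)%type.
Implicit Types f g u v : R * R -> R.

(** The measure of [leb2], carrying its measure structure in the type. *)
Definition lebp : {measure set plane -> \bar R} := (mu \x mu)%E.

Notation B := (@ball2 R).
Notation IB := (ii lebp B).
Notation L2 := (L2 lebp B).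
Notation L1 := (L1 lebp B).

Let mB : measurable (B : set plane). Proof. exact: measurable_ball2. Qed.

Lemma intBE f : L1 f -> intB f = (IB f)%:E.
Proof. by move=> h; rewrite -L1E. Qed.

(** Links the product topology to the product sigma-algebra: an open set is the countable union of
    the boxes with rational centre and side 2 / (n + 1) that it contains. *)
Lemma open_measurable_plane (U : set (R * R)) : open U -> measurable (U : set plane).
Proof.
move=> oU.
pose box (q1 q2 : rat) (n : nat) : set plane :=
  `](ratr q1 - n.+1%:R^-1), (ratr q1 + n.+1%:R^-1)[%classic `*` `](ratr q2 - n.+1%:R^-1), (ratr q2 + n.+1%:R^-1)[%classic.
have mbox q1 q2 n : measurable (box q1 q2 n) by apply: measurableX.
pose F q1 q2 n : set plane := if `[< box q1 q2 n `<=` U >] then box q1 q2 n else set0.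
have -> : U = \bigcup_q1 \bigcup_q2 \bigcup_n F q1 q2 n.
  apply/seteqP; split => x; last first.
    by move=> [q1 _ [q2 _ [n _]]]; rewrite /F; case: asboolP => // h; exact: h.
  move=> Ux; have /nbhs_ballP[e /= e0 he] := open_nbhs_nbhs (conj oU Ux).
  have [n ne] : exists n : nat, n.+1%:R^-1 < e / 2.
    exists (Num.truncn ((e / 2)^-1)).
    rewrite invf_plt ?posrE ?ltr0n ?divr_gt0//; exact: truncnS_gt.
  have n0 : 0 < n.+1%:R^-1 :> R by rewrite invr_gt0 ltr0n.
  have lt12 (y : R) : y - n.+1%:R^-1 < y + n.+1%:R^-1 by rewrite ltrBlDr -addrA ltrDl addr_gt0.
  have [q1] := rat_in_itvoo (lt12 x.1).
  rewrite in_itv/= => /andP[q11 q12].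
  have [q2] := rat_in_itvoo (lt12 x.2).
  rewrite in_itv/= => /andP[q21 q22].
  exists q1 => //; exists q2 => //; exists n => //; rewrite /F; case: asboolP => [_|].
    move: q11 q12 q21 q22; rewrite /box /=; move: (n.+1%:R^-1) => dd q11 q12 q21 q22.
    by split; rewrite /= in_itv/=; apply/andP; split; lra.
  case=> y [/=]; rewrite !in_itv/= => /andP[y11 y12] /andP[y21 y22].
  move: ne q11 q12 q21 q22 y11 y12 y21 y22; move: (n.+1%:R^-1) => dd ne q11 q12 q21 q22 y11 y12 y21 y22.
  apply: he; split; rewrite /ball/= ltr_norml; apply/andP; split; lra.
apply: bigcupT_measurable_rat => q1; apply: bigcupT_measurable_rat => q2.
apply: bigcupT_measurable => n; rewrite /F; case: asboolP => // _; exact: mbox.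
Qed.

Lemma continuous_measurable_plane (f : R * R -> R) : continuous f -> measurable_fun setT (f : plane -> R).
Proof.
move=> cf; apply: (@measurability _ _ plane (measurableTypeR R) setT f (@RGenOInfty.G R) (RGenOInfty.measurableE R)) => _ [_ [a ->] <-].
rewrite setTI; apply: open_measurable_plane; apply: open_comp; last exact: interval_open.
by move=> x _; exact: cf.
Qed.

Lemma continuous_bounded_ball (f : R * R -> R) : continuous f -> exists M, 0 <= M /\ forall x, B x -> `|f x| <= M.
Proof.
move=> cf; pose K : set (R * R) := `[-1, 1]%classic `*` `[-1, 1]%classic.
have cK : compact K by apply: compact_setX; exact: segment_compact.
have := continuous_compact (continuous_subspaceT cf) cK => /compact_bounded [M [_ HM]].
exists (`|M| + 1); split; first by rewrite addr_ge0.
move=> x Bx; apply: (HM (`|M| + 1)); first by rewrite (le_lt_trans (ler_norm M))// ltrDl.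
exists x => //; split => /=; rewrite in_itv/= -ler_norml.
  exact: le_trans (fst_le_enorm x) (ltW Bx).
exact: le_trans (snd_le_enorm x) (ltW Bx).
Qed.

Lemma leb_ball_lty : (lebp B < +oo)%E.
Proof.
have -> : lebp B = (@darea R)%:E by exact: (@leb2_unit_disc_fin R).
exact: ltry.
Qed.

Lemma L1_intro f : measurable_fun (B : set plane) f -> (forall x, B x -> 0 <= f x) ->
  (intB f < +oo)%E -> L1 f.
Proof. by move=> mf f0 h; have [_ H] := @L1P _ _ _ lebp B f mf f0; exact: H. Qed.

Lemma L1_cst (c : R) : L1 (fun=> c).
Proof.
have h : L1 (fun=> `|c|).
  apply: L1_intro; [exact: measurable_cst|by move=> x _; exact: normr_ge0|].
  have := @integral_cst _ _ _ lebp B mB (`|c|%:E); rewrite /cst /intB => ->.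
  by rewrite lte_mul_pinfty// leb_ball_lty.
by apply: (L1_le mB _ _ h); [exact: measurable_cst|].
Qed.

Lemma L1_bounded M f : measurable_fun (B : set plane) f -> (forall x, B x -> `|f x| <= M) -> L1 f.
Proof. by move=> mf h; apply: (L1_le mB mf h); exact: L1_cst. Qed.

Lemma L2_bounded_cst M f : measurable_fun (B : set plane) f -> (forall x, B x -> `|f x| <= M) -> L2 f.
Proof.
move=> mf h; split => //; apply: (@L1_bounded (M ^+ 2)); first exact: measurable_funX.
by move=> x Bx; rewrite normrX ler_pXn2r ?nnegrE ?h// (le_trans _ (h x Bx)).
Qed.

Lemma continuous_L2 f : continuous f -> L2 f.
Proof.
move=> cf; have [M [_ HM]] := continuous_bounded_ball cf.
apply: L2_bounded_cst HM; exact: measurable_funTS (continuous_measurable_plane cf).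
Qed.

Lemma smooth2_cont f : smooth2 f -> continuous f.
Proof. by move=> h x; have [_ []] := h [::] x. Qed.

Lemma smooth2_pd b f : smooth2 f -> smooth2 (pd b f).
Proof.
move=> h ds x; have -> : dpart ds (pd b f) = dpart (rcons ds b) f; last exact: h.
by elim: ds => //= c ds ->.
Qed.

Lemma smooth2_L2 f : smooth2 f -> L2 f.
Proof. by move=> /smooth2_cont; exact: continuous_L2. Qed.

Lemma isd_derive1 (f : R -> R) (x : R) : derivable f x 1 -> isd x f (derive1 f x).
Proof. by move=> h; rewrite derive1E; exact: derivableP. Qed.

Lemma derive1_isd (f : R -> R) (x a : R) : isd x f a -> derivable f x 1 /\ derive1 f x = a.
Proof. by move=> [h1 h2]; rewrite derive1E. Qed.

Lemma isd_lin (f g : R -> R) (x a c : R) : derivable f x 1 -> derivable g x 1 ->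
  isd x (fun t => a * f t + c * g t) (a * derive1 f x + c * derive1 g x).
Proof. by move=> /isd_derive1 hf /isd_derive1 hg; apply: derD; apply: derZ. Qed.

Lemma pd_lin b f g (a c : R) :
  (forall x : R * R, derivable (fun t => f (t, x.2)) x.1 1 /\ derivable (fun t => f (x.1, t)) x.2 1) ->
  (forall x : R * R, derivable (fun t => g (t, x.2)) x.1 1 /\ derivable (fun t => g (x.1, t)) x.2 1) ->
  pd b (fun x => a * f x + c * g x) = fun x => a * pd b f x + c * pd b g x.
Proof.
move=> hf hg; apply/funext => x; rewrite /pd; have [f1 f2] := hf x; have [g1 g2] := hg x.
by case: b; [have [] := derive1_isd (isd_lin a c f1 g1)|have [] := derive1_isd (isd_lin a c f2 g2)].
Qed.

Lemma dpart_lin ds f g (a c : R) : smooth2 f -> smooth2 g ->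
  dpart ds (fun x => a * f x + c * g x) = fun x => a * dpart ds f x + c * dpart ds g x.
Proof.
move=> hf hg; elim: ds => //= b ds ->; apply: pd_lin => x.
  by have [? []] := hf ds x.
by have [? []] := hg ds x.
Qed.

Lemma smooth2_lin f g (a c : R) : smooth2 f -> smooth2 g -> smooth2 (fun x => a * f x + c * g x).
Proof.
move=> hf hg ds x; rewrite dpart_lin//; have [f1 [f2 f3]] := hf ds x; have [g1 [g2 g3]] := hg ds x.
split; first by have [] := isd_lin a c f1 g1.
split; first by have [] := isd_lin a c f2 g2.
by apply: cvgD; apply: cvgM => //; exact: cvg_cst.
Qed.

Lemma testfun_lin f g (a c : R) : testfun f -> testfun g -> testfun (fun x => a * f x + c * g x).
Proof.
move=> [hf [r [r1 fr]]] [hg [s [s1 gs]]]; split; first exact: smooth2_lin.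
exists (Num.max r s); split; first by rewrite gt_max r1.
by move=> x; rewrite gt_max => /andP[/fr -> /gs ->]; rewrite !mulr0 addr0.
Qed.

Lemma pd_lin_test b f g (a c : R) : testfun f -> testfun g ->
  pd b (fun x => a * f x + c * g x) = fun x => a * pd b f x + c * pd b g x.
Proof. by move=> [hf _] [hg _]; exact: (dpart_lin [:: b]). Qed.

Definition dist2 f g := IB (fun x => (f x - g x) ^+ 2).

Lemma dist2_ge0 f g : 0 <= dist2 f g.
Proof. by apply: ii_ge0 => x _; exact: sqr_ge0. Qed.

Lemma dist2_tri f g h : L2 f -> L2 g -> L2 h -> dist2 f h <= 2 * dist2 f g + 2 * dist2 g h.
Proof.
move=> hf hg hh; have h1 := (L2B mB hf hg).2; have h2 := (L2B mB hg hh).2.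
rewrite /dist2 -(ii_lin2 mB)//; apply: (ii_le mB).
- exact: (L2B mB hf hh).2.
- by apply: (L1D mB); exact: (L1Z mB).
- by move=> x _; have := sqr_ge0 ((f x - g x) - (g x - h x)); nra.
Qed.

(** Convergence to 0 of extended-real integrals makes some of them finite, and one finite distance
    to a function of [L2] already puts u in [L2]. *)
Lemma intB_sqr_cvg (phi : nat -> R * R -> R) u : measurable_fun (B : set plane) u ->
  (forall n, L2 (phi n)) -> (fun n => intB (fun x => (phi n x - u x) ^+ 2)) @ \oo --> 0%E ->
  L2 u /\ (fun n => dist2 (phi n) u) @ \oo --> (0 : R).
Proof.
move=> mu_ hphi h.
split; last exact: (fine_cvg h).
have [n hn] := @filter_ex _ \oo _ _ (cvg_is_fine h).
have m1 : measurable_fun (B : set plane) (fun x => phi n x - u x).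
  by apply: measurable_funB => //; exact: (hphi n).1.
have d1 : L2 (fun x => phi n x - u x).
  split => //; apply: L1_intro; [exact: measurable_funX|by move=> x _; exact: sqr_ge0|].
  by rewrite -ge0_fin_numE//; apply: integral_ge0 => x _; rewrite lee_fin sqr_ge0.
by apply: (eq_L2 mB) (L2B mB (hphi n) d1) => x _; ring.
Qed.

Lemma H10_seq u g1 g2 : H10 u g1 g2 -> [/\ L2 u, L2 g1 & L2 g2] /\
  exists phi : nat -> R * R -> R, (forall n, testfun (phi n)) /\
    [/\ (fun n => dist2 (phi n) u) @ \oo --> (0 : R),
        (fun n => dist2 (pd true (phi n)) g1) @ \oo --> (0 : R) &
        (fun n => dist2 (pd false (phi n)) g2) @ \oo --> (0 : R)].
Proof.
move=> [mu_ m1 m2 [phi [ht [h0 h1 h2]]]].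
have [a0 b0] := intB_sqr_cvg mu_ (fun n => smooth2_L2 (ht n).1) h0.
have [a1 b1] := intB_sqr_cvg m1 (fun n => smooth2_L2 (smooth2_pd true (ht n).1)) h1.
have [a2 b2] := intB_sqr_cvg m2 (fun n => smooth2_L2 (smooth2_pd false (ht n).1)) h2.
by split => //; exists phi.
Qed.

Lemma H10_approx u g1 g2 e : 0 < e -> H10 u g1 g2 -> exists phi, testfun phi /\
  [/\ dist2 phi u < e, dist2 (pd true phi) g1 < e & dist2 (pd false phi) g2 < e].
Proof.
move=> e0 /H10_seq[_ [phi [ht [/cvgrPdist_lt/(_ e e0) h0 /cvgrPdist_lt/(_ e e0) h1 /cvgrPdist_lt/(_ e e0) h2]]]].
have [n [[h0' h1'] h2']] := @filter_ex _ \oo _ _ (filterI (filterI h0 h1) h2).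
exists (phi n); split => //; move: h0' h1' h2'.
by rewrite !sub0r !normrN !ger0_norm ?dist2_ge0.
Qed.

Lemma H10_intro u g1 g2 : L2 u -> L2 g1 -> L2 g2 ->
  (forall e, 0 < e -> exists phi, testfun phi /\
  [/\ dist2 phi u < e, dist2 (pd true phi) g1 < e & dist2 (pd false phi) g2 < e]) -> H10 u g1 g2.
Proof.
move=> hu h1 h2 H; split; [exact: hu.1|exact: h1.1|exact: h2.1|].
have /choice [phi hphi] : forall n : nat, exists phi, testfun phi /\
  [/\ dist2 phi u < n.+1%:R^-1, dist2 (pd true phi) g1 < n.+1%:R^-1 & dist2 (pd false phi) g2 < n.+1%:R^-1].
  by move=> n; apply: H; rewrite invr_gt0 ltr0n.
exists phi; split; first by move=> n; case: (hphi n).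
have key (f : nat -> R * R -> R) g : (forall n, L2 (f n)) -> L2 g -> (forall n, dist2 (f n) g < n.+1%:R^-1) ->
    (fun n => intB (fun x => (f n x - g x) ^+ 2)) @ \oo --> 0%E.
  move=> hf hg hn.
  have -> : (fun n => intB (fun x => (f n x - g x) ^+ 2)) = EFin \o (fun n => dist2 (f n) g).
    by apply/funext => n /=; rewrite intBE//; exact: (L2B mB (hf n) hg).2.
  apply: cvg_EFin; first by apply: nearW.
  apply: (@squeeze_cvgr _ _ _ _ (fun=> 0) (fun n => n.+1%:R^-1)); [|exact: cvg_cst|exact: cvg_harmonic].
  by apply: nearW => n /=; rewrite dist2_ge0 ltW.
have sm n : smooth2 (phi n) by have [[]] := hphi n.
split; apply: key => // n; first exact: smooth2_L2.
- by have [_ []] := hphi n.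
- exact: smooth2_L2 (smooth2_pd true (sm n)).
- by have [_ []] := hphi n.
- exact: smooth2_L2 (smooth2_pd false (sm n)).
- by have [_ []] := hphi n.
Qed.

Lemma H10_L2 u g1 g2 : H10 u g1 g2 -> [/\ L2 u, L2 g1 & L2 g2].
Proof. by case/H10_seq. Qed.

(** Closedness of the space in the graph norm: memberships can be proved through successive
    approximations without returning to test functions. *)
Lemma H10_lim u g1 g2 : L2 u -> L2 g1 -> L2 g2 ->
  (forall e, 0 < e -> exists v h1 h2, H10 v h1 h2 /\
  [/\ dist2 v u < e, dist2 h1 g1 < e & dist2 h2 g2 < e]) -> H10 u g1 g2.
Proof.
move=> hu hg1 hg2 H; apply: H10_intro => // e e0.
have e4 : 0 < e / 4 by rewrite divr_gt0.
have [v [h1 [h2 [Hv [a0 a1 a2]]]]] := H _ e4.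
have [phi [ht [b0 b1 b2]]] := H10_approx e4 Hv.
have [hv hh1 hh2] := H10_L2 Hv; have sm := ht.1.
exists phi; split => //; split.
- by have := dist2_tri (smooth2_L2 sm) hv hu; lra.
- by have := dist2_tri (smooth2_L2 (smooth2_pd true sm)) hh1 hg1; lra.
- by have := dist2_tri (smooth2_L2 (smooth2_pd false sm)) hh2 hg2; lra.
Qed.

Lemma H10_test (phi : R * R -> R) : testfun phi -> H10 phi (pd true phi) (pd false phi).
Proof.
move=> ht; have sm := ht.1; apply: H10_intro; try by apply: smooth2_L2 => //; exact: smooth2_pd.
move=> e e0; exists phi; split => //.
have z f : dist2 f f = 0.
  rewrite /dist2 /ii /Rintegral integral0_eq// => x _; by rewrite subrr expr0n.
by rewrite !z.
Qed.

Lemma H10_lin u g1 g2 v h1 h2 (a c : R) : H10 u g1 g2 -> H10 v h1 h2 ->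
  H10 (fun x => a * u x + c * v x) (fun x => a * g1 x + c * h1 x) (fun x => a * g2 x + c * h2 x).
Proof.
move=> Hu Hv; have [hu hg1 hg2] := H10_L2 Hu; have [hv hh1 hh2] := H10_L2 Hv.
have lin2 f g : L2 f -> L2 g -> L2 (fun x => a * f x + c * g x).
  by move=> hf hg; apply: (L2D mB); exact: (L2Z mB).
apply: H10_intro; [exact: lin2..|] => e e0.
pose k := a ^+ 2 + c ^+ 2 + 1.
have k0 : 0 < k by rewrite ltr_wpDl// addr_ge0// sqr_ge0.
have e4 : 0 < e / (4 * k) by rewrite divr_gt0// mulr_gt0.
have [phi [ht [a0 a1 a2]]] := H10_approx e4 Hu.
have [psi [hs [b0 b1 b2]]] := H10_approx e4 Hv.
have est f f' g g' : L2 f -> L2 f' -> L2 g -> L2 g' -> dist2 f f' < e / (4 * k) -> dist2 g g' < e / (4 * k) ->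
    dist2 (fun x => a * f x + c * g x) (fun x => a * f' x + c * g' x) < e.
  move=> hf hf' hg hg' d1 d2.
  have l1 := (L2B mB hf hf').2; have l2 := (L2B mB hg hg').2.
  have : dist2 (fun x => a * f x + c * g x) (fun x => a * f' x + c * g' x) <= (2 * a ^+ 2) * dist2 f f' + (2 * c ^+ 2) * dist2 g g'.
    rewrite /dist2 -(ii_lin2 mB)//; apply: (ii_le mB).
    - by apply: (L2B mB (lin2 _ _ _ _) (lin2 _ _ _ _)).2.
    - by apply: (L1D mB); exact: (L1Z mB).
    - move=> x _; have := sqr_ge0 (a * (f x - f' x) - c * (g x - g' x)); nra.
  move=> /le_lt_trans; apply.
  have q1 : (2 * a ^+ 2) * dist2 f f' <= (2 * a ^+ 2) * (e / (4 * k)).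
    by rewrite ler_wpM2l ?(ltW d1)// mulr_ge0// sqr_ge0.
  have q2 : (2 * c ^+ 2) * dist2 g g' <= (2 * c ^+ 2) * (e / (4 * k)).
    by rewrite ler_wpM2l ?(ltW d2)// mulr_ge0// sqr_ge0.
  have q3 : (2 * a ^+ 2) * (e / (4 * k)) + (2 * c ^+ 2) * (e / (4 * k)) + 2 * (e / (4 * k)) = e / 2.
    by rewrite /k; field; rewrite gt_eqF.
  by lra.
have smp := ht.1; have sms := hs.1.
exists (fun x => a * phi x + c * psi x); split; first exact: testfun_lin.
rewrite !pd_lin_test//; split; apply: est => //; try by apply: smooth2_L2 => //; exact: smooth2_pd.
Qed.

Lemma H10_ext u g1 g2 v h1 h2 : H10 u g1 g2 -> (forall x, B x -> u x = v x) ->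
  (forall x, B x -> g1 x = h1 x) -> (forall x, B x -> g2 x = h2 x) -> H10 v h1 h2.
Proof.
move=> Hu e0 e1 e2; have [hu hg1 hg2] := H10_L2 Hu.
apply: H10_lim; [exact: (eq_L2 mB) e0 hu|exact: (eq_L2 mB) e1 hg1|exact: (eq_L2 mB) e2 hg2|].
move=> e e_; exists u, g1, g2; split => //.
have z f g : (forall x, B x -> f x = g x) -> dist2 f g = 0.
  by move=> E; rewrite /dist2 /ii /Rintegral integral0_eq// => x Bx; rewrite E// subrr expr0n.
by rewrite !z.
Qed.

Lemma H10_zero : H10 (fun _ : R * R => 0 : R) (fun=> 0) (fun=> 0).
Proof.
have h : continuous (fun _ : R * R => 0 : R) by move=> x; exact: cvg_cst.
have E b : pd b (fun _ : R * R => 0 : R) = (fun=> 0).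
  by apply/funext => x; rewrite /pd; case: b; rewrite derive1_cst.
have E' ds : dpart ds (fun _ : R * R => 0 : R) = (fun=> 0) by elim: ds => //= b ds ->.
have ht : testfun (fun _ : R * R => 0 : R).
  split; last by exists 0.
  by move=> ds x; rewrite E'; split; [exact: derivable_cst|split; [exact: derivable_cst|exact: h]].
by have := H10_test ht; rewrite !E.
Qed.

Lemma H10_sum m (c : 'I_m -> R) (U G1 G2 : 'I_m -> R * R -> R) : (forall i, H10 (U i) (G1 i) (G2 i)) ->
  H10 (fun x => \sum_i c i * U i x) (fun x => \sum_i c i * G1 i x) (fun x => \sum_i c i * G2 i x).
Proof.
elim: m c U G1 G2 => [|m IH] c U G1 G2 H.
  by apply: H10_ext H10_zero _ _ _ => x _; rewrite big_ord0.
have := IH (fun i => c (lift ord0 i)) _ _ _ (fun i => H (lift ord0 i)) => h.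
by apply: H10_ext (H10_lin (c ord0) 1 (H ord0) h) _ _ _ => x _; rewrite big_ord_recl mul1r.
Qed.

Lemma dirichletE g1 g2 : L2 g1 -> L2 g2 ->
  dirichlet g1 g2 = (IB (fun x => g1 x ^+ 2) + IB (fun x => g2 x ^+ 2))%:E.
Proof.
by move=> h1 h2; rewrite /dirichlet intBE ?(iiD mB)//; [exact: h1.2|exact: h2.2|exact: (L1D mB h1.2 h2.2)].
Qed.

End H10basics.

(** * Smooth cut-offs *)

Section membership.
Context {R : realType}.
Notation plane := (measurableTypeR R * measurableTypeR R)%type.
Notation lebp := (@lebp R).
Notation B := (@ball2 R).
Notation IB := (ii lebp B).
Notation L2 := (L2 lebp B).
Notation L1 := (L1 lebp B).
Implicit Types f g u v : R * R -> R.

Let mB : measurable (B : set plane). Proof. exact: measurable_ball2. Qed.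

Lemma ae_enorm_gt0 : {ae lebp, forall x : plane, 0 < enorm x}.
Proof.
have m0 : measurable ([set x | enorm x <= 0] : set plane).
  rewrite (_ : [set _ | _] = setT `&` @enorm R @^-1` `]-oo, 0]%classic).
    exact: measurable_enorm.
  by rewrite setTI; apply/seteqP; split => x /=; rewrite in_itv.
exists [set x | enorm x <= 0]; split => //; last first.
  by move=> x /= /negP; rewrite -leNgt.
apply/eqP; rewrite eq_le measure_ge0 andbT; apply/lee_addgt0Pr => e e0; rewrite add0e.
have d0 := @darea_gt0 R; pose b := Num.min 1 (e / darea).
have b0 : 0 < b by rewrite lt_min ltr01 divr_gt0.
have b1 : b <= 1 by rewrite ge_min lexx.
have b2 : b * darea <= e by rewrite -ler_pdivlMr// ge_min lexx orbT.
apply: (@le_trans _ _ (lebp [set x | enorm x < b])).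
  apply: le_measure; rewrite ?inE; [exact: m0|exact: measurable_disc|].
  by move=> x /= h; exact: le_lt_trans h b0.
have -> : lebp [set x | enorm x < b] = (darea * b ^+ 2)%:E by exact: leb2_disc.
rewrite lee_fin; have : b ^+ 2 <= b by rewrite expr2 ler_piMl// ltW.
by nra.
Qed.

(** Bounds and convergence are only asked away from the origin, a null set, because the formulas for
    singular radial functions have arbitrary values there. *)
Lemma dct_ball (f_ : nat -> R * R -> R) f M :
  (forall n, measurable_fun (B : set plane) (f_ n)) -> measurable_fun (B : set plane) f ->
  (forall n x, B x -> 0 < enorm x -> `|f_ n x| <= M) ->
  (forall x, B x -> 0 < enorm x -> (f_ n x @[n --> \oo] --> f x)) ->
  [/\ (forall n, L2 (f_ n)), L2 f & (fun n => dist2 (f_ n) f) @ \oo --> (0 : R)].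
Proof.
move=> mf_ mf fM ff.
have fM' x : B x -> 0 < enorm x -> `|f x| <= M.
  move=> Bx x0; have h : (fun n => `|f_ n x|) @ \oo --> `|f x| by apply: cvg_norm; exact: ff.
  rewrite -(cvg_lim _ h)//; apply: limr_le; first by apply/cvg_ex; exists `|f x|.
  by apply: nearW => n; exact: fM.
have aeL2 g : measurable_fun (B : set plane) g -> (forall x, B x -> 0 < enorm x -> `|g x| <= M) -> L2 g.
  move=> mg gM; split => //.
  have m2 : measurable_fun (B : set plane) (fun x => g x ^+ 2) by exact: measurable_funX.
  have M2 : L1 (fun=> M ^+ 2) by exact: L1_cst.
  apply: L1_intro => //; first by move=> x _; exact: sqr_ge0.
  apply: (@le_lt_trans _ _ (\int[lebp]_(x in B) (M ^+ 2)%:E)%E); last first.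
    by rewrite (L1E mB M2) ltry.
  apply: ae_ge0_le_integral => //.
  - by move=> x _; rewrite lee_fin sqr_ge0.
  - by apply/measurable_EFinP.
  - by move=> x _; rewrite lee_fin sqr_ge0.
  - apply: filterS ae_enorm_gt0 => x x0 Bx; rewrite lee_fin -real_normK ?num_real//.
    by rewrite ler_pXn2r ?nnegrE ?gM// (le_trans _ (gM x Bx x0)).
have L2f := aeL2 f mf fM'; have L2n n := aeL2 (f_ n) (mf_ n) (fM n).
split => //.
pose F n x := ((f_ n x - f x) ^+ 2)%:E.
have mF n : measurable_fun (B : set plane) (F n).
  by apply/measurable_EFinP; apply: measurable_funX; apply: measurable_funB.
have Fc : {ae lebp, forall x, B x -> F ^~ x @ \oo --> 0%E}.
  apply: filterS ae_enorm_gt0 => x x0 Bx.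
  apply: cvg_EFin; first exact: nearW.
  have h : (fun n => (f_ n x - f x) ^+ 2) @ \oo --> (f x - f x) ^+ 2.
    by apply: cvgM; apply: cvgB; (exact: ff || exact: cvg_cst).
  by move: h; rewrite subrr expr0n.
have iG : lebp.-integrable B (fun=> ((2 * M) ^+ 2)%:E) by exact: (L1_cst ((2 * M) ^+ 2)).
have FM : {ae lebp, forall x n, B x -> (`|F n x| <= ((2 * M) ^+ 2)%:E)%E}.
  apply: filterS ae_enorm_gt0 => x x0 n Bx.
  rewrite /F abse_EFin lee_fin normrX ler_pXn2r ?nnegrE//.
    by rewrite (le_trans (ler_normB _ _))// mulr_natl mulr2n lerD// ?fM// fM'.
  by rewrite mulr_ge0// (le_trans _ (fM n x Bx x0)).
have [_ _] := dominated_convergence mB mF (measurable_cst 0%E) Fc iG FM.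
rewrite integral0 => h.
have E : (fun n => dist2 (f_ n) f) = fine \o (fun n => \int[lebp]_(x in B) F n x)%E by [].
by rewrite E; exact: (fine_cvg h).
Qed.

(** The working criterion for membership: uniformly bounded functions and gradients that converge
    pointwise off the origin. *)
Lemma H10_dct (u_ g_ h_ : nat -> R * R -> R) (u g h : R * R -> R) M :
  (forall n, H10 (u_ n) (g_ n) (h_ n)) ->
  measurable_fun (B : set plane) u -> measurable_fun (B : set plane) g -> measurable_fun (B : set plane) h ->
  (forall n x, B x -> 0 < enorm x -> [/\ `|u_ n x| <= M, `|g_ n x| <= M & `|h_ n x| <= M]) ->
  (forall x, B x -> 0 < enorm x -> [/\ u_ n x @[n --> \oo] --> u x, g_ n x @[n --> \oo] --> g x
    & h_ n x @[n --> \oo] --> h x]) ->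
  H10 u g h.
Proof.
move=> H mu_ mg mh bd cv.
have [hu lu cu] : [/\ (forall n, L2 (u_ n)), L2 u & (fun n => dist2 (u_ n) u) @ \oo --> (0 : R)].
  apply: (@dct_ball u_ u M) => //.
  - by move=> n; case: (H n).
  - by move=> n x Bx x0; case: (bd n x Bx x0).
  - by move=> x Bx x0; case: (cv x Bx x0).
have [hg lg cg] : [/\ (forall n, L2 (g_ n)), L2 g & (fun n => dist2 (g_ n) g) @ \oo --> (0 : R)].
  apply: (@dct_ball g_ g M) => //.
  - by move=> n; case: (H n).
  - by move=> n x Bx x0; case: (bd n x Bx x0).
  - by move=> x Bx x0; case: (cv x Bx x0).
have [hh lh ch] : [/\ (forall n, L2 (h_ n)), L2 h & (fun n => dist2 (h_ n) h) @ \oo --> (0 : R)].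
  apply: (@dct_ball h_ h M) => //.
  - by move=> n; case: (H n).
  - by move=> n x Bx x0; case: (bd n x Bx x0).
  - by move=> x Bx x0; case: (cv x Bx x0).
apply: H10_lim => // e e0.
move/cvgrPdist_lt/(_ e e0) : cu => cu; move/cvgrPdist_lt/(_ e e0) : cg => cg.
move/cvgrPdist_lt/(_ e e0) : ch => ch.
have [n [[h0' h1'] h2']] := @filter_ex _ \oo _ _ (filterI (filterI cu cg) ch).
exists (u_ n), (g_ n), (h_ n); split => //; move: h0' h1' h2'.
by rewrite !sub0r !normrN !ger0_norm ?dist2_ge0.
Qed.

(** * A class of smooth functions closed under partial derivatives *)

Section smooth_class.
Variables eps a : R.
Hypothesis eps0 : 0 < eps.

(** The standard flat function with all its factors s^(-n): the derivative of each member is a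
    combination of two later members, so one family handles all orders. *)
Definition flat (n : nat) (s : R) : R := if 0 < s then s ^- n * expR (- (eps / s)) else 0.

Lemma flat_pos n s : 0 < s -> flat n s = s ^- n * expR (- (eps / s)).
Proof. by rewrite /flat => ->. Qed.

Lemma flat_neg n s : s <= 0 -> flat n s = 0.
Proof. by rewrite /flat leNgt => /negbTE ->. Qed.

(** One term of the exponential series, of order n + 2, dominates s^(-n) with two powers to spare;
    this gives derivative 0 at the origin. *)
Lemma flat_sqr_bound n : exists C, 0 <= C /\ forall s, `|flat n s| <= C * s ^+ 2.
Proof.
exists ((n.+2)`!%:R / eps ^+ n.+2); split.
  by rewrite divr_ge0// exprn_ge0// ltW.
move=> s; have [s0|s0] := ltP 0 s; last first.
  by rewrite flat_neg// normr0 mulr_ge0 ?sqr_ge0// divr_ge0// exprn_ge0// ltW.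
have es : 0 < eps / s by rewrite divr_gt0.
rewrite flat_pos// ger0_norm; last by rewrite mulr_ge0 ?expR_ge0// invr_ge0 exprn_ge0// ltW.
have h := expR_ge1Dxn n.+1 (ltW es).
have f0 : 0 < (n.+2)`!%:R :> R by rewrite ltr0n fact_gt0.
have h' : (eps / s) ^+ n.+2 / (n.+2)`!%:R <= expR (eps / s) by rewrite (le_trans _ h)// lerDr.
rewrite expRN.
have p0 : 0 < (eps / s) ^+ n.+2 / (n.+2)`!%:R by rewrite divr_gt0// exprn_gt0.
have : (expR (eps / s))^-1 <= ((eps / s) ^+ n.+2 / (n.+2)`!%:R)^-1.
  by rewrite lef_pV2// posrE// expR_gt0.
have sn0 : 0 <= s ^- n by rewrite invr_ge0 exprn_ge0// ltW.
move=> /(ler_wpM2l sn0) le1; apply: le_trans le1 _.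
rewrite le_eqVlt; apply/orP; left; apply/eqP.
have sn : s ^+ n != 0 by rewrite expf_neq0// gt_eqF.
have en : eps ^+ n.+2 != 0 by rewrite expf_neq0// gt_eqF.
rewrite exprMn exprVn (exprS s n.+1) (exprS s n).
by field; rewrite ?en ?sn gt_eqF ?gt_eqF.
Qed.

Lemma flat_der n (s : R) : isd s (flat n) (- n%:R * flat n.+1 s + eps * flat n.+2 s).
Proof.
have [s0|s0|s0] := ltgtP 0 s.
- have sn : s != 0 by rewrite gt_eqF.
  have d : isd s (fun t => t ^- n * expR (- (eps / t))) (- n%:R * flat n.+1 s + eps * flat n.+2 s).
    have d1 : isd s (fun t => t ^+ n) (n%:R * s ^+ n.-1).
      elim: (n) => [|k IH]; first by rewrite mul0r; exact: derC.
      under eq_fun do rewrite exprS.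
      apply: der_eq (derM (derI s) IH) _; case: k {IH} => [|k] /=; first by rewrite !expr0; ring.
      by rewrite -[k.+2%:R]natr1 exprS; ring.
    have d2 := @derV _ (fun t => t ^+ n) s _ (expf_neq0 n sn) d1.
    have d3 : isd s (fun t => - (eps / t)) (eps / s ^+ 2).
      by apply: der_eq (derN (derM (derC eps s) (derV sn (derI s)))) _; field.
    apply: der_eq (derM d2 (der_comp d3 (is_derive_expR _))) _.
    rewrite !flat_pos//; case: n {d1 d2} => [|n]; first by rewrite /=; field.
    by rewrite /= !exprS; field; rewrite expf_neq0.
  apply: der_near d; apply: filterS (lt_nbhsr s0) => t t0.
  by rewrite flat_pos.
- rewrite !flat_neg ?ltW// !mulr0 addr0; apply: der_near (derC 0 s).
  by apply: filterS (lt_nbhsl s0) => t t0; rewrite flat_neg// ltW.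
- rewrite -s0 !flat_neg// !mulr0 addr0; apply: slope_der => e e0.
  have [C [C0 HC]] := flat_sqr_bound n.
  have d0 : 0 < e / (C + 1) by rewrite divr_gt0// ltr_wpDl.
  apply/nbhs_ballP; exists (e / (C + 1)) => //= y; rewrite /ball/= sub0r normrN => yd.
  rewrite (flat_neg n (lexx 0)) !subr0 mul0r subr0; apply: le_trans (HC y) _.
  rewrite -real_normK ?num_real// expr2 mulrA ler_wpM2r//.
  apply: (@le_trans _ _ ((C + 1) * `|y|)); first by rewrite ler_wpM2r// lerDl.
  by move: yd; rewrite ltr_pdivlMr ?ltr_wpDl// mulrC => /ltW.
Qed.

Lemma flat_cont n : continuous (flat n).
Proof. by move=> s; apply: der_cts (flat_der n s). Qed.

(** A syntactic class containing its own partial derivatives, so that [smooth2], which asks for all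
    iterated partials, becomes an induction. *)
Inductive sm : (R * R -> R) -> Prop :=
| sm_cst c : sm (fun=> c)
| sm_fst : sm (fun x => x.1)
| sm_snd : sm (fun x => x.2)
| sm_add f g : sm f -> sm g -> sm (fun x => f x + g x)
| sm_mul f g : sm f -> sm g -> sm (fun x => f x * g x)
| sm_flat n : sm (fun x => flat n (a - (x.1 ^+ 2 + x.2 ^+ 2))).

Lemma plane_cts_comp (f : R * R -> R) (h : R -> R) : continuous f -> continuous h -> continuous (fun x => h (f x)).
Proof. by move=> cf ch x; apply: (@continuous_comp _ _ _ f h); [exact: cf|exact: ch]. Qed.

Lemma plane_ctsD f g : continuous f -> continuous g -> continuous (fun x => f x + g x).
Proof. by move=> cf cg x; apply: cvgD; [exact: cf|exact: cg]. Qed.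

Lemma plane_ctsM f g : continuous f -> continuous g -> continuous (fun x => f x * g x).
Proof. by move=> cf cg x; apply: cvgM; [exact: cf|exact: cg]. Qed.

Lemma plane_cts1 : continuous (fun x : R * R => x.1).
Proof. by move=> x; exact: cvg_fst. Qed.

Lemma plane_cts2 : continuous (fun x : R * R => x.2).
Proof. by move=> x; exact: cvg_snd. Qed.

Lemma plane_ctsC (c : R) : continuous (fun _ : R * R => c).
Proof. by move=> x; exact: cvg_cst. Qed.

Lemma plane_cts_norm2 : continuous (fun x : R * R => x.1 ^+ 2 + x.2 ^+ 2).
Proof.
by apply: plane_ctsD; apply: plane_ctsM; (exact: plane_cts1 || exact: plane_cts2).
Qed.

Lemma sm_cont f : sm f -> continuous f.
Proof.
elim=> [c| | |g h _ cg _ ch|g h _ cg _ ch|n].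
- exact: plane_ctsC.
- exact: plane_cts1.
- exact: plane_cts2.
- exact: plane_ctsD.
- exact: plane_ctsM.
- apply: plane_cts_comp; last exact: flat_cont.
  apply: plane_ctsD; first exact: plane_ctsC.
  have := plane_ctsM (@plane_ctsC (-1)) plane_cts_norm2.
  by under eq_fun do rewrite mulN1r.
Qed.

Definition grad_of f g1 g2 := forall x : R * R,
  isd x.1 (fun t => f (t, x.2)) (g1 x) /\ isd x.2 (fun t => f (x.1, t)) (g2 x).

Lemma grad_pd f g1 g2 : grad_of f g1 g2 -> pd true f = g1 /\ pd false f = g2.
Proof.
move=> h; split; apply/funext => x; rewrite /pd; have [h1 h2] := h x.
  by have [_ ->] := derive1_isd h1.
by have [_ ->] := derive1_isd h2.
Qed.

Lemma gradD f g f1 f2 g1 g2 : grad_of f f1 f2 -> grad_of g g1 g2 ->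
  grad_of (fun x => f x + g x) (fun x => f1 x + g1 x) (fun x => f2 x + g2 x).
Proof. by move=> hf hg x; have [a1 a2] := hf x; have [b1 b2] := hg x; split; exact: derD. Qed.

Lemma gradM f g f1 f2 g1 g2 : grad_of f f1 f2 -> grad_of g g1 g2 ->
  grad_of (fun x => f x * g x) (fun x => f1 x * g x + f x * g1 x) (fun x => f2 x * g x + f x * g2 x).
Proof.
move=> hf hg [y z]; have [/= a1 a2] := hf (y, z); have [/= b1 b2] := hg (y, z).
by split => /=; [apply: der_eq (derM a1 b1) _|apply: der_eq (derM a2 b2) _].
Qed.

Lemma grad_radial (h dh : R -> R) : (forall s, isd s h (dh s)) ->
  grad_of (fun x => h (a - (x.1 ^+ 2 + x.2 ^+ 2))) (fun x => dh (a - (x.1 ^+ 2 + x.2 ^+ 2)) * (-2 * x.1))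
   (fun x => dh (a - (x.1 ^+ 2 + x.2 ^+ 2)) * (-2 * x.2)).
Proof.
move=> hd [y z] /=.
have d1 : isd y (fun t => a - (t ^+ 2 + z ^+ 2)) (-2 * y).
  by apply: der_eq (derB (derC a y) (derD (derX2 (derI y)) (derC _ _))) _; ring.
have d2 : isd z (fun t => a - (y ^+ 2 + t ^+ 2)) (-2 * z).
  by apply: der_eq (derB (derC a z) (derD (derC _ _) (derX2 (derI z)))) _; ring.
by split; [exact: der_comp d1 (hd _)|exact: der_comp d2 (hd _)].
Qed.

Lemma sm_grad f : sm f -> exists g1 g2, [/\ sm g1, sm g2 & grad_of f g1 g2].
Proof.
elim=> [c| | |g h sg [g1 [g2 [a1 a2 a3]]] sh [h1 [h2 [b1 b2 b3]]]|g h sg [g1 [g2 [a1 a2 a3]]] sh [h1 [h2 [b1 b2 b3]]]|n].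
- exists (fun=> 0), (fun=> 0); split; [exact: sm_cst..|].
  by move=> x; split; exact: derC.
- exists (fun=> 1), (fun=> 0); split; [exact: sm_cst..|].
  by move=> x; split; [exact: derI|exact: derC].
- exists (fun=> 0), (fun=> 1); split; [exact: sm_cst..|].
  by move=> x; split; [exact: derC|exact: derI].
- exists (fun x => g1 x + h1 x), (fun x => g2 x + h2 x); split; [exact: sm_add..|].
  exact: gradD.
- exists (fun x => g1 x * h x + g x * h1 x), (fun x => g2 x * h x + g x * h2 x); split.
  + by apply: sm_add; exact: sm_mul.
  + by apply: sm_add; exact: sm_mul.
  + exact: gradM.
- have s k : sm (fun x => (- n%:R * flat n.+1 (a - (x.1 ^+ 2 + x.2 ^+ 2)) + eps * flat n.+2 (a - (x.1 ^+ 2 + x.2 ^+ 2))) * (-2 * k x)) -> True by [].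
  have sd : sm (fun x => - n%:R * flat n.+1 (a - (x.1 ^+ 2 + x.2 ^+ 2)) + eps * flat n.+2 (a - (x.1 ^+ 2 + x.2 ^+ 2))).
    by apply: sm_add; apply: sm_mul; (exact: sm_cst || exact: sm_flat).
  eexists; eexists; split; last exact: grad_radial (flat_der n).
  + by apply: sm_mul => //; apply: sm_mul; [exact: sm_cst|exact: sm_fst].
  + by apply: sm_mul => //; apply: sm_mul; [exact: sm_cst|exact: sm_snd].
Qed.

Lemma sm_smooth2 f : sm f -> smooth2 f.
Proof.
move=> sf; have h ds : sm (dpart ds f).
  elim: ds => //= b ds /sm_grad[g1 [g2 [s1 s2 /grad_pd[E1 E2]]]].
  by case: b; rewrite ?E1 ?E2.
move=> ds x; have [g1 [g2 [_ _ hg]]] := sm_grad (h ds); have [h1 h2] := hg x.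
split; first by case: h1.
split; first by case: h2.
exact: sm_cont (h ds) x.
Qed.

End smooth_class.

End membership.

(** * Radial multiples of harmonic polynomials in H10 *)

Section cutoffs.
Context {R : realType}.
Notation plane := (measurableTypeR R * measurableTypeR R)%type.
Notation lebp := (@lebp R).
Notation B := (@ball2 R).
Implicit Types f g u v P : R * R -> R.

Definition nsq (x : R * R) : R := x.1 ^+ 2 + x.2 ^+ 2.

Lemma nsqE x : nsq x = enorm x ^+ 2. Proof. by rewrite enorm_sqr. Qed.

Lemma nsq_ge0 x : 0 <= nsq x. Proof. by rewrite nsqE sqr_ge0. Qed.

Lemma nsq_lt1 x : B x -> nsq x < 1.
Proof. by move=> Bx; rewrite nsqE expr_lt1// enorm_ge0. Qed.

Lemma nsq_cont : continuous nsq. Proof. exact: plane_cts_norm2. Qed.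

Lemma ball_fst x : B x -> `|x.1| <= 1.
Proof. by move=> Bx; exact: le_trans (fst_le_enorm x) (ltW Bx). Qed.

Lemma ball_snd x : B x -> `|x.2| <= 1.
Proof. by move=> Bx; exact: le_trans (snd_le_enorm x) (ltW Bx). Qed.

(** Multipliers that can be combined with every cut-off; in use they are the constant 1 and the
    harmonic polynomials. *)
Definition gpoly P P1 P2 := [/\ forall e a, sm e a P, grad_of P P1 P2, continuous P1 & continuous P2].

Lemma gpoly_cont P P1 P2 : gpoly P P1 P2 -> continuous P.
Proof. by move=> [/(_ 1 0) h _ _ _]; apply: sm_cont h; exact: ltr01. Qed.

Lemma gpoly_bound P P1 P2 : gpoly P P1 P2 -> exists2 K, 0 <= K &
  forall x, B x -> [/\ `|P x| <= K, `|P1 x| <= K & `|P2 x| <= K].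
Proof.
move=> hP; have [K0 [K00 h0]] := continuous_bounded_ball (gpoly_cont hP).
case: hP => _ _ c1 c2.
have [K1 [K10 h1]] := continuous_bounded_ball c1.
have [K2 [K20 h2]] := continuous_bounded_ball c2.
exists (K0 + K1 + K2); first by rewrite !addr_ge0.
by move=> x Bx; have := h0 x Bx; have := h1 x Bx; have := h2 x Bx; split; lra.
Qed.

(** Smooth approximation of the positive part: t exp (-e / t) for t > 0, with e tending to 0; [deta]
    is its derivative. *)
Definition eta (e t : R) : R := t * flat e 0 t.

Definition deta (e t : R) : R := flat e 0 t + t * (e * flat e 2 t).

Lemma eta_der e t : 0 < e -> isd t (eta e) (deta e t).
Proof. by move=> e0; apply: der_eq (derM (derI t) (flat_der e0 0 t)) _; rewrite /deta; ring. Qed.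

Lemma eta_pos e t : 0 < t -> eta e t = t * expR (- (e / t)).
Proof. by move=> t0; rewrite /eta flat_pos// expr0 invr1 mul1r. Qed.

Lemma deta_pos e t : 0 < t -> deta e t = expR (- (e / t)) * (1 + e / t).
Proof.
by move=> t0; rewrite /deta !flat_pos// expr0 invr1 mul1r; field; rewrite gt_eqF.
Qed.

Lemma eta_neg e t : t <= 0 -> eta e t = 0 /\ deta e t = 0.
Proof. by move=> t0; rewrite /eta /deta !flat_neg// !mulr0 addr0. Qed.

(** For t > 0 the derivative is exp (-x)(1 + x) with x = e / t, at most 1 uniformly in e; this is
    the domination needed for the limit. *)
Lemma eta_bound e t : 0 < e -> t <= 1 -> `|eta e t| <= 1 /\ `|deta e t| <= 1.
Proof.
move=> e0 t1; have [t0|t0] := ltP 0 t; last by have [-> ->] := eta_neg e t0; rewrite normr0.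
have et : 0 < e / t by rewrite divr_gt0.
rewrite eta_pos// deta_pos// !ger0_norm ?mulr_ge0 ?expR_ge0 ?addr_ge0 ?(ltW et) ?(ltW t0)//.
split.
  by rewrite mulr_ile1 ?(ltW t0) ?expR_ge0// expR_le1 oppr_le0 ltW.
by rewrite expRN mulrC ler_pdivrMr ?expR_gt0// mul1r expR_ge1Dx.
Qed.

(** Approaching t from below makes both sequences identically zero when t <= 0, which fixes the
    value 0 for the derivative of the positive part at its corner. *)
Lemma eta_cvg (e_ t_ : nat -> R) (t : R) : (forall n, 0 < e_ n) -> (forall n, t_ n <= t) ->
  e_ @ \oo --> (0 : R) -> t_ @ \oo --> t ->
  (fun n => eta (e_ n) (t_ n)) @ \oo --> Num.max t 0 /\
  (fun n => deta (e_ n) (t_ n)) @ \oo --> (if 0 < t then 1 else 0 : R).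
Proof.
move=> e0 tt ce ct; have [t0|t0] := ltP 0 t; last first.
  have E n := eta_neg (e_ n) (le_trans (tt n) t0).
  split.
    by rewrite (_ : (fun n => _) = fun=> 0); [exact: cvg_cst|apply/funext => n; case: (E n)].
  by rewrite (_ : (fun n => _) = fun=> 0); [exact: cvg_cst|apply/funext => n; case: (E n)].
have pos : \forall n \near \oo, 0 < t_ n by apply: (cvgr_gt t).
have cx : (fun n => e_ n / t_ n) @ \oo --> (0 : R).
  by rewrite -(mul0r t^-1); apply: cvgM => //; apply: cvgV => //; rewrite gt_eqF.
have cE : (fun n => expR (- (e_ n / t_ n))) @ \oo --> (1 : R).
  have : (fun n => expR (- (e_ n / t_ n))) @ \oo --> expR (- 0).
    apply: (@continuous_cvg _ _ _ _ _ (fun n => - (e_ n / t_ n)) expR); first exact: continuous_expR.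
    exact: cvgN.
  by rewrite oppr0 expR0.
split.
  have h : (fun n => t_ n * expR (- (e_ n / t_ n))) @ \oo --> t by rewrite -[X in _ --> X]mulr1; exact: cvgM.
  apply: cvg_trans h; apply: near_eq_cvg; apply: filterS pos => n tn.
  by rewrite eta_pos.
have h : (fun n => expR (- (e_ n / t_ n)) * (1 + e_ n / t_ n)) @ \oo --> (1 : R).
  have : (fun n => expR (- (e_ n / t_ n)) * (1 + e_ n / t_ n)) @ \oo --> 1 * (1 + 0 : R).
    by apply: cvgM => //; apply: cvgD => //; exact: cvg_cst.
  by rewrite addr0 mulr1.
apply: cvg_trans h; apply: near_eq_cvg; apply: filterS pos => n tn.
by rewrite deta_pos.
Qed.

Lemma cvg_harm (c : R) : (fun n => c / n.+1%:R) @ \oo --> (0 : R).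
Proof. by rewrite -[X in _ --> X](mulr0 c); apply: cvgM; [exact: cvg_cst|exact: cvg_harmonic]. Qed.

Lemma ifmeas (p : R * R -> bool) f g : measurable (p : set plane) ->
  measurable_fun setT (f : plane -> R) -> measurable_fun setT (g : plane -> R) ->
  measurable_fun setT ((fun x => if p x then f x else g x) : plane -> R).
Proof.
move=> mp mf mg; apply: measurable_fun_if => //.
- by apply: (@measurable_fun_bool _ _ setT p true) => //; rewrite setTI (_ : _ @^-1` _ = p)//; apply/seteqP; split => x /=; case: (p x).
- exact: measurable_funTS.
- exact: measurable_funTS.
Qed.

Lemma nsq_meas : measurable_fun setT (nsq : plane -> R).
Proof. exact: continuous_measurable_plane nsq_cont. Qed.

Lemma nsq_lt_meas b : measurable ((fun x => nsq x < b) : set plane).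
Proof.
rewrite (_ : (fun _ => _) = setT `&` nsq @^-1` `]-oo, b[%classic); first exact: nsq_meas.
by rewrite setTI; apply/seteqP; split => x /=; rewrite in_itv.
Qed.

Lemma nsq_ge_meas b : measurable ((fun x => b <= nsq x) : set plane).
Proof.
rewrite (_ : (fun _ => _) = setT `&` nsq @^-1` `[b, +oo[%classic); first exact: nsq_meas.
by rewrite setTI; apply/seteqP; split => x /=; rewrite in_itv/= andbT.
Qed.

Lemma max0_cont (b : R) : continuous (fun s : R => Num.max (b - s) 0).
Proof.
move=> s; apply: (@continuous_max _ R (fun s => b - s) (fun=> 0)).
  by apply: cvgB; [exact: cvg_cst|exact: cvg_id].
exact: cvg_cst.
Qed.

(** Building block for all radial memberships: by linearity, finite combinations of hinges give
    every radial function that is piecewise linear in |x|^2 and vanishes on the boundary. *)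
Lemma H10_hinge b P P1 P2 : 0 < b -> b <= 1 -> gpoly P P1 P2 ->
  H10 (fun x => Num.max (b - nsq x) 0 * P x)
      (fun x => (if nsq x < b then -2 * x.1 else 0) * P x + Num.max (b - nsq x) 0 * P1 x)
      (fun x => (if nsq x < b then -2 * x.2 else 0) * P x + Num.max (b - nsq x) 0 * P2 x).
Proof.
move=> b0 b1 hP; have [K K0 HK] := gpoly_bound hP; have cP := gpoly_cont hP.
have [sP gP c1 c2] := hP.
(* Lowering b by the smoothing parameter keeps the support inside the disc of radius sqrt (1 - e_n),
   even for b = 1. *)
pose e_ n : R := n.+1%:R^-1; pose a_ n := b - e_ n.
have e0 n : 0 < e_ n by rewrite invr_gt0 ltr0n.
pose u_ n x := eta (e_ n) (a_ n - nsq x) * P x.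
pose g_ n x := (deta (e_ n) (a_ n - nsq x) * (-2 * x.1)) * P x + eta (e_ n) (a_ n - nsq x) * P1 x.
pose h_ n x := (deta (e_ n) (a_ n - nsq x) * (-2 * x.2)) * P x + eta (e_ n) (a_ n - nsq x) * P2 x.
have mmax : measurable_fun setT ((fun x => Num.max (b - nsq x) 0) : plane -> R).
  apply: continuous_measurable_plane.
  exact: (plane_cts_comp nsq_cont (@max0_cont b)).
have mi (k : R * R -> R) : continuous k -> measurable_fun setT ((fun x => if nsq x < b then -2 * k x else 0) : plane -> R).
  move=> ck; apply: ifmeas; [exact: nsq_lt_meas|apply: continuous_measurable_plane|exact: measurable_cst].
  exact: plane_ctsM (@plane_ctsC _ (-2)) ck.
have mP := continuous_measurable_plane cP.
have mg (k Q : R * R -> R) : continuous k -> continuous Q ->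
    measurable_fun (B : set plane) (fun x => (if nsq x < b then -2 * k x else 0) * P x + Num.max (b - nsq x) 0 * Q x).
  move=> ck cQ; apply: measurable_funTS; apply: measurable_funD; apply: measurable_funM => //.
    exact: mi.
  exact: continuous_measurable_plane.
apply: (@H10_dct _ u_ g_ h_ _ _ _ (3 * K)).
- move=> n; have gr : grad_of (u_ n) (g_ n) (h_ n).
    by have := gradM (grad_radial (a_ n) (fun t => eta_der t (e0 n))) gP.
  have sx : sm (e_ n) (a_ n) (u_ n).
    apply: sm_mul; last exact: sP.
    rewrite (_ : (fun x => _) = fun x => (a_ n + (-1) * (x.1 * x.1 + x.2 * x.2)) * flat (e_ n) 0 (a_ n - (x.1 ^+ 2 + x.2 ^+ 2))).
      apply: sm_mul; last exact: sm_flat.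
      apply: sm_add; first exact: sm_cst.
      apply: sm_mul; first exact: sm_cst.
      by apply: sm_add; apply: sm_mul; (exact: sm_fst || exact: sm_snd).
    by apply/funext => x; rewrite /eta /nsq mulN1r.
  have [<- <-] := grad_pd gr; apply: H10_test; split; first exact: (sm_smooth2 (e0 n) sx).
  have e1 : e_ n <= 1 by rewrite invf_le1 ?ltr0n// ler1n.
  exists (Num.sqrt (1 - e_ n)); split.
    by rewrite -[X in _ < X]sqrtr1 ltr_sqrt// ltrBlDr ltrDl.
  move=> x rx; suff nb : a_ n - nsq x <= 0 by rewrite /u_ (eta_neg (e_ n) nb).1 mul0r.
  rewrite subr_le0 nsqE /a_.
  have : 1 - e_ n < enorm x ^+ 2.
    have -> : 1 - e_ n = Num.sqrt (1 - e_ n) ^+ 2 by rewrite sqr_sqrtr ?subr_ge0.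
    by rewrite ltr_pXn2r// nnegrE ?sqrtr_ge0//; exact: enorm_ge0.
  by move: b1; lra.
- apply: measurable_funTS; exact: measurable_funM.
- exact: mg plane_cts1 c1.
- exact: mg plane_cts2 c2.
- move=> n x Bx _; have [k0 k1 k2] := HK x Bx.
  have t1 : a_ n - nsq x <= 1 by have := nsq_ge0 x; have := e0 n; rewrite /a_; lra.
  have [q1 q2] := eta_bound (e0 n) t1.
  have x1 := ball_fst Bx; have x2 := ball_snd Bx.
  have est (y p1 : R) : `|y| <= 1 -> `|p1| <= K ->
     `|deta (e_ n) (a_ n - nsq x) * (-2 * y) * P x + eta (e_ n) (a_ n - nsq x) * p1| <= 3 * K.
    move=> y1 pK; move: q1 q2; move: (eta _ _) (deta _ _) => E D E1 D1.
    apply: le_trans (ler_normD _ _) _; rewrite !normrM.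
    have -> : `|-2 : R| = 2 by rewrite normrN ger0_norm.
    have z1 : `|D| * (2 * `|y|) <= 1 * 2 by apply: ler_pM => //; lra.
    have z2 : `|D| * (2 * `|y|) * `|P x| <= 1 * 2 * K.
      by apply: ler_pM => //; rewrite !mulr_ge0.
    have z3 : `|E| * `|p1| <= 1 * K by apply: ler_pM.
    by lra.
  split; [|exact: est|exact: est].
  rewrite /u_ normrM; apply: (@le_trans _ _ (1 * K)); first exact: ler_pM.
  by lra.
- move=> x Bx _.
  have ca : (fun n => a_ n - nsq x) @ \oo --> b - nsq x.
    apply: cvgB; last exact: cvg_cst.
    by rewrite -[X in _ --> X]subr0; apply: cvgB; [exact: cvg_cst|exact: cvg_harmonic].
  have le n : a_ n - nsq x <= b - nsq x by rewrite lerD2r gerBl ltW.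
  have [q1 q2] := eta_cvg e0 le (@cvg_harmonic R) ca.
  rewrite subr_gt0 in q2.
  have cd (y p1 : R) : (fun n => deta (e_ n) (a_ n - nsq x) * (-2 * y) * P x + eta (e_ n) (a_ n - nsq x) * p1) @ \oo -->
      (if nsq x < b then -2 * y else 0) * P x + Num.max (b - nsq x) 0 * p1.
    have -> : (if nsq x < b then -2 * y else 0) = (if nsq x < b then 1 else 0) * (-2 * y).
      by case: ifP; rewrite ?mul1r ?mul0r.
    apply: cvgD; apply: cvgM; try exact: cvg_cst; last exact: q1.
    by apply: cvgM; [exact: q2|exact: cvg_cst].
  split; [|exact: cd|exact: cd].
  by apply: cvgM; [exact: q1|exact: cvg_cst].
Qed.

End cutoffs.

(** * From piecewise linear radial factors to singular ones *)

Section truncation.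
Context {R : realType}.
Notation plane := (measurableTypeR R * measurableTypeR R)%type.
Notation lebp := (@lebp R).
Notation B := (@ball2 R).
Implicit Types f g u v P : R * R -> R.

Lemma mvt_cc (F dF : R -> R) (a b : R) : a < b -> (forall x, a <= x <= b -> isd x F (dF x)) ->
  exists2 c, a <= c <= b & F b - F a = dF c * (b - a).
Proof.
move=> ab d.
have h x : x \in `]a, b[%R -> isd x F (dF x).
  by rewrite in_itv/= => /andP[ax xb]; apply: d; rewrite !ltW.
have cf : {within `[a, b], continuous F}.
  by apply: derivable_within_continuous => x; rewrite in_itv/= => /d[].
have [c cab E] := MVT ab h cf; exists c => //.
by move: cab; rewrite in_itv/= => /andP[ac cb]; rewrite !ltW.
Qed.

(** Piecewise linear interpolation written as a combination of differences of hinges, one per cell,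
    with minus the slope as coefficient. To the left of d it is constant, which matches the
    truncation F (max (s, d)). *)
Lemma pl_approx (F dF : R -> R) (d K : R) (n : nat) : 0 < d -> d < 1 -> F 1 = 0 ->
  (forall s, 0 < s -> isd s F (dF s)) -> (forall s, d <= s <= 1 -> `|dF s| <= K) ->
  let h := (1 - d) / n.+1%:R in let sk k := d + k%:R * h in
  let c k := - ((F (sk k.+1) - F (sk k)) / h) in
  let L s := \sum_(k < n.+1) c k * (Num.max (sk k.+1 - s) 0 - Num.max (sk k - s) 0) in
  let dL s := \sum_(k < n.+1) c k * ((if s < sk k.+1 then -1 else 0) - (if s < sk k then -1 else 0)) in
  (forall s, s < d -> L s = F d /\ dL s = 0) /\
  (forall s, d <= s < 1 -> exists x, [/\ d <= x <= 1, `|x - s| <= h, dL s = dF x & `|L s - F s| <= 2 * K * h]).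
Proof.
move=> d0 d1 F1 HF HK h sk c L dL.
have h0 : 0 < h by rewrite divr_gt0 ?subr_gt0.
have hn : h != 0 by rewrite gt_eqF.
have skS k : sk k.+1 = sk k + h by rewrite /sk -natr1; ring.
have sk0 : sk 0%N = d by rewrite /sk mul0r addr0.
have skn : sk n.+1 = 1 by rewrite /sk /h mulrCA mulfV ?pnatr_eq0// mulr1; ring.
have skm i k : (i <= k)%N -> sk i <= sk k by move=> ik; rewrite lerD2l ler_pM2r// ler_nat.
(* A cell lying to the right of s contributes its full increment; these telescope down to F 1 =
   0. *)
have tel a b : (a <= b)%N -> \sum_(a <= k < b) c k * h = F (sk a) - F (sk b).
  move=> ab; rewrite -opprB -(telescope_sumr (fun k => F (sk k)) ab) -sumrN.
  by apply: eq_bigr => k _; rewrite /c mulNr divfK.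
split=> s.
  move=> sd; have sl k : s < sk k by rewrite (lt_le_trans sd)// -sk0 skm.
  split.
    transitivity (\sum_(0 <= k < n.+1) c k * h); last by rewrite tel// skn F1 subr0 sk0.
    rewrite big_mkord; apply: eq_bigr => k _; congr (_ * _).
    by rewrite !max_l ?subr_ge0 ?ltW// skS; ring.
  by apply: big1 => k _; rewrite !sl subrr mulr0.
move=> /andP[ds s1].
pose j := Num.truncn ((s - d) / h).
have sd0 : 0 <= (s - d) / h by apply: divr_ge0; [rewrite subr_ge0|exact: ltW].
have jl : sk j <= s.
  have /andP[+ _] := truncn_itv sd0; rewrite -/j ler_pdivlMr// /sk; lra.
have jr : s < sk j.+1.
  have := truncnS_gt ((s - d) / h); rewrite -/j ltr_pdivrMr// /sk; lra.
have jn : (j < n.+1)%N.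
  by rewrite ltnNge; apply/negP => /skm; rewrite skn => ?; move: jl s1; lra.
have split_sum (t : nat -> R) (v w : R) : (forall k, (k < j)%N -> t k = 0) -> t j = v ->
    \sum_(j.+1 <= k < n.+1) t k = w -> \sum_(k < n.+1) t k = v + w.
  move=> z <- <-; rewrite -(big_mkord xpredT t) (big_cat_nat (n := j))//=; last exact: ltnW.
  rewrite big_nat big1 ?add0r; last by move=> k /andP[_ kj]; exact: z.
  by rewrite big_ltn.
have slt k : (k < j)%N -> sk k.+1 <= s by move=> kj; rewrite (le_trans (skm _ _ kj)).
have sgt k : (j < k)%N -> s < sk k by move=> jk; rewrite (lt_le_trans jr)// skm.
have LE : L s = c j * (sk j.+1 - s) + F (sk j.+1).
  apply: (split_sum (fun k => c k * (Num.max (sk k.+1 - s) 0 - Num.max (sk k - s) 0))).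
  - move=> k kj; have := slt k kj; have : sk k <= sk k.+1 by apply: skm.
    by move=> h1 h2; rewrite !max_r ?subrr ?mulr0// subr_le0//; lra.
  - by rewrite max_l ?max_r ?subr0// ?subr_le0 ?subr_ge0// ltW.
  - transitivity (\sum_(j.+1 <= k < n.+1) c k * h); last by rewrite tel// skn F1 subr0.
    apply: eq_big_nat => k /andP[jk _]; congr (_ * _).
    have := sgt k jk; have := sgt k.+1 (leqW jk) => h1 h2.
    by rewrite !max_l ?subr_ge0 ?ltW// skS; ring.
have dLE : dL s = - c j.
  rewrite -[RHS]addr0; apply: (split_sum (fun k => c k * ((if s < sk k.+1 then -1 else 0) - (if s < sk k then -1 else 0)))).
  - move=> k kj; have := slt k kj; have : sk k <= sk k.+1 by apply: skm.
    by move=> h1 h2; rewrite !ltNge h2 (le_trans h1 h2)/= subrr mulr0.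
  - by rewrite jr ltNge jl/= subr0 mulrN1.
  - rewrite big_nat big1// => k /andP[jk _].
    by rewrite (sgt k jk) (sgt k.+1 (leqW jk)) subrr mulr0.
have lt_j : sk j < sk j.+1 by rewrite skS ltrDl.
have rng x : sk j <= x <= sk j.+1 -> d <= x <= 1.
  move=> /andP[a b]; rewrite -sk0 -skn (le_trans (skm _ _ (leq0n j)) a)//=.
  by rewrite (le_trans b)// skm.
have pos x : d <= x <= 1 -> 0 < x by move=> /andP[a _]; exact: lt_le_trans a.
have [x xr xE] := mvt_cc lt_j (fun x hx => HF x (pos x (rng x hx))).
have cj : - c j = dF x by rewrite /c opprK xE skS addrAC subrr add0r mulfK.
have K0 : 0 <= K by apply: le_trans (HK x (rng x xr)).
exists x; split; [exact: rng| |by rewrite dLE|].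
  move: xr => /andP[x1 x2]; rewrite skS in x2 jr; rewrite ler_norml; apply/andP; split; lra.
have [y yr yE] := mvt_cc jr (fun y hy => HF y (pos y (rng y (ltac:(move: hy => /andP[y1 y2]; rewrite y2 andbT; lra))))).
have yK := HK y (rng y (ltac:(move: yr => /andP[y1 y2]; rewrite y2 andbT; lra))).
rewrite LE; have -> : c j * (sk j.+1 - s) + F (sk j.+1) - F s = (dF y - dF x) * (sk j.+1 - s).
  by rewrite mulrBl -yE -cj; ring.
rewrite normrM (ger0_norm (_ : 0 <= sk j.+1 - s)) ?subr_ge0 ?(ltW jr)//.
apply: ler_pM => //; last by rewrite skS; lra.
  by rewrite subr_ge0 ltW.
apply: le_trans (ler_normB _ _) _; have := HK x (rng x xr); lra.
Qed.

Lemma max_cont (d : R) : continuous (fun s : R => Num.max s d).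
Proof.
move=> s; apply: (@continuous_max _ R (fun s => s) (fun=> d)); first exact: cvg_id.
exact: cvg_cst.
Qed.

Lemma cts_max_comp (F : R -> R) (d : R) : 0 < d -> (forall s, 0 < s -> {for s, continuous F}) ->
  continuous (fun s => F (Num.max s d)).
Proof.
move=> d0 cF s; apply: (@continuous_comp _ _ _ (fun s => Num.max s d) F); first exact: max_cont.
by apply: cF; rewrite lt_max d0 orbT.
Qed.

Lemma cts_bounded_cc (F : R -> R) (a b : R) : continuous F -> exists2 K, 0 <= K & forall s, a <= s <= b -> `|F s| <= K.
Proof.
move=> cF; have := continuous_compact (continuous_subspaceT cF) (@segment_compact R a b) => /compact_bounded [M [_ HM]].
exists (`|M| + 1); first by rewrite addr_ge0.
move=> x Bx; apply: (HM (`|M| + 1)); first by rewrite (le_lt_trans (ler_norm M))// ltrDl.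
by exists x.
Qed.

Lemma H10_trunc (F dF : R -> R) (d : R) P P1 P2 : 0 < d -> d < 1 -> F 1 = 0 ->
  (forall s, 0 < s -> isd s F (dF s)) -> (forall s, 0 < s -> {for s, continuous dF}) -> gpoly P P1 P2 ->
  H10 (fun x => F (Num.max (nsq x) d) * P x)
      (fun x => (if d <= nsq x then dF (Num.max (nsq x) d) else 0) * (2 * x.1) * P x + F (Num.max (nsq x) d) * P1 x)
      (fun x => (if d <= nsq x then dF (Num.max (nsq x) d) else 0) * (2 * x.2) * P x + F (Num.max (nsq x) d) * P2 x).
Proof.
move=> d0 d1 F1 HF cdF hP; have [KP KP0 HKP] := gpoly_bound hP; have cP := gpoly_cont hP.
have [_ _ c1 c2] := hP.
have cF s : 0 < s -> {for s, continuous F} by move=> s0; exact: der_cts (HF s s0).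
have cFm := cts_max_comp d0 cF; have cdFm := cts_max_comp d0 cdF.
have [K1 K10 HK1] := cts_bounded_cc d 1 cFm; have [K2 K20 HK2] := cts_bounded_cc d 1 cdFm.
pose K := K1 + K2.
have HKF s : d <= s <= 1 -> `|F s| <= K.
  by move=> h; have := HK1 s h; rewrite max_l ?/K; [lra|case/andP: h].
have HKdF s : d <= s <= 1 -> `|dF s| <= K.
  by move=> h; have := HK2 s h; rewrite max_l ?/K; [lra|case/andP: h].
have K0 : 0 <= K by rewrite addr_ge0.
pose h n := (1 - d) / n.+1%:R; pose sk n k := d + k%:R * h n.
pose c n k := - ((F (sk n k.+1) - F (sk n k)) / h n).
pose L n s := \sum_(k < n.+1) c n k * (Num.max (sk n k.+1 - s) 0 - Num.max (sk n k - s) 0).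
pose dL n s := \sum_(k < n.+1) c n k * ((if s < sk n k.+1 then -1 else 0) - (if s < sk n k then -1 else 0)).
have PL n : (forall s, s < d -> L n s = F d /\ dL n s = 0) /\
  (forall s, d <= s < 1 -> exists x, [/\ d <= x <= 1, `|x - s| <= h n, dL n s = dF x & `|L n s - F s| <= 2 * K * h n]).
  exact: (@pl_approx F dF d K n d0 d1 F1 HF HKdF).
have h0 n : 0 < h n by rewrite divr_gt0 ?subr_gt0.
have h1 n : h n <= 1 by rewrite ler_pdivrMr ?ltr0n// mul1r; have h1n : 1 <= n.+1%:R :> R by [rewrite ler1n]; move: h1n d0; lra.
have hc : h @ \oo --> (0 : R) by exact: cvg_harm.
have skb n (k : nat) : (k <= n.+1)%N -> 0 < sk n k /\ sk n k <= 1.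
  move=> kn; split; first by rewrite ltr_wpDr// mulr_ge0// ltW.
  have -> : 1 = sk n n.+1 by rewrite /sk /h mulrCA mulfV ?pnatr_eq0// mulr1; ring.
  by rewrite lerD2l ler_pM2r// ler_nat.
pose G n (y : R * R -> R) (Q : R * R -> R) x := dL n (nsq x) * (2 * y x) * P x + L n (nsq x) * Q x.
apply: (@H10_dct _ (fun n x => L n (nsq x) * P x) (fun n => G n (fun x => x.1) P1) (fun n => G n (fun x => x.2) P2) _ _ _ (5 * K * KP)).
- move=> n.
  pose U b x := Num.max (b - nsq x) 0 * P x.
  pose GU b (y : R * R -> R) (Q : R * R -> R) x := (if nsq x < b then -2 * y x else 0) * P x + Num.max (b - nsq x) 0 * Q x.
  have HU k : (k <= n.+1)%N -> H10 (U (sk n k)) (GU (sk n k) (fun x => x.1) P1) (GU (sk n k) (fun x => x.2) P2).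
    by move=> /skb[q1 q2]; exact: H10_hinge.
  have H := @H10_sum R n.+1 (fun k => c n k) _ _ _ (fun k : 'I_n.+1 => H10_lin 1 (-1) (HU k.+1 (ltn_ord k)) (HU k (ltnW (ltn_ord k)))).
  apply: H10_ext H _ _ _ => x _.
  + by rewrite /L mulr_suml; apply: eq_bigr => k _; rewrite /U; ring.
  + rewrite /G /L /dL !mulr_suml -big_split/=; apply: eq_bigr => k _; rewrite /GU.
    by case: ifP => _; case: ifP => _; ring.
  + rewrite /G /L /dL !mulr_suml -big_split/=; apply: eq_bigr => k _; rewrite /GU.
    by case: ifP => _; case: ifP => _; ring.
- apply: measurable_funTS; apply: continuous_measurable_plane.
  by apply: plane_ctsM => //; exact: (plane_cts_comp nsq_cont cFm).
- apply: measurable_funTS; apply: measurable_funD; last first.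
    by apply: continuous_measurable_plane; apply: plane_ctsM => //; exact: (plane_cts_comp nsq_cont cFm).
  apply: measurable_funM; last exact: continuous_measurable_plane.
  apply: measurable_funM; last by apply: continuous_measurable_plane; exact: plane_ctsM (@plane_ctsC _ 2) plane_cts1.
  apply: ifmeas; [exact: nsq_ge_meas|apply: continuous_measurable_plane|exact: measurable_cst].
  exact: (plane_cts_comp nsq_cont cdFm).
- apply: measurable_funTS; apply: measurable_funD; last first.
    by apply: continuous_measurable_plane; apply: plane_ctsM => //; exact: (plane_cts_comp nsq_cont cFm).
  apply: measurable_funM; last exact: continuous_measurable_plane.
  apply: measurable_funM; last by apply: continuous_measurable_plane; exact: plane_ctsM (@plane_ctsC _ 2) plane_cts2.
  apply: ifmeas; [exact: nsq_ge_meas|apply: continuous_measurable_plane|exact: measurable_cst].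
  exact: (plane_cts_comp nsq_cont cdFm).
- move=> n x Bx _; have [k0 k1 k2] := HKP x Bx; have s1 := nsq_lt1 Bx.
  have [bL bdL] : `|L n (nsq x)| <= 3 * K /\ `|dL n (nsq x)| <= K.
    have [l1 l2] := PL n; have [sd|sd] := ltP (nsq x) d.
      have [-> ->] := l1 _ sd; rewrite normr0; split => //.
      have := HKF d; rewrite lexx (ltW d1) => /(_ isT); lra.
    have [z [zr _ -> zL]] := l2 (nsq x) (ltac:(by rewrite sd s1)).
    split; last exact: HKdF.
    have -> : L n (nsq x) = (L n (nsq x) - F (nsq x)) + F (nsq x) by rewrite subrK.
    apply: le_trans (ler_normD _ _) _.
    have := HKF (nsq x); rewrite sd (ltW s1) => /(_ isT) f1.
    have : 2 * K * h n <= 2 * K by rewrite -[leRHS]mulr1 ler_wpM2l ?mulr_ge0.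
    by move: zL; rewrite -/(L n (nsq x)) -/(h n); lra.
  have est (y p1 : R) : `|y| <= 1 -> `|p1| <= KP -> `|dL n (nsq x) * (2 * y) * P x + L n (nsq x) * p1| <= 5 * K * KP.
    move=> y1 pK; apply: le_trans (ler_normD _ _) _; rewrite !normrM.
    have -> : `|2 : R| = 2 by rewrite ger0_norm.
    have z1 : `|dL n (nsq x)| * (2 * `|y|) <= K * 2.
      by apply: ler_pM => //; lra.
    have z2 : `|dL n (nsq x)| * (2 * `|y|) * `|P x| <= K * 2 * KP.
      by apply: ler_pM => //; rewrite !mulr_ge0.
    have z3 : `|L n (nsq x)| * `|p1| <= 3 * K * KP by apply: ler_pM.
    by lra.
  split; [|exact: est (ball_fst Bx) k1|exact: est (ball_snd Bx) k2].
  rewrite normrM; apply: (@le_trans _ _ (3 * K * KP)); first exact: ler_pM.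
  have : 0 <= K * KP by rewrite mulr_ge0.
  by lra.
- move=> x Bx _; have s1 := nsq_lt1 Bx.
  have [cL cdL] : (fun n => L n (nsq x)) @ \oo --> F (Num.max (nsq x) d) /\
     (fun n => dL n (nsq x)) @ \oo --> (if d <= nsq x then dF (Num.max (nsq x) d) else 0).
    have [sd|sd] := ltP (nsq x) d.
      split.
        by rewrite (_ : (fun n => _) = fun=> F d); [exact: cvg_cst|apply/funext => n; have [l1 _] := PL n; case: (l1 _ sd)].
      by rewrite (_ : (fun n => _) = fun=> 0); [exact: cvg_cst|apply/funext => n; have [l1 _] := PL n; case: (l1 _ sd)].
    have sr : d <= nsq x < 1 by rewrite sd s1.
    have s0 : 0 < nsq x := lt_le_trans d0 sd.
    split.
      apply/cvgrPdist_le => e e0.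
      have : (fun n => 2 * K * h n) @ \oo --> (0 : R) by rewrite -(mulr0 (2 * K)); apply: cvgM => //; exact: cvg_cst.
      move=> /cvgrPdist_le/(_ e e0); apply: filterS => n; have h2 : 0 <= 2 * K * h n := mulr_ge0 (mulr_ge0 (ler0n R 2) K0) (ltW (h0 n)).
      rewrite sub0r normrN (ger0_norm h2) => hle.
      by have [_ l2] := PL n; have [z [_ _ _ zL]] := l2 _ sr; rewrite distrC (le_trans zL).
    have /choice[z Hz] : forall n, exists z, `|z - nsq x| <= h n /\ dL n (nsq x) = dF z.
      by move=> n; have [_ l2] := PL n; have [z [_ a b _]] := l2 _ sr; exists z.
    have cz : z @ \oo --> nsq x.
      apply/cvgrPdist_le => e e0; move/cvgrPdist_le/(_ e e0): hc; apply: filterS => n.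
      rewrite sub0r normrN ger0_norm ?(ltW (h0 n))// distrC => hle.
      by have [a _] := Hz n; exact: le_trans hle.
    rewrite (_ : (fun n => _) = dF \o z); last by apply/funext => n /=; case: (Hz n).
    exact: (continuous_cvg _ (cdF _ s0) cz).
  split; first by apply: cvgM => //; exact: cvg_cst.
    by rewrite /G; apply: cvgD; apply: cvgM; try exact: cvg_cst; [apply: cvgM; [exact: cdL|exact: cvg_cst]|exact: cL].
  by rewrite /G; apply: cvgD; apply: cvgM; try exact: cvg_cst; [apply: cvgM; [exact: cdL|exact: cvg_cst]|exact: cL].
Qed.

(** Removes the truncation at the origin. The three bounds by M are the sizes of the function and of
    the two parts of its gradient at radius r, when P is homogeneous of degree j. *)
Lemma H10_radial_poly (F dF : R -> R) (j : nat) (M : R) P P1 P2 : F 1 = 0 ->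
  measurable_fun setT (F : measurableTypeR R -> R) -> measurable_fun setT (dF : measurableTypeR R -> R) ->
  (forall s, 0 < s -> isd s F (dF s)) -> (forall s, 0 < s -> {for s, continuous dF}) -> gpoly P P1 P2 ->
  (forall x, [/\ `|P x| <= enorm x ^+ j, `|P1 x| <= j%:R * enorm x ^+ j.-1 & `|P2 x| <= j%:R * enorm x ^+ j.-1]) ->
  (forall r, 0 < r -> r < 1 -> [/\ `|F (r ^+ 2)| * r ^+ j <= M, `|dF (r ^+ 2)| * r ^+ j.+1 <= M
      & `|F (r ^+ 2)| * (j%:R * r ^+ j.-1) <= M]) ->
  H10 (fun x => F (nsq x) * P x)
      (fun x => dF (nsq x) * (2 * x.1) * P x + F (nsq x) * P1 x)
      (fun x => dF (nsq x) * (2 * x.2) * P x + F (nsq x) * P2 x).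
Proof.
move=> F1 mF mdF HF cdF hP HPb HM; have cP := gpoly_cont hP; have [_ _ c1 c2] := hP.
pose rho n : R := n.+2%:R^-1.
have rho0 n : 0 < rho n by rewrite invr_gt0.
have rho1 n : rho n < 1 by rewrite invf_lt1 ?ltr1n.
pose d n := rho n ^+ 2.
have d0 n : 0 < d n by rewrite exprn_gt0.
have d1 n : d n < 1 by rewrite expr_lt1// ltW.
have crho : rho @ \oo --> (0 : R).
  by have := @cvg_harmonic R; rewrite -(cvg_shiftS) => h; exact: h.
have M0 : 0 <= M by have [h _ _] := HM _ (rho0 0%N) (rho1 0%N); apply: le_trans h; rewrite mulr_ge0// exprn_ge0// ltW.
pose U n x := F (Num.max (nsq x) (d n)) * P x.
pose G n (y : R * R -> R) (Q : R * R -> R) x := (if d n <= nsq x then dF (Num.max (nsq x) (d n)) else 0) * (2 * y x) * P x + F (Num.max (nsq x) (d n)) * Q x.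
have mFn : measurable_fun setT ((fun x => F (nsq x)) : plane -> R) by exact: measurableT_comp mF nsq_meas.
have mdFn : measurable_fun setT ((fun x => dF (nsq x)) : plane -> R) by exact: measurableT_comp mdF nsq_meas.
have mG (y Q : R * R -> R) : continuous y -> continuous Q ->
   measurable_fun (B : set plane) (fun x => dF (nsq x) * (2 * y x) * P x + F (nsq x) * Q x).
  move=> cy cQ; apply: measurable_funTS; apply: measurable_funD; apply: measurable_funM => //; try exact: continuous_measurable_plane.
  apply: measurable_funM => //; apply: continuous_measurable_plane.
  exact: plane_ctsM (@plane_ctsC _ 2) cy.
apply: (@H10_dct _ U (fun n => G n (fun x => x.1) P1) (fun n => G n (fun x => x.2) P2) _ _ _ (3 * M)).
- by move=> n; exact: H10_trunc.
- apply: measurable_funTS; apply: measurable_funM => //; exact: continuous_measurable_plane.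
- exact: mG plane_cts1 c1.
- exact: mG plane_cts2 c2.
- move=> n x Bx x0; have [p0 p1 p2] := HPb x.
  set r := enorm x in x0 p0 p1 p2; have r1 : r < 1 by exact: Bx.
  pose m := Num.max r (rho n).
  have m0 : 0 < m by rewrite lt_max x0.
  have m1 : m < 1 by rewrite gt_max r1 rho1.
  have rm : r <= m by rewrite le_max lexx.
  (* The truncated factor is the original one at radius m = max (|x|, [rho] n). As powers of |x| are
     at most those of m, the hypotheses at m bound every truncation uniformly. *)
  have mE : Num.max (nsq x) (d n) = m ^+ 2.
    rewrite nsqE /d /m; have [rr|rr] := leP r (rho n).
      by rewrite max_r// ler_pXn2r// nnegrE ltW.
    by rewrite max_l// ler_pXn2r ?nnegrE ?(ltW (rho0 n)) ?(ltW x0)// ltW.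
  have [b0 b1 b2] := HM m m0 m1.
  have pw (k : nat) : r ^+ k <= m ^+ k by rewrite lerXn2r ?nnegrE// ltW.
  have e0 : `|F (m ^+ 2)| * `|P x| <= M.
    by apply: le_trans b0; rewrite ler_wpM2l// (le_trans p0).
  have est (y q : R) : `|y| <= r -> `|q| <= j%:R * r ^+ j.-1 ->
     `|(if d n <= nsq x then dF (Num.max (nsq x) (d n)) else 0) * (2 * y) * P x + F (Num.max (nsq x) (d n)) * q| <= 3 * M.
    move=> yr qr; rewrite mE; apply: le_trans (ler_normD _ _) _.
    have z1 : `|F (m ^+ 2) * q| <= M.
      rewrite normrM; apply: le_trans b2; rewrite ler_wpM2l// (le_trans qr)// ler_wpM2l//.
    have z2 : `|(if d n <= nsq x then dF (m ^+ 2) else 0) * (2 * y) * P x| <= 2 * M.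
      apply: (@le_trans _ _ (2 * (`|dF (m ^+ 2)| * (`|y| * `|P x|)))).
        rewrite !normrM (ger0_norm (_ : 0 <= 2))//.
        have t1 : `|if d n <= nsq x then dF (m ^+ 2) else 0| <= `|dF (m ^+ 2)| by case: ifP; rewrite ?normr0.
        rewrite (_ : _ * _ * _ = `|if d n <= nsq x then dF (m ^+ 2) else 0| * (2 * (`|y| * `|P x|))); last by ring.
        rewrite [leRHS](_ : _ = `|dF (m ^+ 2)| * (2 * (`|y| * `|P x|))); last by ring.
        by rewrite ler_wpM2r// !mulr_ge0.
      rewrite ler_wpM2l//; apply: le_trans b1; rewrite ler_wpM2l// exprS.
      by apply: ler_pM => //; [exact: le_trans rm|exact: le_trans (pw j)].
    by lra.
  split; [|exact: est (fst_le_enorm x) p1|exact: est (snd_le_enorm x) p2].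
  by rewrite /U mE normrM; lra.
- move=> x Bx x0.
  have ev : \forall n \near \oo, d n <= nsq x.
    move/cvgrPdist_lt/(_ _ x0): crho; apply: filterS => n.
    rewrite sub0r normrN ger0_norm ?(ltW (rho0 n))// => h.
    by rewrite nsqE ler_pXn2r ?nnegrE ?(ltW (rho0 n)) ?(ltW x0)// ltW.
  have key (f : nat -> R) l : (forall n, d n <= nsq x -> f n = l) -> f @ \oo --> l.
    move=> h; have : (fun _ : nat => l) @ \oo --> l by exact: cvg_cst.
    by apply: cvg_trans; apply: near_eq_cvg; apply: filterS ev => n /h ->.
  by split; apply: key => n dn; rewrite ?/U ?/G ?dn max_l.
Qed.

End truncation.

(** * The Euler-Lagrange equation *)

Section euler_lagrange.
Context {R : realType}.
Notation plane := (measurableTypeR R * measurableTypeR R)%type.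
Notation lebp := (@lebp R).
Notation B := (@ball2 R).
Notation IB := (ii lebp B).
Notation L2 := (L2 lebp B).
Notation L1 := (L1 lebp B).
Implicit Types f g u v : R * R -> R.

Let mB : measurable (B : set plane). Proof. exact: measurable_ball2. Qed.

Definition wt (alpha : R) (x : R * R) : R := enorm x `^ alpha.

Lemma wt_ge0 alpha x : 0 <= wt alpha x. Proof. exact: powR_ge0. Qed.

Lemma wt_le1 alpha x : 0 <= alpha -> B x -> wt alpha x <= 1.
Proof.
move=> a0 Bx; have -> : 1 = 1 `^ alpha :> R by rewrite powR1.
by rewrite ge0_ler_powR ?nnegrE ?ler01 ?enorm_ge0//; exact: ltW.
Qed.

Lemma wt_gt0 alpha x : 0 < enorm x -> 0 < wt alpha x. Proof. exact: powR_gt0. Qed.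

Lemma meas_wt alpha : measurable_fun setT (wt alpha : plane -> R).
Proof. exact: measurableT_comp (measurable_powR _) (@measurable_enorm R). Qed.

Lemma meas_pow (D : set plane) (q : R) f : measurable_fun D (f : plane -> R) ->
  measurable_fun D ((fun x => `|f x| `^ q) : plane -> R).
Proof.
by move=> mf; apply: (measurableT_comp (measurable_powR q)); apply: measurableT_comp.
Qed.

Lemma aeS (P Q : R * R -> Prop) : {ae lebp, forall x, P x} -> (forall x, P x -> Q x) ->
  {ae lebp, forall x, Q x}.
Proof.
by move=> [N [mN N0 NP]] PQ; exists N; split => // x nQ; apply: NP => Px; apply: nQ; exact: PQ.
Qed.

Lemma aeS2 (P Q S : R * R -> Prop) : {ae lebp, forall x, P x} -> {ae lebp, forall x, Q x} ->
  (forall x, P x -> Q x -> S x) -> {ae lebp, forall x, S x}.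
Proof.
move=> [N [mN N0 NP]] [M [mM M0 MQ]] PQ; exists (N `|` M); split; first exact: measurableU.
  by rewrite measureU0.
move=> x nS; case: (pselect (P x)) => Px; [right; apply: MQ => Qx; apply: nS; exact: PQ|left; exact: NP].
Qed.

Lemma powR_young (m y s : R) : 1 < m -> 0 <= y -> 0 <= s ->
  m * s `^ (m - 1) * y - (m - 1) * s `^ m <= y `^ m.
Proof.
move=> m1 y0 s0; have m0 : 0 < m by apply: lt_trans m1.
have mm : 0 < m - 1 by rewrite subr_gt0.
have := @conjugate_powR R y (s `^ (m - 1)) m (m / (m - 1)) y0 (powR_ge0 _ _) m0 (divr_gt0 m0 mm).
have -> : m^-1 + (m / (m - 1))^-1 = 1 by field; rewrite !gt_eqF.
move=> /(_ erefl); rewrite -powRrM.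
have -> : (m - 1) * (m / (m - 1)) = m by field; rewrite gt_eqF.
move=> h; have {}h : m * (y * s `^ (m - 1)) <= m * (y `^ m / m + s `^ m / (m / (m - 1))).
  by rewrite ler_wpM2l// ltW.
have E : m * (y `^ m / m + s `^ m / (m / (m - 1))) = y `^ m + (m - 1) * s `^ m.
  by field; rewrite !gt_eqF.
by rewrite E in h; lra.
Qed.

(** Tangent line inequality for |.|^m, from Young's inequality; it holds for every t, so perturbing
    u needs no pointwise smallness. *)
Lemma powR_convex_norm (m s t : R) : 1 < m -> 0 < s ->
  s `^ m + m * s `^ (m - 1) * t <= `|s + t| `^ m.
Proof.
move=> m1 s0; have m0 : 0 < m by apply: lt_trans m1.
have h := powR_young m1 (normr_ge0 (s + t)) (ltW s0).
have q : s * s `^ (m - 1) = s `^ m by rewrite mulr_powRB1// ltW.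
have k : m * s `^ (m - 1) * (s + t) <= m * s `^ (m - 1) * `|s + t|.
  by rewrite ler_wpM2l ?ler_norm// mulr_ge0 ?powR_ge0// ltW.
have : m * s `^ (m - 1) * (s + t) = m * s `^ m + m * s `^ (m - 1) * t by rewrite -q; ring.
by lra.
Qed.

Lemma powR_norm_add (m s t : R) : 0 < m -> `|s + t| `^ m <= 2 `^ m * (`|s| `^ m + `|t| `^ m).
Proof.
move=> m0; have [st|st] := leP `|s| `|t|.
  apply: (@le_trans _ _ (2 `^ m * `|t| `^ m)).
    rewrite -powRM// ge0_ler_powR ?nnegrE ?mulr_ge0 ?(ltW m0)//.
    by apply: le_trans (ler_normD _ _) _; lra.
  by rewrite ler_wpM2l ?powR_ge0// lerDr powR_ge0.
apply: (@le_trans _ _ (2 `^ m * `|s| `^ m)).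
  rewrite -powRM// ge0_ler_powR ?nnegrE ?mulr_ge0 ?(ltW m0)//.
  by apply: le_trans (ler_normD _ _) _; lra.
by rewrite ler_wpM2l ?powR_ge0// lerDl powR_ge0.
Qed.

Lemma powR_le_add1 (m s : R) : 1 < m -> 0 <= s -> s `^ (m - 1) <= 1 + s `^ m.
Proof.
move=> m1 s0; have [s1|s1] := leP s 1.
  apply: (@le_trans _ _ 1); last by rewrite lerDl powR_ge0.
  have h1 : s `^ (m - 1) <= 1 `^ (m - 1) by apply: ge0_ler_powR; rewrite ?nnegrE ?subr_ge0// ltW.
  by rewrite powR1 in h1.
apply: (@le_trans _ _ (s `^ m)); last by rewrite lerDr.
by rewrite ler_powR ?(ltW s1)// gerBl.
Qed.

(** The difference of the two sides vanishes at e = 0 and is nonnegative nearby, so its derivative 2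
    q D^(q-1) (b - A) is zero. *)
Lemma crit_point (D d b A q : R) : 1 < q -> 0 < D ->
  (exists2 e0, 0 < e0 & forall e, `|e| < e0 ->
     D `^ (q - 1) * (D + 2 * q * e * A) <= (D + 2 * e * b + e ^+ 2 * d) `^ q) -> b = A.
Proof.
move=> q1 D0 [e0 e00 H].
pose f e := (D + 2 * e * b + e ^+ 2 * d) `^ q - D `^ (q - 1) * (D + 2 * q * e * A).
have q0 : 0 < q by apply: lt_trans q1.
have DD : D * D `^ (q - 1) = D `^ q by rewrite mulr_powRB1// ltW.
have f0 : f 0 = 0.
  by rewrite /f !mulr0 expr0n/= !mul0r !addr0 [_ * D]mulrC DD subrr.
have dp : isd 0 (fun e => D + 2 * e * b + e ^+ 2 * d) (2 * b).
  apply: der_eq (derD (derD (derC D 0) (derM (derZ 2 (derI 0)) (derC b 0))) (derM (derX2 (derI 0)) (derC d 0))) _.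
  by ring.
have E0 : D + 2 * 0 * b + 0 ^+ 2 * d = D by ring.
have dq : isd (D + 2 * 0 * b + 0 ^+ 2 * d) (fun y => y `^ q) (q * D `^ (q - 1)).
  by rewrite E0; exact: is_derive1_powR.
have df : isd 0 f (q * D `^ (q - 1) * (2 * b) - D `^ (q - 1) * (2 * q * A)).
  apply: der_eq (derB (der_comp dp dq) (derZ (D `^ (q - 1)) (derD (derC D 0) (derM (derZ (2 * q) (derI 0)) (derC A 0))))) _.
  by ring.
have lo : - e0 / 2 < 0 by lra.
have hi : 0 < e0 / 2 by lra.
pose k := q * D `^ (q - 1) * (2 * b) - D `^ (q - 1) * (2 * q * A).
suff k0 : k = 0.
  have c0 : 0 < 2 * q * D `^ (q - 1) by rewrite !mulr_gt0// powR_gt0.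
  have : 2 * q * D `^ (q - 1) * (b - A) = 0 by rewrite -k0 /k; ring.
  by move/eqP; rewrite mulf_eq0 gt_eqF//= subr_eq0 => /eqP.
have slope e : 0 < e -> \forall y \near (0 : R), `|f y - f 0 - k * (y - 0)| <= e * `|y - 0| by move=> ?; exact: der_slope.
apply/eqP; apply/negPn/negP => kn.
have kp : 0 < `|k| / 2 by rewrite divr_gt0// normr_gt0.
have [t /= t0 Ht] := slope _ kp.
(* A step against the sign of the derivative k, inside both radii; the slope estimate with constant
   |k| / 2 would make f negative there. *)
pose y := - Num.sg k * (Num.min t e0 / 2).
have m0 : 0 < Num.min t e0 by rewrite lt_min t0.
have yn : `|y| = Num.min t e0 / 2.
  by rewrite normrM normrN normr_sg kn mul1r ger0_norm// divr_ge0// ltW.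
have mt : Num.min t e0 <= t by rewrite ge_min lexx.
have me : Num.min t e0 <= e0 by rewrite ge_min lexx orbT.
have := Ht y; rewrite /= sub0r normrN yn => /(_ (ltac:(lra))).
have := H y; rewrite yn => /(_ (ltac:(lra))); rewrite -subr_ge0 -/(f y) => fy.
rewrite f0 !subr0 yn.
have -> : k * y = - (`|k| * (Num.min t e0 / 2)).
  by rewrite /y normrEsg; ring.
rewrite opprK ger0_norm; last by rewrite addr_ge0// mulr_ge0// ltW// divr_gt0.
have : 0 < `|k| * (Num.min t e0 / 2) by rewrite mulr_gt0 ?normr_gt0// divr_gt0.
by lra.
Qed.

Lemma ii_le_ae f g : L1 f -> L1 g -> {ae lebp, forall x, B x -> f x <= g x} -> IB f <= IB g.
Proof.
move=> hf hg fg; rewrite -subr_ge0 -(iiB mB)//.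
have hh := L1B mB hg hf; set h := (fun x => g x - f x) in hh *.
have mh := L1_meas hh.
have -> : IB h = IB (fun x => Num.max (h x) 0).
  rewrite /ii /Rintegral; congr fine; apply: ae_eq_integral => //.
  - by apply/measurable_EFinP.
  - by apply/measurable_EFinP; apply: measurable_maxr.
  - by apply: (aeS fg) => x hx Bx /=; rewrite max_l// /h subr_ge0 hx.
by apply: ii_ge0 => x _; rewrite le_max lexx orbT.
Qed.

(** Here t = (E / W)^(1/(p-1)) brings a function with Dirichlet energy E and weighted norm W onto
    the Nehari set. Minimality then becomes the scale-invariant inequality D^((p-1)/2) W <=
    E^((p+1)/2), which can be varied freely. *)
Lemma nehari_scaling (p D E W : R) : 1 < p -> 0 < D -> 0 < E -> 0 < W ->
  exists t, [/\ 0 < t, t ^+ 2 * E = t `^ (p + 1) * W &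
   2^-1 * D - (p + 1)^-1 * D <= 2^-1 * (t ^+ 2 * E) - (p + 1)^-1 * (t ^+ 2 * E) ->
   D `^ ((p + 1) / 2 - 1) * W <= E `^ ((p + 1) / 2)].
Proof.
move=> p1 D0 E0 W0; have p10 : 0 < p + 1 by lra.
have EW : 0 < E / W by exact: divr_gt0.
pose t := (E / W) `^ (p - 1)^-1.
have t0 : 0 < t by exact: powR_gt0.
have pn : p - 1 != 0 by rewrite subr_eq0 gt_eqF.
have Wn := lt0r_neq0 W0.
have tp : t `^ (p - 1) = E / W by rewrite /t -powRrM (mulVf pn) (powRr1 (ltW EW)).
have tpp : t `^ (p + 1) = t ^+ 2 * (E / W).
  have -> : p + 1 = 2 + (p - 1) by ring.
  rewrite powRD; last by rewrite [in t == 0]gt_eqF ?implybT.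
  by rewrite tp powR_mulrn// ltW.
have tE : t ^+ 2 * E = t `^ (p + 1) * W by rewrite tpp -mulrA (divfK Wn).
exists t; split => //.
have c0 : 0 < 2^-1 - (p + 1)^-1 by rewrite subr_gt0 ltf_pV2 ?posrE//; lra.
rewrite -!mulrBl ler_pM2l// => DD.
have q1 : 0 <= (p + 1) / 2 - 1 by lra.
have h : D `^ ((p + 1) / 2 - 1) <= (t ^+ 2 * E) `^ ((p + 1) / 2 - 1).
  by rewrite ge0_ler_powR// nnegrE ?mulr_ge0 ?sqr_ge0// ltW.
have F : (t ^+ 2 * E) `^ ((p + 1) / 2 - 1) = E / W * E `^ ((p + 1) / 2 - 1).
  rewrite powRM ?sqr_ge0 ?(ltW E0)//; congr (_ * _).
  have e2 : 2 * ((p + 1) / 2 - 1) = p - 1 by field.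
  by rewrite -(powR_mulrn 2 (ltW t0)) -(powRrM t) e2 tp.
have -> : E `^ ((p + 1) / 2) = E * E `^ ((p + 1) / 2 - 1) by rewrite mulr_powRB1 ?(ltW E0)//; lra.
by rewrite -ler_pdivlMr//; apply: le_trans h _; rewrite F mulrAC.
Qed.

(** * Variation of the minimizer in bounded radial directions *)

Section minimizer.
Variables (alpha p : R) (u g1 g2 : R * R -> R).
Hypothesis alpha0 : 0 <= alpha.
Hypothesis p1 : 1 < p.
Hypothesis Hu : nehari_rad alpha p u g1 g2.
Hypothesis umin : forall v h1 h2, nehari_rad alpha p v h1 h2 ->
  (energy alpha p u g1 g2 <= energy alpha p v h1 h2)%E.
Hypothesis upos : {ae @leb2 R, forall x, B x -> 0 < u x}.

Let p10 : 0 < p + 1. Proof. by move: p1; lra. Qed.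

Definition wpow (v : R * R -> R) x := wt alpha x * `|v x| `^ (p + 1).

Definition dir (h1 h2 : R * R -> R) := IB (fun x => h1 x ^+ 2) + IB (fun x => h2 x ^+ 2).

Lemma meas_wpow v : measurable_fun (B : set plane) v -> measurable_fun (B : set plane) (wpow v).
Proof.
move=> mv; apply: measurable_funM; first by apply: measurable_funTS; exact: meas_wt.
exact: meas_pow.
Qed.

Lemma wpow_ge0 v x : 0 <= wpow v x. Proof. by rewrite mulr_ge0 ?powR_ge0. Qed.

Lemma minimizer_L1 : L1 (wpow u) /\ dir g1 g2 = IB (wpow u).
Proof.
have [H _ _ E] := Hu; have [hu h1 h2] := H10_L2 H.
have l : L1 (wpow u).
  apply: L1_intro; [exact: meas_wpow hu.1|by move=> x _; exact: wpow_ge0|].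
  by move: E; rewrite dirichletE// /weighted => <-; rewrite ltry.
split => //; move: E; rewrite dirichletE// /weighted => E.
have := L1E mB l; rewrite -[LHS]E => -[]; exact.
Qed.

Lemma minimizer_pow_L1 : L1 (fun x => wt alpha x * `|u x| `^ p).
Proof.
have [l _] := minimizer_L1; have [H _ _ _] := Hu; have [hu _ _] := H10_L2 H.
apply: (@L1_le _ _ _ lebp B mB _ (fun x => 1 + wpow u x)).
- apply: measurable_funM; first by apply: measurable_funTS; exact: meas_wt.
  by apply: meas_pow; exact: hu.1.
- move=> x Bx; rewrite ger0_norm ?mulr_ge0 ?powR_ge0//.
  have := @powR_le_add1 (p + 1) `|u x| (ltac:(by move: p1; lra)) (normr_ge0 _); rewrite addrK => h.
  apply: le_trans (ler_wpM2l (wt_ge0 alpha x) h) _.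
  by rewrite mulrDr mulr1 lerD2r wt_le1.
- by apply: (L1D mB) => //; exact: L1_cst.
Qed.

Lemma minimizer_W_gt0 : 0 < IB (wpow u).
Proof.
have [l _] := minimizer_L1; have [H _ nz _] := Hu.
have W0 : 0 <= IB (wpow u) by apply: ii_ge0 => x _; exact: wpow_ge0.
rewrite lt_neqAle W0 andbT; apply/negP => /eqP W00; apply: nz.
have hu := (H10_L2 H); have [[mu_ _] _ _] := hu.
have : (\int[lebp]_(x in B) `|(wpow u x)%:E| = 0)%E.
  transitivity (\int[lebp]_(x in B) (wpow u x)%:E)%E; last by have := L1E mB l; rewrite -W00.
  apply: eq_integral => x _.
  by rewrite gee0_abs// lee_fin wpow_ge0.
have mw : measurable_fun (B : set plane) (EFin \o wpow u).
  by apply/measurable_EFinP; exact: meas_wpow.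
move=> /(ae_eq_integral_abs lebp mB mw).1 h0.
have {}h0 : {ae lebp, forall x, B x -> wpow u x = 0}.
  by apply: (aeS h0) => x hx Bx; have := hx Bx => /= -[].
have : {ae lebp, forall x, B x -> u x = 0}; last by [].
apply: (aeS2 h0 (@ae_enorm_gt0 R)) => x hx x0 Bx.
have /eqP := hx Bx; rewrite mulf_eq0 gt_eqF ?wt_gt0//= powR_eq0 => /andP[/eqP/normr0P/eqP].
by [].
Qed.

Lemma nehari_scale v h1 h2 : H10 v h1 h2 -> radial v -> L1 (wpow v) -> 0 < IB (wpow v) -> 0 < dir h1 h2 ->
  dir g1 g2 `^ ((p + 1) / 2 - 1) * IB (wpow v) <= dir h1 h2 `^ ((p + 1) / 2).
Proof.
move=> Hv [rv rvE0] lv Wv Dvp; have rvE : {ae lebp, forall x, B x -> v x = rv (enorm x)} := rvE0.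
 have [hv hh1 hh2] := H10_L2 Hv.
have [lu Du] := minimizer_L1; have W0 := minimizer_W_gt0.
have [HHu _ _ Eu] := Hu; have [hu hg1 hg2] := H10_L2 HHu.
set D := dir g1 g2; set Dv := dir h1 h2; set W := IB (wpow v).
have Dv0 : 0 <= Dv by exact: ltW.
have D0 : 0 < D by rewrite /D Du.
have scaled (t : R) : 0 < t -> [/\ H10 (fun x => t * v x) (fun x => t * h1 x) (fun x => t * h2 x),
    radial (fun x => t * v x), ~ ae_zero (fun x => t * v x),
    dirichlet (fun x => t * h1 x) (fun x => t * h2 x) = (t ^+ 2 * Dv)%:E &
    weighted alpha (p + 1) (fun x => t * v x) = (t `^ (p + 1) * W)%:E].
  move=> t0; split.
  - by apply: H10_ext (H10_lin t 0 Hv Hv) _ _ _ => x _; rewrite mul0r addr0.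
  - exists (fun r => t * rv r).
    have h : {ae lebp, forall x, B x -> t * v x = t * rv (enorm x)}.
      by apply: (aeS rvE) => x hx Bx; rewrite hx.
    exact: h.
  - move=> z0; have z : {ae lebp, forall x, B x -> t * v x = 0} := z0.
    suff W00 : W <= 0 by move: (lt_le_trans Wv W00); rewrite ltxx.
    have z' : {ae lebp, forall x, B x -> wpow v x = 0}.
      apply: (aeS z) => x hx Bx; have /eqP := hx Bx; rewrite mulf_eq0 gt_eqF//= => /eqP vx.
      by rewrite /wpow vx normr0 powR0 ?mulr0// gt_eqF.
    apply: (@le_trans _ _ (IB (fun=> 0))).
      by apply: (ii_le_ae lv (L1_cst 0)); apply: (aeS z') => x hx Bx; rewrite hx.
    by rewrite /ii /Rintegral integral0_eq.
  - rewrite dirichletE; [|exact: (L2Z mB)|exact: (L2Z mB)]; congr EFin.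
    rewrite /Dv /dir mulrDr -!(iiZ mB); [|exact: hh2.2|exact: hh1.2].
    by congr (_ + _); apply: (eq_ii lebp) => x _; rewrite exprMn.
  - have E x : enorm x `^ alpha * `|t * v x| `^ (p + 1) = t `^ (p + 1) * wpow v x.
      by rewrite /wpow normrM (gtr0_norm t0) powRM ?(ltW t0)// mulrCA.
    rewrite /weighted; under [X in intB X]eq_fun do rewrite E.
    by rewrite intBE ?(iiZ mB)//; exact: (L1Z mB).
have [t [t0 tE tD]] := nehari_scaling p1 D0 Dvp Wv.
have [s1 s2 s3 s4 s5] := scaled t t0.
have nh : nehari_rad alpha p (fun x => t * v x) (fun x => t * h1 x) (fun x => t * h2 x).
  by split; [exact: s1|exact: s2|exact: s3|rewrite s4 s5 -tE].
apply: tD; have := umin nh; rewrite /energy s4 s5 -tE.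
have -> : dirichlet g1 g2 = D%:E by rewrite dirichletE.
have -> : weighted alpha (p + 1) u = D%:E by rewrite -Eu dirichletE.
by rewrite -!EFinM -!EFinB lee_fin.
Qed.

(** Along u + e phi the Dirichlet energy is an exact quadratic in e and convexity bounds the
    weighted norm below by an affine function; [crit_point] with q = (p + 1) / 2 compares the linear
    terms. Positivity of u identifies the derivative of |u|^(p+1). *)
Lemma euler_lagrange phi k1 k2 M : H10 phi k1 k2 -> radial phi -> (forall x, B x -> `|phi x| <= M) ->
  IB (fun x => g1 x * k1 x) + IB (fun x => g2 x * k2 x) = IB (fun x => wt alpha x * `|u x| `^ p * phi x).
Proof.
move=> Hphi [rp rpE0] bphi; have [hphi hk1 hk2] := H10_L2 Hphi.
have rpE : {ae lebp, forall x, B x -> phi x = rp (enorm x)} := rpE0.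
have [lu Du] := minimizer_L1; have W0 := minimizer_W_gt0; have lp := minimizer_pow_L1.
have [HHu [ru ruE0] _ _] := Hu; have [hu hg1 hg2] := H10_L2 HHu.
have ruE : {ae lebp, forall x, B x -> u x = ru (enorm x)} := ruE0.
have up : {ae lebp, forall x, B x -> 0 < u x} := upos.
set b := _ + _; set A := IB _; set D := dir g1 g2; pose d := dir k1 k2.
have D0 : 0 < D by rewrite /D Du.
have d0 : 0 <= d by rewrite addr_ge0// ii_ge0// => x _; exact: sqr_ge0.
have q1 : 1 < (p + 1) / 2 by move: p1; lra.
have lA : L1 (fun x => wt alpha x * `|u x| `^ p * phi x).
  apply: (@L1_le _ _ _ lebp B mB _ (fun x => `|M| * (wt alpha x * `|u x| `^ p))); last exact: (L1Z mB).
    by apply: measurable_funM; [exact: (L1_meas lp)|exact: hphi.1].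
  move=> x Bx; rewrite normrM (ger0_norm (mulr_ge0 (wt_ge0 _ _) (powR_ge0 _ _))) mulrC ler_wpM2r ?mulr_ge0 ?powR_ge0//.
  exact: le_trans (bphi x Bx) (ler_norm M).
apply: (crit_point q1 D0 (d := d)).
(* For |e| < D / c both D + (p + 1) e A and the perturbed Dirichlet energy stay positive, so the
   perturbed function can be rescaled onto the Nehari set. *)
pose c := 2 * (2 * `|b| + (p + 1) * `|A| + 1).
have c0 : 0 < c by rewrite mulr_gt0// ltr_wpDl// addr_ge0// mulr_ge0// ltW.
exists (D / c); first exact: divr_gt0.
move=> e; rewrite ltr_pdivlMr// => ec.
have ec' : `|e| * (4 * `|b|) + `|e| * (2 * (p + 1) * `|A|) + `|e| * 2 < D.
  by apply: le_lt_trans ec; rewrite /c le_eqVlt; apply/orP; left; apply/eqP; ring.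
have eb0 : 0 <= `|e| * (4 * `|b|) by rewrite !mulr_ge0.
have eA0 : 0 <= `|e| * (2 * (p + 1) * `|A|) by rewrite !mulr_ge0// ltW.
have e2 : 0 <= `|e| * 2 by rewrite mulr_ge0.
have Hv := H10_lin 1 e HHu Hphi.
set v := (fun x => 1 * u x + e * phi x) in Hv.
have [hv _ _] := H10_L2 Hv.
have lv : L1 (wpow v).
  apply: (@L1_le _ _ _ lebp B mB _ (fun x => 2 `^ (p + 1) * wpow u x + 2 `^ (p + 1) * `|e * M| `^ (p + 1))).
  - by apply: meas_wpow; exact: hv.1.
  - move=> x Bx; rewrite ger0_norm ?wpow_ge0//.
    have h := @powR_norm_add (p + 1) (u x) (e * phi x) p10.
    apply: (@le_trans _ _ (wt alpha x * (2 `^ (p + 1) * (`|u x| `^ (p + 1) + `|e * phi x| `^ (p + 1))))).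
      by rewrite /wpow /v mul1r ler_wpM2l ?wt_ge0.
    have -> : wt alpha x * (2 `^ (p + 1) * (`|u x| `^ (p + 1) + `|e * phi x| `^ (p + 1))) =
       2 `^ (p + 1) * wpow u x + 2 `^ (p + 1) * (wt alpha x * `|e * phi x| `^ (p + 1)) by rewrite /wpow; ring.
    rewrite lerD2l ler_wpM2l ?powR_ge0// -[leRHS]mul1r; apply: ler_pM; rewrite ?wt_ge0 ?powR_ge0 ?wt_le1//.
    rewrite ge0_ler_powR ?nnegrE ?(ltW p10)// !normrM ler_wpM2l//.
    exact: le_trans (bphi x Bx) (ler_norm M).
  - by apply: (L1D mB); [exact: (L1Z mB)|exact: L1_cst].
have lin : L1 (fun x => wpow u x + (p + 1) * e * (wt alpha x * `|u x| `^ p * phi x)).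
  by apply: (L1D mB) => //; exact: (L1Z mB).
have Wlow : D + (p + 1) * e * A <= IB (wpow v).
  have -> : D + (p + 1) * e * A = IB (fun x => wpow u x + (p + 1) * e * (wt alpha x * `|u x| `^ p * phi x)).
    have -> : D = IB (wpow u) by exact: Du.
    by rewrite (iiD mB lu (L1Z mB _ lA)) (iiZ mB _ lA).
  apply: ii_le_ae => //; apply: (aeS up) => x ux Bx; have {}ux := ux Bx.
  rewrite /wpow /v (gtr0_norm ux) mul1r.
  have m1 : 1 < p + 1 by move: p1; lra.
  have := powR_convex_norm (e * phi x) m1 ux; rewrite addrK => h.
  apply: le_trans (ler_wpM2l (wt_ge0 alpha x) h).
  by rewrite le_eqVlt; apply/orP; left; apply/eqP; ring.
have absA : - (`|e| * `|A|) <= e * A by rewrite -normrM lerNl (le_trans (ler_norm _))// normrN.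
have absb : - (`|e| * `|b|) <= e * b by rewrite -normrM lerNl (le_trans (ler_norm _))// normrN.
have Wp : 0 < D + (p + 1) * e * A.
  have : (p + 1) * (- (`|e| * `|A|)) <= (p + 1) * (e * A) by rewrite ler_wpM2l// ltW.
  by move=> h; move: h eA0 eb0 e2 ec'; clear; lra.
have dirE : dir (fun x => 1 * g1 x + e * k1 x) (fun x => 1 * g2 x + e * k2 x) = D + 2 * e * b + e ^+ 2 * d.
  have one (g k : R * R -> R) : L2 g -> L2 k -> IB (fun x => (1 * g x + e * k x) ^+ 2) =
     1 * IB (fun x => g x ^+ 2) + 2 * e * IB (fun x => g x * k x) + e ^+ 2 * IB (fun x => k x ^+ 2).
    move=> hg hk; rewrite -(ii_lin mB); [|exact: hg.2|exact: (L2M mB)|exact: hk.2].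
    by apply: (eq_ii lebp) => x _; ring.
  by rewrite /dir !one// /D /d /dir /b; ring.
have dirp : 0 < D + 2 * e * b + e ^+ 2 * d.
  have : 0 <= e ^+ 2 * d by rewrite mulr_ge0// sqr_ge0.
  by move=> h; move: h absb eA0 eb0 e2 ec'; clear; lra.
have rv : radial v.
  exists (fun r => ru r + e * rp r).
  have h : {ae lebp, forall x, B x -> v x = ru (enorm x) + e * rp (enorm x)}.
    by apply: (aeS2 ruE rpE) => x h1 h2 Bx; rewrite /v mul1r h1// h2.
  exact: h.
have := nehari_scale Hv rv lv (lt_le_trans Wp Wlow); rewrite dirE => /(_ dirp).
move=> h; apply: le_trans h; apply: ler_wpM2l; first exact: powR_ge0.
by rewrite (_ : 2 * ((p + 1) / 2) = p + 1)//; field.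
Qed.

End minimizer.

End euler_lagrange.

(** * Integrals over circles *)

Section param_integrals.
Context {R : realType}.
Notation mu := (@lebesgue_measure R).
Notation plane := (measurableTypeR R * measurableTypeR R)%type.
Notation lebp := (@lebp R).
Notation B := (@ball2 R).
Notation IB := (ii lebp B).
Notation L2 := (L2 lebp B).
Notation L1 := (L1 lebp B).
Notation T := (pi *+ 2 : R).

Let mB : measurable (B : set plane). Proof. exact: measurable_ball2. Qed.

Lemma cts_slice1 (F : R * R -> R) t : continuous F -> continuous (fun r => F (r, t)).
Proof.
move=> cF r; apply: (@continuous_comp _ _ _ (fun r => (r, t)) F); last exact: cF.
by apply: (@cvg_pair _ _ _ (nbhs r) (nbhs r) (nbhs t)); [exact: cvg_id|exact: cvg_cst].
Qed.

Lemma cts_slice2 (F : R * R -> R) r : continuous F -> continuous (fun t => F (r, t)).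
Proof.
move=> cF t; apply: (@continuous_comp _ _ _ (fun t => (r, t)) F); last exact: cF.
by apply: (@cvg_pair _ _ _ (nbhs t) (nbhs r) (nbhs t)); [exact: cvg_cst|exact: cvg_id].
Qed.

Lemma cts_rect_bounded (F : R * R -> R) (a b c d : R) : continuous F ->
  exists2 M, 0 <= M & forall r t, a <= r <= b -> c <= t <= d -> `|F (r, t)| <= M.
Proof.
move=> cF; pose K : set (R * R) := `[a, b]%classic `*` `[c, d]%classic.
have cK : compact K by apply: compact_setX; exact: segment_compact.
have := continuous_compact (continuous_subspaceT cF) cK => /compact_bounded [M [_ HM]].
exists (`|M| + 1); first by rewrite addr_ge0.
move=> r t rab tcd; apply: (HM (`|M| + 1)); first by rewrite (le_lt_trans (ler_norm M))// ltrDl.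
by exists (r, t) => //; split; rewrite /= in_itv.
Qed.

Lemma cst_integrable (a b M : R) : mu.-integrable `[a, b] (EFin \o (fun=> M)).
Proof. by apply: cts_integrable => x; exact: cvg_cst. Qed.

Lemma cts_itg_param (F : R * R -> R) a b : continuous F -> continuous (fun r => itg a b (fun t => F (r, t))).
Proof.
move=> cF r0; have [M M0 HM] := cts_rect_bounded (r0 - 1) (r0 + 1) a b cF.
have sub r : `]r0 - 1, r0 + 1[%classic r -> r0 - 1 <= r <= r0 + 1.
  by rewrite /= in_itv/= => /andP[? ?]; rewrite !ltW.
apply: (@continuity_under_integral R _ _ mu (fun r t => F (r, t)) `[a, b]%classic _ (r0 - 1) (r0 + 1) _ _ (fun=> M)) => //.
- by move=> r _; apply: cts_integrable; exact: cts_slice2.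
- by apply: aeW => t _ r _; exact: cts_slice1.
- exact: cst_integrable.
- by move=> r /sub rr; apply: aeW => t /=; rewrite in_itv/= => tt; exact: HM.
- by rewrite inE/= in_itv/=; apply/andP; split; lra.
Qed.

Lemma der_itg_param (F dF : R * R -> R) a b r0 : continuous F -> continuous dF ->
  (forall r t, isd r (fun r => F (r, t)) (dF (r, t))) ->
  isd r0 (fun r => itg a b (fun t => F (r, t))) (itg a b (fun t => dF (r0, t))).
Proof.
move=> cF cdF d; have [M M0 HM] := cts_rect_bounded (r0 - 1) (r0 + 1) a b cdF.
have sub r : `]r0 - 1, r0 + 1[%classic r -> r0 - 1 <= r <= r0 + 1.
  by rewrite /= in_itv/= => /andP[? ?]; rewrite !ltW.
have Ir : `]r0 - 1, r0 + 1[%classic r0 by rewrite /= in_itv/=; apply/andP; split; lra.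
have i1 (r : R) : `]r0 - 1, r0 + 1[%classic r -> mu.-integrable `[a, b] (EFin \o (fun t => F (r, t))).
  by move=> _; apply: cts_integrable; exact: cts_slice2.
have d1 (r t : R) : `]r0 - 1, r0 + 1[%classic r -> `[a, b]%classic t -> derivable ((fun r t => F (r, t)) ^~ t) r 1.
  by move=> _ _; case: (d r t).
have E (r t : R) : partial1of2 (fun r t => F (r, t)) r t = dF (r, t).
  by rewrite partial1of2E; case: (d r t) => _ <-.
have b1 (r t : R) : `]r0 - 1, r0 + 1[%classic r -> `[a, b]%classic t -> `|partial1of2 (fun r t => F (r, t)) r t| <= M.
  by move=> /sub rr; rewrite /= in_itv/= E => tt; exact: HM.
have h1 := @derivable_under_integral R _ _ mu (fun r t => F (r, t)) `[a, b]%classic (measurable_itv _) r0 (r0 - 1) (r0 + 1) Ir i1 d1 (fun=> M) (fun=> M0) (cst_integrable a b M) b1.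
have h2 := @differentiation_under_integral R _ _ mu (fun r t => F (r, t)) `[a, b]%classic (measurable_itv _) r0 (r0 - 1) (r0 + 1) Ir i1 d1 (fun=> M) (fun=> M0) (cst_integrable a b M) b1.
apply: der_eq (isd_derive1 h1) _.
by apply: etrans h2 _; apply: eq_Rintegral => t _; exact: E.
Qed.

Lemma plane_cts_pair (f g : R * R -> R) (F : R * R -> R) : continuous f -> continuous g -> continuous F ->
  continuous (fun x => F (f x, g x)).
Proof.
move=> cf cg cF x; apply: (@continuous_comp _ _ _ (fun x => (f x, g x)) F); last exact: cF.
by apply: (@cvg_pair _ _ _ (nbhs x) (nbhs (f x)) (nbhs (g x))); [exact: cf|exact: cg].
Qed.

Lemma cts_polar (F : R * R -> R) : continuous F -> continuous (fun x => F (polar x.1 x.2)).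
Proof.
move=> cF; apply: plane_cts_pair => //; apply: plane_ctsM; try exact: plane_cts1.
  by apply: plane_cts_comp; [exact: plane_cts2|exact: continuous_cos].
by apply: plane_cts_comp; [exact: plane_cts2|exact: continuous_sin].
Qed.

Lemma cts_polar_slice (f : R * R -> R) (r : R) : continuous f -> continuous (fun t : R => f (polar r t)).
Proof. by move=> cf; exact: (@cts_slice2 (fun x => f (polar x.1 x.2)) r (cts_polar cf)). Qed.

Lemma cts_polar_itg (f : R * R -> R) : continuous f -> continuous (fun r : R => itg 0 T (fun t => f (polar r t))).
Proof. by move=> cf; exact: (@cts_itg_param (fun x => f (polar x.1 x.2)) 0 T (cts_polar cf)). Qed.

Lemma cts_polar_ritg (f : R * R -> R) : continuous f -> continuous (fun r : R => r * itg 0 T (fun t => f (polar r t))).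
Proof. by move=> cf; apply: (@ctsM _ (fun r => r)); [exact: ctsI|exact: cts_polar_itg]. Qed.

Lemma enorm_cont : continuous (@enorm R).
Proof. exact: (plane_cts_comp nsq_cont (@sqrt_continuous R)). Qed.

Lemma itg_setI (a : R) (h : R -> R) : 0 <= a -> a <= 1 -> continuous h -> (forall r, 0 <= r -> 0 <= h r) ->
  (\int[mu]_(r in `]0%R, 1%R[) (if (a <= r)%R then (h r)%:E else 0) = (itg a 1 h)%:E)%E.
Proof.
move=> a0 a1 ch h0.
have mh : measurable_fun setT (fun r : measurableTypeR R => if a <= r then (h r)%:E else 0%E).
  apply: measurable_fun_if => //.
  - by apply: measurable_fun_ler; [exact: measurable_cst|exact: measurable_id].
  - by apply: measurable_funTS; apply/measurable_EFinP; exact: continuous_measurable_fun.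
transitivity (\int[mu]_(r in `[0%R, 1%R]) (if (a <= r)%R then (h r)%:E else 0))%E.
  by apply/esym; apply: integral_itv_bndoo; exact: measurable_funTS.
rewrite /itg /Rintegral fineK; last by apply: integrable_fin_num => //; exact: cts_integrable.
rewrite [LHS]integral_mkcond [RHS]integral_mkcond.
apply: eq_integral => r _.
rewrite !patchE; have [ar|ar] := leP a r.
  have -> : (r \in `[0, 1]%classic) = (r \in `[a, 1]%classic) :> bool.
    by apply/idP/idP; rewrite !inE /= !in_itv/= ar (le_trans a0 ar).
  by case: ifP.
rewrite [in RHS]memNset; last by rewrite /= in_itv/= leNgt ar.
by case: ifP.
Qed.

Lemma polar_cut_ge0 (f : R * R -> R) (a : R) : 0 <= a -> a <= 1 -> continuous f -> (forall x, 0 <= f x) ->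
  IB (fun x => if a <= enorm x then f x else 0) = kappa * itg a 1 (fun r => r * itg 0 T (fun t => f (polar r t))).
Proof.
move=> a0 a1 cf f0.
pose h r := r * itg 0 T (fun t => f (polar r t)).
have ch : continuous h by exact: cts_polar_ritg.
have mc : measurable ((fun x => a <= enorm x) : set plane).
  rewrite (_ : (fun _ => _) = setT `&` @enorm R @^-1` `[a, +oo[%classic); first exact: measurable_enorm.
  by rewrite setTI; apply/seteqP; split => x /=; rewrite in_itv/= andbT.
rewrite /ii /Rintegral.
have -> : (\int[lebp]_(x in B) (if a <= enorm x then f x else 0)%:E = (kappa * itg a 1 h)%:E)%E; last by [].
have mG : measurable_fun setT ((fun x => (if a <= enorm x then f x else 0)%:E) : plane -> \bar R).
  apply/measurable_EFinP; apply: ifmeas => //; exact: continuous_measurable_plane.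
have G0 x : (0 <= (if a <= enorm x then f x else 0)%:E)%E by rewrite lee_fin; case: ifP.
have := ge0_integral_polar mG G0; rewrite /= => E.
transitivity (kappa%:E *
    \int[mu]_(r in `]0%R, 1%R[)
      (r%:E * \int[mu]_(t in `]0%R, T]) (if a <= enorm (polar r t) then f (polar r t) else 0)%:E))%E; first exact: E.
rewrite [RHS]EFinM -(itg_setI a0 a1 ch); last first.
  by move=> r r0; rewrite mulr_ge0//; apply: itg_ge0.
congr (_ * _)%E; apply: eq_integral => r; rewrite inE/= in_itv/= => /andP[r0 r1].
under eq_integral do rewrite (enorm_polar _ (ltW r0)).
case: ifP => _; last by rewrite integral0 mule0.
rewrite /h EFinM; congr (_ * _)%E.
rewrite (integral_itv_obnd_cbnd); last first.
  by apply: measurable_funTS; apply/measurable_EFinP; apply: continuous_measurable_fun; exact: (@cts_polar_slice _ r cf).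
rewrite /itg /Rintegral fineK//; apply: integrable_fin_num => //; apply: cts_integrable.
exact: (@cts_polar_slice _ r cf).
Qed.

Lemma L1_cut (f : R * R -> R) (a : R) : continuous f -> L1 (fun x => if a <= enorm x then f x else 0).
Proof.
move=> cf; have [M [M0 HM]] := continuous_bounded_ball cf.
have mc : measurable ((fun x => a <= enorm x) : set plane).
  rewrite (_ : (fun _ => _) = setT `&` @enorm R @^-1` `[a, +oo[%classic); first exact: measurable_enorm.
  by rewrite setTI; apply/seteqP; split => x /=; rewrite in_itv/= andbT.
apply: (@L1_bounded R M); last by move=> x Bx; case: ifP => _; rewrite ?normr0// HM.
apply: measurable_funTS; apply: ifmeas => //; exact: continuous_measurable_plane.
Qed.

Lemma plane_ctsN (f : R * R -> R) : continuous f -> continuous (fun x => - f x).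
Proof. by move=> cf x; apply: cvgN; exact: cf. Qed.

Lemma polar_cut (f : R * R -> R) (a : R) : 0 <= a -> a <= 1 -> continuous f ->
  IB (fun x => if a <= enorm x then f x else 0) = kappa * itg a 1 (fun r => r * itg 0 T (fun t => f (polar r t))).
Proof.
move=> a0 a1 cf.
pose fp x := Num.max (f x) 0; pose fm x := Num.max (- f x) 0.
have cfp : continuous fp by apply: (plane_cts_comp cf (@max_cont _ 0)).
have cfm : continuous fm by apply: (plane_cts_comp (plane_ctsN cf) (@max_cont _ 0)).
have E x : f x = fp x - fm x.
  by rewrite /fp /fm; have [h|h] := leP (f x) 0; [rewrite max_l ?oppr_ge0//; ring|rewrite max_r ?oppr_le0 ?(ltW h)//; ring].
transitivity (IB (fun x => if a <= enorm x then fp x else 0) - IB (fun x => if a <= enorm x then fm x else 0)).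
  rewrite -(iiB mB); [|exact: L1_cut|exact: L1_cut].
  by apply: (eq_ii lebp) => x _; case: ifP => _; rewrite ?subr0// E.
rewrite !polar_cut_ge0//; try by move=> x; rewrite le_max lexx orbT.
rewrite -mulrBr -itgB.
- congr (_ * _); apply: eq_itg => r _; rewrite -mulrBr; congr (_ * _).
  have c1 := @cts_polar_slice _ r cfp; have c2 := @cts_polar_slice _ r cfm.
  by rewrite -(itgB 0 T c1 c2); apply: eq_itg => t _; rewrite E.
- exact: (cts_polar_ritg cfp).
- exact: (cts_polar_ritg cfm).
Qed.

Lemma polar_full (f : R * R -> R) : continuous f ->
  IB f = kappa * itg 0 1 (fun r => r * itg 0 T (fun t => f (polar r t))).
Proof.
move=> cf; rewrite -polar_cut// ?ler01//; apply: (eq_ii lebp) => x _.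
by rewrite enorm_ge0.
Qed.

End param_integrals.

(** * Circle means and the logarithmic test function *)

Section circle_means.
Context {R : realType}.
Notation mu := (@lebesgue_measure R).
Notation plane := (measurableTypeR R * measurableTypeR R)%type.
Notation lebp := (@lebp R).
Notation B := (@ball2 R).
Notation IB := (ii lebp B).
Notation L2 := (L2 lebp B).
Notation L1 := (L1 lebp B).
Notation T := (pi *+ 2 : R).

Let mB : measurable (B : set plane). Proof. exact: measurable_ball2. Qed.

Lemma mvt_any (F dF : R -> R) (a b : R) : (forall x, isd x F (dF x)) ->
  exists2 c, `|c - a| <= `|b - a| & F b - F a = dF c * (b - a).
Proof.
move=> d; have [ab|ab|->] := ltgtP a b.
- have [c /andP[c1 c2] E] := mvt_cc ab (fun x _ => d x); exists c => //.
  by rewrite !ger0_norm ?subr_ge0 ?(ltW ab)// lerD2r.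
- have [c /andP[c1 c2] E] := mvt_cc ab (fun x _ => d x); exists c.
    by rewrite !ler0_norm ?subr_le0 ?(ltW ab)// lerN2 lerD2r.
  by rewrite -[LHS]opprB E; ring.
- by exists b; rewrite ?subrr ?mulr0.
Qed.

(** The test functions are given through partial derivatives; continuity of these yields the chain
    rule by splitting the increment along the axes and applying the mean value theorem to each
    piece. *)
Lemma chain2 (f f1 f2 : R * R -> R) (x y : R -> R) (s dx dy : R) :
  grad_of f f1 f2 -> continuous f1 -> continuous f2 -> isd s x dx -> isd s y dy ->
  isd s (fun s => f (x s, y s)) (f1 (x s, y s) * dx + f2 (x s, y s) * dy).
Proof.
move=> gf c1 c2 hx hy; apply: slope_der => e e0.
pose K := `|dx| + `|dy| + 2 + `|f1 (x s, y s)| + `|f2 (x s, y s)|.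
have K0 : 0 < K by rewrite /K -!addrA ltr_wpDl// ltr_wpDl// ltr_pwDl// addr_ge0.
pose e' := Num.min 1 (e / K).
have e'0 : 0 < e' by rewrite lt_min ltr01 divr_gt0.
have e'1 : e' <= 1 by rewrite ge_min lexx.
have e'K : e' * K <= e by rewrite -ler_pdivlMr// ge_min lexx orbT.
have nb (g : R * R -> R) : continuous g -> exists2 d, 0 < d & forall a b, `|a - x s| < d -> `|b - y s| < d -> `|g (a, b) - g (x s, y s)| <= e'.
  move=> cg; have /cvgrPdist_le/(_ _ e'0)/nbhs_ballP[d /= d0 Hd] := cg (x s, y s).
  exists d => // a b ad bd; rewrite distrC; apply: Hd; split; rewrite /ball/= distrC//.
have [d1 d10 H1] := nb f1 c1; have [d2 d20 H2] := nb f2 c2.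
have cx : {for s, continuous x} := der_cts hx; have cy : {for s, continuous y} := der_cts hy.
have m0 : 0 < Num.min d1 d2 by rewrite lt_min d10.
have nx : \forall t \near s, `|x t - x s| < Num.min d1 d2.
  by move/cvgrPdist_lt/(_ _ m0): cx; apply: filterS => t; rewrite distrC.
have ny : \forall t \near s, `|y t - y s| < Num.min d1 d2.
  by move/cvgrPdist_lt/(_ _ m0): cy; apply: filterS => t; rewrite distrC.
have sx := der_slope hx e'0; have sy := der_slope hy e'0.
apply: filterS2 (filterI nx ny) (filterI sx sy) => t [n1 n2] [q1 q2].
move: n1 n2; rewrite !lt_min => /andP[n11 n12] /andP[n21 n22].
have [c cE E1] := @mvt_any (fun z => f (z, y t)) (fun z => f1 (z, y t)) (x s) (x t) (fun z => (gf (z, y t)).1).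
have [k kE E2] := @mvt_any (fun z => f (x s, z)) (fun z => f2 (x s, z)) (y s) (y t) (fun z => (gf (x s, z)).2).
have b1 : `|f1 (c, y t) - f1 (x s, y s)| <= e' by apply: H1 => //; exact: le_lt_trans cE n11.
have b2 : `|f2 (x s, k) - f2 (x s, y s)| <= e'.
  by apply: H2; rewrite ?subrr ?normr0//; exact: le_lt_trans kE n22.
have -> : f (x t, y t) - f (x s, y s) - (f1 (x s, y s) * dx + f2 (x s, y s) * dy) * (t - s) =
  (f1 (c, y t) - f1 (x s, y s)) * (x t - x s) + f1 (x s, y s) * (x t - x s - dx * (t - s)) +
  ((f2 (x s, k) - f2 (x s, y s)) * (y t - y s) + f2 (x s, y s) * (y t - y s - dy * (t - s))).
  have -> : f (x t, y t) - f (x s, y s) = (f (x t, y t) - f (x s, y t)) + (f (x s, y t) - f (x s, y s)) by ring.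
  by rewrite E1 E2; ring.
have lip (z : R -> R) (dz : R) : `|z t - z s - dz * (t - s)| <= e' * `|t - s| -> `|z t - z s| <= (`|dz| + 1) * `|t - s|.
  move=> h; have -> : z t - z s = (z t - z s - dz * (t - s)) + dz * (t - s) by ring.
  apply: le_trans (ler_normD _ _) _; rewrite normrM mulrDl mul1r addrC lerD2l.
  by apply: le_trans h _; rewrite ler_piMl.
have l1 := lip _ _ q1; have l2 := lip _ _ q2.
have t1 : `|(f1 (c, y t) - f1 (x s, y s)) * (x t - x s)| <= e' * ((`|dx| + 1) * `|t - s|).
  by rewrite normrM; apply: ler_pM.
have t2 : `|f1 (x s, y s) * (x t - x s - dx * (t - s))| <= `|f1 (x s, y s)| * (e' * `|t - s|).
  by rewrite normrM; apply: ler_wpM2l.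
have t3 : `|(f2 (x s, k) - f2 (x s, y s)) * (y t - y s)| <= e' * ((`|dy| + 1) * `|t - s|).
  by rewrite normrM; apply: ler_pM.
have t4 : `|f2 (x s, y s) * (y t - y s - dy * (t - s))| <= `|f2 (x s, y s)| * (e' * `|t - s|).
  by rewrite normrM; apply: ler_wpM2l.
apply: (@le_trans _ _ (e' * K * `|t - s|)); last by rewrite ler_wpM2r.
have -> : e' * K * `|t - s| = (e' * ((`|dx| + 1) * `|t - s|) + `|f1 (x s, y s)| * (e' * `|t - s|)) +
  (e' * ((`|dy| + 1) * `|t - s|) + `|f2 (x s, y s)| * (e' * `|t - s|)) by rewrite /K; ring.
apply: le_trans (ler_normD _ _) _; apply: lerD; apply: le_trans (ler_normD _ _) _; exact: lerD.
Qed.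

Lemma smooth2_grad (phi : R * R -> R) : smooth2 phi -> grad_of phi (pd true phi) (pd false phi).
Proof.
move=> h x; have [h1 [h2 _]] := h [::] x; by split; [exact: (isd_derive1 h1)|exact: (isd_derive1 h2)].
Qed.

Definition radd (phi : R * R -> R) (x : R * R) : R :=
  pd true phi (polar x.1 x.2) * cos x.2 + pd false phi (polar x.1 x.2) * sin x.2.

(** Derivative in the angle, that is r times the tangential component of the gradient; without
    division by r it is continuous at the origin. *)
Definition angd (phi : R * R -> R) (x : R * R) : R :=
  x.1 * (pd false phi (polar x.1 x.2) * cos x.2 - pd true phi (polar x.1 x.2) * sin x.2).

Lemma der_radial (phi : R * R -> R) (r t : R) : smooth2 phi ->
  isd r (fun r => phi (polar r t)) (radd phi (r, t)).
Proof.
move=> sm; have c b := smooth2_cont (smooth2_pd b sm).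
have d (k : R) : isd r (fun r => r * k) k by apply: der_eq (derM (derI r) (derC k r)) _; ring.
exact: (chain2 (smooth2_grad sm) (c true) (c false) (d (cos t)) (d (sin t))).
Qed.

Lemma der_angular (phi : R * R -> R) (r t : R) : smooth2 phi ->
  isd t (fun t => phi (polar r t)) (angd phi (r, t)).
Proof.
move=> sm; have c b := smooth2_cont (smooth2_pd b sm).
have dx : isd t (fun t => r * cos t) (- (r * sin t)).
  by apply: der_eq (derZ r (is_derive_cos t)) _; rewrite mulrN.
have dy : isd t (fun t => r * sin t) (r * cos t) by exact: (derZ r (is_derive_sin t)).
apply: der_eq (chain2 (smooth2_grad sm) (c true) (c false) dx dy) _.
by rewrite /angd /=; ring.
Qed.

Lemma cts_sin2 : continuous (fun x : R * R => sin x.2).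
Proof. by apply: plane_cts_comp; [exact: plane_cts2|exact: continuous_sin]. Qed.

Lemma cts_cos2 : continuous (fun x : R * R => cos x.2).
Proof. by apply: plane_cts_comp; [exact: plane_cts2|exact: continuous_cos]. Qed.

Lemma radd_cont (phi : R * R -> R) : smooth2 phi -> continuous (radd phi).
Proof.
move=> sm; have c b := cts_polar (smooth2_cont (smooth2_pd b sm)).
by apply: plane_ctsD; apply: plane_ctsM; [exact: c|exact: cts_cos2|exact: c|exact: cts_sin2].
Qed.

Lemma angd_cont (phi : R * R -> R) : smooth2 phi -> continuous (angd phi).
Proof.
move=> sm; have c b := cts_polar (smooth2_cont (smooth2_pd b sm)).
apply: plane_ctsM; first exact: plane_cts1.
apply: plane_ctsD; first by apply: plane_ctsM; [exact: c|exact: cts_cos2].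
by apply: plane_ctsN; apply: plane_ctsM; [exact: c|exact: cts_sin2].
Qed.

Definition cmean (phi : R * R -> R) (r : R) : R := itg 0 T (fun t => phi (polar r t)).

Lemma der_cmean (phi : R * R -> R) (r : R) : smooth2 phi ->
  isd r (cmean phi) (itg 0 T (fun t => radd phi (r, t))).
Proof.
move=> sm.
apply: (@der_itg_param _ (fun x => phi (polar x.1 x.2)) (radd phi) 0 T r).
- exact: cts_polar (smooth2_cont sm).
- exact: radd_cont.
- by move=> ? ?; exact: der_radial.
Qed.

(** A component of the gradient of [lam]: with y a coordinate it is that component of -x / |x|^2
    outside the disc of radius a. *)
Definition klam (a : R) (y : R * R -> R) (x : R * R) : R :=
  if a <= enorm x then - (y x / nsq x) else 0.

Definition lam (a : R) (x : R * R) : R := - ln (Num.max (enorm x) a).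

Lemma le_enorm_nsq (a : R) x : 0 <= a -> (a <= enorm x) = (a ^+ 2 <= nsq x).
Proof. by move=> a0; rewrite nsqE ler_pXn2r// nnegrE// enorm_ge0. Qed.

Lemma H10_lam (a : R) : 0 < a -> a < 1 ->
  H10 (lam a) (klam a (fun x => x.1)) (klam a (fun x => x.2)).
Proof.
move=> a0 a1; have a20 : 0 < a ^+ 2 by rewrite exprn_gt0.
have a21 : a ^+ 2 < 1 by rewrite expr_lt1// ltW.
(* [H10_trunc] works in the variable s = |x|^2, hence the factor 1/2 and the truncation level
   a^2. *)
pose F s : R := - (2^-1 * ln s); pose dF s : R := - (2^-1 * s^-1).
have F1 : F 1 = 0 by rewrite /F ln1 mulr0 oppr0.
have dFF s : 0 < s -> isd s F (dF s).
  by move=> s0; apply: derN; apply: derZ; exact: is_derive1_ln.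
have cdF s : 0 < s -> {for s, continuous dF}.
  move=> s0; apply: cvgN; apply: cvgM; first exact: cvg_cst.
  by apply: cvgV; [rewrite gt_eqF|exact: cvg_id].
have gp : gpoly (fun _ : R * R => 1) (fun=> 0) (fun=> 0).
  split; [by move=> e b; exact: sm_cst|by move=> x; split; exact: derC|exact: plane_ctsC|exact: plane_ctsC].
apply: H10_ext (H10_trunc a20 a21 F1 dFF cdF gp) _ _ _ => x _.
- rewrite mulr1 /F /lam; congr (- _).
  have -> : Num.max (nsq x) (a ^+ 2) = Num.max (enorm x) a ^+ 2.
    rewrite nsqE; have [h|h] := leP (enorm x) a.
      by rewrite max_r// ler_pXn2r// nnegrE ?enorm_ge0// ltW.
    by rewrite max_l// ler_pXn2r ?nnegrE ?enorm_ge0// ltW.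
  by rewrite lnXn ?lt_max ?a0 ?orbT// -[ln _ *+ 2]mulr_natl mulKf.
- rewrite /klam le_enorm_nsq ?(ltW a0)//; case: ifP => h; last by ring.
  by rewrite max_l// /dF; field; rewrite gt_eqF// (lt_le_trans a20).
- rewrite /klam le_enorm_nsq ?(ltW a0)//; case: ifP => h; last by ring.
  by rewrite max_l// /dF; field; rewrite gt_eqF// (lt_le_trans a20).
Qed.

(** In polar coordinates the pairing is minus the integral over [a, 1] of the derivative of the
    circle integral of phi, which vanishes at radius 1. *)
Lemma circle_formula (phi : R * R -> R) (a : R) : testfun phi -> 0 < a -> a < 1 ->
  IB (fun x => pd true phi x * klam a (fun x => x.1) x) +
  IB (fun x => pd false phi x * klam a (fun x => x.2) x) = kappa * cmean phi a.
Proof.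
move=> [sm [r0 [r01 phi0]]] a0 a1; have c b := smooth2_cont (smooth2_pd b sm).
have a20 : 0 < a ^+ 2 by rewrite exprn_gt0.
pose m x := Num.max (nsq x) (a ^+ 2).
have m0 x : 0 < m x by rewrite lt_max a20 orbT.
have cm : continuous m by apply: (plane_cts_comp nsq_cont (@max_cont _ (a ^+ 2))).
have cmV : continuous (fun x => (m x)^-1) by move=> x; apply: cvgV; [rewrite gt_eqF|exact: cm].
pose f x := - (pd true phi x * x.1 + pd false phi x * x.2) * (m x)^-1.
have cf : continuous f.
  apply: plane_ctsM => //; apply: plane_ctsN; apply: plane_ctsD; apply: plane_ctsM;
  by [exact: c|exact: plane_cts1|exact: plane_cts2].
have [l1 l2 l3] := H10_L2 (H10_lam a0 a1).
have sL2 b := smooth2_L2 (smooth2_pd b sm).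
rewrite -(iiD mB); [|exact: (L2M mB)|exact: (L2M mB)].
transitivity (IB (fun x => if a <= enorm x then f x else 0)).
  apply: (eq_ii lebp) => x _; rewrite /klam; case: ifP => h; last by ring.
  rewrite /f /m max_l; last by rewrite -le_enorm_nsq// ltW.
  by ring.
rewrite polar_cut// ?(ltW a0) ?(ltW a1)//; congr (_ * _).
transitivity (itg a 1 (fun r => - itg 0 T (fun t => radd phi (r, t)))).
  apply: eq_itg => r /andP[ar r1]; have rp : 0 < r := lt_le_trans a0 ar.
  rewrite -itgZ; last exact: cts_polar_slice.
  rewrite -mulN1r -itgZ; last by apply: cts_slice2; exact: radd_cont.
  apply: eq_itg => t _; rewrite /f /m /radd /= max_l; last by rewrite nsqE enorm_polar ?(ltW rp)// ler_pXn2r// nnegrE ltW.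
  by rewrite nsqE enorm_polar ?(ltW rp)//; field; rewrite gt_eqF.
have cI : continuous (fun r : R => itg 0 T (fun t => radd phi (r, t))) by apply: cts_itg_param; exact: radd_cont.
have cC : continuous (cmean phi) by move=> r; apply: der_cts (der_cmean r sm).
rewrite (@itg_FTC _ a 1 (fun r => - cmean phi r)) ?(ltW a1)//; [|exact: ctsN|exact: ctsN|].
  have -> : cmean phi 1 = 0.
    rewrite /cmean (@eq_itg _ _ _ _ (fun=> 0 * 0)) ?itgZ ?mul0r//; first exact: ctsC.
    by move=> t _; rewrite phi0 ?mul0r// enorm_polar.
  by rewrite oppr0 sub0r opprK.
by move=> r _; apply: derN; exact: der_cmean.
Qed.

End circle_means.

(** * Averaging over rotations *)

Section radial_average.
Context {R : realType}.
Notation mu := (@lebesgue_measure R).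
Notation plane := (measurableTypeR R * measurableTypeR R)%type.
Notation lebp := (@lebp R).
Notation B := (@ball2 R).
Notation IB := (ii lebp B).
Notation L2 := (L2 lebp B).
Notation L1 := (L1 lebp B).
Notation T := (pi *+ 2 : R).

Let mB : measurable (B : set plane). Proof. exact: measurable_ball2. Qed.

Lemma itg_rot (phi : R * R -> R) (x : R * R) : continuous phi ->
  itg 0 T (fun a => phi (rot2 a x)) = cmean phi (enorm x).
Proof.
move=> cphi; have [w _ xE] := polar_angle x; rewrite {1}xE /cmean.
rewrite -(@itg_periodic _ (fun t => phi (polar (enorm x) t)) w).
- by apply: eq_itg => a _; rewrite rot_polar.
- exact: cts_polar_slice.
- by move=> t; rewrite /polar cosD2pi sinD2pi.
Qed.

(** Bessel's inequality for the constant mode alone. *)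
Lemma itg_jensen (h : R -> R) (c : R) : continuous h ->
  T * (itg 0 T h / T - c) ^+ 2 <= itg 0 T (fun t => (h t - c) ^+ 2).
Proof.
move=> ch; have chc : continuous (fun t => h t - c) by cts.
have := bessel 1 chc; rewrite big_ord1.
have -> : itg 0 T (fun x => (h x - c) * trig 0 x) = itg 0 T h - c * T.
  have -> : c * T = itg 0 T (fun=> c).
    rewrite (@itg_FTC _ 0 T (fun x => c * x)) ?(ltW T_gt0) ?mulr0 ?subr0//; [by cts|by cts|].
    by move=> x _; apply: der_eq (derZ c (derI x)) _; rewrite mulr1.
  rewrite -itgB; [|by []|by cts]; apply: eq_itg => x _.
  by rewrite /trig/= /freq/= mul0r cos0 mulr1.
rewrite /tnorm/=; have T0 : T != 0 by rewrite gt_eqF ?T_gt0.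
have E (t A : R) : t != 0 -> t * (A / t - c) ^+ 2 = (A - c * t) ^+ 2 / t by move=> tn; field.
by rewrite E.
Qed.

Lemma measurable_rot_pair : measurable_fun setT (fun z : plane * measurableTypeR R => rot2 z.2 z.1 : plane).
Proof.
have m1 : measurable_fun setT (fun z : (R * R) * R => z.1.1).
  exact: measurableT_comp measurable_fst measurable_fst.
have m2 : measurable_fun setT (fun z : (R * R) * R => z.1.2).
  exact: measurableT_comp measurable_snd measurable_fst.
have mc : measurable_fun setT (fun z : (R * R) * R => cos z.2).
  apply: measurableT_comp measurable_snd.
  exact: continuous_measurable_fun (@continuous_cos R).
have ms : measurable_fun setT (fun z : (R * R) * R => sin z.2).
  apply: measurableT_comp measurable_snd.
  exact: continuous_measurable_fun (@continuous_sin R).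
by apply: measurable_pairfun; [apply: measurable_funB|apply: measurable_funD];
  apply: measurable_funM.
Qed.

(** Radiality is known almost everywhere, so comparing u at x and at a rotated point requires null
    sets to be preserved by rotations. *)
Lemma rot_null (a : R) (N : set plane) : measurable N -> lebp N = 0%E -> 
  measurable (rot2 a @^-1` N : set plane) /\ lebp (rot2 a @^-1` N) = 0%E.
Proof.
move=> mN N0.
have mr : measurable (rot2 a @^-1` N : set plane) by rewrite -[X in measurable X]setTI; exact: measurable_rot2.
split => //.
have i1 : lebp (rot2 a @^-1` N) = (\int[leb2 (R:=R)]_x (\1_(rot2 a @^-1` N) x)%:E)%E by exact: (leb2_indic mr).
have i2 : lebp N = (\int[leb2 (R:=R)]_x (\1_N x)%:E)%E by exact: (leb2_indic mN).
rewrite i1 -N0 i2 -[RHS](leb2_rot a (G := fun x => (\1_N x)%:E)).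
- by apply: eq_integral => x _; rewrite !indicE; congr ((nat_of_bool _)%:R%:E); apply/idP/idP; rewrite !inE.
- by apply/measurable_EFinP.
- by move=> x; rewrite lee_fin.
Qed.

(* Averages of [phi] over circles are at least as close to the radial function [u] as [phi] is. *)
Lemma avg_contract (phi u : R * R -> R) : continuous phi -> L2 u -> radial u ->
  dist2 (fun x => cmean phi (enorm x) / T) u <= dist2 phi u.
Proof.
move=> cphi hu [v vE0]; have vE : {ae lebp, forall x, B x -> u x = v (enorm x)} := vE0.
have T0 : 0 < T := T_gt0.
have lphi := continuous_L2 cphi.
have ccm : continuous (cmean phi) by exact: cts_polar_itg.
have cavg : continuous (fun x : R * R => cmean phi (enorm x) / T).
  by apply: plane_ctsM; [exact: (plane_cts_comp enorm_cont ccm)|exact: plane_ctsC].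
have lavg := continuous_L2 cavg.
pose U : R * R -> R := u \_ B.
have UE x : B x -> U x = u x by move=> Bx; rewrite /U patchE mem_set.
have mU : measurable_fun setT (U : plane -> R).
  have [+ _] := measurable_restrictT u mB; apply; exact: hu.1.
pose H x : \bar R := (((phi x - U x) ^+ 2)%:E).
have mH : measurable_fun setT (H : plane -> \bar R).
  apply/measurable_EFinP; apply: measurable_funX; apply: measurable_funB => //.
  exact: continuous_measurable_plane.
have H0 x : (0 <= H x)%E by rewrite lee_fin sqr_ge0.
(* Integrating [K] first in the angle and using Jensen gives the distance of the average;
   integrating first in x and using rotation invariance gives the distance of phi. Tonelli equates
   the two. *)
pose K (z : (R * R) * R) : \bar R :=
  if (enorm z.1 < 1) && (0 < z.2 <= T) then ((phi (rot2 z.2 z.1) - U z.1) ^+ 2)%:E else 0%E.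
have K0 z : (0 <= K z)%E by rewrite /K; case: ifP => // _; rewrite lee_fin sqr_ge0.
have mK : measurable_fun setT (K : plane * measurableTypeR R -> \bar R).
  apply: measurable_fun_if => //.
  - apply: measurable_and.
      apply: measurable_fun_ltr; last exact: measurable_cst.
      exact: measurableT_comp (@measurable_enorm R) measurable_fst.
    by apply: measurable_and; apply: measurable_fun_ltr || apply: measurable_fun_ler;
        (exact: measurable_cst || exact: measurable_snd).
  - apply: measurable_funTS; apply/measurable_EFinP; apply: measurable_funX; apply: measurable_funB.
      exact: measurableT_comp (continuous_measurable_plane cphi) measurable_rot_pair.
    exact: measurableT_comp mU measurable_fst.
pose m2d : {sigma_finite_measure set plane -> \bar R} :=
  HB.pack (mu \x mu)%E (Measure_isSigmaFinite.Build _ _ _ (mu \x mu)%E (@sigma_finite_plane R)).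
have FT := @fubini_tonelli _ _ plane (measurableTypeR R) R m2d mu K mK K0.
have lhs : ((T * dist2 (fun x => cmean phi (enorm x) / T) u)%:E <= \int[m2d]_x \int[mu]_y K (x, y))%E.
  have -> : (T * dist2 (fun x => cmean phi (enorm x) / T) u)%:E =
      (\int[lebp]_(x in B) (T * (cmean phi (enorm x) / T - u x) ^+ 2)%:E)%E.
    rewrite (L1E mB (f := fun x => T * (cmean phi (enorm x) / T - u x) ^+ 2)); last by apply: (L1Z mB); exact: (L2B mB lavg hu).2.
    by rewrite (iiZ mB)//; exact: (L2B mB lavg hu).2.
  rewrite integral_mkcond; apply: ge0_le_integral => //.
  - by move=> x _; rewrite patchE; case: ifP => // _; rewrite lee_fin mulr_ge0 ?sqr_ge0 ?(ltW T0).
  - have mq : measurable_fun (B : set plane) (fun x => (T * (cmean phi (enorm x) / T - u x) ^+ 2)%:E).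
      apply/measurable_EFinP; apply: measurable_funM => //.
      by apply: measurable_funX; exact: (L2B mB lavg hu).1.
    exact: (measurable_restrictT _ mB).1 mq.
  - exact: (@measurable_fun_fubini_tonelli_F _ _ _ _ _ mu K).
  move=> x _; rewrite patchE; case: ifPn => Bx; last by apply: integral_ge0.
  have {}Bx : B x by rewrite inE in Bx.
  have crot : continuous (fun a : R => phi (rot2 a x)).
    have [w _ ->] := polar_angle x; under eq_fun do rewrite rot_polar.
    apply: (@cts_comp _ (fun t => phi (polar (enorm x) t)) (fun a => w + a)); last by cts.
    exact: cts_polar_slice.
  have cs : continuous (fun a : R => (phi (rot2 a x) - u x) ^+ 2) by cts.
  apply: (@le_trans _ _ (itg 0 T (fun a => (phi (rot2 a x) - u x) ^+ 2))%:E).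
    by rewrite lee_fin -itg_rot//; exact: itg_jensen.
  rewrite le_eqVlt; apply/orP; left; apply/eqP.
  transitivity (\int[mu]_(a in `]0%R, T]) ((phi (rot2 a x) - u x) ^+ 2)%:E)%E.
    rewrite integral_itv_obnd_cbnd; last first.
      by apply: measurable_funTS; apply/measurable_EFinP; exact: continuous_measurable_fun.
    by rewrite /itg /Rintegral fineK//; apply: integrable_fin_num => //; exact: cts_integrable.
  rewrite integral_mkcond; apply: eq_integral => a _; rewrite patchE /K /=.
  have -> : enorm x < 1 by exact: Bx.
  rewrite UE//=; congr (if _ then _ else _).
  by apply/idP/idP; rewrite inE/= in_itv.
have rhs : (\int[mu]_y \int[m2d]_x K (x, y) = (T * dist2 phi u)%:E)%E.
  transitivity (\int[mu]_(a in `]0%R, T]) (cst (dist2 phi u)%:E a))%E; last first.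
    by rewrite integral_cst//= lebesgue_measure_itv/= lte_fin T0 -EFinB subr0 -EFinM mulrC.
  rewrite [RHS]integral_mkcond; apply: eq_integral => a _; rewrite patchE.
  case: ifPn => aT; last first.
    rewrite integral0_eq// => x _; rewrite /K /= ifF//; apply/negbTE; apply: contra aT => /andP[_ h].
    by rewrite inE/= in_itv.
  have {}aT : 0 < a <= T by move: aT; rewrite inE/= in_itv.
  pose G x : \bar R := (H \_ B) x.
  have mG : measurable_fun setT (G : plane -> \bar R).
    by apply: (measurable_restrictT _ mB).1; exact: measurable_funTS.
  have G0 x : (0 <= G x)%E by rewrite /G patchE; case: ifP.
  have -> : (dist2 phi u)%:E = (\int[leb2 (R:=R)]_x G x)%E.
    transitivity (\int[lebp]_(x in B) ((phi x - u x) ^+ 2)%:E)%E.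
      by rewrite (L1E mB)//; exact: (L2B mB lphi hu).2.
    rewrite integral_mkcond; apply: eq_integral => x _; rewrite /G !patchE; case: ifPn => // Bx.
    by rewrite /H UE//; rewrite inE in Bx.
  rewrite -(leb2_rot a mG G0).
  have mrot := @measurable_rot2 R a.
  have E : ae_eq lebp setT (fun x => K (x, a)) (fun x => G (rot2 a x)).
    have [N [mN N0 NP]] := vE; have [mrN rN0] := rot_null a mN N0.
    exists (N `|` rot2 a @^-1` N); split; first exact: measurableU.
      by rewrite measureU0.
    move=> x; rewrite /= => nK; apply: contrapT => /not_orP[xN rxN]; apply: nK => _.
    have e1 : B x -> u x = v (enorm x) by move=> Bx; apply: contrapT => h; apply: xN; apply: NP => /(_ Bx).
    have e2 : B (rot2 a x) -> u (rot2 a x) = v (enorm x).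
      move=> Bx; rewrite -(enorm_rot a x); apply: contrapT => h; apply: rxN; apply: NP => /(_ Bx) q.
      by apply: h.
    rewrite /K /G /= aT andbT patchE.
    have -> : (rot2 a x \in B) = (enorm x < 1).
      by apply/idP/idP; rewrite inE /ball2/= enorm_rot.
    case: ifP => // Bx; rewrite /H; have Bx' : B x := Bx.
    have Brx : B (rot2 a x) by rewrite /ball2/= enorm_rot.
    by rewrite !UE// e1// e2.
  apply: (@ae_eq_integral _ _ _ lebp setT) => //.
  - have mp : measurable_fun setT (fun x : plane => (x, a) : plane * measurableTypeR R).
      by apply: measurable_fun_pair; [exact: measurable_id|exact: measurable_cst].
    exact: measurableT_comp mK mp.
  - exact: measurableT_comp mG mrot.
move: lhs; rewrite FT rhs lee_fin ler_pM2l//.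
Qed.

End radial_average.

(** * Harmonic polynomials *)

Section punctured_polar.
Context {R : realType}.
Notation plane := (measurableTypeR R * measurableTypeR R)%type.
Notation lebp := (@lebp R).
Notation B := (@ball2 R).
Notation IB := (ii lebp B).
Notation L2 := (L2 lebp B).
Notation L1 := (L1 lebp B).
Notation T := (pi *+ 2 : R).

Let mB : measurable (B : set plane). Proof. exact: measurable_ball2. Qed.

Lemma pp1D (a x : R) : 0 < x -> pp (1 + a) x = x * x `^ a.
Proof. by move=> x0; rewrite (ppE _ (ltW x0)) powRD; [rewrite powRr1// ltW|rewrite (gt_eqF x0) implybT]. Qed.

Lemma itg_cst a b (c : R) : a <= b -> itg a b (fun=> c) = c * (b - a).
Proof.
move=> ab; rewrite (@itg_FTC _ a b (fun r => c * r)) //; first by rewrite mulrBr.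
- exact: ctsC.
- by cts.
by move=> x _; apply: der_eq (derZ c (derI x)) _; rewrite mulr1.
Qed.

Lemma enorm_lt_meas (a : R) : measurable ((fun x => enorm x < a) : set plane).
Proof. exact: measurable_disc. Qed.

Lemma L1_if f (b : R * R -> bool) : L1 f -> measurable (b : set plane) -> L1 (fun x => if b x then f x else 0).
Proof.
move=> hf mb; apply: (@L1_le _ _ _ lebp B mB _ (fun x => `|f x|)); last exact: (integrable_norm hf).
  have -> : (fun x => if b x then f x else 0) = (fun x => (if b x then 1 else 0) * f x).
    by apply/funext => x; case: ifP; rewrite ?mul1r ?mul0r.
  by apply: measurable_funM; [apply: measurable_funTS; apply: ifmeas|exact: (L1_meas hf)].
by move=> x _; case: ifP => _; rewrite ?normr0.
Qed.

Lemma disc_cvg0 f : L1 f ->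
  (fun n => IB (fun x => if enorm x < harmonic n then f x else 0)) @ \oo --> (0 : R).
Proof.
move=> hf; pose F n x := ((if enorm x < harmonic n then f x else 0)%:E : \bar R).
have lF n : L1 (fun x => if enorm x < harmonic n then f x else 0) by apply: L1_if => //; exact: enorm_lt_meas.
have mF n : measurable_fun (B : set plane) (F n) by have /integrableP[] := lF n.
have Fc : {ae lebp, forall x, B x -> F ^~ x @ \oo --> 0%E}.
  apply: filterS (@ae_enorm_gt0 R) => x x0 Bx; apply: cvg_EFin; first exact: nearW.
  have /cvgrPdist_lt/(_ _ x0) hn := @cvg_harmonic R.
  apply: cvg_trans (@cvg_cst _ (0 : R) _ \oo _); apply: near_eq_cvg.
  apply: filterS hn => n; rewrite sub0r normrN => hn.
  by rewrite /= ltNge ltW// (le_lt_trans (ler_norm _)).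
have FM : {ae lebp, forall x n, B x -> (`|F n x| <= (`|f x|%R)%:E)%E}.
  by apply: nearW => x n _; rewrite /F abse_EFin lee_fin; case: ifP => _; rewrite ?normr0.
have [_ _] := dominated_convergence mB mF (measurable_cst 0%E) Fc (integrable_norm hf) FM.
by rewrite integral0 => h; exact: (fine_cvg h).
Qed.

(** Continuity off the origin, phrased as agreement outside each disc with a globally continuous
    function, so that [polar_cut] applies directly. *)
Definition punct_cts (f : R * R -> R) := forall a, 0 < a ->
  exists2 fa : R * R -> R, continuous fa & forall x, a <= enorm x -> f x = fa x.

Lemma punct_ctsC f : continuous f -> punct_cts f.
Proof. by move=> cf a _; exists f. Qed.

Lemma punct_ctsD f g : punct_cts f -> punct_cts g -> punct_cts (fun x => f x + g x).
Proof.
move=> hf hg a a0; have [f' cf ef] := hf a a0; have [g' cg eg] := hg a a0.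
by exists (fun x => f' x + g' x) => [|x ax]; [exact: plane_ctsD|rewrite ef// eg].
Qed.

Lemma punct_ctsM f g : punct_cts f -> punct_cts g -> punct_cts (fun x => f x * g x).
Proof.
move=> hf hg a a0; have [f' cf ef] := hf a a0; have [g' cg eg] := hg a a0.
by exists (fun x => f' x * g' x) => [|x ax]; [exact: plane_ctsM|rewrite ef// eg].
Qed.

Lemma punct_ctsN f : punct_cts f -> punct_cts (fun x => - f x).
Proof.
move=> hf a a0; have [f' cf ef] := hf a a0.
by exists (fun x => - f' x) => [|x ax]; [exact: plane_ctsN|rewrite ef].
Qed.

Lemma punct_cts_sum (F : nat -> R * R -> R) m : (forall i, punct_cts (F i)) -> punct_cts (fun x => \sum_(i < m) F i x).
Proof.
move=> hF; elim: m => [|m IH].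
  by under eq_fun do rewrite big_ord0; apply: punct_ctsC; exact: plane_ctsC.
by under eq_fun do rewrite big_ord_recr/=; exact: punct_ctsD.
Qed.

Lemma punct_cts_enorm (h : R -> R) : (forall s, 0 < s -> {for s, continuous h}) -> punct_cts (fun x => h (enorm x)).
Proof.
move=> ch a a0; exists (fun x => h (Num.max (enorm x) a)) => [|x ax]; last by rewrite max_l.
by have := @plane_cts_comp R (@enorm R) (fun r => h (Num.max r a)) (@enorm_cont R); apply; exact: cts_max_comp.
Qed.

Lemma punct_cts_nsq (h : R -> R) : (forall s, 0 < s -> {for s, continuous h}) -> punct_cts (fun x => h (nsq x)).
Proof.
move=> ch a a0; exists (fun x => h (Num.max (nsq x) (a ^+ 2))) => [|x ax].
  have := @plane_cts_comp R (@nsq R) (fun r => h (Num.max r (a ^+ 2))) (@nsq_cont R); apply.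
  by apply: cts_max_comp => //; rewrite exprn_gt0.
by rewrite max_l// -le_enorm_nsq// ltW.
Qed.

(** Polar coordinates outside discs of radius 1 / (n + 1); the discs contribute nothing in the limit
    by integrability. *)
Lemma polar_punct (f : R * R -> R) (H : R -> R) : L1 f -> continuous H -> punct_cts f ->
  (forall r, 0 < r -> r <= 1 -> r * itg 0 T (fun t => f (polar r t)) = H r) ->
  IB f = kappa * itg 0 1 H.
Proof.
move=> hf cH hfa hH; have [N N0 dN] := antiderivative cH.
have cN : continuous N by move=> x; exact: der_cts (dN x).
pose I n := IB (fun x => if enorm x < harmonic n then f x else 0).
have split n : I n + kappa * (N 1 - N (harmonic n)) = IB f.
  have h0 : 0 < harmonic n :> R by exact: harmonic_gt0.
  have h1 : harmonic n <= 1 :> R by rewrite /harmonic/= invf_le1 ?ler1n ?ltr0n.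
  move: h0 h1; rewrite /I; move: (harmonic n) => a h0 h1; have [g cg fg] := hfa a h0.
  have -> : N 1 - N a = itg a 1 (fun r => r * itg 0 T (fun t => g (polar r t))).
    rewrite -(itg_FTC h1 cH cN) => [|x _]; last exact: dN.
    apply: eq_itg => r /andP[ar r1]; have r0 := lt_le_trans h0 ar; rewrite -hH//; congr (_ * _).
    by apply: eq_itg => t _; rewrite fg// enorm_polar// ltW.
  rewrite -(polar_cut (ltW h0) h1 cg) -(iiD mB); [|by apply: L1_if => //; exact: enorm_lt_meas|exact: (L1_cut a cg)].
  apply: (eq_ii lebp) => x _; have [xa|xa] := ltP (enorm x) a; first by rewrite addr0.
  by rewrite add0r fg.
have lim : (fun n => I n + kappa * (N 1 - N (harmonic n))) @ \oo --> 0 + kappa * (N 1 - N 0).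
  apply: cvgD; first exact: disc_cvg0.
  apply: cvgM; first exact: cvg_cst.
  apply: cvgB; first exact: cvg_cst.
  by apply: continuous_cvg; [exact: cN|exact: cvg_harmonic].
rewrite (itg_FTC ler01 cH cN) => [|x _]; last exact: dN.
have E : (fun n => I n + kappa * (N 1 - N (harmonic n))) = (fun=> IB f) by apply/funext => n; exact: split.
rewrite E add0r in lim; exact: (cvg_unique _ (@cvg_cst _ (IB f) _ \oo _) lim).
Qed.

End punctured_polar.

(** * Real and imaginary parts of the powers of x.1 + i x.2 *)

Section complex_powers.
Context {R : realType}.
Notation T := (pi *+ 2 : R).

(** The complex power as a pair. The real part is written as a sum with - x.2 rather than a
    difference, to fit the closure rules of [sm] and [grad_of]. *)
Fixpoint cpow (n : nat) (x : R * R) : R * R :=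
  if n is m.+1 then (x.1 * (cpow m x).1 + (- x.2) * (cpow m x).2, x.1 * (cpow m x).2 + x.2 * (cpow m x).1)
  else (1, 0).

Definition cre n x := (cpow n x).1.
Definition cim n x := (cpow n x).2.

Lemma creS n : cre n.+1 = fun x => x.1 * cre n x + (- x.2) * cim n x. Proof. by []. Qed.
Lemma cimS n : cim n.+1 = fun x => x.1 * cim n x + x.2 * cre n x. Proof. by []. Qed.

Lemma cpow_polar n (r t : R) : cre n (polar r t) = r ^+ n * cos (n%:R * t) /\ cim n (polar r t) = r ^+ n * sin (n%:R * t).
Proof.
elim: n => [|n [IH1 IH2]]; first by rewrite /cre /cim/= mul0r cos0 sin0 mulr1 mulr0.
rewrite creS cimS/= IH1 IH2 -natr1 mulrDl mul1r cosD sinD exprS; split; ring.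
Qed.

Lemma cpow_norm n (x : R * R) : cre n x ^+ 2 + cim n x ^+ 2 = (enorm x ^+ n) ^+ 2.
Proof.
have [t _ ->] := polar_angle x; rewrite enorm_polar ?enorm_ge0//.
have [-> ->] := cpow_polar n (enorm x) t.
by rewrite !exprMn -mulrDr cos2Dsin2 mulr1.
Qed.

Lemma cpow_bound n (x : R * R) : `|cre n x| <= enorm x ^+ n /\ `|cim n x| <= enorm x ^+ n.
Proof.
have h0 : 0 <= enorm x ^+ n by rewrite exprn_ge0 ?enorm_ge0.
have h := cpow_norm n x.
split; rewrite -(ger0_norm h0) -ler_sqr ?nnegrE// !real_normK ?num_real// -h.
  by rewrite lerDl sqr_ge0.
by rewrite lerDr sqr_ge0.
Qed.

Lemma cpow_sm n e a : sm e a (cre n) /\ sm e a (cim n).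
Proof.
elim: n => [|n [h1 h2]]; first by split; exact: sm_cst.
rewrite creS cimS; split; apply: sm_add; apply: sm_mul => //; try exact: sm_fst; try exact: sm_snd.
have -> : (fun x : R * R => - x.2) = (fun x => (-1) * x.2) by apply/funext => x; rewrite mulN1r.
by apply: sm_mul; [exact: sm_cst|exact: sm_snd].
Qed.

Lemma cpow_cont n : continuous (cre n) /\ continuous (cim n).
Proof. by have [h1 h2] := cpow_sm n 1 0; split; apply: sm_cont; [exact: ltr01|exact: h1|exact: ltr01|exact: h2]. Qed.

Lemma cpow_grad n :
  grad_of (cre n) (fun x => n%:R * cre n.-1 x) (fun x => - (n%:R * cim n.-1 x)) /\
  grad_of (cim n) (fun x => n%:R * cim n.-1 x) (fun x => n%:R * cre n.-1 x).
Proof.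
have gx : grad_of (fun x : R * R => x.1) (fun=> 1) (fun=> 0) by move=> x; split; [exact: derI|exact: derC].
have gy : grad_of (fun x : R * R => x.2) (fun=> 0) (fun=> 1) by move=> x; split; [exact: derC|exact: derI].
have gny : grad_of (fun x : R * R => - x.2) (fun=> 0) (fun=> - 1).
  by move=> x; split; [exact: (derC (- x.2) _)|exact: derN (derI _)].
elim: n => [|n [IH1 IH2]].
  by split=> x; rewrite !mul0r ?oppr0; split; exact: derC.
have k1 x : n%:R * cre n x = n%:R * (x.1 * cre n.-1 x + - x.2 * cim n.-1 x).
  by case: n {IH1 IH2} => [|n]; rewrite ?mul0r.
have k2 x : n%:R * cim n x = n%:R * (x.1 * cim n.-1 x + x.2 * cre n.-1 x).
  by case: n {IH1 IH2 k1} => [|n]; rewrite ?mul0r.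
have ext f f1 f2 h1 h2 : grad_of f f1 f2 -> (forall x, f1 x = h1 x) -> (forall x, f2 x = h2 x) -> grad_of f h1 h2.
  by move=> g e1 e2 x; rewrite -e1 -e2.
rewrite creS cimS /= -natr1; split.
  apply: ext (gradD (gradM gx IH1) (gradM gny IH2)) _ _ => x; rewrite mulrDl ?k1 ?k2; ring.
by apply: ext (gradD (gradM gx IH2) (gradM gy IH1)) _ _ => x; rewrite mulrDl ?k1 ?k2; ring.
Qed.

(** Harmonic extension of the i-th Fourier mode, with the numbering of [trig]; [harm1] and [harm2]
    are its partial derivatives. *)
Definition harm (i : nat) : R * R -> R := if odd i then cim (uphalf i) else cre (uphalf i).
Definition harm1 (i : nat) (x : R * R) : R :=
  freq i * (if odd i then cim (uphalf i).-1 x else cre (uphalf i).-1 x).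
Definition harm2 (i : nat) (x : R * R) : R :=
  freq i * (if odd i then cre (uphalf i).-1 x else - cim (uphalf i).-1 x).

Lemma harm_gpoly i : gpoly (harm i) (harm1 i) (harm2 i).
Proof.
have [g1 g2] := cpow_grad (uphalf i); have [c1 c2] := cpow_cont (uphalf i).-1.
rewrite /harm /harm1 /harm2 /freq; case: odd; split => //.
- by move=> e a; have [] := cpow_sm (uphalf i) e a.
- by apply: plane_ctsM => //; exact: plane_ctsC.
- by apply: plane_ctsM => //; exact: plane_ctsC.
- by move=> e a; have [] := cpow_sm (uphalf i) e a.
- by move=> x; rewrite mulrN; exact: g1.
- by apply: plane_ctsM => //; exact: plane_ctsC.
- by apply: plane_ctsM; [exact: plane_ctsC|exact: plane_ctsN].
Qed.

Lemma harm_polar i (r t : R) : harm i (polar r t) = r ^+ uphalf i * trig i t.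
Proof. by rewrite /harm /trig /freq; have [h1 h2] := cpow_polar (uphalf i) r t; case: odd. Qed.

Lemma harm_bound i (x : R * R) : [/\ `|harm i x| <= enorm x ^+ uphalf i,
  `|harm1 i x| <= (uphalf i)%:R * enorm x ^+ (uphalf i).-1 & `|harm2 i x| <= (uphalf i)%:R * enorm x ^+ (uphalf i).-1].
Proof.
have [a1 a2] := cpow_bound (uphalf i) x; have [b1 b2] := cpow_bound (uphalf i).-1 x.
rewrite /harm /harm1 /harm2 /freq !normrM !(ger0_norm (ler0n R _)).
by case: odd; split => //; rewrite ler_wpM2l// ?normrN.
Qed.

Lemma harm_grad_polar i (r t : R) :
  cos t * harm1 i (polar r t) + sin t * harm2 i (polar r t) = freq i * r ^+ (uphalf i).-1 * trig i t /\
  - sin t * harm1 i (polar r t) + cos t * harm2 i (polar r t) = r ^+ (uphalf i).-1 * dtrig i t.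
Proof.
rewrite /harm1 /harm2 /trig /dtrig /freq; have [-> ->] := cpow_polar (uphalf i).-1 r t.
case: (uphalf i) => [|n]; first by rewrite !mul0r; case: odd; rewrite ?mulr0 ?oppr0 ?mulr0 addr0.
rewrite /= -natr1 !mulrDl !mul1r sinD cosD; have := cos2Dsin2 t.
move: (cos t) (sin t) (cos (n%:R * t)) (sin (n%:R * t)) (r ^+ n) (n%:R) => c s C S q m e.
by case: odd; split; nra.
Qed.

End complex_powers.

(** * The minimizer as a profile *)

Section radial_profile.
Context {R : realType}.
Notation mu := (@lebesgue_measure R).
Notation plane := (measurableTypeR R * measurableTypeR R)%type.
Notation lebp := (@lebp R).
Notation B := (@ball2 R).
Notation IB := (ii lebp B).
Notation L2 := (L2 lebp B).
Notation L1 := (L1 lebp B).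
Notation T := (pi *+ 2 : R).

Let mB : measurable (B : set plane). Proof. exact: measurable_ball2. Qed.

Lemma klam_L2 (a : R) : 0 < a -> a < 1 ->
  L2 (klam a (fun x => x.1)) /\ L2 (klam a (fun x => x.2)).
Proof. by move=> a0 a1; have [_ h1 h2] := H10_L2 (H10_lam a0 a1). Qed.

Lemma lam_bound (a : R) x : 0 < a -> B x -> `|lam a x| <= `|ln a|.
Proof.
move=> a0 Bx; rewrite /lam normrN; have [a1|a1] := leP 1 a.
  by rewrite max_r// ltW// (lt_le_trans (_ : enorm x < 1)).
have m0 : 0 < Num.max (enorm x) a by rewrite lt_max a0 orbT.
have m1 : Num.max (enorm x) a <= 1 by rewrite ge_max (ltW a1) ltW.
by rewrite !ler0_norm ?ln_le0 ?(ltW a1)// lerN2 ler_ln ?posrE// le_max lexx orbT.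
Qed.

Lemma lam_cont (a : R) : 0 < a -> continuous (lam a).
Proof.
move=> a0; apply: (@plane_ctsN R (fun x => ln (Num.max (enorm x) a))).
have := @plane_cts_comp R (@enorm R) (fun r => ln (Num.max r a)) (@enorm_cont R); apply.
by apply: (cts_max_comp a0) => s s0; exact: continuous_ln.
Qed.

Section data.
Variables (alpha p : R) (u g1 g2 : R * R -> R).
Hypothesis alpha0 : 0 <= alpha.
Hypothesis p1 : 1 < p.
Hypothesis Hu : H10 u g1 g2.
Hypothesis ru : radial u.
Hypothesis upos : {ae lebp, forall x, B x -> 0 < u x}.

Definition src x := wt alpha x * `|u x| `^ p.

Hypothesis srcL1 : L1 src.
Hypothesis EL : forall a, 0 < a -> a < 1 ->
  IB (fun x => g1 x * klam a (fun x => x.1) x) + IB (fun x => g2 x * klam a (fun x => x.2) x) =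
  IB (fun x => src x * lam a x).

Definition kT : R := kappa * T.

Lemma kT_gt0 : 0 < kT. Proof. by rewrite mulr_gt0 ?kappa_gt0 ?T_gt0. Qed.

(** The value u must have at radius a: the tested equation has this right-hand side, and its
    left-hand side is a circle mean. The divisor [kT] is 2 pi. *)
Definition W (a : R) : R := IB (fun x => src x * lam a x) / kT.

(** By the divergence theorem this is -a u'(a), the future X. *)
Definition flux (a : R) : R := IB (fun x => if enorm x < a then src x else 0) / kT.

Definition mass : R := IB src / kT.

Lemma src_ge0 x : 0 <= src x. Proof. by rewrite mulr_ge0 ?powR_ge0. Qed.

Lemma src_lam_L1 a : 0 < a -> L1 (fun x => src x * lam a x).
Proof.
move=> a0; apply: (@L1_le _ _ _ lebp B mB _ (fun x => `|ln a| * src x)); last exact: (L1Z mB).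
  apply: measurable_funM; first exact: (L1_meas srcL1).
  by apply: measurable_funTS; apply: continuous_measurable_plane; exact: lam_cont.
by move=> x Bx; rewrite normrM (ger0_norm (src_ge0 x)) mulrC ler_wpM2r ?src_ge0// lam_bound.
Qed.

Lemma flux_L1 a : L1 (fun x => if enorm x < a then src x else 0).
Proof. by apply: L1_if => //; exact: enorm_lt_meas. Qed.

Lemma flux_ge0 a : 0 <= flux a.
Proof.
rewrite divr_ge0 ?(ltW kT_gt0)//; apply: ii_ge0 => x _; by case: ifP => _; rewrite ?src_ge0.
Qed.

Lemma flux_mono a b : a <= b -> flux a <= flux b.
Proof.
move=> ab; rewrite ler_pM2r ?invr_gt0 ?kT_gt0//; apply: (ii_le mB); try exact: flux_L1.
move=> x _; case: ifP => h; last by case: ifP => _; rewrite ?src_ge0.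
by rewrite (lt_le_trans h ab).
Qed.

Lemma flux_neg a : a <= 0 -> flux a = 0.
Proof.
move=> a0; rewrite /flux /ii /Rintegral integral0_eq ?mul0r// => x _.
by rewrite ltNge (le_trans a0 (enorm_ge0 x)).
Qed.

Lemma flux_ge1 a : 1 <= a -> flux a = mass.
Proof.
move=> a1; congr (_ / _); apply: (eq_ii lebp) => x Bx.
by rewrite (lt_le_trans (_ : enorm x < 1)).
Qed.

Lemma W_ge1 a : 1 <= a -> W a = - (ln a * mass).
Proof.
move=> a1; rewrite /W /mass -mulNr mulrA; congr (_ / _); rewrite -(iiZ mB)//; apply: (eq_ii lebp) => x Bx.
rewrite /lam max_r 1?mulrC// ltW// (lt_le_trans (_ : enorm x < 1))//.
Qed.

Lemma W1 : W 1 = 0. Proof. by rewrite W_ge1// ln1 mul0r oppr0. Qed.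

(** [lam a] - [lam b] equals ln (b / a) for |x| < a, vanishes for |x| >= b and lies between these
    values in the annulus. Monotonicity, continuity and differentiability of W all come from this
    sandwich. *)
Lemma W_diff a b : 0 < a -> a <= b ->
  flux a * ln (b / a) <= W a - W b /\ W a - W b <= flux b * ln (b / a).
Proof.
move=> a0 ab; have b0 : 0 < b := lt_le_trans a0 ab.
have ba : 0 <= ln (b / a) by rewrite ln_ge0// ler_pdivlMr// mul1r.
have lE : ln (b / a) = ln b - ln a by rewrite ln_div ?posrE.
have -> : W a - W b = IB (fun x => src x * (lam a x - lam b x)) / kT.
  rewrite /W -mulrBl -(iiB mB); [|exact: src_lam_L1|exact: src_lam_L1].
  by congr (_ / _); apply: (eq_ii lebp) => x _; rewrite mulrBr.
have lint : L1 (fun x => src x * (lam a x - lam b x)).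
  by apply: (eq_L1 mB) (L1B mB (src_lam_L1 a0) (src_lam_L1 b0)) => x _; rewrite mulrBr.
have key x : (enorm x < a -> lam a x - lam b x = ln (b / a)) /\ (b <= enorm x -> lam a x - lam b x = 0) /\
    0 <= lam a x - lam b x <= ln (b / a).
  have h0 : 0 < Num.max (enorm x) a by rewrite lt_max a0 orbT.
  have h1 : 0 < Num.max (enorm x) b by rewrite lt_max b0 orbT.
  have E : lam a x - lam b x = ln (Num.max (enorm x) b) - ln (Num.max (enorm x) a) by rewrite /lam; ring.
  split.
    by move=> xa; rewrite E !max_r ?lE// ltW// (lt_le_trans xa).
  split.
    by move=> bx; rewrite E !max_l ?subrr// (le_trans ab).
  rewrite E; apply/andP; split.
    by rewrite subr_ge0 ler_ln ?posrE// ge_max !le_max lexx ab orbT.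
  have ba0 : 0 < b / a by rewrite divr_gt0.
  rewrite lE lerBlDr -lE -lnM ?posrE// ler_ln ?posrE ?(mulr_gt0 ba0)//.
  rewrite ge_max; apply/andP; split.
    rewrite (@le_trans _ _ (Num.max (enorm x) a))//; first by rewrite le_max lexx.
    by rewrite ler_peMl ?(ltW h0)// ler_pdivlMr// mul1r.
  by rewrite -mulrA ler_peMr ?(ltW b0)// ler_pdivlMl// mulr1 le_max lexx orbT.
have flE c : flux c * ln (b / a) = IB (fun x => ln (b / a) * (if enorm x < c then src x else 0)) / kT.
  by rewrite (iiZ mB) /flux; [ring|exact: flux_L1].
split; rewrite flE ler_pM2r ?invr_gt0 ?kT_gt0//; apply: (ii_le mB) => //; try (by apply: (L1Z mB); exact: flux_L1).
  move=> x _; have [k1 [k2 /andP[k3 k4]]] := key x; case: ifP => h; first by rewrite k1// mulrC.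
  by rewrite mulr0 mulr_ge0// src_ge0.
move=> x _; have [k1 [k2 /andP[k3 k4]]] := key x; case: ifP => h; first by rewrite mulrC ler_wpM2r ?src_ge0.
by rewrite k2 ?mulr0// leNgt h.
Qed.

Lemma W_noninc a b : 0 < a -> a <= b -> W b <= W a.
Proof.
move=> a0 ab; have [h _] := W_diff a0 ab; rewrite -subr_ge0 (le_trans _ h)// mulr_ge0 ?flux_ge0//.
by rewrite ln_ge0// ler_pdivlMr// mul1r.
Qed.

Lemma flux_le_mass a : flux a <= mass.
Proof. by rewrite -(@flux_ge1 (Num.max a 1)) ?le_max ?lexx ?orbT//; apply: flux_mono; rewrite le_max lexx. Qed.

Lemma W_cont a : 0 < a -> {for a, continuous W}.
Proof.
move=> a0; apply/cvgrPdist_le => e e0.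
have m0 : 0 < mass + 1 by rewrite ltr_wpDl// (le_trans (flux_ge0 0)) ?flux_le_mass.
have e'0 : 0 < e / (mass + 1) by rewrite divr_gt0.
have /cvgrPdist_le/(_ _ e'0) := continuous_ln a0.
apply: filterS2 (lt_nbhsr a0) => b b0 lab.
have main x y : 0 < x -> x <= y -> `|W x - W y| <= mass * `|ln x - ln y|.
  move=> x0 xy; have y0 := lt_le_trans x0 xy; have [h1 h2] := W_diff x0 xy.
  have l0 : 0 <= ln (y / x) by rewrite ln_ge0// ler_pdivlMr// mul1r.
  have E : ln (y / x) = ln y - ln x by rewrite ln_div ?posrE.
  rewrite ger0_norm ?subr_ge0 ?W_noninc// distrC -E ger0_norm//.
  by apply: le_trans h2 _; rewrite ler_wpM2r// flux_le_mass.
have {}main : `|W a - W b| <= mass * `|ln a - ln b|.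
  have [ab|ba] := leP a b; first exact: main.
  by rewrite distrC [`|ln a - _|]distrC; apply: main => //; exact: ltW.
apply: le_trans main _; apply: (@le_trans _ _ ((mass + 1) * `|ln a - ln b|)).
  by rewrite ler_wpM2r// lerDl.
by rewrite mulrC -ler_pdivlMr.
Qed.

Lemma W_max_cont (a0 : R) : 0 < a0 -> continuous (fun r : R => W (Num.max r a0)).
Proof. by move=> h; apply: (cts_max_comp h) => s; exact: W_cont. Qed.

Lemma W_enorm_meas : measurable_fun setT ((fun x => if 0 < enorm x then W (enorm x) else 0) : plane -> R).
Proof.
have mW : measurable_fun setT ((fun r => if 0 < r then W r else 0) : measurableTypeR R -> R).
  have -> : (fun r => if 0 < r then W r else 0) = W \_ `]0, +oo[%classic.
    apply/funext => r; rewrite patchE; congr (if _ then _ else _).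
    by apply/idP/idP; rewrite inE/= in_itv/= andbT.
  have [+ _] := @measurable_restrictT _ _ (measurableTypeR R) (measurableTypeR R) `]0, +oo[%classic W (measurable_itv _).
  apply; apply: open_continuous_measurable_fun; first exact: interval_open.
  by move=> r; rewrite inE/= in_itv/= andbT; exact: W_cont.
exact: measurableT_comp mW (@measurable_enorm R).
Qed.

Lemma min_sqr_bound (a b : R) : Num.min `|a + b| 1 ^+ 2 <= 2 * a ^+ 2 + 2 * Num.min `|b| 1 ^+ 2.
Proof.
have h : Num.min `|a + b| 1 <= `|a| + Num.min `|b| 1.
  rewrite ge_min; have [b1|b1] := leP `|b| 1; first by rewrite ler_normD.
  by rewrite (_ : 1 <= `|a| + 1) ?orbT// lerDr.
have h0 : 0 <= Num.min `|a + b| 1 by rewrite le_min normr_ge0/=.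
have h1 : 0 <= Num.min `|b| 1 by rewrite le_min normr_ge0/=.
apply: (@le_trans _ _ ((`|a| + Num.min `|b| 1) ^+ 2)).
  by rewrite ler_pXn2r ?nnegrE// addr_ge0.
rewrite -[a ^+ 2]real_normK ?num_real//; move: (`|a|) (Num.min `|b| 1) => x y.
by have := sqr_ge0 (x - y); nra.
Qed.

Lemma min_sqr_bound3 (a b c : R) : Num.min `|a - c| 1 ^+ 2 <= 2 * (b - a) ^+ 2 + 2 * Num.min `|b - c| 1 ^+ 2.
Proof.
by have := min_sqr_bound (a - b) (b - c); rewrite addrA subrK [(a - b) ^+ 2](_ : _ = (b - a) ^+ 2)//; ring.
Qed.

(** For approximating test functions, circle averages converge pointwise to W by [circle_formula]
    and the tested equation, and in the [L2] norm to u by [avg_contract]; the two limits agree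
    almost everywhere. *)
Lemma u_eq_W : {ae lebp, forall x, B x -> u x = W (enorm x)}.
Proof.
have [[hu hg1 hg2] [phi [ht [c0 c1 c2]]]] := H10_seq Hu.
have sm n : smooth2 (phi n) by case: (ht n).
pose A n x := cmean (phi n) (enorm x) / T.
pose V x := if 0 < enorm x then W (enorm x) else 0.
have cA n : continuous (A n).
  apply: plane_ctsM; last exact: plane_ctsC.
  exact: (plane_cts_comp enorm_cont (cts_polar_itg (smooth2_cont (sm n)))).
have cvA x : B x -> 0 < enorm x -> A n x @[n --> \oo] --> V x.
  move=> Bx x0; rewrite /V x0; have x1 : enorm x < 1 := Bx.
  have [k1 k2] := klam_L2 x0 x1.
  have h1 := cvg_ip mB (fun n => smooth2_L2 (smooth2_pd true (sm n))) hg1 k1 c1.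
  have h2 := cvg_ip mB (fun n => smooth2_L2 (smooth2_pd false (sm n))) hg2 k2 c2.
  have h := cvgD h1 h2; rewrite EL// in h.
  have {}h : (fun n => kappa * cmean (phi n) (enorm x) / kT) @ \oo --> W (enorm x).
    apply: cvgM; last exact: cvg_cst.
    have E : (fun n => kappa * cmean (phi n) (enorm x)) =
      (fun n => IB (fun y => pd true (phi n) y * klam (enorm x) (fun x => x.1) y)) \+
      (fun n => IB (fun y => pd false (phi n) y * klam (enorm x) (fun x => x.2) y)).
      by apply/funext => n /=; rewrite -circle_formula.
    rewrite E; exact: h.
  apply: cvg_trans h; apply: near_eq_cvg; apply: nearW => n /=.
  rewrite /A /kT; have := @kappa_gt0 R; have := @T_gt0 R; move: (T) (kappa) => t k t0 k0.
  by field; rewrite !gt_eqF.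
have mV := W_enorm_meas; rewrite -/V in mV.
pose m n x := Num.min `|A n x - V x| 1.
have mm n : measurable_fun (B : set plane) (m n).
  apply: measurable_funTS; apply: measurable_minr; last exact: measurable_cst.
  apply: measurableT_comp => //; apply: measurable_funB => //; exact: continuous_measurable_plane.
have m0 n x : 0 <= m n x by rewrite le_min normr_ge0/=.
have [lm _ cm] : [/\ (forall n, L2 (m n)), L2 (fun=> 0) & (fun n => dist2 (m n) (fun=> 0)) @ \oo --> (0 : R)].
  apply: (@dct_ball _ m (fun=> 0) 1) => //.
  - by move=> n x _ _; rewrite ger0_norm// ge_min lexx orbT.
  - move=> x Bx x0; have h := cvA x Bx x0.
    apply/cvgrPdist_le => e e0; move/cvgrPdist_le/(_ e e0): h; apply: filterS => n hn.
    by rewrite sub0r normrN ger0_norm// (le_trans _ hn)// distrC ge_min lexx.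
(* W could still be unbounded at the origin at this stage; truncating the difference at 1 secures
   square integrability and domination. *)
pose z x := Num.min `|u x - V x| 1.
have z0 x : 0 <= z x by rewrite le_min normr_ge0/=.
have mz : measurable_fun (B : set plane) z.
  apply: measurable_minr; last exact: measurable_cst.
  apply: measurableT_comp => //; apply: measurable_funB; [exact: hu.1|exact: measurable_funTS].
have lz : L2 z.
  by apply: (@L2_bounded_cst R 1) => // x _; rewrite ger0_norm// ge_min lexx orbT.
have zle n : IB (fun x => z x ^+ 2) <= 2 * dist2 (phi n) u + 2 * dist2 (m n) (fun=> 0).
  have avg := avg_contract (smooth2_cont (sm n)) hu ru; rewrite -/(A n) in avg.
  have lA := continuous_L2 (cA n).
  apply: (@le_trans _ _ (2 * dist2 (A n) u + 2 * dist2 (m n) (fun=> 0))); last by lra.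
  have d1 := (L2B mB lA hu).2; have d2 : L1 (fun x => (m n x - 0) ^+ 2).
    by apply: (eq_L1 mB) (lm n).2 => x _; rewrite subr0.
  rewrite /dist2 -(ii_lin2 mB)//; apply: (ii_le mB); [exact: lz.2|by apply: (L1D mB); exact: (L1Z mB)|].
  by move=> x _; rewrite subr0; exact: min_sqr_bound3.
have zz : IB (fun x => z x ^+ 2) = 0.
  apply/eqP; rewrite eq_le; apply/andP; split; last by apply: ii_ge0 => x _; exact: sqr_ge0.
  have lim : (fun n => 2 * dist2 (phi n) u + 2 * dist2 (m n) (fun=> 0)) @ \oo --> (2 * 0 + 2 * 0 : R).
    by apply: cvgD; apply: cvgM => //; exact: cvg_cst.
  have l0 : 2 * 0 + 2 * 0 = 0 :> R by ring.
  rewrite -l0 -(cvg_lim _ lim)//; apply: limr_ge; first by apply/cvg_ex; eexists; exact: lim.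
  exact: nearW.
have m2 : measurable_fun (B : set plane) (EFin \o (fun x => z x ^+ 2)).
  by apply/measurable_EFinP; apply: measurable_funX.
have : (\int[lebp]_(x in B) `|(z x ^+ 2)%:E| = 0)%E.
  transitivity (\int[lebp]_(x in B) (z x ^+ 2)%:E)%E; last by have := L1E mB lz.2; rewrite zz.
  by apply: eq_integral => x _; rewrite abse_EFin ger0_norm ?sqr_ge0.
move=> /(ae_eq_integral_abs lebp mB m2).1 h0.
have {}h0 : {ae lebp, forall x, B x -> z x ^+ 2 = 0}.
  by apply: filterS h0 => x hx Bx; have := hx Bx => /= -[].
have pos : {ae lebp, forall x, 0 < enorm x} := @ae_enorm_gt0 R.
apply: (aeS2 h0 pos) => x hx x0 Bx; have /eqP := hx Bx; rewrite sqrf_eq0 /z /V x0 => zx.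
have : `|u x - W (enorm x)| = 0.
  by move: zx; have [h|h] := leP `|u x - W (enorm x)| 1 => /eqP // /eqP; rewrite oner_eq0.
by move/normr0_eq0/eqP; rewrite subr_eq0 => /eqP.
Qed.

Lemma eq_ii_ae f g : L1 f -> L1 g -> {ae lebp, forall x, B x -> f x = g x} -> IB f = IB g.
Proof.
move=> hf hg fg; have {}fg : {ae lebp, forall x, B x -> f x = g x} := fg.
apply/eqP; rewrite eq_le; apply/andP; split; apply: ii_le_ae => //; apply: (aeS fg) => x h Bx; by rewrite h.
Qed.

(** W is nonincreasing, so W a <= 0 would make u <= 0 on an annulus of positive measure, against the
    positivity of u. *)
Lemma W_pos a : 0 < a -> a < 1 -> 0 < W a.
Proof.
move=> a0 a1; rewrite ltNge; apply/negP => Wa.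
pose one x := if a <= enorm x then 1 else 0 : R.
have c1 : continuous (fun _ : R * R => 1 : R) by exact: plane_ctsC.
have I1 : IB one = kappa * (T * ((1 - a ^+ 2) / 2)).
  rewrite /one (polar_cut (ltW a0) (ltW a1) c1); congr (_ * _).
  rewrite (@itg_FTC _ a 1 (fun r => T * (r ^+ 2 / 2))) ?(ltW a1)//; first by field.
  - by apply: ctsM; [exact: ctsI|exact: ctsC].
  - by apply: ctsM; [exact: ctsC|apply: ctsM; [apply: ctsX; exact: ctsI|exact: ctsC]].
  move=> x _; apply: der_eq (derZ T (derM (derX2 (derI x)) (derC _ _))) _.
  rewrite itg_cst ?(ltW T_gt0)//; move: (T) => t; by field.
have h1 : L1 one by exact: (L1_cut a c1).
have h0 : L1 (fun=> 0) by exact: L1_cst.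
have : IB one <= IB (fun=> 0).
  have up : {ae lebp, forall x, B x -> 0 < u x} := upos.
  apply: ii_le_ae => //; apply: (aeS2 up u_eq_W) => x h2 h3 Bx; rewrite /one; case: ifP => // ax.
  by have := h2 Bx; rewrite h3// ltNge (le_trans _ Wa)// W_noninc.
apply/negP; rewrite -ltNge I1.
have -> : IB (fun=> 0) = 0 by rewrite /ii /Rintegral integral0_eq.
have a2 : 0 < (1 - a ^+ 2) / 2 by rewrite divr_gt0// subr_gt0 expr_lt1// ltW.
by rewrite (mulr_gt0 kappa_gt0)// (mulr_gt0 T_gt0).
Qed.

Lemma W_le0 a : 1 <= a -> W a <= 0.
Proof. by move=> a1; rewrite W_ge1// oppr_le0 mulr_ge0 ?ln_ge0// (le_trans (flux_ge0 0)) ?flux_le_mass. Qed.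

(** The derivative of the flux, frozen below radius a0 to be continuous on the whole line. *)
Definition fluxd (a0 r : R) := pp (1 + alpha) r * pp p (W (Num.max r a0)).

Lemma fluxd_cont a0 : 0 < a0 -> continuous (fluxd a0).
Proof.
move=> h; apply: ctsM; first by apply: pp_cont; move: alpha0; lra.
apply: (@cts_comp _ (pp p)); [by apply: pp_cont; move: p1; lra|exact: W_max_cont].
Qed.

(** The complement is computed rather than the flux itself because polar coordinates on an annulus
    stay away from the origin, where W is not yet controlled. *)
Lemma flux_compl a0 a : 0 < a0 -> a0 <= a -> a <= 1 -> mass - flux a = itg a 1 (fluxd a0).
Proof.
move=> h0 a0a a1; have a_0 := lt_le_trans h0 a0a.
pose g r := pp (1 + alpha) (Num.max r a0) / Num.max r a0 * pp p (W (Num.max r a0)).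
have cg : continuous g.
  apply: (@cts_max_comp R (fun s => pp (1 + alpha) s / s * pp p (W s)) _ h0) => s s0.
  apply: cvgM; first apply: cvgM.
  - by apply: pp_cont; move: alpha0; lra.
  - by apply: cvgV; [rewrite gt_eqF|exact: cvg_id].
  apply: (@continuous_comp _ _ _ W (pp p)); first exact: W_cont.
  by apply: pp_cont; move: p1; lra.
have cf : continuous (fun x => g (enorm x)) by exact: (plane_cts_comp enorm_cont cg).
have E : IB (fun x => if a <= enorm x then src x else 0) = kT * itg a 1 (fluxd a0).
  transitivity (IB (fun x => if a <= enorm x then g (enorm x) else 0)).
    apply: eq_ii_ae; [|exact: (L1_cut a cf)|].
      apply: L1_if => //; rewrite (_ : (fun _ => _) = ~` (fun x => enorm x < a)).
        by apply: measurableC; exact: enorm_lt_meas.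
      by apply/funext => x; apply/propext; rewrite leNgt; split => [/negP|h]//; apply/negP.
    have up : {ae lebp, forall x, B x -> 0 < u x} := upos.
    apply: (aeS2 up u_eq_W) => x h1 h2 Bx; case: ifP => // ax.
    have ax0 : a0 <= enorm x by rewrite (le_trans a0a).
    have x0 : 0 < enorm x by rewrite (lt_le_trans h0).
    rewrite /g /src /wt (max_l ax0) h2// -h2// gtr0_norm ?h1// (ppE p (ltW (h1 Bx))); congr (_ * _).
    by rewrite pp1D// mulrAC mulfV ?mul1r// gt_eqF.
  rewrite (polar_cut (ltW a_0) a1 cf) /kT -mulrA; congr (_ * _).
  rewrite -itgZ; last exact: fluxd_cont.
  apply: eq_itg => r /andP[ar r1]; have r0 : 0 < r by rewrite (lt_le_trans a_0).
  have -> : itg 0 T (fun t => g (enorm (polar r t))) = T * g r.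
    under [X in itg _ _ X]funext => t do rewrite enorm_polar ?(ltW r0)//.
    by rewrite itg_cst ?ltW ?T_gt0// subr0 mulrC.
  rewrite /g /fluxd (max_l (le_trans a0a ar)); have := gt_eqF r0; move: (T) => t rn.
  by field; rewrite rn.
have -> : itg a 1 (fluxd a0) = IB (fun x => if a <= enorm x then src x else 0) / kT.
  by rewrite E mulrC mulKf// gt_eqF ?kT_gt0.
rewrite /mass /flux -mulrBl; congr (_ / _); rewrite -(iiB mB)//; last exact: flux_L1.
by apply: (eq_ii lebp) => x _; rewrite leNgt; case: ifP => _ /=; rewrite ?subrr ?subr0.
Qed.

(** Beyond radius 1 the flux is constant, and the formula agrees because W <= 0 there and [pp] cuts
    off negative values. *)
Lemma der_flux a : 0 < a -> isd a flux (pp (1 + alpha) a * pp p (W a)).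
Proof.
move=> a_0; pose a0 := Num.min (a / 2) (1 / 2).
have h0 : 0 < a0 by rewrite lt_min !divr_gt0.
have h1 : a0 < 1 by rewrite gt_min; apply/orP; right; lra.
have h2 : a0 < a by rewrite gt_min; apply/orP; left; lra.
have cd := fluxd_cont h0; have [N N0 dN] := antiderivative cd.
have cN : continuous N by move=> x; exact: der_cts (dN x).
have key b : a0 <= b -> flux b = mass - N 1 + N b.
  move=> ab; have [b1|b1] := leP b 1.
    have := flux_compl h0 ab b1; rewrite (itg_FTC b1 cd cN) => [|x _]; last exact: dN.
    by move=> e; lra.
  have : itg 1 b (fluxd a0) = 0.
    rewrite (@eq_itg _ 1 b _ (fun=> 0)) ?itg_cst ?mul0r ?(ltW b1)// => x /andP[x1 _].
    rewrite /fluxd max_l ?(le_trans (ltW h1))// (@pp_neg _ p) ?mulr0 ?W_le0//.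
    by apply/eqP; move: p1; lra.
  rewrite (itg_FTC (ltW b1) cd cN) => [|x _]; last exact: dN.
  by rewrite flux_ge1 ?(ltW b1)//; lra.
apply: (@der_near _ (fun b => mass - N 1 + N b)).
  by apply: filterS (lt_nbhsr h2) => b b0; rewrite key// ltW.
apply: der_eq (derD (derC _ _) (dN a)) _.
by rewrite add0r /fluxd max_l// ltW.
Qed.

Lemma der_W a : 0 < a -> isd a W (- (flux a / a)).
Proof.
move=> a0; have dln : isd a (@ln R) a^-1 by exact: is_derive1_ln.
(* By [W_diff] the increment of this function from a to b is at most |flux a - flux b| |ln b - ln
   a|, hence o(|b - a|). *)
suff h : isd a (fun b => W b + flux a * ln b) 0.
  have -> : W = (fun b => W b + flux a * ln b - flux a * ln b) by apply/funext => b; rewrite addrK.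
  by apply: der_eq (derB h (derZ (flux a) dln)) _; rewrite sub0r.
apply: slope_der => e e0; have c0 : 0 < a^-1 + 1 by rewrite addr_gt0 ?invr_gt0.
have e1 : 0 < e / (a^-1 + 1) by rewrite divr_gt0.
have /cvgrPdist_le/(_ _ e1) hf := der_cts (der_flux a0).
have hl := der_slope dln ltr01.
apply: filterS3 hf hl (lt_nbhsr a0) => b hf hl b0.
rewrite mul0r subr0.
have dl : `|ln b - ln a| <= (a^-1 + 1) * `|b - a|.
  rewrite -(subrK (a^-1 * (b - a)) (ln b - ln a)) (le_trans (ler_normD _ _))// normrM.
  by rewrite (gtr0_norm (_ : 0 < a^-1)) ?invr_gt0//; lra.
have main : `|W b + flux a * ln b - (W a + flux a * ln a)| <= `|flux a - flux b| * `|ln b - ln a|.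
  have [ab|ba] := leP a b.
    have [l1 l2] := W_diff a0 ab; move: l1 l2; rewrite ln_div ?posrE//.
    have l0 : 0 <= ln b - ln a by rewrite subr_ge0 ler_ln ?posrE.
    have f0 : flux a <= flux b by exact: flux_mono.
    rewrite (ger0_norm l0) [`|flux a - _|]distrC (ger0_norm (_ : 0 <= flux b - _)) ?subr_ge0// => l1 l2.
    by rewrite ler_norml; apply/andP; split; nra.
  have [l1 l2] := W_diff b0 (ltW ba); move: l1 l2; rewrite ln_div ?posrE//.
  have l0 : 0 <= ln a - ln b by rewrite subr_ge0 ler_ln ?posrE// ltW.
  have f0 : flux b <= flux a by rewrite flux_mono// ltW.
  rewrite [`|ln b - _|]distrC (ger0_norm l0) (ger0_norm (_ : 0 <= flux a - _)) ?subr_ge0// => l1 l2.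
  by rewrite ler_norml; apply/andP; split; nra.
apply: le_trans main _; apply: (@le_trans _ _ (e / (a^-1 + 1) * ((a^-1 + 1) * `|b - a|))).
  by apply: ler_pM.
by rewrite mulrA divfK ?gt_eqF.
Qed.

Lemma flux0 : (fun n => flux (harmonic n)) @ \oo --> (0 : R).
Proof. by rewrite -(mul0r kT^-1); apply: cvgM; [exact: disc_cvg0|exact: cvg_cst]. Qed.

Lemma ln_inv_sublinear (b : R) : 0 < b -> b * - ln b <= 1.
Proof.
move=> b0; have := ln_sublinear (_ : 0 < b^-1); rewrite lnV ?posrE// invr_gt0 => /(_ b0) h.
by rewrite -(mulfV (lt0r_neq0 b0)) ler_pM2l// ltW.
Qed.

Lemma W_le_ln a : 0 < a -> a <= 1 -> W a <= mass * - ln a.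
Proof.
move=> a0 a1; have [_] := W_diff a0 a1; rewrite W1 subr0 div1r lnV ?posrE// => h; apply: le_trans h _.
by rewrite ler_wpM2r ?flux_le_mass// oppr_ge0 ln_le0.
Qed.

Lemma mass_ge0 : 0 <= mass. Proof. exact: le_trans (flux_ge0 0) (flux_le_mass 0). Qed.

Lemma flux_source_bound : exists2 C, 0 <= C & forall r, 0 < r -> r <= 1 ->
  pp (1 + alpha) r * pp p (W r) <= C * Num.sqrt r.
Proof.
have p0 : 0 < p by move: p1; lra.
exists ((mass * (2 * p)) `^ p); first exact: powR_ge0.
(* W grows at most like -ln r, and this small power of r absorbs it: W b is bounded because b (- ln
   b) <= 1, while b^p = sqrt r. *)
move=> r r0 r1; pose b := r `^ (2 * p)^-1; have b0 : 0 < b by rewrite powR_gt0.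
have W0 : 0 <= W r by rewrite -W1 W_noninc.
have bp : b `^ p = Num.sqrt r.
  by rewrite /b -powRrM -powR12_sqrt ?(ltW r0)// invfM -mulrA mulVf ?mulr1// gt_eqF.
have Wb : W r * b <= mass * (2 * p).
  have lb : ln r = 2 * p * ln b by rewrite /b ln_powR mulrA mulfV ?mul1r// gt_eqF// mulr_gt0.
  have h := W_le_ln r0 r1; have h2 := ln_inv_sublinear b0.
  apply: (@le_trans _ _ (mass * - ln r * b)); first by rewrite ler_pM2r.
  rewrite lb -mulrA ler_wpM2l ?mass_ge0// -mulrN -mulrA [- _ * b]mulrC ler_piMr//.
  by rewrite mulr_ge0// ltW.
have s0 : 0 < Num.sqrt r by rewrite sqrtr_gt0.
have rs : pp (1 + alpha) r <= Num.sqrt r * Num.sqrt r.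
  rewrite -expr2 sqr_sqrtr ?(ltW r0)// pp1D// ler_piMr ?(ltW r0)//.
  have -> : 1 = 1 `^ alpha :> R by rewrite powR1.
  by rewrite ge0_ler_powR ?nnegrE ?ler01 ?(ltW r0).
apply: (@le_trans _ _ (Num.sqrt r * Num.sqrt r * pp p (W r))); first by rewrite ler_wpM2r ?pp_ge0.
rewrite mulrAC ler_pM2r// mulrC ppE// -bp -powRM ?(ltW b0)//.
by rewrite ge0_ler_powR ?nnegrE ?(ltW p0)// mulr_ge0 ?(ltW b0) ?mass_ge0// mulr_ge0// ltW.
Qed.

(** The source is at most C sqrt r, and the derivative of C r sqrt r is 3/2 of that. The exponent
    3/2 > 1 makes flux / r vanish at the origin. *)
Lemma flux_bound : exists2 C, 0 <= C & forall a, 0 < a -> a <= 1 -> flux a <= C * (a * Num.sqrt a).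
Proof.
have [C C0 hC] := flux_source_bound; exists C => // a a0 a1.
have step e : 0 < e -> e <= a -> flux a - flux e <= C * (a * Num.sqrt a).
  move=> e0 ea.
  have ds r : 0 < r -> isd r (fun s => C * (s * Num.sqrt s)) (C * (3 / 2 * Num.sqrt r)).
    move=> r0; have s0 : 0 < Num.sqrt r by rewrite sqrtr_gt0.
    have dsq : isd r Num.sqrt (2 * Num.sqrt r)^-1 by exact: is_derive1_sqrt.
    apply: der_eq (derZ C (derM (derI r) dsq)) _.
    have := sqr_sqrtr (ltW r0); move: (Num.sqrt r) s0 => q q0 e2.
    by rewrite -e2; field; rewrite gt_eqF.
  have := @der_mono_cc _ (fun r => C * (r * Num.sqrt r) - flux r)
    (fun r => C * (3 / 2 * Num.sqrt r) - pp (1 + alpha) r * pp p (W r)) e a ea.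
  have h1 : 0 <= C * (e * Num.sqrt e) by rewrite !mulr_ge0 ?sqrtr_ge0// ltW.
  move=> h; suff : C * (e * Num.sqrt e) - flux e <= C * (a * Num.sqrt a) - flux a by lra.
  apply: h => r /andP[er ra]; have r0 := lt_le_trans e0 er.
    by apply: derB; [exact: ds|exact: der_flux].
  have := hC r r0 (le_trans ra a1); have : 0 <= C * Num.sqrt r by rewrite mulr_ge0 ?sqrtr_ge0.
  by lra.
have lim : (fun n => flux a - flux (harmonic n)) @ \oo --> flux a - 0.
  by apply: cvgB; [exact: cvg_cst|exact: flux0].
rewrite -[flux a]subr0 -(cvg_lim _ lim)//; apply: limr_le; first by apply/cvg_ex; eexists; exact: lim.
have /cvgrPdist_lt/(_ _ a0) hn := @cvg_harmonic R.
apply: filterS hn => n; rewrite sub0r normrN => hn; apply: step; first exact: harmonic_gt0.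
by rewrite ltW// (le_lt_trans (ler_norm _)).
Qed.

Lemma flux_div_cont : continuous (fun r => flux r / r).
Proof.
move=> r; have [r0|r0|->] : [\/ 0 < r, r < 0 | r = 0] by case: (ltgtP r 0) => h; [constructor 2|constructor 1|constructor 3].
- by apply: cvgM; [exact: der_cts (der_flux r0)|apply: cvgV; [rewrite gt_eqF|exact: cvg_id]].
- apply: cvg_trans (@cvg_cst _ (flux r / r) _ (nbhs r) _); apply: near_eq_cvg.
  apply: filterS (lt_nbhsl r0) => s s0; rewrite !flux_neg ?mul0r ?(ltW r0)//; exact: ltW.
have [C C0 hC] := flux_bound.
rewrite /= /continuous_at flux_neg// mul0r; apply/cvgrPdist_le => e e0.
pose q := e / (C + 1); have q0 : 0 < q by rewrite divr_gt0// ltr_wpDl.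
pose d := Num.min (q ^+ 2) 1; have d0 : 0 < d by rewrite lt_min ltr01 exprn_gt0.
apply/nbhs_ballP; exists d => //= s; rewrite /ball/= sub0r normrN => sd; rewrite sub0r normrN.
have [s0|s0] := leP s 0; first by rewrite flux_neg// mul0r normr0 ltW.
rewrite (gtr0_norm s0) lt_min in sd; have [sq s1] := andP sd.
rewrite ger0_norm; last by rewrite divr_ge0 ?flux_ge0 ?(ltW s0).
rewrite ler_pdivrMr//; apply: le_trans (hC s s0 (ltW s1)) _.
have sle : Num.sqrt s <= q by rewrite -[leRHS](gtr0_norm q0) -sqrtr_sqr ler_wsqrtr// ltW.
have qE : e = q * (C + 1) by rewrite /q divfK// gt_eqF// ltr_wpDl.
rewrite qE [s * _]mulrC mulrA ler_pM2r//.
apply: (@le_trans _ _ (C * q)); first by rewrite ler_wpM2l.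
by rewrite mulrC ler_pM2l// lerDl.
Qed.

Lemma radial_profile : 3 < p -> exists w X, profile (1 + alpha / 2) p w X /\
  {ae lebp, forall x, B x -> u x = w (enorm x)}.
Proof.
move=> p3; have cY := flux_div_cont; have [N N0 dN] := antiderivative cY.
have cN : continuous N by move=> x; exact: der_cts (dN x).
(* Defined from a primitive of flux / r instead of from W, so that continuity at and below r = 0 is
   automatic; it agrees with W for r > 0. *)
pose w r := N 1 - N r.
have dw r : isd r w (- (flux r / r)) by apply: der_eq (derB (derC _ _) (dN r)) _; rewrite sub0r.
have cw : continuous w by move=> r; exact: der_cts (dw r).
have wW r : 0 < r -> w r = W r.
  move=> r0; pose d s := w s - W s.
  have dd s : 0 < s -> isd s d 0 by move=> s0; apply: der_eq (derB (dw s) (der_W s0)) _; rewrite subrr.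
  have d1 : d 1 = 0 by rewrite /d /w W1 !subrr.
  have cst s t : 0 < s -> s <= t -> d s = d t.
    by move=> s0 st; apply: der0_const => // x /andP[sx _]; exact: dd (lt_le_trans s0 sx).
  suff : d r = 0 by move/eqP; rewrite subr_eq0 => /eqP.
  by have [h|h] := leP r 1; [rewrite (cst r 1)|rewrite -(cst 1 r)// ltW].
have wpos r : 0 < r -> r < 1 -> 0 < w r by move=> r0 r1; rewrite wW// W_pos.
exists w, flux; split; last first.
  have pos : {ae lebp, forall x, 0 < enorm x} := @ae_enorm_gt0 R.
  by apply: (aeS2 pos u_eq_W) => x x0 h Bx; rewrite h// wW.
have tE : 2 * (1 + alpha / 2) - 1 = 1 + alpha by field.
split => //.
- by move: alpha0; lra.
- move=> r; have [r0|r0] := ltP 0 r; first exact: der_cts (der_flux r0).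
  have -> : flux = (fun r => flux r / r * r).
    apply/funext => s; have [->|s0] := eqVneq s 0; first by rewrite mulr0 flux_neg.
    by rewrite divfK.
  by apply: ctsM => //; exact: ctsI.
- by move=> r r0; apply: der_eq (der_flux r0) _; rewrite tE wW.
- by rewrite /w subrr.
- move=> r; rewrite le_eqVlt => /orP[/eqP <- _|r0 r1]; last exact: wpos.
  have h2 : 0 < 1 / 2 :> R by lra.
  apply: (lt_le_trans (wpos _ h2 _)); first by lra.
  rewrite -lerN2; apply: (@der_mono_cc _ (fun x => - w x) (fun r => flux r / r)); first by lra.
    by move=> x _; apply: der_eq (derN (dw x)) _; rewrite opprK.
  by move=> x /andP[x0 _]; rewrite divr_ge0 ?flux_ge0.
- by move=> r r0; rewrite flux_neg.
Qed.

End data.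

End radial_profile.

(** * Negative directions *)

Section linearized.
Context {R : realType}.
Notation plane := (measurableTypeR R * measurableTypeR R)%type.
Notation lebp := (@lebp R).
Notation B := (@ball2 R).
Notation IB := (ii lebp B).
Notation L2 := (L2 lebp B).
Notation L1 := (L1 lebp B).
Notation T := (pi *+ 2 : R).

Let mB : measurable (B : set plane). Proof. exact: measurable_ball2. Qed.

Variables (alpha p : R) (w X : R -> R).
Hypothesis alpha0 : 0 <= alpha.
Notation tau := (1 + alpha / 2).
Hypothesis H : profile tau p w X.
Notation k0 := (@k0 R tau p w).
Notation k1 := (@k1 R tau p w X).
Notation k2 := (@k2 R tau p w X).
Notation kk := (@kk R tau p w).
Notation pb := (@pb R p w).

Let p3 : 3 < p. Proof. exact: prof_p H. Qed.
Let cw : continuous w. Proof. exact: prof_cw H. Qed.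
Let cX : continuous X. Proof. exact: prof_cX H. Qed.

Definition pot (x : R * R) : R := p * (wt alpha x * pp (p - 1) (w (enorm x))).

Lemma pot_meas : measurable_fun (B : set plane) pot.
Proof.
apply: measurable_funTS; apply: measurable_funM; first exact: measurable_cst.
apply: measurable_funM; first exact: meas_wt.
have c : continuous (fun r => pp (p - 1) (w r)) by apply: (ppw_cont H); move: p3; lra.
exact: continuous_measurable_plane (plane_cts_comp enorm_cont c).
Qed.

Lemma pot_ge0 x : 0 <= pot x.
Proof. by rewrite !mulr_ge0 ?wt_ge0 ?pp_ge0//; move: p3; lra. Qed.

Lemma cts_bounded01 (h : R -> R) : continuous h -> exists2 M, 0 <= M & forall r, 0 <= r -> r <= 1 -> `|h r| <= M.
Proof.
move=> ch; have [M M0 hM] := cts_rect_bounded 0 1 0 1 (plane_cts_comp (@plane_cts1 R) ch).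
by exists M => // r r0 r1; apply: (hM r 0); rewrite ?r0 ?r1 ?lexx ?ler01.
Qed.

Lemma pot_bound : exists M, forall x, B x -> `|pot x| <= M.
Proof.
have c : continuous (fun r => pp (p - 1) (w r)) by apply: (ppw_cont H); move: p3; lra.
have [M M0 hM] := cts_bounded01 c; exists (p * M) => x Bx.
have p0 : 0 <= p by move: p3; lra.
rewrite ger0_norm ?pot_ge0// /pot ler_wpM2l//.
apply: (@le_trans _ _ (1 * pp (p - 1) (w (enorm x)))).
  by rewrite ler_wpM2r ?pp_ge0// wt_le1.
by rewrite mul1r (le_trans (ler_norm _))// hM ?enorm_ge0// ltW.
Qed.

Lemma pot_L1 f : L2 f -> L1 (fun x => pot x * f x ^+ 2).
Proof.
move=> [mf hf]; have [M HM] := pot_bound.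
apply: (@L1_le _ _ _ lebp B mB _ (fun x => M * f x ^+ 2)); last exact: (L1Z mB).
  by apply: measurable_funM; [exact: pot_meas|exact: measurable_funX].
by move=> x Bx; rewrite normrM [`|f x ^+ 2|]ger0_norm ?sqr_ge0// ler_wpM2r ?sqr_ge0 ?HM.
Qed.

Lemma pot_radial r : 0 < r -> r * (p * (r `^ alpha * pp (p - 1) (w r))) = p * k0 r.
Proof.
move=> r0; rewrite (ppb2 H) /k0 /pa.
have -> : 2 * tau - 1 = 1 + alpha by field.
by rewrite pp1D//; ring.
Qed.

Lemma pot_polar r t : 0 < r -> r * pot (polar r t) = p * k0 r.
Proof. by move=> r0; rewrite /pot /wt enorm_polar ?(ltW r0)// pot_radial. Qed.

Lemma pot_cut : punct_cts pot.
Proof.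
move=> a a0; pose g r := p * (r `^ alpha * pp (p - 1) (w r)).
apply: (@punct_cts_enorm R g) => // s s0; apply: cvgM; first exact: cvg_cst.
apply: cvgM; last by apply: (ppw_cont H); move: p3; lra.
exact: der_cts (is_derive1_powR alpha s0).
Qed.

Lemma QformE u psi h1 h2 : measurable_fun (B : set plane) u ->
  {ae lebp, forall x, B x -> u x = w (enorm x)} -> L2 psi -> L2 h1 -> L2 h2 ->
  Qform alpha p u psi h1 h2 =
    (IB (fun x => h1 x ^+ 2) + IB (fun x => h2 x ^+ 2) - IB (fun x => pot x * psi x ^+ 2))%:E.
Proof.
move=> mu uw0 hp hh1 hh2; have uw : {ae lebp, forall x, B x -> u x = w (enorm x)} := uw0.
rewrite /Qform dirichletE// EFinB; congr (_ - _)%E.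
have hV := pot_L1 hp.
rewrite -(L1E mB hV); apply: ae_eq_integral => //.
- have -> : (fun x => (p * enorm x `^ alpha * `|u x| `^ (p - 1) * psi x ^+ 2)%:E) =
     EFin \o (fun x => p * (wt alpha x * `|u x| `^ (p - 1)) * psi x ^+ 2).
    by apply/funext => x /=; rewrite mulrA.
  apply/measurable_EFinP; apply: measurable_funM; last by apply: measurable_funX; exact: hp.1.
  apply: measurable_funM; first exact: measurable_cst.
  by apply: measurable_funM; [apply: measurable_funTS; exact: meas_wt|exact: meas_pow].
- by have /integrableP[] := hV.
apply: (aeS uw) => x h Bx; rewrite h// /pot /wt !mulrA; congr (_ * _ * _)%:E.
have w0 : 0 <= w (enorm x) by rewrite ltW// (prof_wpos H) ?enorm_ge0.
by rewrite ger0_norm// ppE.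
Qed.

(** * The trial functions *)

Section trial.
Variable j : nat.

Definition tpow (r : R) := pp ((p - 1) / 2) (w r).
Definition tpow' (r : R) := pp ((p - 3) / 2) (w r).

(** Radial factor in s = |x|^2. Multiplied by a harmonic polynomial of degree j it gives r^tau
    w^((p-1)/2) times the angular mode, hence the exponent (tau - j) / 2. *)
Definition tF (s : R) := s `^ ((tau - j%:R) / 2) * tpow (Num.sqrt s).
Definition tdF (s : R) := (tau - j%:R) / 2 * s `^ ((tau - j%:R) / 2 - 1) * tpow (Num.sqrt s)
  - s `^ ((tau - j%:R) / 2) * ((p - 1) / 4 * tpow' (Num.sqrt s) * X (Num.sqrt s) * s `^ (-1)).

Lemma tpow_cont : continuous tpow.
Proof. by apply: (ppw_cont H); move: p3; lra. Qed.

Lemma tpow'_cont : continuous tpow'.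
Proof. by apply: (ppw_cont H); move: p3; lra. Qed.

Lemma tpow_sqr r : [/\ tpow r ^+ 2 = w r ^+ 2 * pb r, tpow r * tpow' r = w r * pb r & tpow' r ^+ 2 = pb r].
Proof.
have q1 : 0 < (p - 1) / 2 by move: p3; lra.
have q2 : 0 < (p - 3) / 2 by move: p3; lra.
rewrite /tpow /tpow' !expr2 !ppM// -/(w r ^+ 2) -expr2 -(ppb2 H) -(ppb1 H) /pb.
by split; congr pp; field.
Qed.

Lemma der_tpow r : 0 < r -> isd r tpow (- ((p - 1) / 2 * tpow' r * (X r / r))).
Proof.
move=> r0; have q1 : 1 < (p - 1) / 2 by move: p3; lra.
apply: der_eq (der_comp (prof_dw H r0) (pp_der _ q1)) _.
by rewrite /tpow' (_ : (p - 1) / 2 - 1 = (p - 3) / 2); [ring|field].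
Qed.

Lemma der_tF s : 0 < s -> isd s tF (tdF s).
Proof.
move=> s0; have q0 : 0 < Num.sqrt s by rewrite sqrtr_gt0.
have dsq : isd s Num.sqrt (2 * Num.sqrt s)^-1 by exact: is_derive1_sqrt.
have dp : isd s (fun s => s `^ ((tau - j%:R) / 2)) ((tau - j%:R) / 2 * s `^ ((tau - j%:R) / 2 - 1)).
  exact: is_derive1_powR.
apply: der_eq (derM dp (der_comp dsq (der_tpow q0))) _.
rewrite /tdF -[in RHS]mulrN powR_inv1 ?(ltW s0)//; congr (_ + _ * _).
have := sqr_sqrtr (ltW s0); move: (Num.sqrt s) q0 => q q0 <-.
by field; rewrite gt_eqF.
Qed.

Lemma tF1 : tF 1 = 0.
Proof. by rewrite /tF sqrtr1 /tpow (w10 H) ?mulr0//; move: p3; lra. Qed.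

Lemma tdF_cont s : 0 < s -> {for s, continuous tdF}.
Proof.
move=> s0; have dp k : {for s, continuous (fun s => s `^ k)}.
  exact: der_cts (is_derive1_powR k s0).
have csq : {for s, continuous Num.sqrt} by exact: sqrt_continuous.
have comp (h : R -> R) : continuous h -> {for s, continuous (fun s => h (Num.sqrt s))}.
  by move=> ch; apply: (@continuous_comp _ _ _ Num.sqrt h) => //; exact: ch.
apply: cvgB; apply: cvgM.
- by apply: cvgM; [exact: cvg_cst|exact: dp].
- by apply: comp; exact: tpow_cont.
- exact: dp.
apply: cvgM; last exact: dp.
apply: cvgM; last exact: comp.
by apply: cvgM; [exact: cvg_cst|apply: comp; exact: tpow'_cont].
Qed.

Lemma tF_meas : measurable_fun setT (tF : measurableTypeR R -> R) /\ measurable_fun setT (tdF : measurableTypeR R -> R).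
Proof.
have mp k : measurable_fun setT ((fun s => s `^ k) : measurableTypeR R -> R) by exact: measurable_powR.
have ms (h : R -> R) : continuous h -> measurable_fun setT ((fun s => h (Num.sqrt s)) : measurableTypeR R -> R).
  move=> ch; apply: continuous_measurable_fun; apply: cts_comp => //; exact: sqrt_continuous.
split; first by apply: measurable_funM => //; apply: ms; exact: tpow_cont.
apply: measurable_funB; apply: measurable_funM => //.
- by apply: measurable_funM => //; exact: measurable_cst.
- by apply: ms; exact: tpow_cont.
apply: measurable_funM => //.
apply: measurable_funM; last exact: ms.
by apply: measurable_funM; [exact: measurable_cst|apply: ms; exact: tpow'_cont].
Qed.

(** E is r^(tau - j), an exponent of either sign; only its product with r^j is used, and that
    depends on r^(tau - 1) alone. *)
Lemma tF_sqr r : 0 < r -> exists E, [/\ E * r ^+ j = r `^ (tau - 1) * r, tF (r ^+ 2) = E * tpow r &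
  tdF (r ^+ 2) = E / r ^+ 2 * ((tau - j%:R) / 2 * tpow r - (p - 1) / 4 * tpow' r * X r)].
Proof.
move=> r0; have n0 : r ^+ 2 != 0 by rewrite gt_eqF// exprn_gt0.
exists ((r ^+ 2) `^ ((tau - j%:R) / 2)).
have sq : Num.sqrt (r ^+ 2) = r by rewrite sqrtr_sqr gtr0_norm.
have e1 : (r ^+ 2) `^ ((tau - j%:R) / 2) = r `^ (tau - j%:R).
  by rewrite -powR_mulrn ?(ltW r0)// -powRrM; congr (_ `^ _); field.
split.
- rewrite e1 -powR_mulrn ?(ltW r0)// -powRD ?(gt_eqF r0) ?implybT// [RHS]mulrC -pp1D// ppE ?(ltW r0)//.
  by congr (_ `^ _); ring.
- by rewrite /tF sq.
have e2 : (r ^+ 2) `^ ((tau - j%:R) / 2 - 1) = (r ^+ 2) `^ ((tau - j%:R) / 2) / r ^+ 2.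
  rewrite powRD ?n0 ?implybT// powR_inv1//; exact: sqr_ge0.
by rewrite /tdF sq e2 powR_inv1 ?sqr_ge0//; field; rewrite gt_eqF.
Qed.

(** The gradient has size r^(tau - 1) times a bounded function, and tau >= 1. For j = 0 the third
    term has a zero factor. *)
Lemma tF_bound : exists M, forall r, 0 < r -> r < 1 ->
  [/\ `|tF (r ^+ 2)| * r ^+ j <= M, `|tdF (r ^+ 2)| * r ^+ j.+1 <= M
      & `|tF (r ^+ 2)| * (j%:R * r ^+ j.-1) <= M].
Proof.
have [M1 M10 h1] := cts_bounded01 tpow_cont.
have cc : continuous (fun r => tpow' r * X r) by apply: ctsM => //; exact: tpow'_cont.
have [M2 M20 h2] := cts_bounded01 cc.
have t0 : 0 <= tau by move: alpha0; lra.
exists ((tau + j%:R + 1) * M1 + p * M2) => r r0 r1.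
have [E [e1 -> ->]] := tF_sqr r0; have {}h1 := h1 r (ltW r0) (ltW r1); have {}h2 := h2 r (ltW r0) (ltW r1).
have rho0 : 0 <= r `^ (tau - 1) by exact: powR_ge0.
have rho1 : r `^ (tau - 1) <= 1.
  have e0 : 1 `^ (tau - 1) = 1 :> R by rewrite powR1.
  rewrite -[leRHS]e0.
  by rewrite ge0_ler_powR ?nnegrE ?ler01 ?(ltW r0) ?(ltW r1)//; move: alpha0; lra.
have rj0 : 0 <= r ^+ j by rewrite exprn_ge0// ltW.
have j0 : 0 <= j%:R :> R by [].
have p0 : 0 < p by move: p3; lra.
have E0 : 0 <= E by rewrite -(pmulr_lge0 _ (exprn_gt0 j r0)) e1 mulr_ge0// ltW.
rewrite !normrM (ger0_norm E0) (ger0_norm (_ : 0 <= (r ^+ 2)^-1)) ?invr_ge0 ?sqr_ge0//.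
have b0 : 0 <= `|tpow r| by [].
have b3 : 0 <= (tau + j%:R) * M1 by rewrite mulr_ge0// addr_ge0.
have b4 : 0 <= p * M2 by rewrite mulr_ge0// ltW.
have s1 : r `^ (tau - 1) * r <= 1 by rewrite -[leRHS](mulr1 1) ler_pM// ltW.
split.
- rewrite mulrAC e1; apply: (@le_trans _ _ (1 * M1)); last by lra.
  by apply: ler_pM => //; rewrite mulr_ge0// ltW.
- have -> : E / r ^+ 2 * `|(tau - j%:R) / 2 * tpow r - (p - 1) / 4 * tpow' r * X r| * r ^+ j.+1 =
    r `^ (tau - 1) * `|(tau - j%:R) / 2 * tpow r - (p - 1) / 4 * tpow' r * X r|.
    rewrite [r ^+ j.+1]exprS; transitivity (E * r ^+ j / r * `|(tau - j%:R) / 2 * tpow r - (p - 1) / 4 * tpow' r * X r|).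
      by field; rewrite gt_eqF.
    by rewrite e1 mulfK// gt_eqF.
  apply: (@le_trans _ _ (1 * ((tau + j%:R) * M1 + p * M2))); last by lra.
  apply: ler_pM => //; apply: (le_trans (ler_normB _ _)).
  rewrite -[X in _ + `|X|]mulrA (normrM (_ / 2)) (normrM (_ / 4)); apply: lerD.
    apply: ler_pM => //; rewrite ler_norml; apply/andP; split; lra.
  apply: ler_pM => //.
  rewrite ler_norml; apply/andP; split; move: p3; lra.
have [jz|jn] := posnP j.
  have : 0 <= tau * M1 by rewrite mulr_ge0.
  by rewrite jz mul0r mulr0 addr0; lra.
have e3 : E * r ^+ j.-1 = r `^ (tau - 1).
  by apply: (mulIf (lt0r_neq0 r0)); rewrite -e1 -mulrA -exprSr prednK.
have -> : E * `|tpow r| * (j%:R * r ^+ j.-1) = r `^ (tau - 1) * (j%:R * `|tpow r|) by rewrite -e3; ring.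
apply: (@le_trans _ _ (1 * (j%:R * M1))); first by apply: ler_pM => //; rewrite ?mulr_ge0// ler_wpM2l.
have : 0 <= tau * M1 by rewrite mulr_ge0.
lra.
Qed.

End trial.

Definition tfun i x := tF (uphalf i) (nsq x) * harm i x.
Definition tg1 i x := tdF (uphalf i) (nsq x) * (2 * x.1) * harm i x + tF (uphalf i) (nsq x) * harm1 i x.
Definition tg2 i x := tdF (uphalf i) (nsq x) * (2 * x.2) * harm i x + tF (uphalf i) (nsq x) * harm2 i x.

Lemma tfun_H10 i : H10 (tfun i) (tg1 i) (tg2 i).
Proof.
have [M hM] := tF_bound (uphalf i); have [m1 m2] := tF_meas (uphalf i).
by apply: (H10_radial_poly (tF1 _) m1 m2 _ _ (harm_gpoly i) (@harm_bound R i) hM) => s s0;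
  [exact: der_tF|exact: tdF_cont].
Qed.

(** With f = r^tau w^((p-1)/2), this is r f' / r^tau. *)
Definition trad (r : R) := tau * tpow r - (p - 1) / 2 * tpow' r * X r.

Lemma tfun_polar i r t : 0 < r ->
  [/\ tfun i (polar r t) = r `^ (tau - 1) * r * tpow r * trig i t,
      cos t * tg1 i (polar r t) + sin t * tg2 i (polar r t) = r `^ (tau - 1) * trad r * trig i t &
      - sin t * tg1 i (polar r t) + cos t * tg2 i (polar r t) = r `^ (tau - 1) * tpow r * dtrig i t].
Proof.
move=> r0; have [E [e1 e2 e3]] := tF_sqr (uphalf i) r0.
have nE : nsq (polar r t) = r ^+ 2 by rewrite nsqE enorm_polar// ltW.
have [h1 h2] := harm_grad_polar i r t.
have e4 k : (uphalf i = 0%N -> k = 0) -> E * (r ^+ (uphalf i).-1 * k) = r `^ (tau - 1) * k.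
  move=> hk; have [j0|j0] := posnP (uphalf i); first by rewrite hk// !mulr0.
  rewrite mulrA; congr (_ * _); apply: (mulIf (lt0r_neq0 r0)).
  by rewrite -e1 -mulrA -exprSr prednK.
have z1 : uphalf i = 0%N -> freq i = 0 :> R by rewrite /freq => ->.
have z2 : uphalf i = 0%N -> dtrig i t = 0.
  by move=> /z1 z; rewrite /dtrig z; case: odd; rewrite mul0r ?oppr0.
have f1 := e4 _ z1; have f2 := e4 _ z2.
have rn : r != 0 by rewrite gt_eqF.
rewrite /tfun /tg1 /tg2 nE e2 e3 harm_polar; split.
- by rewrite -e1; ring.
- transitivity (2 * (E * r ^+ uphalf i) / r * ((tau - (uphalf i)%:R) / 2 * tpow r - (p - 1) / 4 * tpow' r * X r) * trig i t
    * (cos t ^+ 2 + sin t ^+ 2) + E * tpow r * (cos t * harm1 i (polar r t) + sin t * harm2 i (polar r t))).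
    by rewrite /polar/=; field.
  rewrite cos2Dsin2 h1 e1 (_ : E * tpow r * (freq i * r ^+ (uphalf i).-1 * trig i t) =
    E * (r ^+ (uphalf i).-1 * freq i) * tpow r * trig i t); last by ring.
  by rewrite f1 /trad /freq; field.
- transitivity (tpow r * (E * (- sin t * harm1 i (polar r t) + cos t * harm2 i (polar r t)))).
    by rewrite /polar/=; field.
  by rewrite h2 f2; ring.
Qed.

Lemma pa_rho r : 0 < r -> pa tau r = r * (r `^ (tau - 1)) ^+ 2.
Proof.
move=> r0; rewrite /pa (_ : 2 * tau - 1 = 1 + alpha); last by field.
rewrite pp1D// expr2 -powRD ?(gt_eqF r0) ?implybT//; congr (_ * _ `^ _); by field.
Qed.

Lemma harm_punct i : [/\ punct_cts (@harm R i), punct_cts (@harm1 R i) & punct_cts (@harm2 R i)].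
Proof.
have g := @harm_gpoly R i; have [_ _ h1 h2] := g.
by split; [exact: (punct_ctsC (gpoly_cont g))|exact: (punct_ctsC h1)|exact: (punct_ctsC h2)].
Qed.

Section combination.
Variables (c : nat -> R) (m : nat).

Let S t := \sum_(i < m) c i * trig i t.
Let S' t := \sum_(i < m) c i * dtrig i t.

(** The density r f'^2 + j2 f^2 / r - p [k0] f^2 of the form on one angular mode, for the trial
    profile f; its integral is the quantity bounded by [moment_neg]. *)
Definition tmode (j2 r : R) := (tau ^+ 2 + j2) * k0 r + (- (tau * (p - 1))) * k1 r
     + (p - 1) ^+ 2 / 4 * k2 r + (- p) * kk r.

Lemma tmode_cont j2 : continuous (tmode j2).
Proof.
have h0 := k0_cont H; have h1 := k1_cont H; have h2 := k2_cont H; have h3 := kk_cont H.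
by rewrite /tmode; cts.
Qed.

Definition tcomb x := \sum_(i < m) c i * tfun i x.
Definition tcomb1 x := \sum_(i < m) c i * tg1 i x.
Definition tcomb2 x := \sum_(i < m) c i * tg2 i x.

Lemma tcomb_polar r t : 0 < r ->
  r * (tcomb1 (polar r t) ^+ 2 + tcomb2 (polar r t) ^+ 2 - pot (polar r t) * tcomb (polar r t) ^+ 2) =
  tmode 0 r * S t ^+ 2 + k0 r * S' t ^+ 2.
Proof.
move=> r0; set C1 := tcomb1 _; set C2 := tcomb2 _; set C0 := tcomb _; set rho := r `^ (tau - 1).
have e0 : C0 = rho * r * tpow r * S t.
  by rewrite /C0 /tcomb /S mulr_sumr; apply: eq_bigr => i _; have [-> _ _] := tfun_polar i t r0; rewrite -/rho; ring.
have e1 : cos t * C1 + sin t * C2 = rho * trad r * S t.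
  rewrite /C1 /C2 /tcomb1 /tcomb2 /S !mulr_sumr -big_split/=; apply: eq_bigr => i _.
  have [_ h _] := tfun_polar i t r0; transitivity (c i * (cos t * tg1 i (polar r t) + sin t * tg2 i (polar r t))); first by ring.
  by rewrite h -/rho; ring.
have e2 : - sin t * C1 + cos t * C2 = rho * tpow r * S' t.
  rewrite /C1 /C2 /tcomb1 /tcomb2 /S' !mulr_sumr -big_split/=; apply: eq_bigr => i _.
  have [_ _ h] := tfun_polar i t r0; transitivity (c i * (- sin t * tg1 i (polar r t) + cos t * tg2 i (polar r t))); first by ring.
  by rewrite h -/rho; ring.
(* The gradient is resolved into radial and tangential components, where the modes separate. *)
have e3 : C1 ^+ 2 + C2 ^+ 2 = (cos t * C1 + sin t * C2) ^+ 2 + (- sin t * C1 + cos t * C2) ^+ 2.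
  by rewrite -[LHS]mul1r -(cos2Dsin2 t); ring.
rewrite mulrBr mulrA pot_polar// e3 e1 e2 e0 /tmode /kk /k0 /k1 /k2 pa_rho// -/rho.
have [q1 q2 q3] := tpow_sqr r; rewrite -q1 -q2 -q3 /trad; move: (tpow r) (tpow' r) => P Q.
by field.
Qed.

Lemma trig_sum_sqr : itg 0 T (fun t => S t ^+ 2) = \sum_(i < m) c i ^+ 2 * tnorm i /\
  itg 0 T (fun t => S' t ^+ 2) = \sum_(i < m) c i ^+ 2 * (freq i ^+ 2 * tnorm i).
Proof.
have z0 (F : nat -> R -> R) (n : nat -> R) : (forall i, continuous (F i)) ->
  (forall i k, itg 0 T (fun x => F i x * F k x) = if i == k then n i else 0) ->
  itg 0 T (fun t => (\sum_(i < m) c i * F i t) ^+ 2) = \sum_(i < m) c i ^+ 2 * n i.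
  move=> cF h; have := @itg_lincomb R m c F (fun=> 0) n (@ctsC R 0) cF h.
  rewrite [X in _ = X - _ + _ -> _](_ : _ = 0); last first.
    by rewrite (@eq_itg _ _ _ _ (fun=> 0)) ?itg_cst ?mul0r ?(ltW T_gt0)// => x _; rewrite expr0n.
  rewrite big1 ?mulr0 ?subr0 ?add0r => [e|i _]; last first.
    rewrite (@eq_itg _ _ _ _ (fun=> 0)) ?itg_cst ?mul0r ?mulr0 ?(ltW T_gt0)// => x _; by rewrite mul0r.
  by rewrite -e; apply: eq_itg => x _; rewrite sub0r sqrrN.
split; first exact: (z0 trig tnorm (@trig_cont R) (@trig_orth R)).
exact: (z0 dtrig (fun i => freq i ^+ 2 * tnorm i) (@dtrig_cont R) (@dtrig_orth R)).
Qed.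

(** Orthogonality of the modes and of their derivatives on each circle makes the form diagonal in
    the coefficients. *)
Lemma tcomb_form : IB (fun x => tcomb1 x ^+ 2) + IB (fun x => tcomb2 x ^+ 2) - IB (fun x => pot x * tcomb x ^+ 2) =
  kappa * \sum_(i < m) c i ^+ 2 * tnorm i * itg 0 1 (tmode (freq i ^+ 2)).
Proof.
have Hi i : H10 (tfun i) (tg1 i) (tg2 i) := tfun_H10 i.
have HH : H10 tcomb tcomb1 tcomb2.
  exact: (@H10_sum R m (fun i => c i) (fun i => tfun i) (fun i => tg1 i) (fun i => tg2 i)).
have [l0 l1 l2] := H10_L2 HH; have lV := pot_L1 l0.
have cS (F : nat -> R -> R) : (forall i, continuous (F i)) -> continuous (fun t => \sum_(i < m) c i * F i t).
  by move=> cF; apply: (@cts_sum R m (fun i t => c i * F i t)) => i; apply: ctsM => //; exact: ctsC.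
have cS1 : continuous S by apply: cS; exact: trig_cont.
have cS2 : continuous S' by apply: cS; exact: dtrig_cont.
rewrite -(iiD mB l1.2 l2.2) -(iiB mB (L1D mB l1.2 l2.2) lV).
pose G i r := (c i ^+ 2 * tnorm i) * tmode (freq i ^+ 2) r.
have cG i : continuous (G i) by apply: ctsM; [exact: ctsC|exact: tmode_cont].
rewrite (@polar_punct R _ (fun r => \sum_(i < m) G i r)).
- congr (_ * _); rewrite itg_sum//; apply: eq_bigr => i _; rewrite itgZ//; exact: tmode_cont.
- exact: (L1B mB (L1D mB l1.2 l2.2) lV).
- exact: cts_sum.
- have pF j : punct_cts (fun x => tF j (nsq x)) by apply: punct_cts_nsq => s s0; exact: der_cts (der_tF j s0).
  have pdF j : punct_cts (fun x => tdF j (nsq x)) by apply: punct_cts_nsq => s s0; exact: tdF_cont.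
  have pc d : punct_cts (fun _ : R * R => d) by apply: punct_ctsC; exact: plane_ctsC.
  have px : punct_cts (fun x : R * R => x.1) by apply: punct_ctsC; exact: plane_cts1.
  have py : punct_cts (fun x : R * R => x.2) by apply: punct_ctsC; exact: plane_cts2.
  have ph i : punct_cts (@harm R i) by have [] := harm_punct i.
  have ph1 i : punct_cts (@harm1 R i) by have [] := harm_punct i.
  have ph2 i : punct_cts (@harm2 R i) by have [] := harm_punct i.
  have p0 : punct_cts tcomb.
    by apply: (@punct_cts_sum R (fun i x => c i * tfun i x)) => i; exact: (punct_ctsM (pc _) (punct_ctsM (pF _) (ph i))).
  have pg (k : R * R -> R) (h : R * R -> R) i : punct_cts k -> punct_cts h ->
      punct_cts (fun x => c i * (tdF (uphalf i) (nsq x) * (2 * k x) * harm i x + tF (uphalf i) (nsq x) * h x)).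
    move=> hk hh; apply: (punct_ctsM (pc _)); apply: (punct_ctsD _ (punct_ctsM (pF _) hh)).
    exact: (punct_ctsM (punct_ctsM (pdF _) (punct_ctsM (pc 2) hk)) (ph i)).
  have q1 : punct_cts tcomb1 by apply: (@punct_cts_sum R (fun i x => c i * tg1 i x)) => i; exact: (pg _ _ i px (ph1 i)).
  have q2 : punct_cts tcomb2 by apply: (@punct_cts_sum R (fun i x => c i * tg2 i x)) => i; exact: (pg _ _ i py (ph2 i)).
  apply: punct_ctsD; first by apply: punct_ctsD; apply: (@punct_ctsM R).
  by apply: punct_ctsN; apply: punct_ctsM; [exact: pot_cut|exact: (@punct_ctsM R)].
move=> r r0 r1.
rewrite (@eq_itg _ _ _ _ (fun t => r^-1 * (tmode 0 r * S t ^+ 2 + k0 r * S' t ^+ 2))); last first.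
  by move=> t _; rewrite -tcomb_polar// mulKf// gt_eqF.
have c1 : continuous (fun t => S t ^+ 2) by exact: ctsX.
have c2 : continuous (fun t => S' t ^+ 2) by exact: ctsX.
rewrite itgZ; last by apply: ctsD; apply: ctsM => //; exact: ctsC.
rewrite mulVKf ?gt_eqF// itgD; [|by apply: ctsM => //; exact: ctsC|by apply: ctsM => //; exact: ctsC].
rewrite !itgZ//; have [-> ->] := trig_sum_sqr; rewrite !mulr_sumr -big_split/=; apply: eq_bigr => i _.
by rewrite /G /tmode; ring.
Qed.

End combination.

End linearized.

(** * Mode expansion of a test function *)

Section mode_expansion.
Context {R : realType}.
Notation T := (pi *+ 2 : R).
Variable phi : R * R -> R.
Hypothesis ht : testfun phi.

Let sm : smooth2 phi. Proof. by case: ht. Qed.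

Definition mcoef (i : nat) (r : R) : R := itg 0 T (fun t => phi (polar r t) * trig i t).
Definition dmcoef (i : nat) (r : R) : R := itg 0 T (fun t => radd phi (r, t) * trig i t).
Definition msq (r : R) : R := itg 0 T (fun t => phi (polar r t) ^+ 2).
Definition mcross (r : R) : R := itg 0 T (fun t => radd phi (r, t) * phi (polar r t)).
Definition mrad (r : R) : R := itg 0 T (fun t => radd phi (r, t) ^+ 2).
Definition mang (r : R) : R := itg 0 T (fun t => angd phi (r, t) ^+ 2).

Let cphi : continuous (fun x : R * R => phi (polar x.1 x.2)).
Proof. exact: cts_polar (smooth2_cont sm). Qed.

Let ctr i : continuous (fun x : R * R => trig i x.2).
Proof. exact: plane_cts_comp (@plane_cts2 R) (@trig_cont R i). Qed.

Let crad : continuous (radd phi). Proof. exact: radd_cont. Qed.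

Lemma dmcoef_cont i : continuous (dmcoef i).
Proof. exact: (@cts_itg_param R (fun x => radd phi x * trig i x.2) 0 T (plane_ctsM crad (@ctr i))). Qed.

Lemma der_mcoef i r : isd r (mcoef i) (dmcoef i r).
Proof.
apply: (@der_itg_param R (fun x => phi (polar x.1 x.2) * trig i x.2) (fun x => radd phi x * trig i x.2)).
- exact: plane_ctsM.
- exact: plane_ctsM.
by move=> s t /=; apply: der_eq (derM (der_radial s t sm) (derC _ _)) _; rewrite mulr0 addr0.
Qed.

Lemma der_msq r : isd r msq (2 * mcross r).
Proof.
have c2 : continuous (fun x : R * R => phi (polar x.1 x.2) ^+ 2) by exact: plane_ctsM.
have c3 : continuous (fun x : R * R => 2 * (radd phi x * phi (polar x.1 x.2))).
  by apply: plane_ctsM; [exact: plane_ctsC|exact: plane_ctsM].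
have := @der_itg_param R _ _ 0 T r c2 c3; rewrite /msq /mcross -itgZ; last first.
  exact: (@cts_slice2 R (fun x => radd phi x * phi (polar x.1 x.2)) r (plane_ctsM crad cphi)).
apply=> s t; apply: der_eq (derX2 (der_radial s t sm)) _; ring.
Qed.

Lemma msq_cont : continuous msq. Proof. by move=> r; exact: der_cts (der_msq r). Qed.
Lemma mcoef_cont i : continuous (mcoef i). Proof. by move=> r; exact: der_cts (der_mcoef i r). Qed.

Lemma phi_boundary t : phi (polar 1 t) = 0.
Proof. by have [_ [r [r1 h]]] := ht; apply: h; rewrite enorm_polar. Qed.

Lemma mcoef1 i : mcoef i 1 = 0.
Proof.
rewrite /mcoef (@eq_itg _ _ _ _ (fun=> 0)) => [|t _]; last by rewrite phi_boundary mul0r.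
by rewrite itg_cst ?mul0r// ltW// T_gt0.
Qed.

Lemma msq1 : msq 1 = 0.
Proof.
rewrite /msq (@eq_itg _ _ _ _ (fun=> 0)) => [|t _]; last by rewrite phi_boundary expr0n.
by rewrite itg_cst ?mul0r// ltW// T_gt0.
Qed.

(** The Bessel remainder on the circle of radius r; for m = 2J + 1 it is the part of phi of
    frequency at least J + 1. *)
Definition mrem (m : nat) (r : R) : R := msq r - \sum_(i < m) mcoef i r ^+ 2 / tnorm i.

Definition dmrem (m : nat) (r : R) : R := 2 * mcross r - \sum_(i < m) 2 * mcoef i r * dmcoef i r / tnorm i.

Lemma der_mrem m r : isd r (mrem m) (dmrem m r).
Proof.
apply: derB; first exact: der_msq.
apply: (@der_sum R m (fun i r => mcoef i r ^+ 2 / tnorm i) (fun i => 2 * mcoef i r * dmcoef i r / tnorm i)) => i.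
by apply: der_eq (derM (derX2 (der_mcoef i r)) (derC _ _)) _; rewrite mulr0 addr0.
Qed.

Let cph r : continuous (fun t => phi (polar r t)). Proof. exact: cts_polar_slice (smooth2_cont sm). Qed.
Let crd r : continuous (fun t => radd phi (r, t)). Proof. exact: cts_slice2. Qed.

Lemma mrem_ge0 m r : 0 <= mrem m r.
Proof. by rewrite /mrem subr_ge0 /mcoef /msq; apply: bessel; exact: cph. Qed.

Lemma mrem1 m : mrem m 1 = 0.
Proof. by rewrite /mrem msq1 big1 ?subrr// => i _; rewrite mcoef1 expr0n mul0r. Qed.

(** On the circle of radius 0 the function is constant, so mode 0 accounts for all of it. *)
Lemma mrem0 m : mrem m.+1 0 <= 0.
Proof.
have E t : phi (polar 0 t) = phi (0, 0) by rewrite /polar !mul0r.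
have t0 := @T_gt0 R.
have s0 : msq 0 = phi (0, 0) ^+ 2 * T.
  by rewrite /msq; under [X in itg _ _ X]funext => t do rewrite E; rewrite itg_cst ?subr0// ltW.
have c0 : mcoef 0 0 = phi (0, 0) * T.
  rewrite /mcoef; under [X in itg _ _ X]funext => t do rewrite E /trig/= /freq/= mul0r cos0 mulr1.
  by rewrite itg_cst ?subr0// ltW.
have e : (phi (0, 0) * T) ^+ 2 / T = phi (0, 0) ^+ 2 * T by move: t0; move: (T) => t t0; field; rewrite gt_eqF.
rewrite /mrem big_ord_recl/= s0 c0 [tnorm 0]/tnorm/= e opprD addrA subrr add0r.
by rewrite oppr_le0 sumr_ge0// => i _; rewrite divr_ge0 ?sqr_ge0// ltW// tnorm_gt0.
Qed.

(* Bessel's inequality for [r phi_r - b phi] on the circle of radius [r]. *)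
Lemma mrad_picone m (r b : R) :
  r * b * dmrem m r - b ^+ 2 * mrem m r <= r ^+ 2 * (mrad r - \sum_(i < m) dmcoef i r ^+ 2 / tnorm i).
Proof.
pose h t := r * radd phi (r, t) - b * phi (polar r t).
have c1 : continuous (fun t => r * radd phi (r, t)) by apply: ctsM => //; exact: ctsC.
have c2 : continuous (fun t => b * phi (polar r t)) by apply: ctsM => //; exact: ctsC.
have ch : continuous h by exact: ctsB.
have := bessel m ch.
have -> : itg 0 T (fun t => h t ^+ 2) = r ^+ 2 * mrad r + (- (2 * r * b)) * mcross r + b ^+ 2 * msq r + 0 * msq r.
  rewrite /mrad /mcross /msq -itg_lin; try by apply: ctsM.
  by apply: eq_itg => t _; rewrite /h; ring.
have co i : itg 0 T (fun t => h t * trig i t) = r * dmcoef i r - b * mcoef i r.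
  have ct := @trig_cont R i.
  have d1 : continuous (fun t => radd phi (r, t) * trig i t) by exact: ctsM.
  have d2 : continuous (fun t => phi (polar r t) * trig i t) by exact: ctsM.
  rewrite /dmcoef /mcoef -!itgZ// -itgB; [|by apply: ctsM => //; exact: ctsC|by apply: ctsM => //; exact: ctsC].
  by apply: eq_itg => t _; rewrite /h; ring.
under eq_bigr => i _ do rewrite co.
have -> : \sum_(i < m) (r * dmcoef i r - b * mcoef i r) ^+ 2 / tnorm i =
  r ^+ 2 * (\sum_(i < m) dmcoef i r ^+ 2 / tnorm i) - r * b * (\sum_(i < m) 2 * mcoef i r * dmcoef i r / tnorm i)
   + b ^+ 2 * (\sum_(i < m) mcoef i r ^+ 2 / tnorm i).
  rewrite !mulr_sumr -sumrB -big_split/=; apply: eq_bigr => i _; ring.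
rewrite /dmrem /mrem; move: (\sum_(i < m) _) (\sum_(i < m) _) (\sum_(i < m) _) => x y z.
by move: (mrad r) (mcross r) (msq r) => A C D; lra.
Qed.

(** Wirtinger with constant (J+1)^2 >= tau^2; the angular energy of the low modes, which is
    nonnegative, is dropped. *)
Lemma mang_ge (J : nat) (tau r : R) : 0 <= tau -> tau <= J.+1%:R -> tau ^+ 2 * mrem J.*2.+1 r <= mang r.
Proof.
move=> t0 tJ; have ca : continuous (fun t => angd phi (r, t)) by apply: cts_slice2; exact: angd_cont.
have per t : phi (polar r (t + T)) = phi (polar r t).
  by rewrite /polar (@cosD2pi R) (@sinD2pi R).
have := @wirtinger R J _ _ ca (fun t => der_angular r t sm) per; apply: le_trans.
have Z0 := mrem_ge0 J.*2.+1 r.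
have t2 : tau ^+ 2 <= J.+1%:R ^+ 2 by rewrite ler_pXn2r ?nnegrE.
apply: (@le_trans _ _ (J.+1%:R ^+ 2 * mrem J.*2.+1 r)); first by rewrite ler_wpM2r.
rewrite /mrem mulrBr lerB// mulr_sumr; apply: ler_sum => i _; rewrite ler_wpM2r//.
  by rewrite divr_ge0 ?sqr_ge0// ltW// tnorm_gt0.
by rewrite gerBl sqr_ge0.
Qed.

Definition mgrad (r : R) : R := itg 0 T (fun t => pd true phi (polar r t) ^+ 2 + pd false phi (polar r t) ^+ 2).

Lemma mgradE r : r ^+ 2 * mgrad r = r ^+ 2 * mrad r + mang r.
Proof.
have c b : continuous (fun t => pd b phi (polar r t)).
  by apply: cts_polar_slice; exact: smooth2_cont (smooth2_pd b sm).
have ca : continuous (fun t => angd phi (r, t)) by apply: cts_slice2; exact: angd_cont.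
have c1 : continuous (fun t => radd phi (r, t) ^+ 2) by exact: ctsX.
have c2 : continuous (fun t => angd phi (r, t) ^+ 2) by exact: ctsX.
rewrite /mgrad /mrad /mang -!itgZ//; last by apply: ctsD; exact: ctsX.
rewrite -itgD//; last by apply: ctsM => //; exact: ctsC.
apply: eq_itg => t _; rewrite /radd /angd/=.
by rewrite -[LHS]mulr1 -(cos2Dsin2 t); ring.
Qed.

End mode_expansion.

(** * The lower bound of the form on test functions *)

Section test_inequality.
Context {R : realType}.
Notation plane := (measurableTypeR R * measurableTypeR R)%type.
Notation lebp := (@lebp R).
Notation B := (@ball2 R).
Notation IB := (ii lebp B).
Notation L2 := (L2 lebp B).
Notation L1 := (L1 lebp B).
Notation T := (pi *+ 2 : R).

Let mB : measurable (B : set plane). Proof. exact: measurable_ball2. Qed.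

Variables (alpha p : R) (w X : R -> R) (J : nat).
Hypothesis alpha0 : 0 <= alpha.
Notation tau := (1 + alpha / 2).
Hypothesis H : profile tau p w X.
Hypothesis tauJ : tau <= J.+1%:R.
Notation k0 := (@k0 R tau p w).
Notation kp := (@kp R tau p w).
Notation kD := (@kD R tau p w).
Notation beta := (@beta R tau p w X).
Notation pot := (@pot R alpha p w).
Notation m := J.*2.+1.

Let p3 : 3 < p. Proof. exact: prof_p H. Qed.
Let tau0 : 0 <= tau. Proof. by move: alpha0; lra. Qed.

Section test.
Variable phi : R * R -> R.
Hypothesis ht : testfun phi.
Let sm : smooth2 phi. Proof. by case: ht. Qed.

(** Density of the form of phi from which the forms of the low modes, each without its angular
    energy, have been subtracted. *)
Definition excess (r : R) : R := r * mgrad phi r - p * k0 r * msq phi r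
  - \sum_(i < m) (tnorm i)^-1 * (r * dmcoef phi i r ^+ 2 - p * k0 r * mcoef phi i r ^+ 2).

Let cgrad : continuous (fun r : R => r * mgrad phi r).
Proof.
have c b := smooth2_cont (smooth2_pd b sm).
have cc : continuous (fun x => pd true phi x ^+ 2 + pd false phi x ^+ 2) by apply: plane_ctsD; apply: plane_ctsM.
exact: cts_polar_ritg cc.
Qed.

Let cpot : continuous (fun r : R => p * k0 r * msq phi r).
Proof. by apply: ctsM; [apply: ctsM; [exact: ctsC|exact: k0_cont H]|exact: msq_cont]. Qed.

Let cmode i : continuous (fun r : R => r * dmcoef phi i r ^+ 2 - p * k0 r * mcoef phi i r ^+ 2).
Proof.
apply: ctsB; apply: ctsM; [exact: ctsI|apply: ctsX; exact: dmcoef_cont| |apply: ctsX; exact: mcoef_cont].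
by apply: ctsM; [exact: ctsC|exact: k0_cont H].
Qed.

Let cmode' i : continuous (fun r : R => (tnorm i)^-1 * (r * dmcoef phi i r ^+ 2 - p * k0 r * mcoef phi i r ^+ 2)).
Proof. by apply: ctsM => //; exact: ctsC. Qed.

Lemma excess_cont : continuous excess.
Proof.
apply: ctsB; first exact: ctsB.
exact: (@cts_sum R m (fun i r => (tnorm i)^-1 * (r * dmcoef phi i r ^+ 2 - p * k0 r * mcoef phi i r ^+ 2))).
Qed.

(** Combines [mrad_picone] at b = [beta] with [mang_ge]. By the Riccati equation of [beta] the
    left-hand side is the derivative of [beta] times the remainder. *)
Lemma excess_ge r : 0 < r -> r <= 1 ->
  (tau ^+ 2 - p * r * k0 r - beta r ^+ 2) / r * mrem phi m r + beta r * dmrem phi m r <= excess r.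
Proof.
move=> r0 r1; rewrite -(ler_pM2l r0).
have h1 := mrad_picone ht m r (beta r); have h2 := mang_ge ht r tau0 tauJ; have h3 := mgradE ht r.
have -> : r * excess r = r ^+ 2 * mgrad phi r - p * r * k0 r * mrem phi m r
    - r ^+ 2 * \sum_(i < m) dmcoef phi i r ^+ 2 / tnorm i.
  rewrite /excess /mrem.
  have -> : \sum_(i < m) (tnorm i)^-1 * (r * dmcoef phi i r ^+ 2 - p * k0 r * mcoef phi i r ^+ 2) =
    r * (\sum_(i < m) dmcoef phi i r ^+ 2 / tnorm i) - p * k0 r * (\sum_(i < m) mcoef phi i r ^+ 2 / tnorm i).
    by rewrite !mulr_sumr -sumrB; apply: eq_bigr => i _; ring.
  ring.
have -> : r * ((tau ^+ 2 - p * r * k0 r - beta r ^+ 2) / r * mrem phi m r + beta r * dmrem phi m r) =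
  (tau ^+ 2 - p * r * k0 r - beta r ^+ 2) * mrem phi m r + r * beta r * dmrem phi m r.
  by field; rewrite gt_eqF.
by rewrite h3; lra.
Qed.

(** After integration over [e, 1] only boundary terms remain: the remainder is 0 at r = 1, and at e
    it is multiplied by a factor at most tau and tends to a nonpositive value. *)
Lemma excess_int : 0 <= itg 0 1 excess.
Proof.
have ce := excess_cont; have [N N0 dN] := antiderivative ce.
have cN : continuous N by move=> x; exact: der_cts (dN x).
rewrite (itg_FTC ler01 ce cN) => [|x _]; last exact: dN.
have cZ : continuous (mrem phi m) by move=> r; exact: der_cts (der_mrem ht m r).
have step e : 0 < e -> e <= 1 -> 0 <= N 1 - N e + tau * mrem phi m e.
  move=> e0 e1.
  have : N e - beta e * mrem phi m e <= N 1 - beta 1 * mrem phi m 1.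
    apply: (@der_mono_cc _ (fun r => N r - beta r * mrem phi m r) (fun r => excess r -
       ((tau ^+ 2 - p * r * k0 r - beta r ^+ 2) / r * mrem phi m r + beta r * dmrem phi m r))) => // r /andP[er r1].
      have r0 := lt_le_trans e0 er.
      by apply: derB; [exact: dN|apply: derM; [exact: der_beta H _ r0 r1|exact: der_mrem]].
    by rewrite subr_ge0 excess_ge// (lt_le_trans e0).
  rewrite mrem1// mulr0 subr0 => h.
  have : beta e * mrem phi m e <= tau * mrem phi m e.
    by rewrite ler_wpM2r ?mrem_ge0// (le_trans (ler_norm _))//; exact: beta_bound H _ e0 e1.
  by lra.
have lim : (fun n => N 1 - N (harmonic n) + tau * mrem phi m (harmonic n)) @ \oo --> N 1 - N 0 + tau * mrem phi m 0.
  apply: cvgD.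
    by apply: cvgB; [exact: cvg_cst|apply: continuous_cvg; [exact: cN|exact: cvg_harmonic]].
  by apply: cvgM; [exact: cvg_cst|apply: continuous_cvg; [exact: cZ|exact: cvg_harmonic]].
have h : 0 <= N 1 - N 0 + tau * mrem phi m 0.
  rewrite -(cvg_lim _ lim)//; apply: limr_ge; first by apply/cvg_ex; eexists; exact: lim.
  apply: nearW => n; apply: step; first exact: harmonic_gt0.
  by rewrite /harmonic/= invf_le1 ?ler1n ?ltr0n.
by apply: (le_trans h); rewrite gerDl mulr_ge0_le0// mrem0.
Qed.

Lemma test_form : IB (fun x => pd true phi x ^+ 2) + IB (fun x => pd false phi x ^+ 2) - IB (fun x => pot x * phi x ^+ 2) =
  kappa * (itg 0 1 (fun r => r * mgrad phi r) - itg 0 1 (fun r => p * k0 r * msq phi r)).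
Proof.
have c b := smooth2_cont (smooth2_pd b sm).
have cc : continuous (fun x => pd true phi x ^+ 2 + pd false phi x ^+ 2) by apply: plane_ctsD; apply: plane_ctsM.
have h b := smooth2_L2 (smooth2_pd b sm).
rewrite mulrBr -(iiD mB (h true).2 (h false).2) (polar_full cc); congr (_ - _).
apply: polar_punct => //.
- by apply: (pot_L1 alpha0 H); exact: smooth2_L2.
- apply: punct_ctsM; first exact: (pot_cut H).
  by apply: punct_ctsC; apply: plane_ctsM; exact: smooth2_cont.
move=> r r0 r1; have cp : continuous (fun t => phi (polar r t)) by apply: cts_polar_slice; exact: smooth2_cont.
rewrite (@eq_itg _ _ _ _ (fun t => (r^-1 * (p * k0 r)) * phi (polar r t) ^+ 2)) => [|t _]; last first.
  by rewrite -(pot_polar H t r0) mulKf// gt_eqF.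
by rewrite itgZ; [rewrite /msq !mulrA divff ?mul1r// gt_eqF|exact: ctsX].
Qed.

(** The high frequencies contribute [excess_int]; each low mode contributes [radial_form_ge] applied
    to its Fourier coefficient, which vanishes at radius 1. *)
Lemma test_form_ge :
  - (kappa * \sum_(i < m) (tnorm i)^-1 * ((p - 1) / itg 0 1 kD * itg 0 1 (fun r => kp r * mcoef phi i r) ^+ 2)) <=
  IB (fun x => pd true phi x ^+ 2) + IB (fun x => pd false phi x ^+ 2) - IB (fun x => pot x * phi x ^+ 2).
Proof.
rewrite test_form -mulrN ler_pM2l ?kappa_gt0//.
have := excess_int; rewrite /excess itgB//; last first.
- exact: (@cts_sum R m (fun i r => (tnorm i)^-1 * (r * dmcoef phi i r ^+ 2 - p * k0 r * mcoef phi i r ^+ 2))).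
- exact: ctsB.
rewrite itgB// (@itg_sum R 0 1 m (fun i r => (tnorm i)^-1 * (r * dmcoef phi i r ^+ 2 - p * k0 r * mcoef phi i r ^+ 2)))//.
rewrite subr_ge0; apply: le_trans; rewrite -sumrN; apply: ler_sum => i _.
rewrite itgZ// -mulrN ler_pM2l ?invr_gt0 ?tnorm_gt0// -mulNr.
apply: (radial_form_ge H); [exact: dmcoef_cont|move=> r; exact: der_mcoef|exact: mcoef1].
Qed.

End test.
End test_inequality.

(** * The Morse index *)

Section morse.
Context {R : realType}.
Notation plane := (measurableTypeR R * measurableTypeR R)%type.
Notation lebp := (@lebp R).
Notation B := (@ball2 R).
Notation IB := (ii lebp B).
Notation L2 := (L2 lebp B).
Notation L1 := (L1 lebp B).
Notation T := (pi *+ 2 : R).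

Let mB : measurable (B : set plane). Proof. exact: measurable_ball2. Qed.

Variables (alpha p : R) (w X : R -> R) (J : nat).
Hypothesis alpha0 : 0 <= alpha.
Notation tau := (1 + alpha / 2).
Hypothesis H : profile tau p w X.
Notation kp := (@kp R tau p w).
Notation kD := (@kD R tau p w).
Notation pot := (@pot R alpha p w).
Notation m := J.*2.+1.

Let p3 : 3 < p. Proof. exact: prof_p H. Qed.

(** The function |x|^alpha w^p times the i-th angular mode. It represents the functional of
    [test_form_ge] as an [L2] pairing, which makes sense on the whole space and is continuous. *)
Definition modew (i : nat) (x : R * R) : R :=
  enorm x `^ alpha * pp p (w (enorm x)) * ((enorm x ^+ uphalf i)^-1 * harm i x).

Lemma modew_punct i : punct_cts (modew i).
Proof.
apply: punct_ctsM; last apply: punct_ctsM.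
- apply: (@punct_cts_enorm R (fun r => r `^ alpha * pp p (w r))) => s s0; apply: cvgM.
    exact: der_cts (is_derive1_powR alpha s0).
  by apply: (ppw_cont H); move: p3; lra.
- apply: (@punct_cts_enorm R (fun r => (r ^+ uphalf i)^-1)) => s s0; apply: cvgV.
    by rewrite expf_neq0// gt_eqF.
  by apply: ctsX; exact: ctsI.
by have [] := @harm_punct R i.
Qed.

Lemma modew_L2 i : L2 (modew i).
Proof.
have cp : continuous (fun r => pp p (w r)) by apply: (ppw_cont H); move: p3; lra.
have [M M0 hM] := cts_bounded01 cp.
have me := measurable_funTS (@measurable_enorm R) : measurable_fun (B : set plane) _.
apply: (@L2_bounded_cst R M).
  apply: measurable_funM; last apply: measurable_funM.
  - apply: measurable_funM; first by apply: measurable_funTS; exact: meas_wt.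
    by apply: measurable_funTS; exact: continuous_measurable_plane (plane_cts_comp enorm_cont cp).
  - have mi : measurable_fun setT ((fun s => s `^ (-1)) : measurableTypeR R -> R) by exact: measurable_powR.
    have -> : (fun x : R * R => (enorm x ^+ uphalf i)^-1) = (fun x => (enorm x ^+ uphalf i) `^ (-1)).
      by apply/funext => x; rewrite powR_inv1// exprn_ge0// enorm_ge0.
    by apply: (measurableT_comp mi); exact: measurable_funX.
  - apply: measurable_funTS; apply: continuous_measurable_plane; exact: gpoly_cont (harm_gpoly i).
move=> x Bx; have e0 := enorm_ge0 x; have [hb _ _] := harm_bound i x.
have q : `|(enorm x ^+ uphalf i)^-1 * harm i x| <= 1.
  rewrite normrM normfV (ger0_norm (exprn_ge0 _ e0)).
  have [z|z] := eqVneq (enorm x ^+ uphalf i) 0; first by rewrite z invr0 mul0r.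
  by rewrite mulrC ler_pdivrMr ?mul1r// lt_def z exprn_ge0.
rewrite /modew normrM -[leRHS]mulr1; apply: ler_pM => //.
rewrite normrM -[leRHS]mul1r; apply: ler_pM => //.
  by rewrite ger0_norm ?powR_ge0//; exact: wt_le1.
by apply: hM => //; exact: ltW.
Qed.

Lemma modew_test phi i : testfun phi -> IB (fun x => phi x * modew i x) =
  kappa * itg 0 1 (fun r => kp r * mcoef phi i r).
Proof.
move=> ht; have sm := ht.1; apply: polar_punct.
- by apply: (L2M mB); [exact: smooth2_L2|exact: modew_L2].
- by apply: ctsM; [exact: kp_cont H|exact: mcoef_cont].
- by apply: punct_ctsM; [apply: punct_ctsC; exact: smooth2_cont|exact: modew_punct].
move=> r r0 r1; have cp : continuous (fun t => phi (polar r t)) by apply: cts_polar_slice; exact: smooth2_cont.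
rewrite (@eq_itg _ _ _ _ (fun t => (r^-1 * kp r) * (phi (polar r t) * trig i t))) => [|t _]; last first.
  have rj : r ^+ uphalf i != 0 by rewrite expf_neq0// gt_eqF.
  rewrite /modew harm_polar enorm_polar ?(ltW r0)// mulKf// /kp -(ppb3 H) /pa.
  rewrite (_ : 2 * tau - 1 = 1 + alpha); last by field.
  by rewrite pp1D// -(mulrA r) mulKf ?gt_eqF//; ring.
rewrite itgZ; last by apply: ctsM => //; exact: trig_cont.
by rewrite -(mulrA r^-1) mulVKf ?gt_eqF.
Qed.

(** The constant of [test_form_ge], adjusted for the factor [kappa] that each pairing with [modew]
    carries. *)
Definition modec (i : nat) : R := (p - 1) / (kappa * tnorm i * itg 0 1 kD).

Lemma cvg_bigsum k (f : nat -> nat -> R) (l : nat -> R) : (forall i, f i @ \oo --> l i) ->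
  (fun n => \sum_(i < k) f i n) @ \oo --> \sum_(i < k) l i.
Proof.
move=> h; elim: k => [|k IH].
  by under eq_fun do rewrite big_ord0; rewrite big_ord0; exact: cvg_cst.
by under eq_fun do rewrite big_ord_recr/=; rewrite big_ord_recr/=; exact: cvgD.
Qed.

(** Both sides are continuous along approximating test functions: the potential is bounded and the
    functionals are [L2] pairings. *)
Lemma form_ge psi h1 h2 : tau <= J.+1%:R -> H10 psi h1 h2 ->
  - (\sum_(i < m) modec i * IB (fun x => psi x * modew i x) ^+ 2) <=
  IB (fun x => h1 x ^+ 2) + IB (fun x => h2 x ^+ 2) - IB (fun x => pot x * psi x ^+ 2).
Proof.
move=> tauJ HH; have [[l0 l1 l2] [phi [ht [c0 c1 c2]]]] := H10_seq HH.
pose F v1 v2 v := IB (fun x => v1 x ^+ 2) + IB (fun x => v2 x ^+ 2) - IB (fun x => pot x * v x ^+ 2)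
  + \sum_(i < m) modec i * IB (fun x => v x * modew i x) ^+ 2 : R.
suff : 0 <= F h1 h2 psi by rewrite /F; lra.
have sL b n : L2 (pd b (phi n)) by apply: smooth2_L2; apply: smooth2_pd; case: (ht n).
have pL n : L2 (phi n) by apply: smooth2_L2; case: (ht n).
have [M hM] := pot_bound alpha0 H.
have sq (v : nat -> R * R -> R) (g : R * R -> R) : (forall n, L2 (v n)) -> L2 g -> (fun n => dist2 (v n) g) @ \oo --> (0 : R) ->
    (fun n => IB (fun x => v n x ^+ 2)) @ \oo --> IB (fun x => g x ^+ 2).
  move=> hv hg hc.
  have E (h : R * R -> R) : IB (fun x => h x ^+ 2) = IB (fun x => 1 * h x ^+ 2).
    by apply: (eq_ii lebp) => x _; rewrite mul1r.
  rewrite E (_ : (fun n => _) = (fun n => IB (fun x => 1 * v n x ^+ 2))); last by apply/funext => n; rewrite E.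
  have n1 (x : R * R) : B x -> `|1 : R| <= 1 by rewrite normr1.
  exact: (@cvg_sq _ _ _ lebp B mB v g (fun=> 1) 1 hv hg (measurable_cst _) n1 hc).
have lim : (fun n => F (pd true (phi n)) (pd false (phi n)) (phi n)) @ \oo --> F h1 h2 psi.
  apply: cvgD; first apply: cvgB.
  - by apply: cvgD; apply: sq.
  - exact: (cvg_sq mB pL l0 (pot_meas H) hM c0).
  apply: (@cvg_bigsum m (fun i n => modec i * IB (fun x => phi n x * modew i x) ^+ 2)
    (fun i => modec i * IB (fun x => psi x * modew i x) ^+ 2)) => i.
  apply: cvgM; first exact: cvg_cst.
  have h := cvg_ip mB pL l0 (modew_L2 i) c0.
  by rewrite expr2; under eq_fun do rewrite expr2; exact: cvgM.
rewrite -(cvg_lim _ lim)//; apply: limr_ge; first by apply/cvg_ex; eexists; exact: lim.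
apply: nearW => n; have := test_form_ge alpha0 H tauJ (ht n).
rewrite mulr_sumr /F => h; rewrite -lerBlDr sub0r; apply: le_trans h; rewrite lerN2.
rewrite le_eqVlt; apply/orP; left; apply/eqP; apply: eq_bigr => i _.
rewrite modew_test// /modec; have k0 := @kappa_gt0 R; have t0 := @tnorm_gt0 R i; have D0 := kD_gt0 H.
move: (itg 0 1 kD) D0 => D D0; move: (itg 0 1 _) => I; move: (kappa) (tnorm i) k0 t0 => k t k0 t0.
by field; rewrite !gt_eqF.
Qed.

Section solution.
Variable u : R * R -> R.
Hypothesis mu : measurable_fun (B : set plane) u.
Hypothesis uw : {ae lebp, forall x, B x -> u x = w (enorm x)}.

Lemma not_neg_subspace : tau <= J.+1%:R -> ~ neg_subspace alpha p u m.+1.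
Proof.
move=> tauJ [psi [h1 [h2 [HH [_ Hneg]]]]].
(* With more rows than columns, A has a nonzero left kernel vector. The corresponding combination
   annihilates all functionals of [form_ge], so its form is nonnegative. *)
pose A := \matrix_(a < m.+1, i < m) IB (fun x => psi a x * modew i x).
have [v vK v0] : exists2 v : 'rV[R]_m.+1, (v <= kermx A)%MS & v != 0.
  apply/rowV0Pn; rewrite kermx_eq0 /row_free; apply: contraTN (rank_leq_col A) => /eqP ->.
  by rewrite -ltnNge ltnSn.
move/sub_kermxP: vK => vA; pose c a := v ord0 a.
have [a ca] : exists a, c a != 0.
  apply/existsP; apply: contraNT v0; rewrite negb_exists => /forallP h; apply/eqP/rowP => a.
  by have := h a; rewrite negbK mxE => /eqP.
have HS := H10_sum c HH; have [s0 s1 s2] := H10_L2 HS.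
have hp b : L2 (psi b) by have [] := H10_L2 (HH b).
have := Hneg c (ex_intro _ a ca); rewrite (QformE alpha0 H mu uw)// lte_fin ltNge => /negP; apply.
apply: le_trans (form_ge tauJ HS); rewrite big1 ?oppr0// => i _.
suff -> : IB (fun x => (\sum_b c b * psi b x) * modew i x) = 0 by rewrite expr0n mulr0.
have l1 b : L1 (fun x => c b * (psi b x * modew i x)) by apply: (L1Z mB); apply: (L2M mB) => //; exact: modew_L2.
have [e _] := ii_sum mB l1.
transitivity (\sum_b IB (fun x => c b * (psi b x * modew i x))).
  rewrite -e; apply: (eq_ii lebp) => x _; rewrite mulr_suml; apply: eq_bigr => b _; by rewrite mulrA.
have := congr1 (fun z : 'rV[R]_m => z ord0 i) vA; rewrite !mxE => e2.
rewrite -[RHS]e2; apply: eq_bigr => b _; rewrite (iiZ mB) ?mxE//; apply: (L2M mB) => //; exact: modew_L2.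
Qed.

(** By [tcomb_form] the trial functions diagonalize the form, so negativity of each mode
    suffices. *)
Lemma neg_subspaceP : (forall i, (i < m)%N -> itg 0 1 (tmode alpha p w X (freq i ^+ 2)) < 0) ->
  neg_subspace alpha p u m.
Proof.
move=> hneg; pose psi (i : 'I_m) := tfun alpha p w i.
pose h1 (i : 'I_m) := tg1 alpha p w X i; pose h2 (i : 'I_m) := tg2 alpha p w X i.
have HH i : H10 (psi i) (h1 i) (h2 i) := tfun_H10 alpha0 H i.
have Qneg c : (exists i, c i != 0) ->
    (Qform alpha p u (fun x => (\sum_i c i * psi i x)%R) (fun x => (\sum_i c i * h1 i x)%R)
       (fun x => (\sum_i c i * h2 i x)%R) < 0)%E.
  move=> [a ca]; have [s0 s1 s2] := H10_L2 (H10_sum c HH).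
  rewrite (QformE alpha0 H mu uw)// lte_fin.
  (* [tcomb_form] takes coefficients indexed by all naturals; c is extended by 0. *)
  pose d i : R := if insub i is Some j then c j else 0.
  have dE (i : 'I_m) : d i = c i by rewrite /d valK.
  have := tcomb_form alpha0 H d m; rewrite /tcomb /tcomb1 /tcomb2.
  under [X in IB X + _ - _ = _ -> _]funext => x do under eq_bigr => i _ do rewrite dE.
  under [X in _ + IB X - _ = _ -> _]funext => x do under eq_bigr => i _ do rewrite dE.
  under [X in _ - IB X = _ -> _]funext => x do under eq_bigr => i _ do rewrite dE.
  move=> ->; rewrite pmulr_rlt0 ?kappa_gt0// (bigD1 a)//= dE.
  have t0 i : 0 < tnorm i :> R by exact: tnorm_gt0.
  rewrite -[ltRHS]addr0; apply: ltr_leD.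
    by rewrite nmulr_llt0 ?hneg// mulr_gt0// lt_def sqr_ge0 sqrf_eq0 ca.
  apply: sumr_le0 => i _; rewrite nmulr_lle0 ?hneg// mulr_ge0 ?sqr_ge0//; exact: ltW.
(* Independence follows from negativity: a combination vanishing almost everywhere has no potential
   term, so its form would be nonnegative. *)
exists psi, h1, h2; split=> //; split=> // c z i; apply: contraTeq isT => ci.
have := Qneg c (ex_intro _ i ci); have [s0 s1 s2] := H10_L2 (H10_sum c HH).
rewrite (QformE alpha0 H mu uw)// lte_fin.
have -> : IB (fun x => pot x * (\sum_i c i * psi i x) ^+ 2) = IB (fun=> 0).
  have z' : {ae lebp, forall x, B x -> \sum_i c i * psi i x = 0} := z.
  apply: eq_ii_ae; [exact: (pot_L1 alpha0 H)|exact: L1_cst|].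
  by apply: (aeS z') => x zx Bx; rewrite zx// expr0n mulr0.
have -> : IB (fun=> 0) = 0 by rewrite /ii /Rintegral integral0_eq.
rewrite subr0 ltNge => /negP[]; rewrite addr_ge0//; apply: ii_ge0 => x _; exact: sqr_ge0.
Qed.

End solution.
End morse.

Section threshold.
Context {R : realType}.

(* As [p] tends to infinity, the left-hand side tends to [j2 - tau ^+ 2]. *)
Lemma threshold (tau p j2 e : R) : 0 <= j2 -> j2 <= tau ^+ 2 - e -> 0 < e -> 3 + 20 * tau ^+ 2 / e < p ->
  j2 - tau ^+ 2 + 4 * tau ^+ 2 * p / (p - 1)
    - 16 * tau ^+ 2 / 3 * (p * (p - 2) - (p - 1) ^+ 2 / 4) / (p + 1) ^+ 2 < 0.
Proof.
move=> j0 je e0 pe; have T0 : 0 <= tau ^+ 2 by exact: sqr_ge0.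
move: (tau ^+ 2) T0 je pe => t t0 je pe.
have q0 : 0 <= 20 * t / e by rewrite divr_ge0 ?(ltW e0)// mulr_ge0.
have p1 : 0 < p - 1 by lra.
have p2 : 0 < p + 1 by lra.
(* In [E1] and [E2] the two terms 4 t cancel; the errors 4 t / (p - 1) and 16 t / (p + 1) add up to
   at most 20 t / (p - 1), which must stay below the gap e. *)
have key : 20 * t < e * (p - 1).
  by rewrite [ltRHS]mulrC -ltr_pdivrMr//; lra.
have E1 : 4 * t * p / (p - 1) = 4 * t + 4 * t / (p - 1) by field; rewrite gt_eqF.
have E2 : 16 * t / 3 * (p * (p - 2) - (p - 1) ^+ 2 / 4) / (p + 1) ^+ 2 =
    4 * t - (16 * t / (p + 1) - 32 * t / 3 / (p + 1) ^+ 2) by field; rewrite gt_eqF.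
have h1 : 16 * t / (p + 1) <= 16 * t / (p - 1).
  by rewrite ler_wpM2l ?mulr_ge0// lef_pV2 ?posrE//; lra.
have h2 : 0 <= 32 * t / 3 / (p + 1) ^+ 2 by rewrite divr_ge0 ?sqr_ge0// divr_ge0// mulr_ge0.
have h3 : 4 * t / (p - 1) + 16 * t / (p - 1) < e.
  by rewrite -mulrDl ltr_pdivrMr//; lra.
by rewrite E1 E2; lra.
Qed.

End threshold.

Theorem theorem1p3 (R : realType) (alpha : R) (halpha : 0 <= alpha) :
  exists pstar : R, 1 < pstar /\
    forall (p : R), pstar < p ->
    forall u : R * R -> R,
      least_energy_radial alpha p u ->
      {ae @leb2 R, forall x, ball2 x -> 0 < u x} ->
      exists k : nat, morse_index alpha p u k /\
        (k%:Z = 1 + 2 * Num.ceil (alpha / 2))%R.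
Proof.
have h2 : 0 <= alpha / 2 by rewrite divr_ge0.
have [J cJ] : exists J : nat, Num.ceil (alpha / 2) = J%:Z.
  by exists `|Num.ceil (alpha / 2)|%N; rewrite gez0_abs// -(ler_int R) (le_trans h2)// ceil_ge.
have J1 : alpha / 2 <= J%:R by have := ceil_ge (alpha / 2); rewrite cJ.
(* The strict inequality J < tau leaves a positive gap for the lower bound, and [J1], that is tau <=
   J + 1, is what the upper bound requires. *)
have J2 : J%:R < 1 + alpha / 2 by have := ceilB1_lt (alpha / 2); rewrite cJ rmorphB/= ltrBlDr addrC.
have J0 : 0 <= J%:R :> R by [].
(* The gap between tau^2 and the largest squared frequency in use; the threshold on p grows like its
   inverse. *)
pose e := (1 + alpha / 2) ^+ 2 - J%:R ^+ 2.
have e0 : 0 < e by rewrite subr_gt0 ltr_pXn2r ?nnegrE// (le_trans J0)// ltW.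
have q0 : 0 <= 20 * (1 + alpha / 2) ^+ 2 / e by rewrite divr_ge0 ?(ltW e0)// mulr_ge0 ?sqr_ge0.
exists (3 + 20 * (1 + alpha / 2) ^+ 2 / e); split; first by lra.
move=> p hp u [g1 [g2 [Hu umin]]] upos.
have p3 : 3 < p by lra.
have p1 : 1 < p by lra.
have [HHu ru _ _] := Hu; have [[mu _] _ _] := H10_L2 HHu.
have bnd a : 0 < a -> a < 1 -> radial (@lam R a).
  move=> _ _; exists (fun r => - ln (Num.max r a)); exact: nearW.
(* The truncated logarithm is radial, bounded by |ln a| and in the energy space, hence an admissible
   direction for [euler_lagrange]. *)
have EL a : 0 < a -> a < 1 -> _ := fun a0 a1 =>
  euler_lagrange halpha p1 Hu umin upos (H10_lam a0 a1) (bnd a a0 a1) (fun x => @lam_bound R a x a0).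
have [w [X [H uw]]] := radial_profile halpha p1 HHu ru upos (minimizer_pow_L1 halpha p1 Hu) EL p3.
exists J.*2.+1; split; last by rewrite cJ -addn1 -mul2n PoszD PoszM addrC.
split.
  apply: (neg_subspaceP halpha H mu uw) => i iJ; apply: (moment_neg H).
  apply: (threshold (e := e)) => //; first exact: sqr_ge0.
  rewrite /e subKr ler_pXn2r ?nnegrE// /freq ler_nat.
  by rewrite -ltnS in iJ; rewrite leq_uphalf_double -ltnS.
by apply: (not_neg_subspace halpha H mu uw); rewrite -(natr1 J); lra.
Qed.
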